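(* Let $\mathcal{P}$ be a pattern on a metric space $(X,d_X)$ and let $\mathcal{C}$ be a cellular pattern on $(X,d_X)$ that represents $\mathcal{P}$. Let $G$ be a commutative ring with identity which, for sufficiently large $R$, has division by $|\mathcal{C}^R_{c,d}|$ for all cells $c,d$ with $|\mathcal{C}^R_{c,d}|\neq 0$. Then $H_\bullet^{\mathcal{P}}(X;G)\cong H_\bullet^{\mathcal{C}}(X;G)$.
   Context: Partial isometries are surjective onto their codomain and are composed on the largest domain for which composition makes sense. A pattern $\mathcal{P}$ on $(X,d_X)$ is a collection of partial isometries $\Phi\colon U\to V$ between open sets of $X$ such that: $\mathrm{Id}_U\in\mathcal{P}$ for every open $U$; $\Phi\in\mathcal{P}\Rightarrow\Phi^{-1}\in\mathcal{P}$; $\Phi_1,\Phi_2\in\mathcal{P}\Rightarrow\Phi_2\circ\Phi_1\in\mathcal{P}$. Let $\mathcal{P}^R_{x,y}$ be the set of $\Phi\in\mathcal{P}$ with $\Phi(x)=y$, domain the open ball $B_{d_X}(x,R)$ and range $B_{d_X}(y,R)$. Singular homology. A singular Borel-Moore $n$-chain is a possibly infinite sum $\sigma=\sum_i c_i\sigma_i$ of singular $n$-simplexes with coefficients in $G$ such that each compact set meets the images of only finitely many $\sigma_i$ with $c_i\ne0$. For $x\in X$, $\sigma^x$ denotes the sum of those terms $c_i\sigma_i$ whose image contains $x$. $\sigma$ is $\mathcal{P}$-equivariant to radius $R$ if each $\sigma_i$ has image contained in some ball of radius $R/2$ and $\Phi_*(\sigma^x)=\sigma^y$ for all $x,y\in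 X$ and $\Phi\in\mathcal{P}^R_{x,y}$; it is $\mathcal{P}$-equivariant if it is so to some radius. These chains form a subcomplex of the Borel-Moore chain complex, whose homology is $H_\bullet^{\mathcal{P}}(X;G)$. Cellular pattern. A cellular pattern $\mathcal{C}$ on $(X,d_X)$ consists of a finite-dimensional, locally finite CW-decomposition of $X$ whose cells are bounded in radius, and for each $R>0$ a groupoid $\mathcal{C}^R$ such that: (1) the objects of $\mathcal{C}^R$ are the closed cells; the morphisms $\mathcal{C}^R_{c,d}$ between $k$-cells $c$ and $d$ form a finite set of cellular isometries of $c$ onto $d$, composed as isometries, and these are tame: for each $k$-cell $c$ ($k>0$) there is a closed neighbourhood $U\subset c$ of $\partial c$ and a deformation retraction $F\colon[0,1]\times U\to U$ with $F(t,x)=x$ for $x\in\partial c$, $F(0,-)=\mathrm{Id}_U$, $F(1,x)\in\partial c$, and $F(t,-)\circ\Phi=\Phi\circ F(t,-)$ for all $\Phi\in\mathcal{C}^R_{c,c}$, $t\in[0,1]$; (2) if $r\le R$ and $\Phi\in\mathcal{C}^R_{c,d}$ then $\Phi\in\mathcal{C}^r_{c,d}$; (3) for every $R>0$ there is $R'>0$ such that for every $\Phi\in\mathcal{C}^{R'}_{c,d}$ between $k$-cells there is a bijection $f$ from the $(k+1)$-cells containing $c$ to the $(k+1)$-cells containing $d$ such that for each $(k+1)$-cell $c'$ containing $c$ some $\Phi'\in\mathcal{C}^R_{c',f(c')}$ restricts to $\Phi$. A cellular Borel-Moore $k$-chain (an assignment of a coefficient in $G$ to each oriented $k$-cell) $\sigma$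 is pattern-equivariant with respect to $\mathcal{C}$ if there is some $R>0$ such that $\Phi_*(\sigma)(c)=\sigma(d)$ for all $k$-cells $c,d$ and $\Phi\in\mathcal{C}^R_{c,d}$, i.e. $\Phi$, taking orientations into account, carries the coefficient at $c$ to the coefficient at $d$. The homology of the complex of these chains with the cellular boundary map is $H_\bullet^{\mathcal{C}}(X;G)$. $\mathcal{C}$ is a cellular representation of (represents) $\mathcal{P}$ if: for all $R>0$ there is $R'>0$ such that if $\Phi\in\mathcal{P}^{R'}_{x,y}$ then $\Phi|_{c_x}\in\mathcal{C}^R_{c_x,\Phi(c_x)}$ for each cell $c_x$ containing $x$; and for all $R>0$ (with $R/2$ greater than the radii of the cells) there is $R'>0$ such that if $\Phi\in\mathcal{C}^{R'}_{c,d}$ then there is some $\Phi'\in\mathcal{P}^R_{x,y}$ with $x$ contained in $c$ and $\Phi'|_c=\Phi$. $G$ has division by $n$ if $n\cdot 1$ is invertible in $G$. *)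

(* Defs.v *)
From HB Require Import structures.
From mathcomp Require Import all_boot all_order all_algebra generic_quotient ring_quotient.
From mathcomp Require Import all_classical all_reals all_analysis.

Set Implicit Arguments.
Unset Strict Implicit.
Unset Printing Implicit Defensive.

Import Order.TTheory GRing.Theory Num.Theory.
Import numFieldNormedType.Exports.

Local Open Scope classical_set_scope.
Local Open Scope ring_scope.

Section Submodule.
Variables (G : pzRingType) (V : lmodType G).

Record submodule := Submodule {
  subm_set : set V ;
  subm0 : subm_set 0 ;
  submP : forall a x y, subm_set x -> subm_set y -> subm_set (a *: x + y) }.

Definition subm_pred (S : submodule) : {pred V} := fun x => `[< subm_set S x >].

Lemma subm_pred_closed S : submod_closed (subm_pred S).
Proof.
split=> [|a x y /asboolP Sx /asboolP Sy]; apply/asboolP; first exact: subm0.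
exact: submP.
Qed.

HB.instance Definition _ S :=
  GRing.isSubmodClosed.Build G V (subm_pred S) (subm_pred_closed S).

Record subm_type (S : submodule) :=
  SubmType { subm_val : V ; _ : subm_val \in subm_pred S }.

HB.instance Definition _ S := [isSub for @subm_val S].
HB.instance Definition _ S := [Choice of subm_type S by <:].
HB.instance Definition _ S :=
  [SubChoice_isSubLmodule of subm_type S by <:].
End Submodule.

Section QuotientModule.
Variables (G : pzRingType) (V : lmodType G) (S : submodule V).
Local Open Scope quotient_scope.

Definition quotm : Type := Quotient.quot (subm_pred S).
HB.instance Definition _ := GRing.Zmodule.on quotm.

Definition quotm_pi (x : V) : quotm := \pi_(Quotient.quot (subm_pred S)) x.
Definition quotm_scale (a : G) (x : quotm) : quotm :=
  quotm_pi (a *: repr (x : Quotient.quot (subm_pred S))).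

Lemma quotm_scaleE a x : quotm_scale a (quotm_pi x) = quotm_pi (a *: x).
Proof.
apply/eqP; rewrite -Quotient.idealrBE -scalerBr rpredZ//.
by rewrite Quotient.idealrBE reprK.
Qed.

Lemma quotm_piD x y : quotm_pi x + quotm_pi y = quotm_pi (x + y).
Proof. by rewrite /quotm_pi; exact/esym/(raddfD \pi_(Quotient.quot (subm_pred S))). Qed.

Lemma quotm_piP (x : quotm) : exists y, x = quotm_pi y.
Proof. by exists (repr (x : Quotient.quot (subm_pred S))); rewrite /quotm_pi reprK. Qed.

Lemma quotm_scaleA a b v :
  quotm_scale a (quotm_scale b v) = quotm_scale (a * b) v.
Proof. by have [x ->] := quotm_piP v; rewrite !quotm_scaleE scalerA. Qed.

Lemma quotm_scale1 : left_id 1 quotm_scale.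
Proof. by move=> v; have [x ->] := quotm_piP v; rewrite quotm_scaleE scale1r. Qed.

Lemma quotm_scaleDr : right_distributive quotm_scale +%R.
Proof.
move=> a u v; have [x ->] := quotm_piP u; have [y ->] := quotm_piP v.
by rewrite quotm_piD !quotm_scaleE quotm_piD scalerDr.
Qed.

Lemma quotm_scaleDl v : {morph quotm_scale^~ v : a b / a + b}.
Proof.
move=> a b; have [x ->] := quotm_piP v.
by rewrite !quotm_scaleE quotm_piD scalerDl.
Qed.

HB.instance Definition _ := GRing.Zmodule_isLmodule.Build G quotm
  quotm_scaleA quotm_scale1 quotm_scaleDr quotm_scaleDl.
End QuotientModule.

(* Homology of the S-part of (V, d): S-cycles modulo the S-cycles of the form
   d y with y in S. When d is a differential preserving S, these are all the
   d y. *)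
Section Homology.
Variables (G : pzRingType) (V : nat -> lmodType G).
Variables (d : forall n, {linear V n.+1 -> V n}) (S : forall n, submodule (V n)).

Definition is_cycle n : V n -> Prop :=
  match n return V n -> Prop with
  | 0 => fun=> True
  | m.+1 => fun x => d m x = 0
  end.

Lemma cycles0 n : (subm_set (S n) `&` @is_cycle n) 0.
Proof. by split; [exact: subm0|case: n => //= n; exact: linear0]. Qed.

Lemma cyclesP n (a : G) x y : (subm_set (S n) `&` @is_cycle n) x ->
  (subm_set (S n) `&` @is_cycle n) y -> (subm_set (S n) `&` @is_cycle n) (a *: x + y).
Proof.
move=> [Sx dx] [Sy dy]; split; first exact: submP.
by case: n x y dx dy {Sx Sy} => //= n x y dx dy; rewrite linearP dx dy scaler0 addr0.
Qed.

Definition cycles n : submodule (V n) :=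
  Submodule (@cycles0 n) (@cyclesP n).

Definition is_boundary n (z : subm_type (cycles n)) :=
  exists2 y, subm_set (S n.+1) y & subm_val z = d n y.

Lemma boundaries0 n : @is_boundary n 0.
Proof. by exists 0; [exact: subm0|rewrite linear0]. Qed.

Lemma boundariesP n (a : G) x y :
  @is_boundary n x -> @is_boundary n y -> @is_boundary n (a *: x + y).
Proof.
move=> [u Su xu] [v Sv yv]; exists (a *: u + v); first exact: submP.
by rewrite linearP -xu -yv.
Qed.

Definition boundaries n : submodule (subm_type (cycles n)) :=
  Submodule (@boundaries0 n) (@boundariesP n).

Definition homology n : lmodType G := quotm (boundaries n).
End Homology.

Section PartialIsometry.
Variables (R : realType) (X : metricType R).

(* A partial map is its graph; the graph of a distance-preserving map is
   automatically functional and injective. *)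
Definition partial_map := set (X * X).
Implicit Types (f g : partial_map) (A : set X).

Definition pdom f : set X := [set x | exists y, f (x, y)].
Definition prange f : set X := [set y | exists x, f (x, y)].
Definition pid A : partial_map := [set p | A p.1 /\ p.1 = p.2].
Definition pinv f : partial_map := [set p | f (p.2, p.1)].
Definition pcomp g f : partial_map := [set p | exists y, f (p.1, y) /\ g (y, p.2)].
Definition prestrict f A : partial_map := [set p | f p /\ A p.1].

Definition isometric f :=
  forall x y x' y', f (x, y) -> f (x', y') -> mdist x x' = mdist y y'.

Record pattern := Pattern {
  pattern_set : set partial_map ;
  pattern_isometric : forall f, pattern_set f -> isometric f ;
  pattern_open_dom : forall f, pattern_set f -> open (pdom f) ;
  pattern_open_range : forall f, pattern_set f -> open (prange f) ;
  pattern_id : forall U, open U -> pattern_set (pid U) ;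
  pattern_inv : forall f, pattern_set f -> pattern_set (pinv f) ;
  pattern_comp : forall f g,
    pattern_set f -> pattern_set g -> pattern_set (pcomp g f) }.

Definition pattern_ball (P : pattern) (r : R) (x y : X) : set partial_map :=
  [set f | [/\ pattern_set P f, f (x, y), pdom f = ball x r &
               prange f = ball y r]].

Lemma metric_ball_open (x : X) (r : R) : open (ball x r).
Proof.
rewrite openE => y; rewrite ballEmdist /= => xy.
apply/nbhs_ballP; exists (r - mdist x y); first by rewrite /= subr_gt0.
move=> z; rewrite !ballEmdist /= ltrBrDl; apply: le_lt_trans.
exact: metric_triangle.
Qed.

Lemma isometric_fun f x y y' : isometric f -> f (x, y) -> f (x, y') -> y = y'.
Proof.
by move=> fi fy fy'; apply: mdist_positivity; rewrite -(fi _ _ _ _ fy fy') mdistxx.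
Qed.

Lemma isometric_inj f x x' y : isometric f -> f (x, y) -> f (x', y) -> x = x'.
Proof.
by move=> fi fy fy'; apply: mdist_positivity; rewrite (fi _ _ _ _ fy fy') mdistxx.
Qed.

Lemma pattern_ball_le P r r' x y f : 0 < r -> r <= r' ->
  pattern_ball P r' x y f -> pattern_ball P r x y (prestrict f (ball x r)).
Proof.
move=> r0 rr' [Pf fxy fdom fran].
have fi := pattern_isometric Pf.
split.
- have -> : prestrict f (ball x r) = pcomp f (pid (ball x r)).
    apply/seteqP; split=> [[u v] [/= fuv xu]|[u v] [w /= [[xu uw] fuv]]].
      by exists u.
    by move: xu fuv => /= xu fuv; split => //=; move: uw => /= ->.
  by apply: pattern_comp => //; apply: pattern_id; exact: metric_ball_open.
- by split => //=; exact: ballxx.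
- apply/seteqP; split=> [u [v [_]]//|u xu].
  have : pdom f u by rewrite fdom; exact: le_ball xu.
  by move=> [v fuv]; exists v.
- apply/seteqP; split=> [v [u [fuv]]|v yv] /=.
    by rewrite !ballEmdist/= (fi _ _ _ _ fxy fuv).
  have : prange f v by rewrite fran; exact: le_ball yv.
  move=> [u fuv]; exists u; split => //=; move: yv.
  by rewrite !ballEmdist/= (fi _ _ _ _ fxy fuv).
Qed.
End PartialIsometry.

Section SingularSimplex.
Variables (R : realType).

Definition std_simplex n : set 'rV[R]_n.+1 :=
  [set v | (forall i, 0 <= v ord0 i) /\ \sum_i v ord0 i = 1].
Arguments std_simplex : clear implicits.

Definition face_row n (i : 'I_n.+2) (v : 'rV[R]_n.+1) : 'rV[R]_n.+2 :=
  \row_j (if unlift i j is Some k then v ord0 k else 0).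

Lemma face_row_std n (i : 'I_n.+2) v :
  std_simplex n v -> std_simplex n.+1 (face_row i v).
Proof.
move=> [v0 v1]; split=> [j|].
  by rewrite mxE; case: unliftP.
rewrite (bigD1_ord i)//= mxE unlift_none add0r -v1.
by apply: eq_bigr => j _; rewrite mxE liftK.
Qed.

Definition face_fun n (i : 'I_n.+2) (p : std_simplex n) : std_simplex n.+1 :=
  exist _ (face_row i (set_val p))
    (mem_set (face_row_std i (set_mem (valP p)))).

Lemma face_row_continuous n (i : 'I_n.+2) : continuous (@face_row n i).
Proof.
move=> v A /nbhs_ballP[e e0 eA].
apply/nbhs_ballP; exists e => // w [_ vw]; apply: eA; split=> // k j.
rewrite !mxE; case: unliftP => [l _|_]; [exact: vw|exact: ballxx].
Qed.

Lemma face_fun_continuous n (i : 'I_n.+2) : continuous (@face_fun n i).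
Proof.
apply/continuous_comp_initial => p.
apply: (@continuous_comp _ _ _ set_val (face_row i)).
  exact: initial_continuous.
exact: face_row_continuous.
Qed.

Lemma std_simplex_rV_compact n : compact (std_simplex n).
Proof.
apply: bounded_closed_compact.
  exists 1; split=> // M M1 v [v0 v1] /=.
  rewrite [leLHS]/Num.norm /= mx_normrE; apply: bigmax_le => [|[k j] _ /=].
    exact: le_trans (ltW M1).
  rewrite ord1 ger0_norm//; apply: le_trans (ltW M1).
  by rewrite -v1 (bigD1 j)//= lerDl sumr_ge0.
have -> : std_simplex n =
    (\bigcap_(i : 'I_n.+1) ((fun v : 'rV[R]_n.+1 => v ord0 i) @^-1` [set x | 0 <= x]))
    `&` ((fun v : 'rV[R]_n.+1 => \sum_i v ord0 i) @^-1` [set 1]).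
  by apply/seteqP; split=> v [v0 v1]; split=> // i; [move=> _|]; exact: v0.
apply: closedI.
  apply: closed_bigI => i _; apply: preimage_closed; last exact: closed_ge.
  by move=> v _; exact: coord_continuous.
apply: preimage_closed; last exact: closed_eq.
suff sc (l : seq 'I_n.+1) :
    continuous (fun v : 'rV[R]_n.+1 => \sum_(i <- l) v ord0 i) by move=> v _; exact: sc.
elim: l => [|i l IHl].
  rewrite (_ : (fun _ => _) = cst 0); first by move=> v; exact: cst_continuous.
  by apply/funext => v; rewrite big_nil.
rewrite (_ : (fun _ => _) =
    (fun v : 'rV[R]_n.+1 => v ord0 i) \+ (fun v => \sum_(i <- l) v ord0 i)).
  by move=> v; apply: continuousD; [exact: coord_continuous|exact: IHl].
by apply/funext => v; rewrite big_cons.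
Qed.

Lemma std_simplex_compact n : compact [set: std_simplex n].
Proof.
move=> F FF _.
have [|v [vS Fv]] := @std_simplex_rV_compact n (set_val @ F) _.
  have : F (set_val @^-1` std_simplex n) by apply: filterS filterT => b _; exact: set_valP.
  exact.
exists (exist _ v (mem_set vS)); split=> // B C FB [_ [[U oU <-] Uv UC]].
have FB' : F (set_val @^-1` (set_val @` B)).
  by apply: filterS FB => b Bb; exists b.
have nU : nbhs v U by apply: open_nbhs_nbhs; split=> //; exact: Uv.
by have [_ [[b Bb <-] Ub]] := Fv _ _ FB' nU; exists b; split=> //; exact: UC.
Qed.
End SingularSimplex.
Arguments std_simplex : clear implicits.

Section SingularChain.
Variables (R : realType) (X : metricType R).

Definition simplex n := continuousType (std_simplex R n) X.

Definition face n (i : 'I_n.+2) (s : simplex n.+1) : simplex n :=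
  s \o mkcts (@face_fun_continuous R n i).

(* A chain, finite or not, is its coefficient function. The sums below are
   finitely supported sums, and are only meaningful as such. *)
Definition bdry (A : zmodType) n (c : simplex n.+1 -> A) : simplex n -> A :=
  fun t => \sum_(i < n.+2)
    (\sum_(s \in [set s | face i s = t]) c s) *~ (-1) ^+ i.

Definition carries (f : partial_map X) n (s t : simplex n) := forall p, f (s p, t p).

Definition push (A : zmodType) (f : partial_map X) n (c : simplex n -> A) :
    simplex n -> A :=
  fun t => \sum_(s \in [set s | carries f s t]) c s.

Definition chain_at (A : zmodType) n (c : simplex n -> A) (x : X) :
    simplex n -> A :=
  fun s => if `[< range s x >] then c s else 0.

Definition locally_finite (A : zmodType) n (c : simplex n -> A) :=
  forall K, compact K ->
    finite_set [set s | c s != 0 /\ range s `&` K !=set0].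

Lemma carries_inj (f : partial_map X) n (s s' t : simplex n) : isometric f ->
  carries f s t -> carries f s' t -> s = s'.
Proof.
move=> fi st s't; apply/continuousEP => p.
exact: (isometric_inj fi (st p) (s't p)).
Qed.

Lemma simplex_compact n (s : simplex n) : compact (range s).
Proof.
apply: continuous_compact; last exact: std_simplex_compact.
by apply: continuous_subspaceT; exact: cts_fun.
Qed.

Lemma simplex_range_neq0 n (s : simplex n) : range s !=set0.
Proof.
have v0 : std_simplex R n (delta_mx ord0 ord0).
  split=> [i|]; first by rewrite mxE ler0n.
  rewrite (bigD1 ord0)//= mxE !eqxx big1 ?addr0// => i i0.
  by rewrite mxE (negPf i0) andbF.
pose p : std_simplex R n := exist (fun v => v \in std_simplex R n) _ (mem_set v0).
by exists (s p), p.
Qed.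

Lemma face_range n i (s : simplex n.+1) : range (face i s) `<=` range s.
Proof. by move=> _ [p _ <-]; exists (face_fun i p). Qed.
End SingularChain.

Section FiniteSums.
Variables (G : pzRingType) (V : lmodType G) (I : choiceType).

Lemma lin_comb0 (a : G) (u v : V) : u = 0 -> v = 0 -> a *: u + v = 0.
Proof. by move=> -> ->; rewrite scaler0 addr0. Qed.

Lemma fct_lin (T : Type) (a : G) (u v : T -> V) t :
  (a *: u + v) t = a *: u t + v t.
Proof. by []. Qed.

Lemma fsum_linear (A : set I) (a : G) (f g : I -> V) :
  finite_set (A `&` [set i | f i != 0]) ->
  finite_set (A `&` [set i | g i != 0]) ->
  \sum_(i \in A) (a *: f i + g i) =
  a *: (\sum_(i \in A) f i) + \sum_(i \in A) g i.
Proof.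
move=> Af Ag; set D := (A `&` [set i | f i != 0]) `|` (A `&` [set i | g i != 0]).
have DA : D `<=` A by move=> i [[]|[]].
have f0 i : (A `\` D) i -> f i = 0.
  by move=> [Ai nD]; apply/eqP/negPn/negP => fi; apply: nD; left.
have g0 i : (A `\` D) i -> g i = 0.
  by move=> [Ai nD]; apply/eqP/negPn/negP => gi; apply: nD; right.
have widen (h : I -> V) : (forall i, (A `\` D) i -> h i = 0) ->
  \sum_(i \in A) h i = \sum_(i \in D) h i.
  by move=> h0; apply/esym/fsbig_widen.
rewrite !widen //; last by move=> i Di /=; rewrite f0// g0// scaler0 addr0.
have fD : finite_set D by rewrite finite_setU.
rewrite !fsbig_finite//= scaler_sumr -big_split /=.
by apply: eq_bigr.
Qed.
End FiniteSums.

Section BorelMoore.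
Variables (R : realType) (X : metricType R) (G : pzRingType) (V : lmodType G).

Lemma locally_finite0 n : locally_finite (0 : simplex X n -> V).
Proof.
move=> K _; rewrite (_ : [set _ | _] = set0)//.
by apply/seteqP; split=> // s [/eqP].
Qed.

Lemma locally_finiteP n (a : G) (c e : simplex X n -> V) :
  locally_finite c -> locally_finite e -> locally_finite (a *: c + e).
Proof.
move=> fc fe K cK.
apply: (@sub_finite_set _ _ ([set s | c s != 0 /\ range s `&` K !=set0] `|`
   [set s | e s != 0 /\ range s `&` K !=set0])).
  move=> s [/= nz sK]; have [cs|cs] := eqVneq (c s) 0; last by left.
  right; split=> //; apply: contra_neq nz => es.
  exact: (@lin_comb0 _ V a (c s) (e s)).
by rewrite finite_setU; split; [exact: fc|exact: fe].
Qed.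

Definition bm_submodule n : submodule (simplex X n -> V) :=
  Submodule (@locally_finite0 n) (@locally_finiteP n).
Definition bm_chain n : lmodType G := subm_type (bm_submodule n).

Lemma bm_chain_finite n (c : bm_chain n) : locally_finite (subm_val c).
Proof. by case: c => c /= /asboolP. Qed.

Lemma face_finite n (c : simplex X n.+1 -> V) i (t : simplex X n) :
  locally_finite c ->
  finite_set ([set s | face i s = t] `&` [set s | c s != 0]).
Proof.
move=> /(_ _ (@simplex_compact _ _ _ t)); apply: sub_finite_set => s /= [st cs].
split=> //; have [x tx] := simplex_range_neq0 t; exists x; split=> //.
by move: tx; rewrite -st; exact: face_range.
Qed.

Lemma bdry_linear n (a : G) (c e : simplex X n.+1 -> V) :
  locally_finite c -> locally_finite e ->
  bdry (a *: c + e) = a *: bdry c + bdry e.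
Proof.
move=> fc fe; apply/funext => t.
rewrite fct_lin /bdry scaler_sumr -big_split/=.
apply: eq_bigr => i _.
by rewrite fsum_linear; [rewrite mulrzDl scalerMzr|exact: face_finite..].
Qed.

Lemma bdry_finite n (c : simplex X n.+1 -> V) :
  locally_finite c -> locally_finite (bdry c).
Proof.
move=> fc K cK; set D := [set s | c s != 0 /\ range s `&` K !=set0].
apply: (@sub_finite_set _ _ (\bigcup_(i in [set: 'I_n.+2]) (face i @` D))).
  move=> t [/= nz [x [tx Kx]]]; apply: contrapT => nD.
  move/eqP: nz; apply; rewrite /bdry big1// => i _.
  rewrite fsbig1 ?mul0rz// => s /= st; apply/eqP/negPn/negP => cs.
  apply: nD; exists i => //; exists s => //; split=> //; exists x; split=> //.
  by move: tx; rewrite -st; exact: face_range.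
by apply: bigcup_finite => // i _; apply: finite_image; exact: fc.
Qed.

Definition bm_bdry n (c : bm_chain n.+1) : bm_chain n :=
  @SubmType G _ (bm_submodule n) (bdry (subm_val c))
    (asboolT (bdry_finite (bm_chain_finite c))).

Lemma bm_bdry_linear n : linear (@bm_bdry n).
Proof.
move=> a c e; apply: val_inj => /=.
exact: (bdry_linear a (bm_chain_finite c) (bm_chain_finite e)).
Qed.

HB.instance Definition _ n :=
  GRing.isLinear.Build G (bm_chain n.+1) (bm_chain n) *:%R (@bm_bdry n)
    (@bm_bdry_linear n).
End BorelMoore.

Section PatternHomology.
Variables (R : realType) (X : metricType R) (P : pattern X).
Variables (G : pzRingType) (V : lmodType G).

Definition equivariant_to (r : R) n (c : simplex X n -> V) :=
  (forall s, c s != 0 -> exists z, range s `<=` ball z (r / 2)) /\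
  forall x y f, pattern_ball P r x y f ->
    push f (chain_at c x) = chain_at c y.

Lemma chain_at_linear n (a : G) (c e : simplex X n -> V) x :
  chain_at (a *: c + e) x = a *: chain_at c x + chain_at e x.
Proof.
apply/funext => s; rewrite fct_lin.
by rewrite /chain_at; case: ifP => // _; rewrite scaler0 addr0.
Qed.

Lemma push_linear (f : partial_map X) n (a : G) (c e : simplex X n -> V) :
  isometric f -> push f (a *: c + e) = a *: push f c + push f e.
Proof.
move=> fi; apply/funext => t; rewrite fct_lin.
have ft : finite_set [set s : simplex X n | carries f s t].
  have [[s st]|ns] := pselect (exists s, carries f s t).
    apply: (@sub_finite_set _ _ [set s]) => // s' s't.
    exact: (carries_inj fi s't st).
  rewrite (_ : [set _ | _] = set0)//; apply/seteqP; split=> // s st.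
  by apply: ns; exists s.
by rewrite /push fsum_linear//; exact: sub_finite_set ft.
Qed.

Lemma equivariant_le (r r' : R) n (c : simplex X n -> V) : 0 < r -> r <= r' ->
  equivariant_to r c -> equivariant_to r' c.
Proof.
move=> r0 rr' [cball cP]; split=> [s /cball[z sz]|x y f fP].
  exists z; apply: (subset_trans sz); apply: le_ball.
  by rewrite ler_pM2r// invr_gt0.
have gP := pattern_ball_le r0 rr' fP; rewrite -(cP _ _ _ gP).
apply/funext => t; rewrite /push; apply/esym/fsbig_widen => [s /= st p|s /= [st nst]].
  by have [] := st p.
rewrite /chain_at; case: asboolP => // sx; apply/eqP/negPn/negP => /cball[z sz].
apply: nst => p; split=> //=.
rewrite [r]splitr; apply: (@ball_triangle _ _ z); last by apply: sz; exists p.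
by apply: ball_sym; exact: sz.
Qed.

Definition equivariant n (c : bm_chain X V n) :=
  exists2 r, 0 < r & equivariant_to r (subm_val c).

Lemma equivariant0 n : equivariant (0 : bm_chain X V n).
Proof.
exists 1 => //; split=> [s /eqP//|x y f fP].
have z x' : chain_at (0 : simplex X n -> V) x' = 0.
  by apply/funext => s; rewrite /chain_at; case: ifP.
rewrite [subm_val _](_ : _ = 0)// !z.
by apply/funext => t; rewrite /push fsbig1.
Qed.

Lemma equivariantP n (a : G) (c e : bm_chain X V n) :
  equivariant c -> equivariant e -> equivariant (a *: c + e).
Proof.
move=> [r r0 cr] [q q0 eq]; exists (Num.max r q); first by rewrite lt_max r0.
have {cr}[cb cP] : equivariant_to (Num.max r q) (subm_val c).
  by apply: equivariant_le cr => //; rewrite le_max lexx.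
have {eq}[eb eP] : equivariant_to (Num.max r q) (subm_val e).
  by apply: equivariant_le eq => //; rewrite le_max lexx orbT.
rewrite /equivariant_to (_ : subm_val _ = a *: subm_val c + subm_val e)//.
split=> [s nz|x y f fP].
  have [cs|cs] := eqVneq (subm_val c s) 0; last exact: cb.
  apply: eb; apply: contra_neq nz => es.
  exact: (@lin_comb0 _ V a (subm_val c s) (subm_val e s)).
rewrite !chain_at_linear push_linear ?(cP _ _ _ fP) ?(eP _ _ _ fP)//.
by have [Pf _ _ _] := fP; exact: (pattern_isometric Pf).
Qed.

Definition pattern_chains n : submodule (bm_chain X V n) :=
  Submodule (@equivariant0 n) (@equivariantP n).
End PatternHomology.

Definition pattern_homology (R : realType) (X : metricType R) (P : pattern X)
    (G : comPzRingType) (n : nat) : lmodType G :=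
  homology (@bm_bdry R X G G^o) (pattern_chains P G^o) n.

Section CWDecomposition.
Variables (R : realType) (X : metricType R).

Definition std_interior n : set (std_simplex R n) :=
  [set p | forall i, 0 < (set_val p : 'rV[R]_n.+1) ord0 i].
Arguments std_interior : clear implicits.

(* The standard simplex plays the role of the closed k-disc, so that a
   characteristic map is itself a singular simplex; it orients its cell, being
   a relative cycle that represents a generator of H_k(c, frontier c; Z). *)
Record cw_decomposition := CWDecomposition {
  cell : nat -> choiceType ;
  cmap : forall k, cell k -> simplex X k ;
  open_cell := fun k (c : cell k) => cmap c @` std_interior k ;
  closed_cell := fun k (c : cell k) => range (cmap c) ;
  cell_frontier := fun k (c : cell k) => cmap c @` (~` std_interior k) ;
  cw_cover : forall x, exists k (c : cell k), open_cell c x ;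
  cw_disjoint : forall k l (c : cell k) (d : cell l) x,
    open_cell c x -> open_cell d x -> Tagged cell c = Tagged cell d ;
  cw_inj : forall k (c : cell k), set_inj (std_interior k) (cmap c) ;
  cw_homeo : forall k (c : cell k) (U : set (std_simplex R k)),
    open U -> U `<=` std_interior k ->
    exists2 W, open W & cmap c @` U = W `&` open_cell c ;
  cw_frontier : forall k (c : cell k) x, cell_frontier c x ->
    exists j (d : cell j), (j < k)%N /\ open_cell d x ;
  cw_closure_finite : forall k (c : cell k),
    finite_set [set d : {j & cell j} |
      closed_cell c `&` open_cell (tagged d) !=set0] ;
  cw_weak : forall A : set X,
    (forall k (c : cell k), closed (A `&` closed_cell c)) -> closed A }.

Variable D : cw_decomposition.

Definition skeleton i : set X :=
  [set x | exists j (c : cell D j), (j <= i)%N /\ closed_cell c x].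

Definition cw_finite_dimensional :=
  exists N, forall k, (N < k)%N -> cell D k -> False.

Definition cw_locally_finite := forall x : X, exists2 U, nbhs x U &
  finite_set [set c : {k & cell D k} | closed_cell (tagged c) `&` U !=set0].

Definition cw_radii_lt (r : R) :=
  forall k (c : cell D k), exists z, closed_cell c `<=` ball z r.

Definition cellular_isometry k (c d : cell D k) (f : partial_map X) :=
  [/\ isometric f, pdom f = closed_cell c, prange f = closed_cell d &
      forall i x y, f (x, y) -> skeleton i x -> skeleton i y].

Definition tame k (c : cell D k) (S : set (partial_map X)) :=
  exists (U : set X) (F : R -> X -> X),
  [/\ closed U, U `<=` closed_cell c,
      exists W, [/\ open W, cell_frontier c `<=` W & W `&` closed_cell c `<=` U],
      {within `[0, 1] `*` U, continuous (fun p : R * X => F p.1 p.2)} &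
  [/\ forall t x, 0 <= t <= 1 -> U x -> U (F t x),
      forall t x, 0 <= t <= 1 -> cell_frontier c x -> F t x = x,
      forall x, U x -> F 0 x = x,
      forall x, U x -> cell_frontier c (F 1 x) &
      forall f t x y, S f -> 0 <= t <= 1 -> f (x, y) -> U x ->
        U y /\ f (F t x, F t y)]].

Definition finite_chain n (c : simplex X n -> int) :=
  finite_set [set s | c s != 0].
Definition carried_by (A : set X) n (c : simplex X n -> int) :=
  forall s, c s != 0 -> range s `<=` A.
Definition unit_chain n (s : simplex X n) (m : int) : simplex X n -> int :=
  fun t => if t == s then m else 0.

(* z and w are finite integral chains in A, equal in H_n(A, B; Z) *)
Definition homologous (A B : set X) n (z w : simplex X n -> int) :=
  exists (b : simplex X n.+1 -> int) (l : simplex X n -> int),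
  [/\ finite_chain b, carried_by A b, finite_chain l, carried_by B l &
      z = w + bdry b + l].

(* f carries the orientation of c to [cell_degree f c d] (that is, 1 or -1)
   times the orientation of d. *)
Definition cell_degree (f : partial_map X) k (c d : cell D k) : int :=
  xget 0 [set m | homologous (closed_cell d) (cell_frontier d)
                    (push f (unit_chain (cmap c) 1)) (unit_chain (cmap d) m)].

(* The coefficient of d in the cellular boundary of c: the image of the
   boundary of c in H_k(X^k, X^k \ e_d; Z), which is infinite cyclic and
   generated by the class of d. *)
Definition incidence k (c : cell D k.+1) (d : cell D k) : int :=
  xget 0 [set m | homologous (skeleton k) (skeleton k `\` open_cell d)
                    (bdry (unit_chain (cmap c) 1)) (unit_chain (cmap d) m)].

Variable G : comPzRingType.

(* The coefficient of a chain at c is the one at c with the orientation given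
   by its characteristic map. Cells c whose closure misses e_d have incidence
   number zero. *)
Definition cell_bdry k (s : cell D k.+1 -> G^o) : cell D k -> G^o :=
  fun d => \sum_(c \in [set c | closed_cell c `&` open_cell d !=set0])
    s c *~ incidence c d.
End CWDecomposition.

Section CellularPattern.
Variables (R : realType) (X : metricType R).

Record cellular_pattern := CellularPattern {
  cp_cw :> cw_decomposition X ;
  cp_dim : cw_finite_dimensional cp_cw ;
  cp_locally_finite : cw_locally_finite cp_cw ;
  cp_bounded : exists r, cw_radii_lt cp_cw r ;
  cp_mor : R -> forall k, cell cp_cw k -> cell cp_cw k -> set (partial_map X) ;
  cp_isometry : forall r, 0 < r -> forall k (c d : cell cp_cw k) f,
    cp_mor r c d f -> cellular_isometry c d f ;
  cp_finite : forall r, 0 < r -> forall k (c d : cell cp_cw k),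
    finite_set (cp_mor r c d) ;
  cp_id : forall r, 0 < r -> forall k (c : cell cp_cw k),
    cp_mor r c c (pid (closed_cell c)) ;
  cp_inv : forall r, 0 < r -> forall k (c d : cell cp_cw k) f,
    cp_mor r c d f -> cp_mor r d c (pinv f) ;
  cp_comp : forall r, 0 < r -> forall k (c d e : cell cp_cw k) f g,
    cp_mor r c d f -> cp_mor r d e g -> cp_mor r c e (pcomp g f) ;
  cp_tame : forall r, 0 < r -> forall k (c : cell cp_cw k), (0 < k)%N ->
    tame c (cp_mor r c c) ;
  cp_le : forall r r', 0 < r -> r <= r' -> forall k (c d : cell cp_cw k) f,
    cp_mor r' c d f -> cp_mor r c d f ;
  cp_extend : forall r, 0 < r -> exists2 r', 0 < r' &
    forall k (c d : cell cp_cw k) f, cp_mor r' c d f ->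
    exists g : cell cp_cw k.+1 -> cell cp_cw k.+1,
      set_bij [set c' | closed_cell c `<=` closed_cell c']
              [set d' | closed_cell d `<=` closed_cell d'] g /\
      forall c', closed_cell c `<=` closed_cell c' ->
        exists2 f', cp_mor r c' (g c') f' & prestrict f' (closed_cell c) = f }.

Definition represents (C : cellular_pattern) (P : pattern X) :=
  (forall r, 0 < r -> exists2 r', 0 < r' &
     forall x y f, pattern_ball P r' x y f ->
     forall k (c : cell C k), closed_cell c x ->
     exists d : cell C k, cp_mor r c d (prestrict f (closed_cell c))) /\
  (forall r, 0 < r -> cw_radii_lt C (r / 2) -> exists2 r', 0 < r' &
     forall k (c d : cell C k) f, cp_mor r' c d f ->
     exists x y f', [/\ closed_cell c x, pattern_ball P r x y f' &
                        prestrict f' (closed_cell c) = f]).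

Variables (C : cellular_pattern) (G : comPzRingType).

Definition cell_equivariant k (s : cell C k -> G^o) :=
  exists2 r, 0 < r & forall (c d : cell C k) f, cp_mor r c d f ->
    s d = s c *~ cell_degree f c d.

Lemma cell_equivariant0 k : @cell_equivariant k 0.
Proof. by exists 1 => // c d f _; rewrite [LHS]/0 mul0rz. Qed.

Lemma cell_equivariantP k (a : G) s t :
  @cell_equivariant k s -> @cell_equivariant k t ->
  @cell_equivariant k (a *: s + t).
Proof.
move=> [r r0 sr] [q q0 tq]; exists (Num.max r q); first by rewrite lt_max r0.
move=> c d f fm.
rewrite !fct_lin (sr c d f) ?(tq c d f) ?mulrzDl ?scalerMzr//.
  by apply: cp_le fm => //; rewrite le_max lexx orbT.
by apply: cp_le fm => //; rewrite le_max lexx.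
Qed.

Definition cell_chains k : submodule (cell C k -> G^o) :=
  Submodule (@cell_equivariant0 k) (@cell_equivariantP k).

Lemma cofaces_finite k (d : cell C k) : finite_set
  [set c : cell C k.+1 | closed_cell c `&` open_cell d !=set0].
Proof.
pose T := {k & cell C k}.
pose F : set_system (set T) :=
  [set Q | exists2 S, finite_set S & forall S', S `<=` S' -> Q S'].
have FF : Filter F.
  split; first by exists set0.
    move=> Q Q' [S fS SQ] [S' fS' SQ']; exists (S `|` S').
      by rewrite finite_setU.
    by move=> S''; rewrite subUset => -[SS SS']; split; [exact: SQ|exact: SQ'].
  by move=> Q Q' QQ' [S fS SQ]; exists S => // S' /SQ /QQ'.
have /compact_near_coveringP : compact (closed_cell d) by exact: simplex_compact.
move=> /(_ _ F (fun S y => forall c : T, closed_cell (tagged c) y -> S c) FF).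
case=> [x _|S fS /(_ S (@subset_refl _ _)) dS].
  have [U Ux Ufin] := cp_locally_finite C x.
  exists (U, [set S | [set c : T | closed_cell (tagged c) `&` U !=set0] `<=` S]).
    by split=> //=; eexists; first exact: Ufin.
  by move=> [y S] /= [Uy US] c cy; apply: US; exists y.
have /finite_preimage : {in Tagged (cell C) @^-1` S &,
    injective (fun c : cell C k.+1 => Tagged (cell C) c)}.
  move=> c c' _ _ /(congr1 (tagged_as (Tagged (cell C) c))).
  by rewrite !tagged_asE.
move=> /(_ fS); apply: sub_finite_set => c /= [y [cy [p _ py]]].
by apply: (dS y) => //; exists p.
Qed.

Lemma cell_bdry_linear k : linear (@cell_bdry R X C G k).
Proof.
move=> a s t; apply/funext => d; rewrite fct_lin /cell_bdry -fsum_linear.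
- by apply: eq_fsbigr => c _; rewrite fct_lin mulrzDl scalerMzr.
- by apply: sub_finite_set (cofaces_finite d) => c [].
- by apply: sub_finite_set (cofaces_finite d) => c [].
Qed.

HB.instance Definition _ k :=
  GRing.isLinear.Build G (cell C k.+1 -> G^o) (cell C k -> G^o) *:%R
    (@cell_bdry R X C G k) (@cell_bdry_linear k).

Definition cellular_homology (n : nat) : lmodType G :=
  @homology G (fun k => (cell C k -> G^o : lmodType G))
    (fun k => @cell_bdry R X C G k) cell_chains n.
End CellularPattern.

Definition has_division (G : pzRingType) (n : nat) := exists u : G, n%:R * u = 1.

(* Main.v *)
(* The P-equivariant Borel-Moore complex is filtered by the skeleta of the CW-decomposition.
   Tameness provides deformations of the closed cells towards their frontiers that commute with
   the morphisms of C. Subdividing finely and deforming, one makes a chain of the k-skeleton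
   homologous, equivariantly, to a sum of chains each of which lies in one closed k-cell, up to
   a chain of the (k-1)-skeleton. Excision then reduces the homology of consecutive skeleta to
   that of simplices modulo their boundaries. The chains that bound inside the cells can be
   chosen equivariantly, because an arbitrary choice may be averaged over the finite sets
   C^R(c, d), whose orders are invertible in G. So the relative homology of the k-skeleton modulo
   the (k-1)-skeleton is concentrated in degree k, where it is the module of pattern-equivariant
   cellular k-chains, and the connecting map is the cellular boundary. *)

Require Import Defs.
From HB Require Import structures.
From mathcomp Require Import all_boot all_order all_algebra.
From mathcomp Require Import zify lra.
From mathcomp Require Import all_classical all_reals all_analysis.
Set Implicit Arguments.
Unset Strict Implicit.
Unset Printing Implicit Defensive.
Import Order.TTheory GRing.Theory Num.Theory.
Import numFieldNormedType.Exports.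
Local Open Scope classical_set_scope.
Local Open Scope ring_scope.

(** * Finite integral chains and their action *)

(** Nothing bounds the number of isometry types of simplices in an equivariant chain, so one number
    of subdivisions does not make all of them small. The number is chosen simplex by simplex, as a
    function of the set of all numbers that work, so that isometric simplices receive the same one.
    A simplex and its faces may then be subdivided differently; this is repaired by induction on the
    dimension, each simplex being subdivided together with the correction that its faces impose
    ([sop], [tail]).

    Averaging applies to conditions that are affine in the unknown chain and preserved by morphisms;
    having a given relative boundary in a cell and representing a given class there are both of this
    kind. No exact sequence is formed: the isomorphism comes from a relation [corresponding] between
    singular and cellular cycles, which is linear, total, onto and matches boundaries with
    boundaries. The coefficient [theta] of a chain at a cell is read in the skeleton modulo the
    complement of the open cell, the pair in which the incidence numbers are defined. *)

Section FiniteSupport.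
Variable K : choiceType.

Definition fsupp (A : zmodType) (c : K -> A) : set K := [set k | c k != 0].

Lemma finite_uniq_seq (S : set K) : finite_set S ->
  exists2 r : seq K, uniq r & forall k, S k <-> k \in r.
Proof.
move=> /finite_seqP[r Sr]; exists (undup r); first exact: undup_uniq.
by move=> k; rewrite Sr mem_undup.
Qed.

Lemma fsumE (A : zmodType) (r : seq K) (F : K -> A) : uniq r ->
  (forall k, F k != 0 -> k \in r) ->
  \sum_(k \in [set: K]) F k = \sum_(k <- r) F k.
Proof.
move=> ur Fr; rewrite [RHS]fsbig_seq//; apply: esym; apply: fsbig_widen => // k [_ nS].
by apply/eqP/negPn/negP => /Fr.
Qed.

Lemma fsum1 (A : zmodType) (F : K -> A) (k0 : K) :
  (forall k, k != k0 -> F k = 0) -> \sum_(k \in [set: K]) F k = F k0.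
Proof.
move=> F0; rewrite (@fsumE _ [:: k0])// ?big_seq1// => k Fk.
by rewrite inE; apply/negPn/negP => /F0/eqP; exact/negP.
Qed.

Lemma fsumD (A : zmodType) (F F' : K -> A) : finite_set (fsupp F) ->
  finite_set (fsupp F') ->
  \sum_(k \in [set: K]) (F k + F' k) =
  \sum_(k \in [set: K]) F k + \sum_(k \in [set: K]) F' k.
Proof.
move=> fF fF'; have [|r ur rP] := @finite_uniq_seq (fsupp F `|` fsupp F').
  by rewrite finite_setU.
rewrite !(@fsumE _ r) ?big_split// => k nz; apply/rP; rewrite /fsupp/=.
- by right.
- by left.
- have [F0|] := eqVneq (F k) 0; last by left.
  by right; move: nz; rewrite F0 add0r.
Qed.

Lemma fsum_neq0 (A : zmodType) (F : K -> A) :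
  \sum_(k \in [set: K]) F k != 0 -> exists k, F k != 0.
Proof.
move=> nz; apply: contrapT => nF; move/eqP: nz; apply.
apply: fsbig1 => k _; apply/eqP/negPn/negP => Fk; apply: nF.
by exists k.
Qed.
End FiniteSupport.

Section FiniteIntegralChains.
Variable K : choiceType.

Lemma fch0 : finite_set (fsupp (0 : K -> int)).
Proof.
by rewrite (_ : fsupp _ = set0)//; apply/seteqP; split=> // k /= /eqP.
Qed.

Lemma fchP (a : int) (x y : K -> int^o) : finite_set (fsupp x) ->
  finite_set (fsupp y) -> finite_set (fsupp (a *: x + y)).
Proof.
move=> fx fy; apply: (@sub_finite_set _ _ (fsupp x `|` fsupp y)).
  move=> k /= nz; have [xk|] := eqVneq (x k) 0; last by left.
  right; apply: contra_neq nz => yk.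
  exact: (@lin_comb0 _ int^o a (x k) (y k)).
by rewrite finite_setU.
Qed.

Definition fch_submodule : submodule (K -> int^o) := Submodule fch0 fchP.
(** The free abelian group on [K]. Operators on simplices take their values here, with integer
    coefficients, so that one definition serves chains with coefficients in any abelian group, on
    which integers act by [*~]. *)
Definition fch : lmodType int := subm_type fch_submodule.
Definition coef (x : fch) (k : K) : int := (subm_val x : K -> int^o) k.

Lemma coef_finite (x : fch) : finite_set (fsupp (coef x)).
Proof. by have /asboolP := valP x. Qed.

Lemma fch_ext (x y : fch) : coef x =1 coef y -> x = y.
Proof. by move=> xy; apply: val_inj; exact/funext. Qed.

Definition coef_at k (x : fch) : int := coef x k.
Lemma coef_at_is_additive k : zmod_morphism (coef_at k).
Proof. by []. Qed.
HB.instance Definition _ k := GRing.isZmodMorphism.Build fch int (coef_at k)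
  (coef_at_is_additive k).

Lemma coef0 k : coef 0 k = 0. Proof. by []. Qed.
Lemma coefD x y k : coef (x + y) k = coef x k + coef y k. Proof. by []. Qed.
Lemma coefN x k : coef (- x) k = - coef x k. Proof. by []. Qed.
Lemma coefB x y k : coef (x - y) k = coef x k - coef y k. Proof. by []. Qed.
Lemma coef_sum I (r : seq I) (P : pred I) (F : I -> fch) k :
  coef (\sum_(i <- r | P i) F i) k = \sum_(i <- r | P i) coef (F i) k.
Proof. exact: (raddf_sum (coef_at k)). Qed.
Lemma coefMz x m k : coef (x *~ m) k = coef x k *~ m.
Proof. exact: (raddfMz (coef_at k)). Qed.

Definition mkfch (f : K -> int) (ff : finite_set (fsupp f)) : fch :=
  @SubmType _ _ fch_submodule f (asboolT ff).

Lemma delta_finite k : finite_set (fsupp (fun l : K => (l == k)%:R : int)).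
Proof.
apply: (@sub_finite_set _ _ [set k]) => // l; rewrite /fsupp/=.
by have [//|_] := eqVneq l k; rewrite eqxx.
Qed.

Definition fdelta k : fch := mkfch (delta_finite k).

Lemma fdeltaE k l : coef (fdelta k) l = (l == k)%:R. Proof. by []. Qed.

Lemma fch_sum (x : fch) (r : seq K) : uniq r ->
  (forall k, coef x k != 0 -> k \in r) ->
  x = \sum_(k <- r) fdelta k *~ coef x k.
Proof.
move=> ur xr; apply: fch_ext => l; rewrite coef_sum.
under eq_bigr do rewrite coefMz fdeltaE.
have [lr|lr] := boolP (l \in r).
  rewrite (bigD1_seq l)//= eqxx intz big1 ?addr0// => k.
  by rewrite eq_sym => /negPf ->; rewrite mul0rz.
rewrite big_seq big1 => [|k kr]; first by apply/eqP; apply: contraNT lr => /xr.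
by case: eqP => [lk|]; [rewrite lk kr in lr|rewrite mul0rz].
Qed.

Section LinearExtension.
Variables (M : zmodType) (f : K -> M).

Definition linext (x : fch) : M := \sum_(k \in [set: K]) f k *~ coef x k.

Lemma linext_finite x : finite_set (fsupp (fun k => f k *~ coef x k)).
Proof.
apply: sub_finite_set (coef_finite x) => k; rewrite /fsupp/=.
by apply: contraNneq => ->; rewrite mulr0z.
Qed.

Lemma linext_is_additive : zmod_morphism linext.
Proof.
have linextD x y : linext (x + y) = linext x + linext y.
  rewrite /linext -fsumD; [|exact: linext_finite..].
  by apply: eq_fsbigr => k _; rewrite coefD mulrzDr.
by move=> x y; apply/eqP; rewrite eq_sym subr_eq -linextD subrK.
Qed.
HB.instance Definition _ := GRing.isZmodMorphism.Build fch M linext linext_is_additive.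

Lemma linext_delta k : linext (fdelta k) = f k.
Proof.
rewrite /linext (@fsum1 _ _ _ k) ?fdeltaE ?eqxx ?mulr1z// => l /negPf lk.
by rewrite fdeltaE lk mulr0z.
Qed.
End LinearExtension.

(** Only the basis elements in the support of [x] have to be compared, so range conditions known for
    the simplices of [x] are available when an identity of operators is checked on generators. *)
Lemma fch_morph_ext (M : zmodType) (g h : {additive fch -> M}) x :
  (forall k, coef x k != 0 -> g (fdelta k) = h (fdelta k)) -> g x = h x.
Proof.
move=> gh; have [r ur xr] := finite_uniq_seq (coef_finite x).
have xr' k : coef x k != 0 -> k \in r by move=> /xr.
rewrite (fch_sum ur xr') !raddf_sum; apply: eq_big_seq => k /xr kx.
by rewrite !raddfMz gh.
Qed.

Lemma linext_eq (M : zmodType) (f g : K -> M) x :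
  (forall k, coef x k != 0 -> f k = g k) -> linext f x = linext g x.
Proof. by move=> fg; apply: fch_morph_ext => k /fg fgk; rewrite /= !linext_delta. Qed.

Lemma linext_morph (M N : zmodType) (g : {additive M -> N}) (f : K -> M) x :
  g (linext f x) = linext (g \o f) x.
Proof.
by apply: (@fch_morph_ext _ (g \o linext f)) => k _; rewrite /= !linext_delta.
Qed.

Lemma linext_id x : linext fdelta x = x.
Proof. by apply: (@fch_morph_ext _ _ idfun) => k _; rewrite /= linext_delta. Qed.

Lemma linext0 (M : zmodType) x : linext (fun=> 0 : M) x = 0.
Proof. by rewrite /linext fsbig1// => k _; rewrite mul0rz. Qed.

Lemma linextfD (M : zmodType) (f g : K -> M) x :
  linext (fun k => f k + g k) x = linext f x + linext g x.
Proof.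
by apply: (@fch_morph_ext _ _ (linext f \+ linext g)) => k _; rewrite /= !linext_delta.
Qed.

Lemma linextfB (M : zmodType) (f g : K -> M) x :
  linext (fun k => f k - g k) x = linext f x - linext g x.
Proof.
by apply: (@fch_morph_ext _ _ (linext f \- linext g)) => k _; rewrite /= !linext_delta.
Qed.

Lemma linextf_sum (M : zmodType) I (r : seq I) (f : I -> K -> M) x :
  linext (fun k => \sum_(i <- r) f i k) x = \sum_(i <- r) linext (f i) x.
Proof.
elim: r => [|i r IHr].
  by rewrite big_nil -[RHS](linext0 M x); apply: linext_eq => k _; rewrite big_nil.
rewrite big_cons -IHr -linextfD; apply: linext_eq => k _; exact: big_cons.
Qed.

End FiniteIntegralChains.

Section Action.
Variables (K K' : choiceType) (A : zmodType).
Implicit Types (D : K -> fch K') (c : K -> A).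

(* The coefficients of a chain need not have finite support; [act] is the
   linear extension of an operator with finite integral values. *)
Definition act D c : K' -> A :=
  fun t => \sum_(s \in [set: K]) c s *~ coef (D s) t.

(** Makes the sum in [act D c] finite at each [t], although the support of [c] may be infinite. *)
Definition admissible D c :=
  forall t, finite_set [set s | c s != 0 /\ coef (D s) t != 0].

Lemma admissible_fin D c : finite_set (fsupp c) -> admissible D c.
Proof. by move=> fc t; apply: sub_finite_set fc => s []. Qed.

Lemma act_supp D c t : finite_set [set s | c s != 0 /\ coef (D s) t != 0] ->
  finite_set (fsupp (fun s => c s *~ coef (D s) t)).
Proof.
apply: sub_finite_set => s; rewrite /fsupp/= => nz; split.
  by apply: contra_neq nz => ->; rewrite mul0rz.
by apply: contra_neq nz => ->; rewrite mulr0z.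
Qed.

Lemma actE D c t (r : seq K) : uniq r ->
  (forall s, c s != 0 -> coef (D s) t != 0 -> s \in r) ->
  act D c t = \sum_(s <- r) c s *~ coef (D s) t.
Proof.
move=> ur rP; apply: fsumE => // s nz; apply: rP.
  by apply: contra_neq nz => ->; rewrite mul0rz.
by apply: contra_neq nz => ->; rewrite mulr0z.
Qed.

Lemma act_neq0 D c t : act D c t != 0 -> exists2 s, c s != 0 & coef (D s) t != 0.
Proof.
move=> /fsum_neq0[s nz]; exists s.
  by apply: contra_neq nz => ->; rewrite mul0rz.
by apply: contra_neq nz => ->; rewrite mulr0z.
Qed.

Lemma act_eq D D' c : (forall s, c s != 0 -> D s = D' s) -> act D c = act D' c.
Proof.
move=> DD'; apply/funext => t; apply: eq_fsbigr => s _.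
by have [->|/DD' ->//] := eqVneq (c s) 0; rewrite !mul0rz.
Qed.

Lemma act0 D : act D 0 = 0.
Proof. by apply/funext => t; apply: fsbig1 => s _; rewrite mul0rz. Qed.

Lemma actD D c c' : admissible D c -> admissible D c' ->
  act D (c + c') = act D c + act D c'.
Proof.
move=> Dc Dc'; apply/funext => t.
rewrite -[RHS]/(act D c t + act D c' t) /act -fsumD; [|exact: act_supp..].
by apply: eq_fsbigr => s _; rewrite -mulrzDl.
Qed.

End Action.

Section ActionMorphism.
Variables (K K' : choiceType).
Implicit Types (D : K -> fch K').

Lemma act_morph (A B : zmodType) (g : {additive A -> B}) D (c : K -> A) :
  admissible D c -> act D (g \o c) = g \o act D c.
Proof.
move=> Dc; apply/funext => t; have [r ur rP] := finite_uniq_seq (Dc t).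
rewrite /= !(@actE _ _ _ _ _ _ r)// => [|s cs Ds|s /= cs Ds].
- by rewrite raddf_sum; apply: eq_bigr => s _; rewrite raddfMz.
- exact/rP.
- by apply/rP; split=> //; apply: contra_neq cs => ->; rewrite raddf0.
Qed.

Variable A : zmodType.
Implicit Types (c : K -> A).

Lemma actN D c : admissible D c -> act D (- c) = - act D c.
Proof. by move=> Dc; exact: (@act_morph _ _ (@GRing.opp A) _ _ Dc). Qed.

Lemma admissibleN D c : admissible D c -> admissible D (- c).
Proof.
move=> Dc t; apply: sub_finite_set (Dc t) => s [].
by rewrite [in X in X -> _]/GRing.opp/= oppr_eq0.
Qed.

Lemma actB D c c' : admissible D c -> admissible D c' ->
  act D (c - c') = act D c - act D c'.
Proof. by move=> Dc Dc'; rewrite actD ?actN//; exact: admissibleN. Qed.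

Lemma act_opD D D' c : admissible D c -> admissible D' c ->
  act (fun s => D s + D' s) c = act D c + act D' c.
Proof.
move=> Dc D'c; apply/funext => t.
rewrite -[RHS]/(act D c t + act D' c t) /act -fsumD; [|exact: act_supp..].
by apply: eq_fsbigr => s _; rewrite coefD mulrzDr.
Qed.

Lemma act_opN D c : admissible D c -> act (fun s => - D s) c = - act D c.
Proof.
move=> Dc; rewrite -actN//; apply/funext => t; apply: eq_fsbigr => s _.
by rewrite coefN mulrNz mulNrz.
Qed.

Lemma admissible_opN D c : admissible D c -> admissible (fun s => - D s) c.
Proof.
by move=> Dc t; apply: sub_finite_set (Dc t) => s []; rewrite coefN oppr_eq0.
Qed.

Lemma act_opB D D' c : admissible D c -> admissible D' c ->
  act (fun s => D s - D' s) c = act D c - act D' c.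
Proof.
by move=> Dc D'c; rewrite act_opD ?act_opN//; exact: admissible_opN.
Qed.

Lemma act_delta (c : K -> A) : act (@fdelta K) c = c.
Proof.
apply/funext => t; rewrite /act (@fsum1 _ _ _ t) ?fdeltaE ?eqxx// => s st.
by rewrite fdeltaE eq_sym (negPf st) mulr0z.
Qed.

Lemma act_fin D c : finite_set (fsupp c) -> finite_set (fsupp (act D c)).
Proof.
move=> fc; apply: (@sub_finite_set _ _ (\bigcup_(s in fsupp c) fsupp (coef (D s)))).
  by move=> t /act_neq0[s cs Dt]; exists s.
by apply: bigcup_finite => // s _; exact: coef_finite.
Qed.

(** Finiteness is required of the intermediate simplices, since in the coefficients of the composite
    they may cancel. Both sums then run over the finite lists [r] and [q] and can be exchanged. *)
Lemma act_comp (K'' : choiceType) (E : K' -> fch K'') D c :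
  (forall u, finite_set [set s | c s != 0 /\
     exists2 t, coef (D s) t != 0 & coef (E t) u != 0]) ->
  admissible D c ->
  act E (act D c) = act (fun s => linext E (D s)) c.
Proof.
move=> fu Dc; apply/funext => u; have [r ur rP] := finite_uniq_seq (fu u).
have [q uq qP] : exists2 q : seq K', uniq q &
    forall t, (exists2 s, s \in r & coef (D s) t != 0) -> t \in q.
  have [|q uq qP] := @finite_uniq_seq _ (\bigcup_(s in [set` r]) fsupp (coef (D s))).
    by apply: bigcup_finite => // s _; exact: coef_finite.
  by exists q => // t [s sr Dt]; apply/qP; exists s.
rewrite (@actE _ _ _ _ _ u r)//; last first.
  move=> s cs; rewrite -[coef _ u]/(coef_at u (linext E (D s))) linext_morph => nz.
  apply/rP; split=> //; have [t nzt] := fsum_neq0 nz; exists t.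
    by apply: contra_neq nzt => ->; rewrite mulr0z.
  by apply: contra_neq nzt; rewrite /= /coef_at => ->; rewrite mul0rz.
rewrite {1}/act (@fsumE _ _ q)//; last first.
  move=> t nz; apply: qP.
  have Et : coef (E t) u != 0 by apply: contra_neq nz => ->; rewrite mulr0z.
  have /act_neq0[s cs Dt] : act D c t != 0.
    by apply: contra_neq nz => ->; rewrite mul0rz.
  by exists s => //; apply/rP; split=> //; exists t.
transitivity (\sum_(t <- q) \sum_(s <- r) c s *~ (coef (E t) u * coef (D s) t)).
  apply: eq_bigr => t _ /=; have [Et|Et] := eqVneq (coef (E t) u) 0.
    by rewrite Et mulr0z big1// => s _; rewrite mul0r mulr0z.
  rewrite (@actE _ _ _ _ _ t r)//; last first.
    by move=> s cs Ds; apply/rP; split=> //; exists t.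
  by rewrite mulrz_suml; apply: eq_bigr => s _; rewrite -mulrzA mulrC.
rewrite exchange_big; apply: eq_big_seq => s sr /=.
rewrite -[coef _ u]/(coef_at u (linext E (D s))) linext_morph.
rewrite /linext (@fsumE _ _ q)//; last first.
  move=> t nz; apply: qP; exists s => //.
  by apply: contra_neq nz => ->; rewrite mulr0z.
by rewrite mulrz_sumr; apply: eq_bigr => t _; rewrite /= mulrzz.
Qed.

Lemma act_comp_fin (K'' : choiceType) (E : K' -> fch K'') D c :
  finite_set (fsupp c) -> act E (act D c) = act (fun s => linext E (D s)) c.
Proof.
move=> fc; apply: act_comp => [u|]; last exact: admissible_fin.
by apply: sub_finite_set fc => s [].
Qed.

End ActionMorphism.

(** * Affine chains *)

Section Support.
Variable K : choiceType.

Definition allc (Q : K -> Prop) (x : fch K) := forall k, coef x k != 0 -> Q k.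

Lemma allc_sub (Q Q' : K -> Prop) x : (forall k, Q k -> Q' k) ->
  allc Q x -> allc Q' x.
Proof. by move=> QQ' Qx k /Qx/QQ'. Qed.

Lemma allc0 Q : allc Q 0.
Proof. by move=> k; rewrite coef0 eqxx. Qed.

Lemma allcD Q x y : allc Q x -> allc Q y -> allc Q (x + y).
Proof.
move=> Qx Qy k; rewrite coefD; have [xk|/Qx//] := eqVneq (coef x k) 0.
by rewrite xk add0r => /Qy.
Qed.

Lemma allcN Q x : allc Q x -> allc Q (- x).
Proof. by move=> Qx k; rewrite coefN oppr_eq0 => /Qx. Qed.

Lemma allcB Q x y : allc Q x -> allc Q y -> allc Q (x - y).
Proof. by move=> Qx Qy; apply: allcD => //; exact: allcN. Qed.

Lemma allcMz Q x m : allc Q x -> allc Q (x *~ m).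
Proof.
by move=> Qx k; rewrite coefMz => nz; apply: Qx; apply: contra_neq nz => ->; rewrite mul0rz.
Qed.

Lemma allc_sum Q I (r : seq I) (F : I -> fch K) :
  (forall i, allc Q (F i)) -> allc Q (\sum_(i <- r) F i).
Proof.
move=> QF; elim: r => [|i r IHr]; first by rewrite big_nil; exact: allc0.
by rewrite big_cons; exact: allcD.
Qed.

Lemma allc_delta (Q : K -> Prop) k : Q k -> allc Q (fdelta k).
Proof. by move=> Qk l; rewrite fdeltaE; have [->|] := eqVneq l k; rewrite ?eqxx. Qed.

Lemma fdelta_neq0 (k l : K) : coef (fdelta k) l != 0 -> l = k.
Proof. by apply/(@allc_delta (fun l => l = k)). Qed.

Lemma fch_oppr_eq (x : fch K) : x = - x -> x = 0.
Proof.
move=> xx; apply: fch_ext => k; rewrite coef0; apply/eqP.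
have /eqP := congr1 (coef_at k) xx; rewrite raddfN /= /coef_at.
by rewrite -subr_eq0 opprK -mulr2n mulrn_eq0.
Qed.
End Support.

Lemma allc_linext (K K' : choiceType) (Q : K' -> Prop) (Q' : K -> Prop)
    (f : K' -> fch K) (x : fch K') :
  allc Q x -> (forall k, Q k -> allc Q' (f k)) -> allc Q' (linext f x).
Proof.
move=> Qx ff l; rewrite -[coef _ l]/(coef_at l (linext f x)) linext_morph => /fsum_neq0[k nz].
apply: (ff k).
  by apply: Qx; apply: contra_neq nz => ->; rewrite mulr0z.
by apply: contra_neq nz; rewrite /= /coef_at => ->; rewrite mul0rz.
Qed.

Section FaceMatrices.
Variable R : realType.

Definition face_mx n (i : 'I_n.+2) : 'M[R]_(n.+1, n.+2) :=
  \matrix_(j, k) (k == lift i j)%:R.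

Lemma face_mxE n i q (w : 'M[R]_(n.+2, q)) j k :
  (face_mx i *m w) j k = w (lift i j) k.
Proof.
rewrite mxE (bigD1 (lift i j))//= mxE eqxx mul1r big1 ?addr0// => l /negPf lij.
by rewrite mxE lij mul0r.
Qed.

Lemma mul_face_mx n i (v : 'rV[R]_n.+1) : v *m face_mx i = face_row i v.
Proof.
apply/rowP => k; rewrite !mxE; case: unliftP => [l ->|->].
  rewrite (bigD1 l)//= mxE eqxx mulr1 big1 ?addr0// => j jl.
  by rewrite mxE (inj_eq lift_inj) eq_sym (negPf jl) mulr0.
by rewrite big1// => j _; rewrite mxE (negPf (neq_lift i j)) mulr0.
Qed.

(** The simplicial identity as an involution. Deleting vertex [p.1] and then vertex [p.2] of what is
    left deletes the same two vertices as the reverse order, in which their indices are shifted by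
    [lift] and [unbump]. *)
Definition swap_face n (p : 'I_n.+3 * 'I_n.+2) : 'I_n.+3 * 'I_n.+2 :=
  (lift p.1 p.2, inord (unbump p.2 p.1)).

Lemma swap_faceE n (p : 'I_n.+3 * 'I_n.+2) :
  (((swap_face p).1 = bump p.1 p.2 :> nat) *
   ((swap_face p).2 = unbump p.2 p.1 :> nat))%type.
Proof.
split=> //=; rewrite inordK//; case: p => [[i /= li] [j /= lj]].
by rewrite /unbump; case: ltnP => ij; lia.
Qed.

Lemma swap_faceK n : involutive (@swap_face n).
Proof.
move=> p; rewrite [LHS]surjective_pairing [RHS]surjective_pairing.
have [a b] := swap_faceE p; have [c d] := swap_faceE (swap_face p).
congr (_, _); apply: val_inj; [move: c|move: d]; rewrite a b => /= ->.
  by rewrite /bump /unbump; case: (ltnP p.2 p.1) => ij; case: leqP; lia.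
by rewrite /bump /unbump; case: (ltnP p.2 p.1) => ij; case: ltnP; case: leqP; lia.
Qed.

Lemma swap_face_sign n (p : 'I_n.+3 * 'I_n.+2) :
  (-1) ^+ ((swap_face p).1 + (swap_face p).2) = - (-1) ^+ (p.1 + p.2) :> int.
Proof.
have [-> ->] := swap_faceE p; rewrite -signr_odd -(signr_odd _ (p.1 + p.2)).
suff -> : odd (bump p.1 p.2 + unbump p.2 p.1) = ~~ odd (p.1 + p.2).
  by case: odd; rewrite ?expr0 ?expr1 ?opprK.
rewrite /bump /unbump; have [ij|ij] := ltnP p.2 p.1.
  rewrite (_ : (false + p.2 + (p.1 - true))%N = (p.1 + p.2).-1); last by lia.
  by case: (p.1 + p.2)%N (leq_ltn_trans (leq0n _) (ltn_addr p.2 ij)) => [|k _ /=]; rewrite ?negbK.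
by rewrite (_ : (true + p.2 + (p.1 - false))%N = (p.1 + p.2).+1)//; lia.
Qed.

Lemma face_mx_swap n (p : 'I_n.+3 * 'I_n.+2) :
  face_mx (swap_face p).2 *m face_mx (swap_face p).1 = face_mx p.2 *m face_mx p.1.
Proof.
apply/matrixP => l k; rewrite !face_mxE !mxE; congr (_ == _)%:R.
apply: val_inj; have [a b] := swap_faceE p.
rewrite [LHS]/(bump (swap_face p).1 (bump (swap_face p).2 l)) a b.
exact: esym (bumpC _ _ _).
Qed.

(** The involution preserves the terms and reverses the signs, so the sum equals its own opposite;
    integral coefficients then force it to vanish. *)
Lemma alternating_sum0 (K : choiceType) n (F : 'I_n.+3 * 'I_n.+2 -> fch K) :
  (forall p, F (swap_face p) = F p) ->
  \sum_i \sum_j F (i, j) *~ (-1) ^+ (i + j) = 0.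
Proof.
move=> FF; rewrite pair_bigA /=; apply: fch_oppr_eq.
rewrite [LHS](reindex_inj (inv_inj (@swap_faceK n))) -sumrN.
apply: eq_bigr => p _; rewrite -[(_, _)]surjective_pairing FF.
by rewrite swap_face_sign mulrNz; case: p.
Qed.
End FaceMatrices.

Section AffineChains.
Variable R : realType.
Local Notation face_mx := (@face_mx R _).

(* A matrix with m.+1 rows stands for the affine simplex spanned by its rows. *)
Definition lmul m p q (B : 'M[R]_(p, m)) : fch 'M[R]_(m, q) -> fch 'M[R]_(p, q) :=
  linext (fun w => fdelta (B *m w)).
Definition rmul m p q (B : 'M[R]_(p, q)) : fch 'M[R]_(m, p) -> fch 'M[R]_(m, q) :=
  linext (fun w => fdelta (w *m B)).
HB.instance Definition _ m p q B := GRing.Additive.on (@lmul m p q B).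
HB.instance Definition _ m p q B := GRing.Additive.on (@rmul m p q B).

Lemma lmul_delta m p q (B : 'M[R]_(p, m)) (w : 'M[R]_(m, q)) :
  lmul B (fdelta w) = fdelta (B *m w).
Proof. exact: linext_delta. Qed.
Lemma rmul_delta m p q (B : 'M[R]_(p, q)) (w : 'M[R]_(m, p)) :
  rmul B (fdelta w) = fdelta (w *m B).
Proof. exact: linext_delta. Qed.

Lemma rmul_comp m p q r (B : 'M[R]_(p, q)) (B' : 'M[R]_(q, r)) (x : fch 'M[R]_(m, p)) :
  rmul B' (rmul B x) = rmul (B *m B') x.
Proof.
apply: (@fch_morph_ext _ _ (rmul B' \o rmul B) (rmul (B *m B'))) => w _ /=.
by rewrite !rmul_delta mulmxA.
Qed.

(** Multiplication by [face_mx i] on the left deletes a vertex of the affine simplex; on the right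
    it embeds the ambient simplex as a face. The two sides commute, which is why this boundary and
    [rbd] below do. *)
Definition lbd m q (x : fch 'M[R]_(m.+2, q)) : fch 'M[R]_(m.+1, q) :=
  \sum_(i < m.+2) lmul (face_mx i) x *~ (-1) ^+ i.

Lemma lbd_is_additive m q : zmod_morphism (@lbd m q).
Proof.
by move=> x y; rewrite /lbd -sumrB; apply: eq_bigr => i _; rewrite raddfB mulrzBl.
Qed.
HB.instance Definition _ m q := GRing.isZmodMorphism.Build _ _ (@lbd m q) (@lbd_is_additive m q).

Definition cons_mx m q (b : 'rV[R]_q) (w : 'M[R]_(m.+1, q)) : 'M[R]_(m.+2, q) :=
  \matrix_(i, k) if unlift ord0 i is Some j then w j k else b ord0 k.

Lemma cons_mx0 m q (b : 'rV[R]_q) (w : 'M[R]_(m.+1, q)) k :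
  cons_mx b w ord0 k = b ord0 k.
Proof. by rewrite mxE unlift_none. Qed.

Lemma cons_mxS m q (b : 'rV[R]_q) (w : 'M[R]_(m.+1, q)) j k :
  cons_mx b w (lift ord0 j) k = w j k.
Proof. by rewrite mxE liftK. Qed.

Definition cone m q (b : 'rV[R]_q) : fch 'M[R]_(m.+1, q) -> fch 'M[R]_(m.+2, q) :=
  linext (fun w => fdelta (cons_mx b w)).
HB.instance Definition _ m q b := GRing.Additive.on (@cone m q b).

Lemma cone_delta m q (b : 'rV[R]_q) (w : 'M[R]_(m.+1, q)) :
  cone b (fdelta w) = fdelta (cons_mx b w).
Proof. exact: linext_delta. Qed.

Lemma face0_cons m q (b : 'rV[R]_q) (w : 'M[R]_(m.+1, q)) :
  face_mx (ord0 : 'I_m.+2) *m cons_mx b w = w.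
Proof. by apply/matrixP => j k; rewrite face_mxE cons_mxS. Qed.

Lemma faceS_cons m q (b : 'rV[R]_q) (w : 'M[R]_(m.+2, q)) (i : 'I_m.+2) :
  face_mx (lift ord0 i) *m cons_mx b w = cons_mx b (face_mx i *m w).
Proof.
apply/matrixP => j k; rewrite face_mxE; case: (unliftP ord0 j) => [l ->|->].
  rewrite (_ : lift (lift ord0 i) (lift ord0 l) = lift ord0 (lift i l)).
    by rewrite !cons_mxS face_mxE.
  by apply: val_inj; rewrite /= /bump /=; lia.
rewrite (_ : lift (lift ord0 i) ord0 = ord0) ?cons_mx0//.
exact: val_inj.
Qed.

Lemma lbd_cone m q (b : 'rV[R]_q) (x : fch 'M[R]_(m.+2, q)) :
  lbd (cone b x) = x - cone b (lbd x).
Proof.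
apply: (@fch_morph_ext _ _ (@lbd _ q \o @cone _ q b)
  (idfun \- (@cone _ q b \o @lbd _ q))) => w _ /=.
rewrite cone_delta /lbd big_ord_recl lmul_delta face0_cons expr0 mulr1z; congr (_ + _).
rewrite (raddf_sum (cone b)) -sumrN; apply: eq_bigr => i _.
rewrite raddfMz /= !lmul_delta faceS_cons cone_delta.
by rewrite /bump leq0n add1n exprS mulN1r mulrNz.
Qed.

Definition aug K : fch K -> int := linext (fun=> 1).
HB.instance Definition _ K := GRing.Additive.on (@aug K).

(** In degree 0 the boundary of each edge of the cone also contains the apex, which is counted
    [aug x] times in all, with a minus sign. *)
Lemma lbd_cone0 q (b : 'rV[R]_q) (x : fch 'M[R]_(1, q)) :
  lbd (cone b x) = x - fdelta b *~ aug x.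
Proof.
rewrite -[RHS]/((idfun \- (fun y : fch 'M[R]_(1, q) => fdelta b *~ aug y)) x).
have [r ur rx] := finite_uniq_seq (coef_finite x).
rewrite {1 2}[x](@fch_sum _ _ r)//; last by move=> k kx; exact/rx.
rewrite /= (raddf_sum (@aug _)) mulrz_sumr -sumrB (raddf_sum (cone b)) (raddf_sum (@lbd _ _)); apply: eq_bigr => w _.
rewrite !raddfMz /= cone_delta /lbd big_ord_recl big_ord1 !lmul_delta face0_cons.
rewrite expr0 expr1 mulr1z mulrNz mulr1z /aug linext_delta.
have -> : face_mx (lift ord0 ord0) *m cons_mx b w = b.
  apply/rowP => k; rewrite face_mxE ord1 -[RHS](cons_mx0 b w k).
  by congr (cons_mx b w _ k); exact: val_inj.
by rewrite mulrzBl mulr1z mulNrz.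
Qed.
End AffineChains.

Section RightBoundary.
Variable R : realType.

(* An abstract family of coface maps, so as to treat the simplices and the
   prisms over them alike. *)
Variables (d : nat -> nat) (D : forall n, 'I_n.+2 -> 'M[R]_(d n, d n.+1)).
Hypothesis D_swap : forall n (p : 'I_n.+3 * 'I_n.+2),
  D (swap_face p).2 *m D (swap_face p).1 = D p.2 *m D p.1.

Definition rbd n m (x : fch 'M[R]_(m, d n)) : fch 'M[R]_(m, d n.+1) :=
  \sum_(i < n.+2) rmul (D i) x *~ (-1) ^+ i.

Lemma rbd_is_additive n m : zmod_morphism (@rbd n m).
Proof.
by move=> x y; rewrite /rbd -sumrB; apply: eq_bigr => i _; rewrite raddfB mulrzBl.
Qed.
HB.instance Definition _ n m :=
  GRing.isZmodMorphism.Build _ _ (@rbd n m) (@rbd_is_additive n m).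

Lemma rbd_rbd n m (x : fch 'M[R]_(m, d n)) : rbd (rbd x) = 0.
Proof.
apply: (@fch_morph_ext _ _ (@rbd n.+1 m \o @rbd n m) \0) => w _ /=.
rewrite -[RHS](@alternating_sum0 _ n (fun p => fdelta (w *m (D p.2 *m D p.1)))).
  rewrite /rbd; apply: eq_bigr => j _ /=.
  rewrite (raddf_sum (rmul _)) mulrz_suml; apply: eq_bigr => i _.
  by rewrite raddfMz /= !rmul_delta exprD -mulrzA mulrC mulmxA.
by move=> p; rewrite D_swap.
Qed.

Lemma lbd_rmul m p q (B : 'M[R]_(p, q)) (x : fch 'M[R]_(m.+2, p)) :
  lbd (rmul B x) = rmul B (lbd x).
Proof.
apply: (@fch_morph_ext _ _ (@lbd _ m q \o rmul B) (rmul B \o @lbd _ m p)) => w _ /=.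
rewrite rmul_delta /lbd (raddf_sum (rmul B)); apply: eq_bigr => i _.
by rewrite raddfMz /= !lmul_delta rmul_delta mulmxA.
Qed.

Lemma lbd_rbd n m (x : fch 'M[R]_(m.+2, d n)) : lbd (rbd x) = rbd (lbd x).
Proof.
rewrite [rbd x]/rbd (raddf_sum (@lbd _ _ _)); apply: eq_bigr => i _.
by rewrite (raddfMz (@lbd _ _ _)) /= lbd_rmul.
Qed.
End RightBoundary.

(** * Barycentric subdivision and its prism, computed in the standard simplex *)

Section Subdivision.
Variable R : realType.
Local Notation face_mx := (@face_mx R _).

Definition barycenter n : 'rV[R]_n.+1 := const_mx (n.+1%:R^-1).

(** Barycentric subdivision of the identity simplex, from which that of every singular simplex is
    obtained by restriction ([sub]). *)
Fixpoint sd n : fch 'M[R]_(n.+1, n.+1) :=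
  match n return fch 'M[R]_(n.+1, n.+1) with
  | 0 => fdelta 1%:M
  | n'.+1 => cone (barycenter n'.+1)
               (rbd (d := succn) (fun n (i : 'I_n.+2) => face_mx i) (sd n'))
  end.
Local Notation sbd := (rbd (d := succn) (fun n (i : 'I_n.+2) => face_mx i)).

Lemma sdS n : sd n.+1 = cone (barycenter n.+1) (sbd (sd n)).
Proof. by []. Qed.
Arguments sd : simpl never.

Lemma lbd_sd n : lbd (sd n.+1) = sbd (sd n).
Proof.
elim: n => [|n IHn].
  rewrite sdS lbd_cone0 /rbd big_ord_recl big_ord1 !rmul_delta.
  rewrite expr0 expr1 mulr1z mulrNz mulr1z raddfB /= /aug !linext_delta.
  by rewrite subrr mulr0z subr0.
rewrite sdS lbd_cone lbd_rbd IHn rbd_rbd ?raddf0 ?oppr0 ?addr0// => k p.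
exact: face_mx_swap.
Qed.

(** A point of the prism is a row of barycentric coordinates followed by one more entry, the time;
    the face maps act on the former and keep the latter. *)
Definition prism_face n (i : 'I_n.+2) : 'M[R]_(n.+1 + 1, n.+2 + 1) :=
  block_mx (face_mx i) 0 0 1%:M.
Definition prism_bottom n : 'M[R]_(n.+1, n.+1 + 1) := row_mx 1%:M 0.
Definition prism_top n : 'M[R]_(n.+1, n.+1 + 1) := row_mx 1%:M (const_mx 1).
Local Notation pbd := (rbd (d := fun n => (n.+1 + 1)%N) prism_face).

Lemma prism_face_swap n (p : 'I_n.+3 * 'I_n.+2) :
  prism_face (swap_face p).2 *m prism_face (swap_face p).1 =
  prism_face p.2 *m prism_face p.1.
Proof.
by rewrite !mulmx_block !mul0mx !mulmx0 !addr0 face_mx_swap.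
Qed.

Lemma prism_bottom_face n (i : 'I_n.+2) :
  face_mx i *m prism_bottom n.+1 = prism_bottom n *m prism_face i.
Proof.
by rewrite mul_mx_row mul_row_block mulmx1 !mulmx0 !mul1mx mul0mx !addr0.
Qed.

Lemma prism_top_face n (i : 'I_n.+2) :
  face_mx i *m prism_top n.+1 = prism_top n *m prism_face i.
Proof.
rewrite mul_mx_row mul_row_block !mulmx1 !mulmx0 !mul1mx addr0 add0r; congr row_mx.
by apply/matrixP => j k; rewrite face_mxE !mxE.
Qed.

(** The prism joins the simplex at time 0 to its subdivision at time 1. The chain that is coned is
    the boundary that the prism must have; the apex is the barycentre at time 0. *)
Fixpoint prism n : fch 'M[R]_(n.+2, n.+1 + 1) :=
  match n return fch 'M[R]_(n.+2, n.+1 + 1) with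
  | 0 => cone (row_mx (barycenter 0) 0)
           (fdelta (prism_bottom 0) - rmul (prism_top 0) (sd 0))
  | n'.+1 => cone (row_mx (barycenter n'.+1) 0) (fdelta (prism_bottom n'.+1) -
               rmul (prism_top n'.+1) (sd n'.+1) - pbd (prism n'))
  end.

Lemma prismS n : prism n.+1 = cone (row_mx (barycenter n.+1) 0)
  (fdelta (prism_bottom n.+1) - rmul (prism_top n.+1) (sd n.+1) - pbd (prism n)).
Proof. by []. Qed.
Arguments prism : simpl never.

Lemma lbd_prism0 : lbd (prism 0) = fdelta (prism_bottom 0) - rmul (prism_top 0) (sd 0).
Proof.
rewrite lbd_cone0 [aug _](_ : _ = 0) ?mulr0z ?subr0//.
by rewrite rmul_delta raddfB /= /aug !linext_delta subrr.
Qed.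

Lemma lbd_pbd n m (x : fch 'M[R]_(m.+2, n.+1 + 1)) : lbd (pbd x) = pbd (lbd x).
Proof. exact: (@lbd_rbd R (fun k => (k.+1 + 1)%N) prism_face n m x). Qed.

Lemma pbd_pbd n m (x : fch 'M[R]_(m, n.+1 + 1)) : pbd (pbd x) = 0.
Proof.
exact: (@rbd_rbd R (fun k => (k.+1 + 1)%N) prism_face prism_face_swap n m x).
Qed.

Lemma lbd_prism n : lbd (prism n.+1) = fdelta (prism_bottom n.+1) -
  rmul (prism_top n.+1) (sd n.+1) - pbd (prism n).
Proof.
have bottom m : lbd (fdelta (prism_bottom m.+1)) = pbd (fdelta (prism_bottom m)).
  apply: eq_bigr => i _; congr (_ *~ _).
  by rewrite lmul_delta rmul_delta prism_bottom_face.
have top m : lbd (rmul (prism_top m.+1) (sd m.+1)) = pbd (rmul (prism_top m) (sd m)).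
  rewrite lbd_rmul lbd_sd /rbd (raddf_sum (rmul _)); apply: eq_bigr => i _.
  by rewrite raddfMz /= !rmul_comp prism_top_face.
have pbdB m p (x y : fch 'M[R]_(p, m.+1 + 1)) : pbd x - pbd y = pbd (x - y).
  by rewrite raddfB.
have lbdB m p (x y : fch 'M[R]_(m.+2, p)) : lbd (x - y) = lbd x - lbd y.
  by rewrite raddfB.
(* Coning the prescribed boundary yields a chain with that boundary as soon as the latter is a
   cycle. In the induction everything cancels except [pbd] applied twice. *)
have main : lbd (fdelta (prism_bottom n.+1) -
    rmul (prism_top n.+1) (sd n.+1) - pbd (prism n)) = 0.
  rewrite !lbdB bottom top lbd_pbd !pbdB.
  elim: n => [|n IHn]; first by rewrite lbd_prism0 subrr raddf0.
  rewrite prismS lbd_cone.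
  rewrite [X in cone _ X](_ : _ = 0); last by rewrite !lbdB bottom top lbd_pbd !pbdB.
  by rewrite raddf0 subr0 opprB addrC subrK pbd_pbd.
by rewrite prismS lbd_cone main raddf0 subr0.
Qed.
End Subdivision.

Section SubdivisionSupport.
Variable R : realType.

Definition stochastic m n (w : 'M[R]_(m, n.+1)) :=
  forall i, std_simplex R n (row i w).

Lemma std_simplex_mul m n (w : 'M[R]_(m.+1, n.+1)) p :
  std_simplex R m p -> stochastic w -> std_simplex R n (p *m w).
Proof.
move=> [p0 p1] sw; split=> [j|].
  rewrite mxE sumr_ge0// => i _; rewrite mulr_ge0//.
  by have [/(_ j)] := sw i; rewrite mxE.
under eq_bigr do rewrite mxE.
rewrite exchange_big -p1; apply: eq_bigr => i _ /=.
rewrite -mulr_sumr; have [_] := sw i.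
by under eq_bigr do rewrite mxE; move=> ->; rewrite mulr1.
Qed.

Lemma stochastic_mul k m n (p : 'M[R]_(k, m.+1)) (w : 'M[R]_(m.+1, n.+1)) :
  stochastic p -> stochastic w -> stochastic (p *m w).
Proof. by move=> sp sw i; rewrite row_mul; exact: std_simplex_mul. Qed.

Lemma stochastic1 n : stochastic (1%:M : 'M[R]_n.+1).
Proof.
move=> i; split=> [j|]; first by rewrite !mxE ler0n.
rewrite (bigD1 i)//= !mxE eqxx big1 ?addr0// => j /negPf ji.
by rewrite !mxE eq_sym ji.
Qed.

Lemma face_mx_stochastic n (i : 'I_n.+2) : stochastic (face_mx R i).
Proof.
move=> j; split=> [k|]; first by rewrite !mxE ler0n.
rewrite (bigD1 (lift i j))//= !mxE eqxx big1 ?addr0// => k /negPf kj.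
by rewrite !mxE kj.
Qed.

Lemma barycenter_std n : std_simplex R n (barycenter R n).
Proof.
split=> [i|]; first by rewrite mxE invr_ge0 ler0n.
under eq_bigr do rewrite mxE.
by rewrite sumr_const card_ord -[RHS](@mulVf _ n.+1%:R) ?pnatr_eq0// mulr_natr.
Qed.

Lemma row_cons0 m q (b : 'rV[R]_q) (w : 'M[R]_(m.+1, q)) : row ord0 (cons_mx b w) = b.
Proof. by apply/rowP => k; rewrite mxE cons_mx0. Qed.

Lemma row_consS m q (b : 'rV[R]_q) (w : 'M[R]_(m.+1, q)) j :
  row (lift ord0 j) (cons_mx b w) = row j w.
Proof. by apply/rowP => k; rewrite !mxE liftK. Qed.

Lemma stochastic_cons m n b (w : 'M[R]_(m.+1, n.+1)) :
  std_simplex R n b -> stochastic w -> stochastic (cons_mx b w).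
Proof.
by move=> sb sw i; case: (unliftP ord0 i) => [j ->|->]; rewrite ?row_cons0 ?row_consS.
Qed.

Lemma allc_rbd (d : nat -> nat) (D : forall n, 'I_n.+2 -> 'M[R]_(d n, d n.+1)) n m
    (Q : 'M[R]_(m, d n) -> Prop) (Q' : 'M[R]_(m, d n.+1) -> Prop) x :
  allc Q x -> (forall w i, Q w -> Q' (w *m D n i)) -> allc Q' (rbd D x).
Proof.
move=> Qx QQ'; apply: allc_sum => i; apply: allcMz.
by apply: allc_linext Qx _ => w Qw; apply: allc_delta; exact: QQ'.
Qed.

Lemma sd_stochastic n : allc (@stochastic n.+1 n) (sd R n).
Proof.
elim: n => [|n IHn]; first by apply: allc_delta; exact: stochastic1.
rewrite sdS; apply: (@allc_linext _ _ (@stochastic n.+1 n.+1)).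
  apply: allc_rbd IHn _ => w i sw; apply: stochastic_mul => //.
  exact: face_mx_stochastic.
move=> w sw; apply: allc_delta; apply: stochastic_cons => //.
exact: barycenter_std.
Qed.

Definition prism_point n (v : 'rV[R]_(n.+1 + 1)) :=
  std_simplex R n (lsubmx v) /\ 0 <= rsubmx v ord0 ord0 <= 1.
Definition prism_points m n (w : 'M[R]_(m, n.+1 + 1)) :=
  forall i, prism_point (row i w).

Lemma prism_point_mul m n p (w : 'M[R]_(m.+1, n.+1 + 1)) :
  std_simplex R m p -> prism_points w -> prism_point (p *m w).
Proof.
move=> sp pw; have [p0 p1] := sp; split.
  rewrite -mulmx_lsub; apply: std_simplex_mul => // i.
  rewrite (_ : row i (lsubmx w) = lsubmx (row i w)); first by have [] := pw i.
  by apply/rowP => k; rewrite !mxE.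
rewrite -mulmx_rsub mxE; have ww i : 0 <= rsubmx w i ord0 <= 1.
  by have [_] := pw i; rewrite !mxE.
apply/andP; split.
  by apply: sumr_ge0 => i _; rewrite mulr_ge0//; have /andP[] := ww i.
rewrite -p1; apply: ler_sum => i _; rewrite ler_piMr//.
by have /andP[] := ww i.
Qed.

Lemma prism_points_mul k m n (p : 'M[R]_(k, m.+1)) (w : 'M[R]_(m.+1, n.+1 + 1)) :
  stochastic p -> prism_points w -> prism_points (p *m w).
Proof. by move=> sp sw i; rewrite row_mul; exact: prism_point_mul. Qed.

Lemma prism_points_cons m n b (w : 'M[R]_(m.+1, n.+1 + 1)) :
  prism_point b -> prism_points w -> prism_points (cons_mx b w).
Proof.
by move=> sb sw i; case: (unliftP ord0 i) => [j ->|->]; rewrite ?row_cons0 ?row_consS.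
Qed.

Lemma prism_points_bottom n : prism_points (prism_bottom R n).
Proof.
move=> i; rewrite /prism_point row_row_mx row_mxKl row_mxKr !mxE lexx ler01.
by split=> //; exact: stochastic1.
Qed.

Lemma prism_points_top n : prism_points (prism_top R n).
Proof.
move=> i; rewrite /prism_point row_row_mx row_mxKl row_mxKr !mxE lexx ler01.
by split=> //; exact: stochastic1.
Qed.

Lemma prism_point_face n (i : 'I_n.+2) v :
  prism_point v -> prism_point (v *m prism_face R i).
Proof.
rewrite -[v in _ -> prism_point (v *m _)]hsubmxK mul_row_block !mulmx0 addr0 add0r.
rewrite mulmx1 /prism_point row_mxKl row_mxKr => -[vl vr]; split=> //.
exact: (std_simplex_mul vl (face_mx_stochastic i)).
Qed.

Lemma prism_support n : allc (@prism_points n.+2 n) (prism R n).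
Proof.
have base m : prism_point (row_mx (barycenter R m) 0 : 'rV[R]_(m.+1 + 1)).
  rewrite /prism_point row_mxKl row_mxKr mxE lexx ler01.
  by split=> //; exact: barycenter_std.
have two m : allc (@prism_points m.+1 m)
    (fdelta (prism_bottom R m) - rmul (prism_top R m) (sd R m)).
  apply: allcB; first by apply: allc_delta; exact: prism_points_bottom.
  apply: allc_linext (@sd_stochastic m) _ => w sw; apply: allc_delta.
  apply: prism_points_mul => //; exact: prism_points_top.
have coneP m x : allc (@prism_points m.+1 m) x ->
    allc (@prism_points m.+2 m) (cone (row_mx (barycenter R m) 0) x).
  move=> xP; apply: allc_linext xP _ => w pw; apply: allc_delta.
  exact: prism_points_cons.
elim: n => [|n IHn]; first exact: coneP (two 0%N).
rewrite prismS; apply: coneP; apply: allcB; first exact: two.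
apply: (@allc_rbd (fun k => (k.+1 + 1)%N) _ _ _ _ _ _ IHn) => w i pw j.
by rewrite row_mul; exact: prism_point_face.
Qed.

(** The diameter estimate in dual form: any affine function, given by its values [y] at the
    vertices, oscillates over the rows of [w] at most [c] times as much as over the vertices. In
    this form the ratios multiply under composition. *)
Definition mesh_le n m (w : 'M[R]_(m.+1, n.+1)) (c : R) :=
  forall (y : 'cV[R]_n.+1) D, (forall i j, y i ord0 - y j ord0 <= D) ->
  forall i j, (w *m y) i ord0 - (w *m y) j ord0 <= c * D.

Lemma convex_le n (p : 'rV[R]_n.+1) (y : 'cV[R]_n.+1) a E : std_simplex R n p ->
  (forall j, a - y j ord0 <= E) -> a - (p *m y) ord0 ord0 <= E.
Proof.
move=> [p0 p1] ayE; rewrite -[a]mul1r -[E]mul1r -p1 mxE !mulr_suml -sumrB.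
by apply: ler_sum => j _; rewrite -mulrBr ler_wpM2l.
Qed.

Lemma convex_ge n (p : 'rV[R]_n.+1) (y : 'cV[R]_n.+1) a E : std_simplex R n p ->
  (forall j, y j ord0 - a <= E) -> (p *m y) ord0 ord0 - a <= E.
Proof.
move=> sp yaE; have := @convex_le _ p (- y) (- a) E sp.
rewrite mulmxN mxE opprK addrC; apply => j.
by rewrite mxE opprK addrC.
Qed.

Lemma barycenter_le n (y : 'cV[R]_n.+2) D (l : 'I_n.+2) :
  (forall i j, y i ord0 - y j ord0 <= D) ->
  (barycenter R n.+1 *m y) ord0 ord0 - y l ord0 <= n.+1%:R / n.+2%:R * D.
Proof.
move=> yD; have [_ b1] := barycenter_std n.+1.
have -> : y l ord0 = \sum_i barycenter R n.+1 ord0 i * y l ord0.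
  by rewrite -mulr_suml b1 mul1r.
rewrite mxE -sumrB.
under eq_bigr do rewrite -mulrBr mxE.
(* The vertex [l] contributes nothing, so n.+1 of the n.+2 equal weights remain: this is the origin
   of the ratio. *)
rewrite (bigD1 l)//= subrr mulr0 add0r.
rewrite (le_trans (ler_sum _ (G := fun=> n.+2%:R^-1 * D) _))//.
  by move=> i _; rewrite ler_wpM2l ?invr_ge0.
by rewrite sumr_const cardC1 card_ord -[leLHS]mulr_natl mulrA.
Qed.

Lemma barycenter_ge n (y : 'cV[R]_n.+2) D (l : 'I_n.+2) :
  (forall i j, y i ord0 - y j ord0 <= D) ->
  y l ord0 - (barycenter R n.+1 *m y) ord0 ord0 <= n.+1%:R / n.+2%:R * D.
Proof.
move=> yD; have := @barycenter_le _ (- y) D l.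
rewrite mulmxN !mxE opprK addrC; apply => i j.
by rewrite !mxE opprK addrC.
Qed.

Lemma sd_mesh n : allc (fun w => mesh_le w (n%:R / n.+1%:R)) (sd R n).
Proof.
elim: n => [|n IHn].
  apply: allc_delta => y D yD i j.
  by rewrite (ord1 i) (ord1 j) subrr !mul0r.
rewrite sdS; apply: (@allc_linext _ _ (fun w : 'M[R]_(n.+1, n.+2) =>
    stochastic w /\ mesh_le w (n%:R / n.+1%:R))).
  have both : allc (fun w : 'M[R]_(n.+1, n.+1) =>
      stochastic w /\ mesh_le w (n%:R / n.+1%:R)) (sd R n).
    by move=> w nz; split; [exact: sd_stochastic|exact: IHn].
  apply: (@allc_rbd succn _ _ _ _ _ _ both) => w i [sw mw]; split.
    by apply: stochastic_mul => //; exact: face_mx_stochastic.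
  move=> y D yD k l; rewrite -!mulmxA; apply: mw => {}k {}l.
  by rewrite !face_mxE.
move=> w [sw mw]; apply: allc_delta => y D yD.
have D0 : 0 <= D by have := yD ord0 ord0; rewrite subrr.
(* The subdivided faces contract by the ratio of one dimension less, which is smaller. *)
have lam : n%:R / n.+1%:R <= n.+1%:R / n.+2%:R :> R.
  by rewrite ler_pdivrMr// mulrAC ler_pdivlMr// -!natrM ler_nat; lia.
have c0 : (cons_mx (barycenter R n.+1) w *m y) ord0 ord0 =
    (barycenter R n.+1 *m y) ord0 ord0.
  by rewrite !mxE; apply: eq_bigr => i _; rewrite cons_mx0.
have cS j : (cons_mx (barycenter R n.+1) w *m y) (lift ord0 j) ord0 =
    (row j w *m y) ord0 ord0.
  by rewrite !mxE; apply: eq_bigr => i _; rewrite cons_mxS mxE.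
move=> i j; case: (unliftP ord0 i) => [k ->|->]; case: (unliftP ord0 j) => [l ->|->].
- rewrite !cS -!row_mul !mxE; have := mw y D yD k l; rewrite !mxE => /le_trans; apply.
  by rewrite ler_wpM2r.
- by rewrite c0 cS; apply: convex_ge => // m; exact: barycenter_ge.
- by rewrite c0 cS; apply: convex_le => // m; exact: barycenter_le.
- by rewrite subrr mulr_ge0 ?divr_ge0.
Qed.
End SubdivisionSupport.

(** * Singular chains *)

Section MatrixMetric.
Variables (R : realType) (m n : nat).
(** Singular simplices take values in metric spaces. This structure makes row vectors such a space,
    so that the standard simplex and its boundary can be treated as a pair of spaces like any
    other. *)
Let dist (x y : 'M[R]_(m, n)) : R := `|x - y|.
Let dist_ge0 x y : 0 <= dist x y. Proof. exact: normr_ge0. Qed.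
Let dist_eq0 x y : dist x y = 0 -> x = y.
Proof. by move=> /eqP; rewrite normr_eq0 subr_eq0 => /eqP. Qed.
Let ball_dist (x : 'M[R]_(m, n)) e : ball x e = [set y | dist x y < e].
Proof. by rewrite -ball_normE. Qed.
HB.instance Definition _ :=
  @PseudoMetric_isMetric.Build R 'M[R]_(m, n) dist dist_ge0 dist_eq0 ball_dist.
End MatrixMetric.

Section Continuity.
Variable R : realType.

Lemma mx_continuous (P : topologicalType) m n (f : P -> 'M[R]_(m, n)) :
  (forall i j, continuous (fun p => f p i j)) -> continuous f.
Proof.
move=> fc p A /nbhs_ballP[e /= e0 eA].
have : \forall q \near p, forall i j, ball (f p i j) e (f q i j).
  apply: filter_forall => i; apply: filter_forall => j.
  by apply: (fc i j p); exact: nbhsx_ballx.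
by apply: filterS => q fq; apply: eA; split.
Qed.

Lemma sum_continuous (P : topologicalType) (I : Type) (r : seq I) (f : I -> P -> R) :
  (forall i, continuous (f i)) -> continuous (fun p => \sum_(i <- r) f i p).
Proof.
move=> fc; elim: r => [|i r IHr].
  rewrite (_ : (fun _ => _) = cst 0); first by move=> p; exact: cst_continuous.
  by apply/funext => p; rewrite big_nil.
rewrite (_ : (fun _ => _) = f i \+ (fun p => \sum_(i <- r) f i p)).
  by move=> p; apply: continuousD; [exact: fc|exact: IHr].
by apply/funext => p; rewrite big_cons.
Qed.

Lemma mulmx_continuous m n p (w : 'M[R]_(n, p)) :
  continuous (fun v : 'M[R]_(m, n) => v *m w).
Proof.
apply: mx_continuous => i j.
rewrite (_ : (fun _ => _) = (fun v : 'M[R]_(m, n) => \sum_k v i k * w k j)).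
  apply: sum_continuous => k v; apply: continuousM; first exact: coord_continuous.
  exact: cst_continuous.
by apply/funext => v; rewrite mxE.
Qed.

Lemma continuous_within_comp (P Z U : topologicalType) (f : P -> Z) (g : Z -> U) S :
  continuous f -> (forall p, S (f p)) -> {within S, continuous g} ->
  continuous (g \o f).
Proof.
move=> fc fS /subspace_continuousP gc p.
apply: cvg_comp; last exact: gc (fS p).
move=> A WA; have : nbhs p (f @^-1` [set z | S z -> A z]) by apply: fc; exact: WA.
by apply: filterS => q; apply; exact: fS.
Qed.
End Continuity.

Section SimplexMaps.
Variable R : realType.

Definition center n : std_simplex R n :=
  exist _ (barycenter R n) (mem_set (@barycenter_std R n)).

(** Points of the simplex form a subtype; this total map lets formulas with matrices be written
    freely. Outside the simplex the value is the barycentre, an arbitrary choice. *)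
Definition mkpt n (v : 'rV[R]_n.+1) : std_simplex R n :=
  if pselect (std_simplex R n v) is left vP then exist _ v (mem_set vP)
  else center n.

Lemma mkptE n (v : 'rV[R]_n.+1) : std_simplex R n v -> set_val (mkpt v) = v.
Proof. by rewrite /mkpt => vP; case: pselect. Qed.

Lemma set_valK n (p : std_simplex R n) : mkpt (set_val p) = p.
Proof. by apply: val_inj; apply: mkptE; exact: set_valP. Qed.

Lemma mkpt_continuous (P : topologicalType) n (g : P -> 'rV[R]_n.+1) :
  continuous g -> (forall p, std_simplex R n (g p)) ->
  continuous (fun p => mkpt (g p)).
Proof.
move=> gc gP; apply/continuous_comp_initial.
rewrite (_ : set_val \o _ = g)//.
by apply/funext => p /=; exact: mkptE.
Qed.

Lemma set_val_continuous n :
  continuous (set_val : std_simplex R n -> 'rV[R]_n.+1).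
Proof. exact: initial_continuous. Qed.

Lemma pt_inj n (p q : std_simplex R n) : set_val p = set_val q -> p = q.
Proof. exact: val_inj. Qed.

Lemma set_val_face n i (p : std_simplex R n) :
  set_val (face_fun i p) = set_val p *m face_mx R i.
Proof. by rewrite mul_face_mx. Qed.

Lemma pt_mul_continuous m n (w : 'M[R]_(m.+1, n)) :
  continuous (fun p : std_simplex R m => set_val p *m w).
Proof.
move=> p; apply: (@cvg_comp _ _ _ (set_val : std_simplex R m -> 'rV_m.+1)
  (fun v : 'rV[R]_m.+1 => v *m w) (nbhs p) (nbhs (set_val p)) (nbhs _)).
  exact: set_val_continuous.
exact: mulmx_continuous.
Qed.

Variables (T : metricType R).

(** Likewise total: a discontinuous [g] yields a constant simplex. Push forwards can thus be written
    for arbitrary maps, continuity on a suitable set being asked for in the lemmas. *)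
Definition mks n (g : std_simplex R n -> T) : simplex T n :=
  if pselect (continuous g) is left gc then mkcts gc
  else mkcts (fun p => @cst_continuous _ T (g (center n)) p).

Lemma mksE n (g : std_simplex R n -> T) : continuous g -> mks g =1 g.
Proof. by move=> gc p; rewrite /mks; case: pselect. Qed.

Lemma mks_eta n (s : simplex T n) : mks s = s.
Proof. by apply/continuousEP => p; apply: mksE; exact: cts_fun. Qed.

Lemma face_mks n (g : std_simplex R n.+1 -> T) i : continuous g ->
  face i (mks g) = mks (g \o face_fun i).
Proof.
move=> gc; apply/continuousEP => p; rewrite [RHS]mksE /=; first exact: mksE.
by move=> q; apply: continuous_comp; [exact: face_fun_continuous|exact: gc].
Qed.

End SimplexMaps.

Section SimplexPush.
Variables (R : realType).

Definition smap (T T' : metricType R) (g : T -> T') n (s : simplex T n) : simplex T' n :=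
  mks (g \o s).

Lemma smap_continuous (T T' : metricType R) (g : T -> T') Y n (s : simplex T n) :
  {within Y, continuous g} -> range s `<=` Y -> continuous (g \o s).
Proof.
move=> gc sY; apply: (@continuous_within_comp _ _ _ s g Y) => // [|p].
  exact: cts_fun.
by apply: sY; exists p.
Qed.

Lemma smapE (T T' : metricType R) (g : T -> T') Y n (s : simplex T n) p :
  {within Y, continuous g} -> range s `<=` Y -> smap g s p = g (s p).
Proof. by move=> gc sY; rewrite /smap mksE//; exact: smap_continuous gc sY. Qed.

Lemma smap_face (T T' : metricType R) (g : T -> T') Y n (s : simplex T n.+1) i :
  {within Y, continuous g} -> range s `<=` Y ->
  face i (smap g s) = smap g (face i s).
Proof.
move=> gc sY; rewrite /smap face_mks; last exact: smap_continuous gc sY.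
by congr mks; apply/funext.
Qed.

Lemma smap_eq (T T' : metricType R) (g g' : T -> T') n (s : simplex T n) :
  (forall x, range s x -> g x = g' x) -> smap g s = smap g' s.
Proof. by move=> gg'; congr mks; apply/funext => p /=; apply: gg'; exists p. Qed.

Lemma smap_id (T : metricType R) (g : T -> T) n (s : simplex T n) :
  (forall x, range s x -> g x = x) -> smap g s = s.
Proof.
move=> gx; rewrite -[RHS]mks_eta; congr mks; apply/funext => p /=.
by apply: gx; exists p.
Qed.

Lemma smap_range (T T' : metricType R) (g : T -> T') Y n (s : simplex T n) :
  {within Y, continuous g} -> range s `<=` Y -> range (smap g s) = g @` range s.
Proof.
move=> gc sY; apply/seteqP; split=> [_ [p _ <-]|_ [_ [p _ <-] <-]].
  by rewrite (smapE _ gc sY); exists (s p) => //; exists p.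
by exists p => //; exact: smapE gc sY.
Qed.

Lemma smap_comp (T T' T'' : metricType R) (g : T -> T') (g' : T' -> T'') Y n
    (s : simplex T n) :
  {within Y, continuous g} -> range s `<=` Y ->
  smap g' (smap g s) = smap (g' \o g) s.
Proof.
by move=> gc sY; congr mks; apply/funext => p /=; rewrite (smapE _ gc sY).
Qed.

Definition fmap (K K' : choiceType) (g : K -> K') : fch K -> fch K' :=
  linext (fun k => fdelta (g k)).
HB.instance Definition _ K K' g := GRing.Additive.on (@fmap K K' g).

Definition lsmap (T T' : metricType R) (g : T -> T') n :
    fch (simplex T n) -> fch (simplex T' n) := fmap (@smap T T' g n).
HB.instance Definition _ T T' g n := GRing.Additive.on (@lsmap T T' g n).

Lemma lsmap_delta (T T' : metricType R) (g : T -> T') n (s : simplex T n) :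
  lsmap g (fdelta s) = fdelta (smap g s).
Proof. exact: linext_delta. Qed.
End SimplexPush.

Section Boundary.
Variables (R : realType) (T : metricType R).

Definition inside (Y : set T) n (s : simplex T n) := range s `<=` Y.

Definition bd n (s : simplex T n.+1) : fch (simplex T n) :=
  \sum_(i < n.+2) fdelta (face i s) *~ (-1) ^+ i.
Definition lbdry n : fch (simplex T n.+1) -> fch (simplex T n) := linext (@bd n).
HB.instance Definition _ n := GRing.Additive.on (@lbdry n).

Lemma lbdry_delta n (s : simplex T n.+1) : lbdry (fdelta s) = bd s.
Proof. exact: linext_delta. Qed.

Lemma face_face n (s : simplex T n.+2) (p : 'I_n.+3 * 'I_n.+2) :
  face (swap_face p).2 (face (swap_face p).1 s) = face p.2 (face p.1 s).
Proof.
apply/continuousEP => q.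
apply: (congr1 s (x := face_fun _ (face_fun _ q)) (y := face_fun _ (face_fun _ q))).
apply: pt_inj; rewrite !set_val_face -!mulmxA face_mx_swap.
by [].
Qed.

Lemma lbdry_bd n (s : simplex T n.+2) : lbdry (bd s) = 0.
Proof.
rewrite -[RHS](@alternating_sum0 _ n (fun p => fdelta (face p.2 (face p.1 s)))).
  rewrite /bd (raddf_sum (@lbdry n)); apply: eq_bigr => i _.
  rewrite raddfMz /= lbdry_delta /bd mulrz_suml; apply: eq_bigr => j _.
  by rewrite exprD -mulrzA mulrC.
by move=> p; rewrite face_face.
Qed.

Lemma bd_range n (s : simplex T n.+1) : allc (inside (range s) (n:=n)) (bd s).
Proof.
by apply: allc_sum => i; apply: allcMz; apply: allc_delta; exact: face_range.
Qed.

Lemma fsum_set (K : choiceType) (A : zmodType) (S : set K) (F : K -> A) :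
  \sum_(k \in S) F k = \sum_(k \in [set: K]) (if `[< S k >] then F k else 0).
Proof.
transitivity (\sum_(k \in S) (if `[< S k >] then F k else 0)).
  by apply: eq_fsbigr => k; rewrite inE => Sk; rewrite asboolT.
by apply: fsbig_widen => // k [_ nS] /=; rewrite asboolF.
Qed.

(** The boundary of the statement becomes a case of [act], for infinite chains too, as soon as every
    simplex is a face of finitely many simplices of the support. *)
Lemma bdry_act (A : zmodType) n (c : simplex T n.+1 -> A) :
  (forall t, finite_set [set s | c s != 0 /\ exists i, face i s = t]) ->
  bdry c = act (@bd n) c.
Proof.
move=> cfin; apply/funext => t; have [r ur rP] := finite_uniq_seq (cfin t).
rewrite (@actE _ _ _ _ _ _ r)//; last first.
  move=> s cs; rewrite /bd coef_sum => nz; apply/rP; split=> //.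
  apply: contrapT => nf; move/eqP: nz; apply.
  rewrite big1// => i _; rewrite coefMz fdeltaE.
  by case: eqP => [ti|]; [case: nf; exists i|rewrite mul0rz].
under [RHS]eq_bigr => s _ do rewrite /bd coef_sum mulrz_sumr.
rewrite exchange_big; apply: eq_bigr => i _ /=.
rewrite fsum_set (@fsumE _ _ r)//; last first.
  move=> s; case: asboolP => [/= st cs|]; last by rewrite eqxx.
  by apply/rP; split=> //; exists i.
rewrite mulrz_suml; apply: eq_bigr => s _; rewrite coefMz fdeltaE.
have -> : `[< [set s0 | face i s0 = t] s >] = (t == face i s).
  by apply/asboolP/eqP => /= ->.
by case: eqP => _; rewrite ?mul0rz ?mulr0z// mulrzz mul1r.
Qed.
End Boundary.

(** * Subdivision and homotopy of singular simplices *)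

Section Homotopy.
Variables (R : realType) (T : metricType R).
Implicit Types (h : R -> T -> T) (Y : set T).

Definition homotopy_on Y h :=
  {within `[0, 1] `*` Y, continuous (fun p : R * T => h p.1 p.2)}.

(** The affine simplex [w] of the prism, mapped by [s] in space and then by [h], whose time is the
    last coordinate. *)
Definition hsimp h n m (s : simplex T n) (w : 'M[R]_(m.+1, n.+1 + 1)) : simplex T m :=
  mks (fun p => h (rsubmx (set_val p *m w) ord0 ord0)
                  (s (mkpt (lsubmx (set_val p *m w))))).

Lemma hsimp_continuous h Y n m (s : simplex T n) (w : 'M[R]_(m.+1, n.+1 + 1)) :
  homotopy_on Y h -> range s `<=` Y -> prism_points w ->
  continuous (fun p : std_simplex R m => h (rsubmx (set_val p *m w) ord0 ord0)
                  (s (mkpt (lsubmx (set_val p *m w))))).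
Proof.
move=> hc sY wP.
have pP (p : std_simplex R m) : prism_point (set_val p *m w).
  by apply: prism_point_mul => //; exact: set_valP.
have wc := pt_mul_continuous (w := w).
have c1 : continuous (fun p : std_simplex R m => rsubmx (set_val p *m w) ord0 ord0).
  rewrite (_ : (fun p : std_simplex R m => _) =
      (fun v : 'rV[R]_(n.+1 + 1) => v ord0 (rshift n.+1 ord0)) \o
      (fun p : std_simplex R m => set_val p *m w)).
    by move=> p; apply: continuous_comp; [exact: wc|exact: coord_continuous].
  by apply/funext => q /=; rewrite mxE.
have c2 : continuous (fun p : std_simplex R m => s (mkpt (lsubmx (set_val p *m w)))).
  move=> p.
  apply: (@continuous_comp _ _ _ (fun p : std_simplex R m => mkpt (lsubmx (set_val p *m w))) s).
    apply: mkpt_continuous => [|q]; last by have [] := pP q.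
    apply: mx_continuous => i j.
    rewrite (_ : (fun p : std_simplex R m => _) =
        (fun v : 'rV[R]_(n.+1 + 1) => v i (lshift 1 j)) \o
        (fun p : std_simplex R m => set_val p *m w)).
      by move=> q; apply: continuous_comp; [exact: wc|exact: coord_continuous].
    by apply/funext => q /=; rewrite !mxE.
  exact: cts_fun.
apply: (@continuous_within_comp _ _ _
  (fun p : std_simplex R m => (rsubmx (set_val p *m w) ord0 ord0,
      s (mkpt (lsubmx (set_val p *m w))))) (fun p => h p.1 p.2) (`[0, 1] `*` Y)) => //.
  by move=> p; exact: (cvg_pair (c1 p) (c2 p)).
move=> p; split=> /=; last by apply: sY; eexists.
by rewrite in_itv /=; have [] := pP p.
Qed.

Lemma hsimp_face h Y n m (s : simplex T n) (w : 'M[R]_(m.+2, n.+1 + 1)) i :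
  homotopy_on Y h -> range s `<=` Y -> prism_points w ->
  face i (hsimp h s w) = hsimp h s (face_mx R i *m w).
Proof.
move=> hc sY wP; rewrite /hsimp face_mks; last exact: hsimp_continuous hc sY wP.
congr mks; apply/funext => p /=.
by rewrite set_val_face !mulmxA.
Qed.

Lemma hsimp_prism_face h n m (s : simplex T n.+1) (w : 'M[R]_(m.+1, n.+1 + 1)) i :
  prism_points w -> hsimp h s (w *m prism_face R i) = hsimp h (face i s) w.
Proof.
move=> wP; congr mks; apply/funext => p /=; rewrite mulmxA.
have [sp _] : prism_point (set_val p *m w).
  by apply: prism_point_mul => //; exact: set_valP.
move: (set_val p *m w) sp => v; rewrite -[v]hsubmxK mul_row_block row_mxKl => sp.
rewrite !mulmx0 addr0 add0r mulmx1 !row_mxKr !row_mxKl; congr (h _ (s _)).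
apply: pt_inj; rewrite [RHS]set_val_face !mkptE//.
by rewrite mul_face_mx; exact: face_row_std.
Qed.

Definition ssimp n m (s : simplex T n) (w : 'M[R]_(m.+1, n.+1)) : simplex T m :=
  mks (fun p => s (mkpt (set_val p *m w))).

Lemma ssimp_continuous n m (s : simplex T n) (w : 'M[R]_(m.+1, n.+1)) :
  stochastic w -> continuous (fun p : std_simplex R m => s (mkpt (set_val p *m w))).
Proof.
move=> sw p.
apply: (@continuous_comp _ _ _ (fun p : std_simplex R m => mkpt (set_val p *m w)) s).
  apply: mkpt_continuous => [q|q].
    exact: pt_mul_continuous.
  by apply: std_simplex_mul => //; exact: set_valP.
exact: cts_fun.
Qed.

Lemma ssimpE n m (s : simplex T n) (w : 'M[R]_(m.+1, n.+1)) p :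
  stochastic w -> ssimp s w p = s (mkpt (set_val p *m w)).
Proof. by move=> sw; rewrite mksE//; exact: ssimp_continuous. Qed.

Lemma ssimp1 n (s : simplex T n) : ssimp s 1%:M = s.
Proof.
rewrite -[RHS]mks_eta; congr mks; apply/funext => p.
by rewrite mulmx1 set_valK.
Qed.

Lemma ssimp_mul n m k (s : simplex T n) (w : 'M[R]_(m.+1, n.+1)) (w' : 'M[R]_(k.+1, m.+1)) :
  stochastic w -> stochastic w' -> ssimp (ssimp s w) w' = ssimp s (w' *m w).
Proof.
move=> sw sw'; congr mks; apply/funext => p; rewrite ssimpE// mkptE ?mulmxA//.
by apply: std_simplex_mul => //; exact: set_valP.
Qed.

Lemma ssimp_range n m (s : simplex T n) (w : 'M[R]_(m.+1, n.+1)) :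
  stochastic w -> range (ssimp s w) `<=` range s.
Proof. by move=> sw _ [p _ <-]; rewrite ssimpE//; eexists. Qed.

Lemma ssimp_face n m (s : simplex T n) (w : 'M[R]_(m.+2, n.+1)) i :
  stochastic w -> face i (ssimp s w) = ssimp s (face_mx R i *m w).
Proof.
move=> sw; rewrite /ssimp face_mks; last exact: ssimp_continuous.
congr mks; apply/funext => p /=.
by rewrite set_val_face !mulmxA.
Qed.

Lemma ssimp_coface n m (s : simplex T n.+1) (w : 'M[R]_(m.+1, n.+1)) i :
  stochastic w -> ssimp s (w *m face_mx R i) = ssimp (face i s) w.
Proof.
move=> sw; congr mks; apply/funext => p /=; congr (s _).
have sp : std_simplex R n (set_val p *m w).
  by apply: std_simplex_mul => //; exact: set_valP.
apply: pt_inj; rewrite [RHS]set_val_face mulmxA !mkptE//.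
by rewrite mul_face_mx; exact: face_row_std.
Qed.

Lemma hsimp_bottom h n (s : simplex T n) : hsimp h s (prism_bottom R n) = smap (h 0) s.
Proof.
congr mks; apply/funext => p /=; rewrite mul_mx_row mulmx1 mulmx0.
by rewrite row_mxKr row_mxKl mxE set_valK.
Qed.

Lemma hsimp_top h n m (s : simplex T n) (w : 'M[R]_(m.+1, n.+1)) : stochastic w ->
  hsimp h s (w *m prism_top R n) = smap (h 1) (ssimp s w).
Proof.
move=> sw; congr mks; apply/funext => p /=; rewrite mul_mx_row mulmx1 mul_mx_row.
rewrite row_mxKl row_mxKr ssimpE//; congr (h _ _); rewrite mulmxA mxE.
have [_] : std_simplex R n (set_val p *m w).
  by apply: std_simplex_mul => //; exact: set_valP.
move=> e1; rewrite -[RHS]e1; apply: eq_bigr => i _.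
by rewrite [const_mx _ _ _]mxE mulr1.
Qed.
End Homotopy.

Section SubdivisionOperators.
Variables (R : realType) (T : metricType R).
Implicit Types (h : R -> T -> T) (Y : set T).

Definition sub n (s : simplex T n) : fch (simplex T n) :=
  linext (fun w => fdelta (ssimp s w)) (sd R n).

Lemma linext_linext (K K' : choiceType) (M : zmodType) (f : K -> fch K') (g : K' -> M) x :
  linext g (linext f x) = linext (fun k => linext g (f k)) x.
Proof. exact: linext_morph. Qed.

Lemma mulrz_congr (M : zmodType) (x y : M) e : x = y -> x *~ e = y *~ e.
Proof. by move=> ->. Qed.

Lemma linext_bigZ (K : choiceType) (M : zmodType) I (r : seq I) (f : K -> M)
    (F : I -> fch K) (e : I -> int) :
  linext f (\sum_(i <- r) F i *~ e i) = \sum_(i <- r) linext f (F i) *~ e i.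
Proof. by rewrite raddf_sum; apply: eq_bigr => i _; rewrite raddfMz. Qed.

Lemma lbdry_sub n (s : simplex T n.+1) : lbdry (sub s) = linext (@sub n) (bd s).
Proof.
transitivity (linext (fun w => fdelta (ssimp s w)) (lbd (sd R n.+1))).
  apply: (@fch_morph_ext _ _ (@lbdry _ _ _ \o linext (fun w => fdelta (ssimp s w)))
    (linext (fun w => fdelta (ssimp s w)) \o @lbd _ _ _)) => w /sd_stochastic sw /=.
  rewrite linext_delta lbdry_delta /bd linext_bigZ; apply: eq_bigr => i _.
  by rewrite lmul_delta linext_delta ssimp_face.
rewrite lbd_sd /rbd linext_bigZ /bd linext_bigZ.
apply: eq_bigr => i _; rewrite linext_delta /rmul linext_linext; apply: mulrz_congr.
by apply: linext_eq => w /sd_stochastic sw; rewrite linext_delta ssimp_coface.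
Qed.

Lemma sub_range n (s : simplex T n) : allc (@inside _ _ (range s) n) (sub s).
Proof.
apply: allc_linext (@sd_stochastic R n) _ => w sw; apply: allc_delta.
exact: ssimp_range.
Qed.

(** Homotopy operator from [h 0] to [h 1] composed with one subdivision: the top end of the prism is
    already subdivided. *)
Definition Theta h n (s : simplex T n) : fch (simplex T n.+1) :=
  linext (fun w => fdelta (hsimp h s w)) (prism R n).

Lemma Theta_lbdry Y h n (s : simplex T n) : homotopy_on Y h -> range s `<=` Y ->
  lbdry (Theta h s) = linext (fun w => fdelta (hsimp h s w)) (lbd (prism R n)).
Proof.
move=> hc sY.
apply: (@fch_morph_ext _ _ (@lbdry _ _ _ \o linext (fun w => fdelta (hsimp h s w)))
    (linext (fun w => fdelta (hsimp h s w)) \o @lbd _ _ _)) => w /prism_support pw /=.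
rewrite linext_delta lbdry_delta /bd linext_bigZ; apply: eq_bigr => i _.
by rewrite lmul_delta linext_delta (hsimp_face _ hc sY).
Qed.

Lemma Theta_ends h n (s : simplex T n) :
  linext (fun w => fdelta (hsimp h s w))
    (fdelta (prism_bottom R n) - rmul (prism_top R n) (sd R n)) =
  fdelta (smap (h 0) s) - lsmap (h 1) (sub s).
Proof.
rewrite raddfB /= linext_delta hsimp_bottom; congr (_ - _).
rewrite /rmul /lsmap /fmap /sub !linext_linext; apply: linext_eq => w /sd_stochastic sw.
by rewrite !linext_delta hsimp_top.
Qed.

Lemma lbdry_Theta0 Y h (s : simplex T 0) : homotopy_on Y h -> range s `<=` Y ->
  lbdry (Theta h s) = fdelta (smap (h 0) s) - lsmap (h 1) (sub s).
Proof. by move=> hc sY; rewrite (Theta_lbdry hc sY) lbd_prism0 Theta_ends. Qed.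

Lemma lbdry_Theta Y h n (s : simplex T n.+1) : homotopy_on Y h -> range s `<=` Y ->
  lbdry (Theta h s) = fdelta (smap (h 0) s) - lsmap (h 1) (sub s) -
    linext (@Theta h n) (bd s).
Proof.
move=> hc sY; rewrite (Theta_lbdry hc sY) lbd_prism raddfB /= Theta_ends; congr (_ - _).
rewrite /rbd /bd !linext_bigZ; apply: eq_bigr => i _; apply: mulrz_congr.
rewrite linext_delta /rmul linext_linext; apply: linext_eq => w /prism_support pw.
by rewrite linext_delta hsimp_prism_face.
Qed.

Lemma Theta_range Y h n (s : simplex T n) Z : homotopy_on Y h -> range s `<=` Y ->
  (forall t x, 0 <= t <= 1 -> range s x -> Z (h t x)) ->
  allc (@inside _ _ Z n.+1) (Theta h s).
Proof.
move=> hc sY sZ; apply: allc_linext (@prism_support R n) _ => w pw.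
apply: allc_delta => _ [p _ <-]; rewrite mksE; last exact: hsimp_continuous hc sY pw.
apply: sZ; last by eexists.
by have [] := prism_point_mul (set_valP p) pw.
Qed.

Fixpoint subm m n (s : simplex T n) : fch (simplex T n) :=
  if m is m'.+1 then linext (@sub n) (subm m' s) else fdelta s.

Lemma lbdry_linext_sub n (y : fch (simplex T n.+1)) :
  lbdry (linext (@sub n.+1) y) = linext (@sub n) (lbdry y).
Proof. by rewrite /lbdry !linext_linext; apply: linext_eq => s _; exact: lbdry_sub. Qed.

Lemma lbdry_subm m n (s : simplex T n.+1) : lbdry (subm m s) = linext (@subm m n) (bd s).
Proof.
elim: m => [|m IHm]; first by rewrite /= lbdry_delta linext_id.
by rewrite /= lbdry_linext_sub IHm linext_linext.
Qed.

Lemma subm_range m n (s : simplex T n) :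
  allc (@inside _ _ (range s) n) (subm m s).
Proof.
elim: m => [|m IHm]; first exact: allc_delta.
apply: allc_linext IHm _ => t ts; apply: allc_sub (@sub_range _ _) => u ut.
exact: subset_trans ts.
Qed.

Lemma subm_mesh m n (s : simplex T n) : allc (fun t : simplex T n =>
  exists w, [/\ stochastic w, mesh_le w ((n%:R / n.+1%:R) ^+ m) & t = ssimp s w]) (subm m s).
Proof.
elim: m => [|m IHm].
  apply: allc_delta; exists 1%:M; rewrite ssimp1; split=> //; first exact: stochastic1.
  by move=> y D yD i j; rewrite mul1mx expr0 mul1r.
apply: allc_linext IHm _ => _ [w [sw mw ->]] u.
rewrite /sub => /(@allc_linext _ _ (fun v => stochastic v /\ mesh_le v (n%:R / n.+1%:R))
  (fun u => exists w, [/\ stochastic w, mesh_le w ((n%:R / n.+1%:R) ^+ m.+1) & u = ssimp s w])).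
apply=> [v vs|v [sv mv]].
  by split; [exact: sd_stochastic vs|exact: sd_mesh vs].
apply: allc_delta; exists (v *m w); split; first exact: stochastic_mul.
  move=> y D yD i j; rewrite -!mulmxA exprS -[_ * _ ^+ _ * D]mulrA.
  by have /(_ i j) := mv (w *m y) ((n%:R / n.+1%:R) ^+ m * D) (fun k l => mw y D yD k l).
by rewrite ssimp_mul.
Qed.

Definition still : R -> T -> T := fun _ x => x.

Lemma still_homotopy : homotopy_on setT still.
Proof.
by apply: continuous_subspaceT => -[t x]; exact: cvg_snd.
Qed.

(* The homotopy from the identity to the m-fold subdivision, followed by one
   more subdivision that is combined with the deformation h. *)
Definition psi h m n (s : simplex T n) : fch (simplex T n.+1) :=
  \sum_(j < m) linext (@Theta still n) (subm j s) + linext (@Theta h n) (subm m s).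

Lemma smap_still t n (s : simplex T n) : smap (still t) s = s.
Proof. exact: smap_id. Qed.

Lemma lbdry_linext_Theta Y h n (y : fch (simplex T n.+1)) : homotopy_on Y h ->
  allc (@inside _ _ Y _) y -> (forall x, Y x -> h 0 x = x) ->
  lbdry (linext (@Theta h n.+1) y) =
  y - lsmap (h 1) (linext (@sub n.+1) y) - linext (@Theta h n) (lbdry y).
Proof.
move=> hc yY h0.
apply: (@fch_morph_ext _ _ (@lbdry _ _ _ \o linext (@Theta h n.+1))
  (idfun \- (@lsmap _ _ _ (h 1) _ \o linext (@sub n.+1)) \-
   (linext (@Theta h n) \o @lbdry _ _ _))) => s /yY sY /=.
rewrite !linext_delta lbdry_delta (lbdry_Theta hc sY).
by rewrite (@smap_id _ _ (h 0))// => x /sY/h0.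
Qed.

Lemma lbdry_linext_Theta0 Y h (y : fch (simplex T 0)) : homotopy_on Y h ->
  allc (@inside _ _ Y _) y -> (forall x, Y x -> h 0 x = x) ->
  lbdry (linext (@Theta h 0) y) = y - lsmap (h 1) (linext (@sub 0) y).
Proof.
move=> hc yY h0.
apply: (@fch_morph_ext _ _ (@lbdry _ _ _ \o linext (@Theta h 0))
  (idfun \- (@lsmap _ _ _ (h 1) _ \o linext (@sub 0)))) => s /yY sY /=.
rewrite !linext_delta (lbdry_Theta0 hc sY).
by rewrite (@smap_id _ _ (h 0))// => x /sY/h0.
Qed.

Lemma lsmap_still n (x : fch (simplex T n)) : lsmap (still 1) x = x.
Proof.
rewrite -[RHS]linext_id; apply: linext_eq => s _.
by apply: (congr1 (@fdelta _)); exact: smap_still.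
Qed.

Lemma psi_bdry Y h m n (s : simplex T n.+1) : homotopy_on Y h -> range s `<=` Y ->
  (forall x, Y x -> h 0 x = x) ->
  lbdry (psi h m s) = fdelta s - lsmap (h 1) (subm m.+1 s) - linext (@psi h m n) (bd s).
Proof.
move=> hc sY h0; rewrite /psi raddfD raddf_sum /=.
have subY j : allc (@inside _ _ Y _) (subm j s).
  by apply: allc_sub (@subm_range _ _ _) => t ts; exact: subset_trans sY.
rewrite (lbdry_linext_Theta hc)// lbdry_subm linext_linext.
rewrite (eq_bigr (fun j : 'I_m => (subm j s - subm j.+1 s) -
    linext (fun t => linext (@Theta still n) (subm j t)) (bd s))); last first.
  move=> j _; rewrite (lbdry_linext_Theta still_homotopy)// lsmap_still.
  by rewrite lbdry_subm linext_linext.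
rewrite sumrB linextfD linextf_sum -[in LHS]sumrN.
(* The successive subdivisions telescope; the term [subm m s] that remains cancels against the start
   of the last homotopy. *)
rewrite (_ : \sum_(j < m) (subm j s - subm j.+1 s) = fdelta s - subm m s); last first.
  elim: m => [|m IHm]; first by rewrite big_ord0 subrr.
  by rewrite big_ord_recr IHm /= addrA subrK.
rewrite sumrN opprD !addrA; congr (_ - _).
by rewrite (addrAC _ _ (subm m s)) subrK addrAC.
Qed.

Lemma psi_bdry0 Y h m (s : simplex T 0) : homotopy_on Y h -> range s `<=` Y ->
  (forall x, Y x -> h 0 x = x) ->
  lbdry (psi h m s) = fdelta s - lsmap (h 1) (subm m.+1 s).
Proof.
move=> hc sY h0; rewrite /psi raddfD raddf_sum /=.
have subY j : allc (@inside _ _ Y _) (subm j s).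
  by apply: allc_sub (@subm_range _ _ _) => t ts; exact: subset_trans sY.
rewrite (lbdry_linext_Theta0 hc)//.
rewrite (eq_bigr (fun j : 'I_m => subm j s - subm j.+1 s)); last first.
  by move=> j _; rewrite (lbdry_linext_Theta0 still_homotopy)// lsmap_still.
rewrite (_ : \sum_(j < m) (subm j s - subm j.+1 s) = fdelta s - subm m s).
  by rewrite addrA subrK.
elim: m => [|m IHm]; first by rewrite big_ord0 subrr.
by rewrite big_ord_recr IHm /= addrA subrK.
Qed.

Lemma psi_range Y h m n (s : simplex T n) Z : homotopy_on Y h -> range s `<=` Y ->
  range s `<=` Z -> (forall t x, 0 <= t <= 1 -> range s x -> Z (h t x)) ->
  allc (@inside _ _ Z n.+1) (psi h m s).
Proof.
move=> hc sY sZ hZ; apply: allcD.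
  apply: allc_sum => j; apply: allc_linext (@subm_range _ _ _) _ => t ts.
  apply: (Theta_range still_homotopy) => // u x _ tx; apply/sZ; exact: ts.
apply: allc_linext (@subm_range _ _ _) _ => t ts; apply: (Theta_range hc).
  exact: subset_trans sY.
by move=> u x u01 tx; apply: hZ => //; exact: ts.
Qed.
End SubdivisionOperators.

(** * Iterated subdivision makes simplices small *)

Section Lebesgue.
Variable R : realType.

(** A Lebesgue number: [Q] stands for being contained in a member of an open cover, and the
    near-covering form of compactness provides the radius. *)
Lemma near_cover_uniform n (Q : set (std_simplex R n) -> Prop) :
  (forall A B : set (std_simplex R n), A `<=` B -> Q B -> Q A) ->
  (forall p : std_simplex R n, exists2 U, nbhs p U & Q U) ->
  exists2 e : R, 0 < e & forall p : std_simplex R n,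
    Q [set q | ball (set_val p) e (set_val q)].
Proof.
move=> QS QU.
have /compact_near_coveringP/(_ _ (0^'+) (fun (e : R) (p : std_simplex R n) =>
  Q [set q | ball (set_val p) e (set_val q)])) := @std_simplex_compact R n.
case=> [p _|].
  have [U [_ [[V oV <-] Vp VU]] QUp] := QU p.
  have /nbhs_ballP[e /= e0 eV] : nbhs (set_val p) V by apply: open_nbhs_nbhs; split.
  exists (set_val @^-1` ball (set_val p) (e / 2), [set x | x < e / 2]).
    split=> /=; last by apply: nbhs_right_lt; rewrite divr_gt0.
    by apply: (@set_val_continuous R n p); apply: nbhsx_ballx; rewrite divr_gt0.
  move=> [q x] /= [pq xe]; apply: QS QUp => q' /= qq'; apply/VU/eV.
  rewrite [e]splitr; apply: ball_triangle pq _.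
  by apply: le_ball qq'; exact: ltW.
move=> e /= e0 eQ; exists (e / 2); first by rewrite divr_gt0.
move=> p; apply: (eQ (e / 2)) => //=; last by rewrite divr_gt0.
by rewrite sub0r normrN gtr0_norm ?divr_gt0// ltr_pdivrMr// ltr_pMr// ltr1n.
Qed.

Lemma subdivision_small n (Q : set (std_simplex R n) -> Prop) :
  (forall A B : set (std_simplex R n), A `<=` B -> Q B -> Q A) ->
  (forall p : std_simplex R n, exists2 U, nbhs p U & Q U) ->
  exists m0, forall m, (m0 <= m)%N -> forall w : 'M[R]_(n.+1, n.+1),
    stochastic w -> mesh_le w ((n%:R / n.+1%:R) ^+ m) ->
    Q (range (fun p : std_simplex R n => mkpt (set_val p *m w))).
Proof.
move=> QS QU; have [e e0 eQ] := near_cover_uniform QS QU.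
have lam1 : n%:R / n.+1%:R < 1 :> R by rewrite ltr_pdivrMr// mul1r ltr_nat.
have lam0 : 0 <= n%:R / n.+1%:R :> R by rewrite divr_ge0.
have [m0 m0e] : exists m0, (n%:R / n.+1%:R) ^+ m0 < e.
  have : (n%:R / n.+1%:R) ^+ m @[m --> \oo] --> (0 : R).
    by apply: cvg_expr; rewrite ger0_norm.
  move=> /cvgrPdist_lt/(_ _ e0)[m0 _ m0P]; exists m0.
  have /= := m0P m0 (leqnn _); rewrite sub0r normrN.
  exact: le_lt_trans (ler_norm _).
exists m0 => m mm0 w sw mw.
(* The mesh bound is used for each coordinate function, whose oscillation over the vertices is at
   most 1; convexity extends it from the vertices of [w] to all its points. *)
have mesh (p q : std_simplex R n) l :
    (set_val p *m w) ord0 l - (set_val q *m w) ord0 l < e.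
  have oscw i j : (col l w) i ord0 - (col l w) j ord0 <= (n%:R / n.+1%:R) ^+ m.
    have := mw (delta_mx l ord0) 1; rewrite -colE mulr1; apply=> {}i {}j.
    rewrite !mxE !andbT lerBlDr; apply: (@le_trans _ _ 1); first by rewrite lern1 leq_b1.
    by rewrite lerDl.
  have cE (p' : std_simplex R n) : (set_val p' *m w) ord0 l = (set_val p' *m col l w) ord0 ord0.
    by rewrite !mxE; apply: eq_bigr => i _; rewrite mxE.
  apply: le_lt_trans (le_lt_trans (ler_wiXn2l lam0 (ltW lam1) mm0) m0e).
  rewrite !cE; apply: convex_ge; first exact: set_valP.
  move=> i; apply: convex_le; first exact: set_valP.
  by move=> j; exact: oscw.
apply: QS (eQ (mkpt (set_val (center R n) *m w))) => _ [p _ <-] /=.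
have inS (q : std_simplex R n) : std_simplex R n (set_val q *m w).
  by apply: std_simplex_mul => //; exact: set_valP.
rewrite !mkptE//; split=> // i j; rewrite (ord1 i).
rewrite -ball_normE /ball_ /= ltr_norml; apply/andP; split; last exact: mesh.
by rewrite ltrNl opprB; exact: mesh.
Qed.

Lemma subm_small (T : metricType R) n (s : simplex T n) (Q : set T -> Prop) :
  (forall A B : set T, A `<=` B -> Q B -> Q A) ->
  (forall p : std_simplex R n, exists2 U, nbhs p U & Q (s @` U)) ->
  exists m0, forall m, (m0 <= m)%N ->
    allc (fun t : simplex T n => Q (range t)) (subm m s).
Proof.
move=> QS QU; have [|m0 m0P] := @subdivision_small n (fun U => Q (s @` U)) _ QU.
  by move=> A B AB; apply: QS; exact: image_subset.
exists m0 => m mm0 t /subm_mesh[w [sw mw ->]]; apply: QS (m0P m mm0 w sw mw).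
by move=> _ [p _ <-]; rewrite ssimpE//; exists (mkpt (set_val p *m w)) => //; exists p.
Qed.
End Lebesgue.

(** * Relative homology with finite chains *)

Section FunctionChains.
Variables (R : realType) (A : zmodType).

Definition finc (K : choiceType) (c : K -> A) := finite_set (fsupp c).

Lemma finc0 (K : choiceType) : finc (0 : K -> A).
Proof.
rewrite /finc (_ : fsupp _ = set0)//.
by apply/seteqP; split=> // k; rewrite /fsupp/= eqxx.
Qed.

Lemma fincD (K : choiceType) (c e : K -> A) : finc c -> finc e -> finc (c + e).
Proof.
move=> fc fe; apply: (@sub_finite_set _ _ (fsupp c `|` fsupp e)); last by rewrite finite_setU.
move=> k; rewrite /fsupp/= => nz; have [ck|] := eqVneq (c k) 0; last by left.
by right; move: nz; rewrite -[(c + e) k]/(c k + e k) ck add0r.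
Qed.

Lemma fincN (K : choiceType) (c : K -> A) : finc c -> finc (- c).
Proof. by apply: sub_finite_set => k; rewrite /fsupp/= oppr_eq0. Qed.

Lemma fincB (K : choiceType) (c e : K -> A) : finc c -> finc e -> finc (c - e).
Proof. by move=> fc fe; apply: fincD => //; exact: fincN. Qed.

Definition restr (K : Type) (Q : K -> Prop) (c : K -> A) : K -> A :=
  fun k => if `[< Q k >] then c k else 0.

Lemma restr_split (K : Type) (Q : K -> Prop) (c : K -> A) :
  c = restr Q c + restr (fun k => ~ Q k) c.
Proof.
apply/funext => k; rewrite -[RHS]/(restr Q c k + restr _ c k) /restr asbool_neg.
by case: ifP; rewrite ?addr0 ?add0r.
Qed.

Lemma restr_neq0 (K : Type) (Q : K -> Prop) (c : K -> A) k : restr Q c k != 0 ->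
  Q k /\ c k != 0.
Proof. by rewrite /restr; case: asboolP => // _; rewrite eqxx. Qed.

Lemma finc_restr (K : choiceType) (Q : K -> Prop) (c : K -> A) : finc c -> finc (restr Q c).
Proof. by move=> fc; apply: sub_finite_set fc => k nz; have [] := restr_neq0 nz. Qed.

Definition single (K : eqType) (k : K) (a : A) : K -> A :=
  fun l => if l == k then a else 0.

Lemma single_neq0 (K : eqType) (k l : K) a : single k a l != 0 -> l = k.
Proof. by rewrite /single; have [//|_] := eqVneq l k; rewrite eqxx. Qed.

Lemma finc_single (K : choiceType) (k : K) a : finc (single k a).
Proof. by apply: (@sub_finite_set _ _ [set k]) => // l /single_neq0. Qed.

Lemma act_single (K K' : choiceType) (D : K -> fch K') k (a : A) :
  act D (single k a) = fun t => a *~ coef (D k) t.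
Proof.
apply/funext => t; rewrite (@actE _ _ _ _ _ t [:: k]) ?big_seq1//.
  by rewrite /single eqxx.
by move=> s /single_neq0 -> _; rewrite inE.
Qed.

Section Chains.
Variable T : metricType R.
Implicit Types (Y B : set T) (h : R -> T -> T).

Definition cin Y n (c : simplex T n -> A) := forall s, c s != 0 -> range s `<=` Y.

Lemma cin_sub Y Y' n (c : simplex T n -> A) : Y `<=` Y' -> cin Y c -> cin Y' c.
Proof. by move=> YY' Yc s /Yc sY; exact: subset_trans YY'. Qed.

Lemma cin0 Y n : cin Y (0 : simplex T n -> A).
Proof. by move=> s; rewrite /= eqxx. Qed.

Lemma cinD Y n (c e : simplex T n -> A) : cin Y c -> cin Y e -> cin Y (c + e).
Proof.
move=> Yc Ye s nz; have [cs|/Yc//] := eqVneq (c s) 0.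
by apply: Ye; move: nz; rewrite -[(c + e) s]/(c s + e s) cs add0r.
Qed.

Lemma cinN Y n (c : simplex T n -> A) : cin Y c -> cin Y (- c).
Proof. by move=> Yc s; rewrite /= oppr_eq0 => /Yc. Qed.

Lemma cinB Y n (c e : simplex T n -> A) : cin Y c -> cin Y e -> cin Y (c - e).
Proof. by move=> Yc Ye; apply: cinD => //; exact: cinN. Qed.

Lemma cin_restr Y n (Q : simplex T n -> Prop) (c : simplex T n -> A) : cin Y c -> cin Y (restr Q c).
Proof. by move=> Yc s nz; have [_ /Yc] := restr_neq0 nz. Qed.

Lemma cin_single Y n (s : simplex T n) a : range s `<=` Y -> cin Y (single s a).
Proof. by move=> sY t /single_neq0 ->. Qed.

Lemma act_cin (Y' : set T) n m (D : simplex T n -> fch (simplex T m)) (c : simplex T n -> A) :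
  (forall s, c s != 0 -> allc (@inside _ _ Y' m) (D s)) -> cin Y' (act D c).
Proof. by move=> DY t /act_neq0[s cs]; apply: DY. Qed.

Lemma bdry_fin n (c : simplex T n.+1 -> A) : finc c -> bdry c = act (@bd _ _ n) c.
Proof. by move=> fc; apply: bdry_act => t; apply: sub_finite_set fc => s []. Qed.

Lemma finc_bdry n (c : simplex T n.+1 -> A) : finc c -> finc (bdry c).
Proof. by move=> fc; rewrite bdry_fin//; exact: act_fin. Qed.

Lemma bdry0 n : bdry (0 : simplex T n.+1 -> A) = 0.
Proof. by rewrite bdry_fin ?act0//; exact: finc0. Qed.

Lemma bdryD n (c e : simplex T n.+1 -> A) : finc c -> finc e ->
  bdry (c + e) = bdry c + bdry e.
Proof.
move=> fc fe; rewrite !bdry_fin ?actD//; [exact: admissible_fin..|exact: fincD].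
Qed.

Lemma bdryN n (c : simplex T n.+1 -> A) : finc c -> bdry (- c) = - bdry c.
Proof.
by move=> fc; rewrite !bdry_fin ?actN//; [exact: admissible_fin|exact: fincN].
Qed.

Lemma bdryB n (c e : simplex T n.+1 -> A) : finc c -> finc e ->
  bdry (c - e) = bdry c - bdry e.
Proof. by move=> fc fe; rewrite bdryD ?bdryN//; exact: fincN. Qed.

Lemma bdry_bdry n (c : simplex T n.+2 -> A) : finc c -> bdry (bdry c) = 0.
Proof.
move=> fc; rewrite bdry_fin; last exact: finc_bdry.
rewrite bdry_fin// act_comp_fin// (@act_eq _ _ _ _ (fun=> 0)).
  by apply/funext => t; apply: fsbig1 => s _; rewrite coef0 mulr0z.
by move=> s _; exact: lbdry_bd.
Qed.

Lemma cin_bdry Y n (c : simplex T n.+1 -> A) : finc c -> cin Y c -> cin Y (bdry c).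
Proof.
move=> fc Yc; rewrite bdry_fin//; apply: act_cin => s /Yc sY.
by apply: allc_sub (@bd_range _ _ _ _) => t; move/subset_trans; apply.
Qed.

Lemma bdry_subm m n (c : simplex T n.+1 -> A) : finc c ->
  bdry (act (@subm _ _ m n.+1) c) = act (@subm _ _ m n) (bdry c).
Proof.
move=> fc; rewrite !bdry_fin//; last exact: act_fin.
by rewrite !act_comp_fin//; apply: act_eq => s _; exact: lbdry_subm.
Qed.

Lemma cin_subm Y m n (c : simplex T n -> A) : cin Y c -> cin Y (act (@subm _ _ m n) c).
Proof.
move=> Yc; apply: act_cin => s /Yc sY.
by apply: allc_sub (@subm_range _ _ _ _ _) => t; move/subset_trans; apply.
Qed.

Lemma cin_psi Y Z h m n (c : simplex T n -> A) : homotopy_on Y h -> cin Y c -> cin Z c ->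
  (forall t x, 0 <= t <= 1 -> Z x -> Z (h t x)) ->
  cin Z (act (@psi _ _ h m n) c).
Proof.
move=> hc Yc Zc hZ; apply: act_cin => s cs.
apply: (psi_range hc (Yc s cs) (Zc s cs)) => t x t01 sx.
by apply: hZ => //; exact: Zc sx.
Qed.
End Chains.

Definition gpush (T T' : metricType R) (g : T -> T') n (c : simplex T n -> A) :
    simplex T' n -> A := act (fun s => fdelta (smap g s)) c.

Section Push.
Variables (T T' : metricType R).
Implicit Types (g : T -> T') (Y : set T).

Lemma finc_gpush g n (c : simplex T n -> A) : finc c -> finc (gpush g c).
Proof. exact: act_fin. Qed.

Lemma gpush_neq0 g n (c : simplex T n -> A) t : gpush g c t != 0 ->
  exists2 s, c s != 0 & t = smap g s.
Proof. by move=> /act_neq0[s cs /fdelta_neq0 ->]; exists s. Qed.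

Lemma gpushD g n (c e : simplex T n -> A) : finc c -> finc e ->
  gpush g (c + e) = gpush g c + gpush g e.
Proof. by move=> fc fe; rewrite /gpush actD//; exact: admissible_fin. Qed.

Lemma gpushB g n (c e : simplex T n -> A) : finc c -> finc e ->
  gpush g (c - e) = gpush g c - gpush g e.
Proof. by move=> fc fe; rewrite /gpush actB//; exact: admissible_fin. Qed.

Lemma gpush_single g n (s : simplex T n) a : gpush g (single s a) = single (smap g s) a.
Proof.
rewrite /gpush act_single; apply/funext => t; rewrite fdeltaE /single.
by case: eqP => _; rewrite ?mulr1z ?mulr0z.
Qed.

Lemma bdry_gpush Y g n (c : simplex T n.+1 -> A) : finc c -> cin Y c ->
  {within Y, continuous g} -> bdry (gpush g c) = gpush g (bdry c).
Proof.
move=> fc Yc gc; rewrite !bdry_fin//; last exact: act_fin.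
rewrite /gpush !act_comp_fin//; apply: act_eq => s /Yc sY.
rewrite linext_delta /bd linext_bigZ; apply: eq_bigr => i _.
by rewrite linext_delta (smap_face _ gc sY).
Qed.

Lemma cin_gpush Y (Z : set T') g n (c : simplex T n -> A) : cin Y c ->
  {within Y, continuous g} -> (forall s x, c s != 0 -> range s x -> Z (g x)) ->
  cin Z (gpush g c).
Proof.
move=> Yc gc gZ _ /gpush_neq0[s cs ->]; rewrite (smap_range gc); last exact: Yc.
by move=> _ [x sx <-]; exact: gZ sx.
Qed.
End Push.

Lemma gpush_comp (T T' T'' : metricType R) (g : T -> T') (g' : T' -> T'') Y n
    (c : simplex T n -> A) : finc c -> cin Y c -> {within Y, continuous g} ->
  gpush g' (gpush g c) = gpush (g' \o g) c.
Proof.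
move=> fc Yc gc; rewrite /gpush act_comp_fin//; apply: act_eq => s /Yc sY.
by rewrite linext_delta (smap_comp _ gc sY).
Qed.

Lemma gpush_eq (T T' : metricType R) (g g' : T -> T') n (c : simplex T n -> A) :
  (forall s x, c s != 0 -> range s x -> g x = g' x) -> gpush g c = gpush g' c.
Proof.
move=> gg'; apply: act_eq => s cs; congr fdelta; apply: smap_eq => x sx.
exact: gg' sx.
Qed.

Lemma gpush_id (T : metricType R) (g : T -> T) n (c : simplex T n -> A) :
  (forall s x, c s != 0 -> range s x -> g x = x) -> gpush g c = c.
Proof.
move=> gx; rewrite -[RHS]act_delta; apply: act_eq => s cs.
by congr fdelta; apply: smap_id => x sx; exact: gx sx.
Qed.

Lemma ssimp_smap (T T' : metricType R) (g : T -> T') Y n m (s : simplex T n)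
    (w : 'M[R]_(m.+1, n.+1)) : {within Y, continuous g} -> range s `<=` Y -> stochastic w ->
  ssimp (smap g s) w = smap g (ssimp s w).
Proof.
move=> gc sY sw; congr mks; apply/funext => p /=.
by rewrite ssimpE// (smapE _ gc sY).
Qed.

Lemma subm_smap (T T' : metricType R) (g : T -> T') Y m n (s : simplex T n) :
  {within Y, continuous g} -> range s `<=` Y -> subm m (smap g s) = lsmap g (subm m s).
Proof.
move=> gc sY; elim: m => [|m IHm]; first by rewrite /= lsmap_delta.
rewrite /= IHm /lsmap /fmap !linext_linext; apply: linext_eq => t ts.
have tY : range t `<=` Y by apply: subset_trans sY; exact: subm_range ts.
rewrite linext_delta /sub !linext_linext; apply: linext_eq => w /sd_stochastic sw.
by rewrite linext_delta (ssimp_smap gc).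
Qed.

Lemma act_subm_gpush (T T' : metricType R) (g : T -> T') Y m n (c : simplex T n -> A) :
  finc c -> cin Y c -> {within Y, continuous g} ->
  act (@subm _ _ m n) (gpush g c) = gpush g (act (@subm _ _ m n) c).
Proof.
move=> fc Yc gc; rewrite /gpush !act_comp_fin//; apply: act_eq => s /Yc sY.
by rewrite linext_delta (subm_smap _ gc sY).
Qed.

Lemma bdry_psi (T : metricType R) (h : R -> T -> T) Y m n (c : simplex T n.+1 -> A) :
  finc c -> cin Y c -> homotopy_on Y h -> (forall x, Y x -> h 0 x = x) ->
  bdry (act (@psi _ _ h m n.+1) c) =
  c - gpush (h 1) (act (@subm _ _ m.+1 n.+1) c) - act (@psi _ _ h m n) (bdry c).
Proof.
move=> fc Yc hc h0; rewrite bdry_fin; last exact: act_fin.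
have cE : c = act (@fdelta _) c by rewrite act_delta.
rewrite bdry_fin// /gpush !act_comp_fin// [X in _ = X - _ - _]cE.
rewrite -!act_opB; [|exact: admissible_fin..].
by apply: act_eq => s /Yc sY; exact: psi_bdry sY h0.
Qed.

Lemma bdry_psi0 (T : metricType R) (h : R -> T -> T) Y m (c : simplex T 0 -> A) :
  finc c -> cin Y c -> homotopy_on Y h -> (forall x, Y x -> h 0 x = x) ->
  bdry (act (@psi _ _ h m 0) c) = c - gpush (h 1) (act (@subm _ _ m.+1 0) c).
Proof.
move=> fc Yc hc h0; rewrite bdry_fin; last exact: act_fin.
have cE : c = act (@fdelta _) c by rewrite act_delta.
rewrite /gpush !act_comp_fin// [X in _ = X - _]cE.
rewrite -!act_opB; [|exact: admissible_fin..].
by apply: act_eq => s /Yc sY; exact: psi_bdry0 sY h0.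
Qed.
End FunctionChains.

Section RelativeHomology.
Variables (R : realType) (A : zmodType) (T : metricType R).
Implicit Types (Y B : set T).

Definition bd_in B n : (simplex T n -> A) -> Prop :=
  match n return (simplex T n -> A) -> Prop with
  | 0 => fun=> True
  | m.+1 => fun z => cin B (bdry z)
  end.

(** [z] vanishes in the homology of [Y] modulo [B]. Explicit witnesses replace quotient groups, so
    that they can be pushed, truncated and averaged. *)
Definition relbound Y B n (z : simplex T n -> A) :=
  exists b l, [/\ finc b, cin Y b, finc l, cin B l & z = bdry b + l].

Lemma relbound_in Y B n (l : simplex T n -> A) : finc l -> cin B l -> relbound Y B l.
Proof.
move=> fl Bl; exists 0, l; split=> //; [exact: finc0|exact: cin0|].
by rewrite bdry0 add0r.
Qed.

Lemma relbound_bdry Y B n (b : simplex T n.+1 -> A) : finc b -> cin Y b ->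
  relbound Y B (bdry b).
Proof.
move=> fb Yb; exists b, 0; split=> //; [exact: finc0|exact: cin0|].
by rewrite addr0.
Qed.

Lemma relboundD Y B n (z z' : simplex T n -> A) :
  relbound Y B z -> relbound Y B z' -> relbound Y B (z + z').
Proof.
move=> [b [l [fb Yb fl Bl ->]]] [b' [l' [fb' Yb' fl' Bl' ->]]].
exists (b + b'), (l + l'); split; [exact: fincD|exact: cinD|exact: fincD|exact: cinD|].
by rewrite bdryD// addrACA.
Qed.

Lemma relboundN Y B n (z : simplex T n -> A) : relbound Y B z -> relbound Y B (- z).
Proof.
move=> [b [l [fb Yb fl Bl ->]]].
exists (- b), (- l); split; [exact: fincN|exact: cinN|exact: fincN|exact: cinN|].
by rewrite bdryN// opprD.
Qed.

Lemma relboundB Y B n (z z' : simplex T n -> A) :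
  relbound Y B z -> relbound Y B z' -> relbound Y B (z - z').
Proof. by move=> zb zb'; apply: relboundD => //; exact: relboundN. Qed.

(** The relative homology of [(Y, B)] with coefficients in [A] is a copy of [A] in degree k,
    generated by [phi], and zero in the other degrees. *)
Record cell_homology Y B k (phi : simplex T k) := CellHomology {
  cellh_vanish : forall n (z : simplex T n -> A), finc z -> cin Y z -> bd_in B z ->
    n <> k -> relbound Y B z ;
  cellh_gen : forall z : simplex T k -> A, finc z -> cin Y z -> bd_in B z ->
    exists a, relbound Y B (z - single phi a) ;
  cellh_free : forall a, relbound Y B (single phi a) -> a = 0 }.
End RelativeHomology.

Lemma relbound_gpush (R : realType) (A : zmodType) (T T' : metricType R) (g : T -> T')
    (Y B : set T) (Y' B' : set T') n (z : simplex T n -> A) :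
  B `<=` Y -> {within Y, continuous g} -> (forall x, Y x -> Y' (g x)) ->
  (forall x, B x -> B' (g x)) ->
  relbound Y B z -> relbound Y' B' (gpush g z).
Proof.
move=> BY gc gY gB [b [l [fb Yb fl Bl ->]]].
have Yl := cin_sub BY Bl.
exists (gpush g b), (gpush g l); split; [exact: finc_gpush| |exact: finc_gpush| |].
- by apply: cin_gpush gc _ => // s x /Yb sY sx; apply/gY; exact: sY.
- by apply: (cin_gpush Yl gc) => s x /Bl sB sx; apply/gB; exact: sB.
- by rewrite gpushD ?(bdry_gpush _ Yb gc)//; exact: finc_bdry.
Qed.

(** * Excision of a cell *)

Section RadialDeformation.
Variables (R : realType) (k : nat).
Local Notation V := 'rV[R]_k.+1.

Definition simplex_boundary : set V :=
  [set v | std_simplex R k v /\ exists i, v ord0 i = 0].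

(* Half of the coordinates of the barycentre. *)
Definition collar_width : R := (k.+1%:R * 2)^-1.

(* [radial t v] moves v away from the barycentre so that at time 1 every point whose least
   coordinate is at most [collar_width] has reached the boundary. *)
Definition depth (v : V) : R := \big[Num.min/collar_width]_i v ord0 i.

Definition radial (t : R) (v : V) : V :=
  \row_i ((v ord0 i - t * depth v) / (1 - k.+1%:R * (t * depth v))).

Lemma collar_width_gt0 : 0 < collar_width.
Proof. by rewrite invr_gt0 mulr_gt0. Qed.

Lemma depth_le_width v : depth v <= collar_width.
Proof. exact: bigmin_le_id. Qed.

Lemma depth_le v i : depth v <= v ord0 i.
Proof. exact: bigmin_le. Qed.

Lemma depth_ge0 v : std_simplex R k v -> 0 <= depth v.
Proof.
move=> [v0 _]; rewrite /depth; elim/big_rec: _ => [|i x _ x0].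
  exact: ltW collar_width_gt0.
by rewrite le_min v0.
Qed.

Lemma depth_attained (v : V) (i : 'I_k.+1) : v ord0 i < collar_width -> exists j, depth v = v ord0 j.
Proof.
move=> vi; have : depth v < collar_width by exact: le_lt_trans (depth_le _ _) vi.
rewrite /depth; elim/big_rec: _ => [|j x _ IH]; first by rewrite ltxx.
by have [vx _|xv /IH] := leP (v ord0 j) x; [exists j|].
Qed.

Lemma depth_continuous : continuous depth.
Proof.
rewrite /depth; elim: (index_enum _) => [|i r IHr].
  rewrite (_ : (fun _ => _) = cst collar_width); first by move=> v; exact: cst_continuous.
  by apply/funext => v; rewrite big_nil.
rewrite (_ : (fun _ => _) = (fun v : V => v ord0 i) \min
    (fun v : V => \big[Num.min/collar_width]_(i <- r) v ord0 i)).
  by move=> v; apply: continuous_min; [exact: coord_continuous|exact: IHr].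
by apply/funext => v; rewrite big_cons.
Qed.

Lemma radial_denom t v : 0 <= t <= 1 -> std_simplex R k v ->
  0 < 1 - k.+1%:R * (t * depth v).
Proof.
move=> /andP[t0 t1] sv; have d0 := depth_ge0 sv.
(* The factor 2 in [collar_width] serves here: the coordinates lose at most 1/2 in all, so the sum
   by which they are divided stays away from 0. *)
have : k.+1%:R * (t * depth v) <= 2^-1.
  apply: (@le_trans _ _ (k.+1%:R * collar_width)).
    by rewrite ler_pM2l// -[leRHS]mul1r ler_pM// depth_le_width.
  by rewrite /collar_width invfM mulrA mulfV ?mul1r// pnatr_eq0.
by move=> /le_lt_trans le2; rewrite subr_gt0 le2// invf_lt1 ?ltr1n.
Qed.

Lemma radial_std t v : 0 <= t <= 1 -> std_simplex R k v -> std_simplex R k (radial t v).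
Proof.
move=> t01 sv; have den := radial_denom t01 sv; have [v0 v1] := sv.
have d0 := depth_ge0 sv; have /andP[t0 t1] := t01; split=> [i|].
  rewrite mxE; apply: divr_ge0; last exact: ltW.
  rewrite subr_ge0; by apply: le_trans (depth_le v i); rewrite ler_piMl.
under eq_bigr do rewrite mxE.
rewrite -mulr_suml sumrB v1 sumr_const card_ord -[X in 1 - X]mulr_natl.
by rewrite mulfV// gt_eqF.
Qed.

Lemma radial0 v : radial 0 v = v.
Proof. by apply/rowP => i; rewrite mxE mul0r mulr0 !subr0 divr1. Qed.

Lemma depth_boundary v : simplex_boundary v -> depth v = 0.
Proof.
move=> [sv [i vi]]; apply/eqP; rewrite eq_le depth_ge0// andbT.
by have := depth_le v i; rewrite vi.
Qed.

Lemma radial_boundary t v : simplex_boundary v -> radial t v = v.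
Proof.
move=> /depth_boundary dv; apply/rowP => i.
by rewrite mxE dv mulr0 mulr0 !subr0 divr1.
Qed.

Lemma radial1_collar v i : std_simplex R k v -> v ord0 i < collar_width ->
  simplex_boundary (radial 1 v).
Proof.
move=> sv vi; split; first by apply: radial_std; rewrite ?ler01 ?lexx.
have [j dj] := depth_attained vi; exists j.
by rewrite mxE mul1r dj subrr mul0r.
Qed.

Lemma radial_homotopy : homotopy_on (std_simplex R k) radial.
Proof.
apply: continuous_in_subspaceT => -[t v]; rewrite inE => -[/= t01 sv].
rewrite in_itv /= in t01; have den := radial_denom t01 sv.
have dc : depth \o snd @ (nbhs (t, v)) --> depth v.
  apply: continuous_comp; first exact: cvg_snd.
  exact: depth_continuous.
have tdc : (fun p : R * V => p.1 * depth p.2) @ (nbhs (t, v)) --> t * depth v.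
  by apply: cvgM => //; exact: cvg_fst.
move=> P /nbhs_ballP[e /= e0 eP].
suff : \forall p \near nbhs (t, v), forall i j,
    ball (radial t v i j) e (radial p.1 p.2 i j).
  by apply: filterS => p pe; apply: eP; split.
apply: filter_forall => i; apply: filter_forall => j.
suff : (fun p : R * V => radial p.1 p.2 i j) @ (nbhs (t, v)) --> radial t v i j.
  by apply; exact: nbhsx_ballx.
rewrite (_ : (fun p : R * V => _) = (fun p => (p.2 ord0 j - p.1 * depth p.2) /
  (1 - k.+1%:R * (p.1 * depth p.2)))); last by apply/funext => p; rewrite mxE.
rewrite mxE; apply: cvgM.
  apply: cvgB => //.
  apply: (@cvg_comp _ _ _ snd (fun v : V => v ord0 j) (nbhs (t, v)) (nbhs v) (nbhs _)).
    exact: cvg_snd.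
  exact: coord_continuous.
apply: cvgV; first by rewrite gt_eqF.
by apply: cvgB; [exact: cvg_cst|apply: cvgM => //; exact: cvg_cst].
Qed.
End RadialDeformation.

Lemma within_continuous_comp (P Z U : topologicalType) (S : set P) (S' : set Z)
    (f : P -> Z) (g : Z -> U) : {within S, continuous f} ->
  (forall x, S x -> S' (f x)) -> {within S', continuous g} ->
  {within S, continuous (g \o f)}.
Proof.
move=> /subspace_continuousP fc fS /subspace_continuousP gc.
apply/subspace_continuousP => x Sx A gA.
have H : within S (nbhs x) [set y | S' (f y) -> A (g (f y))].
  exact: fc x Sx _ (gc _ (fS x Sx) A gA).
suff : within S (nbhs x) [set y | A (g (f y))] by [].
move: H; rewrite /within /=; apply: filterS => y yP Sy.
exact: yP Sy (fS y Sy).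
Qed.

Lemma prod_hausdorff (P Q : topologicalType) : hausdorff_space P ->
  hausdorff_space Q -> hausdorff_space (P * Q)%type.
Proof.
move=> hP hQ [p q] [p' q'] pq; congr (_, _).
  apply: hP => A B Ap Bp'.
  have nA : nbhs (p, q) (A `*` setT) by exists (A, setT) => //; split=> //; exact: filterT.
  have nB : nbhs (p', q') (B `*` setT) by exists (B, setT) => //; split=> //; exact: filterT.
  by have [[x y] [[Ax _] [Bx _]]] := pq _ _ nA nB; exists x.
apply: hQ => A B Aq Bq'.
have nA : nbhs (p, q) (setT `*` A) by exists (setT, A) => //; split=> //; exact: filterT.
have nB : nbhs (p', q') (setT `*` B) by exists (setT, B) => //; split=> //; exact: filterT.
by have [[x y] [[_ Ay] [_ By]]] := pq _ _ nA nB; exists y.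
Qed.

Lemma closed_rectangle (P Q : topologicalType) (A : set P) (B : set Q) :
  closed A -> closed B -> closed (A `*` B).
Proof.
move=> cA cB.
have -> : A `*` B = (fst @^-1` A) `&` (snd @^-1` B) by [].
by apply: closedI; apply: preimage_closed => // x _; [exact: cvg_fst|exact: cvg_snd].
Qed.

(** A continuous map from a compact set to a Hausdorff space is closed, so continuity of [g] on the
    image can be tested after composing with [q]. *)
Lemma within_continuous_quotient (P Z W : topologicalType) (S : set P) (q : P -> Z)
    (g : Z -> W) : hausdorff_space Z -> compact S -> {within S, continuous q} ->
  {within S, continuous (g \o q)} -> {within q @` S, continuous g}.
Proof.
move=> hZ cS qc gqc; apply/continuous_closedP => C cC; apply/closed_subspaceP.
have /continuous_closedP/(_ _ cC)/closed_subspaceP[V cV VS] := gqc.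
exists (q @` (S `&` V)).
  apply: compact_closed => //; apply: continuous_compact; last exact: compact_closedI.
  by apply: continuous_subspaceW qc => x [].
apply/seteqP; split=> [_ [[x [Sx Vx] <-] _]|z [Cz [x Sx xz]]].
  split; last by exists x.
  have : (V `&` S) x by [].
  by rewrite VS => -[].
split; last by exists x.
exists x => //; split=> //.
have : (from_subspace S (g \o q) @^-1` C `&` S) x by split=> //=; rewrite /from_subspace /= xz.
by rewrite -VS => -[].
Qed.

(** [Y] arises from its part in [B'] by attaching one cell. This covers a closed cell over its
    frontier, a skeleton over all its cells but one, and the boundary of a simplex over a horn. *)
Record cell_in (R : realType) (T : metricType R) k (phi : simplex T k) (Y B' : set T) := CellIn {
  cell_in_inj : set_inj (@std_interior R k) phi ;
  cell_in_range : range phi `<=` Y ;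
  cell_in_closed : closed B' ;
  cell_in_boundary : phi @` (~` @std_interior R k) `<=` B' ;
  cell_in_interior : forall p, @std_interior R k p -> ~ B' (phi p) ;
  cell_in_cover : forall y, Y y -> B' y \/ (phi @` @std_interior R k) y }.

Section CellCollar.
Variables (R : realType) (T : metricType R) (k : nat) (phi : simplex T k).
Variables (Y B' : set T).
Local Notation V := 'rV[R]_k.+1.
Local Notation int := (@std_interior R k).

Hypothesis phi_cell : cell_in phi Y B'.
Let phi_inj := cell_in_inj phi_cell.
Let phi_Y := cell_in_range phi_cell.
Let B'_closed := cell_in_closed phi_cell.
Let phi_boundary := cell_in_boundary phi_cell.
Let phi_interior := cell_in_interior phi_cell.
Let Y_cover := cell_in_cover phi_cell.

Definition ocell : set T := phi @` int.
Definition char_bary (v : V) : T := phi (mkpt v).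
(** Barycentric coordinates on the open cell. Off it the value is the barycentre, so that it is a
    point of the simplex in every case. *)
Definition coord (y : T) : V := set_val (xget (center R k) [set p | int p /\ phi p = y]).

Lemma coordK p : int p -> coord (phi p) = set_val p.
Proof.
move=> ip; rewrite /coord; case: xgetP => [q _ [iq qp]|/(_ p)]; last by case.
by congr set_val; apply: phi_inj; rewrite ?inE.
Qed.

Lemma hat_coord y : ocell y -> char_bary (coord y) = y.
Proof. by move=> [p ip <-]; rewrite coordK// /char_bary set_valK. Qed.

Lemma coord_std y : std_simplex R k (coord y).
Proof. exact: set_valP. Qed.

Lemma hat_continuous : {within std_simplex R k, continuous char_bary}.
Proof.
apply/subspace_continuousP => v sv A Av.
have [_ [[U oU <-] Uv UA]] : nbhs (mkpt v) (phi @^-1` A) by exact: (@cts_fun _ _ phi).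
have nU : nbhs v U by apply: open_nbhs_nbhs; split=> //; rewrite -(mkptE sv).
by apply: filterS nU => u Uu su; apply: UA; rewrite /= mkptE.
Qed.

Lemma std_int_or_boundary v : std_simplex R k v -> int (mkpt v) \/ simplex_boundary v.
Proof.
move=> sv; have [ip|nip] := pselect (int (mkpt v)); first by left.
right; split=> //; apply: contrapT => nz; apply: nip => i.
rewrite mkptE// lt_neqAle; have [-> _] := sv; rewrite andbT.
by apply/eqP => vi; apply: nz; exists i.
Qed.

Lemma int_mkpt v : std_simplex R k v -> int (mkpt v) <-> forall i, 0 < v ord0 i.
Proof. by move=> sv; split=> ip i; have := ip i; rewrite mkptE. Qed.

Lemma boundary_B' v : simplex_boundary v -> B' (char_bary v).
Proof.
move=> [sv [i vi]]; apply: phi_boundary; exists (mkpt v) => //.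
by move=> /(_ i); rewrite mkptE// vi ltxx.
Qed.

Lemma ocell_notB' y : ocell y -> ~ B' y.
Proof. by move=> [p ip <-]; exact: phi_interior. Qed.

Lemma ocell_hat v : std_simplex R k v -> ocell (char_bary v) -> int (mkpt v).
Proof. by move=> /std_int_or_boundary[//|/boundary_B' bv /ocell_notB']. Qed.

Lemma coord_hat v : int (mkpt v) -> std_simplex R k v -> coord (char_bary v) = v.
Proof. by move=> iv sv; rewrite /char_bary coordK// mkptE. Qed.

Lemma hat_closed C : closed C -> closed (char_bary @` (std_simplex R k `&` C)).
Proof.
move=> cC; apply: compact_closed; first exact: metric_hausdorff.
apply: continuous_compact.
  by apply: continuous_subspaceW hat_continuous => x [].
by apply: compact_closedI => //; exact: std_simplex_rV_compact.
Qed.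

(** [char_bary] sends closed subsets of the compact simplex to closed sets and is injective over the
    open cell, so its inverse there is continuous. *)
Lemma coord_continuous : {within ocell, continuous coord}.
Proof.
apply/continuous_closedP => C cC; apply/closed_subspaceP.
exists (char_bary @` (std_simplex R k `&` C)); first exact: hat_closed.
apply/seteqP; split=> y [].
  move=> [v [sv Cv] <-] ov; split=> //.
  by rewrite /from_subspace /= coord_hat//; exact: ocell_hat.
move=> Cy oy; split=> //; exists (coord y); last exact: hat_coord.
by split=> //; exact: coord_std.
Qed.

Definition extend_radial (t : R) (y : T) : T :=
  if `[< ocell y >] then char_bary (radial t (coord y)) else y.

Lemma extend_radial_hat t v : 0 <= t <= 1 -> std_simplex R k v ->
  extend_radial t (char_bary v) = char_bary (radial t v).
Proof.
move=> t01 sv; rewrite /extend_radial; case: asboolP => [ov|nov].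
  by rewrite coord_hat//; exact: ocell_hat.
have [iv|bv] := std_int_or_boundary sv; last by rewrite radial_boundary.
by case: nov; exists (mkpt v).
Qed.

Lemma extend_radial_B' t y : B' y -> extend_radial t y = y.
Proof. by move=> By; rewrite /extend_radial; case: asboolP => // /ocell_notB'. Qed.

Lemma Y_hat y : Y y -> B' y \/ exists2 v, std_simplex R k v & y = char_bary v.
Proof.
move=> /Y_cover[|oy]; [by left|right].
by exists (coord y); [exact: coord_std|rewrite hat_coord].
Qed.

Lemma extend_radial0 y : Y y -> extend_radial 0 y = y.
Proof.
move=> /Y_hat[/extend_radial_B'->//|[v sv ->]].
by rewrite extend_radial_hat ?radial0// lexx ler01.
Qed.

Lemma extend_radial_Y t y : 0 <= t <= 1 -> Y y -> Y (extend_radial t y).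
Proof.
move=> t01 Yy; have [By|[v sv yv]] := Y_hat Yy; first by rewrite extend_radial_B'.
by rewrite yv extend_radial_hat//; apply: phi_Y; eexists.
Qed.

(** A closed part of the open cell outside which the deformation ends in [B']; it leaves a margin in
    which subdivided simplices fit. *)
Definition core : set T :=
  char_bary @` (std_simplex R k `&` [set v : V | forall i, collar_width R k <= v ord0 i]).

Lemma core_closed : closed core.
Proof.
apply: hat_closed; rewrite (_ : [set _ | _] = \bigcap_(i in [set: 'I_k.+1])
    ((fun v : V => v ord0 i) @^-1` [set x | collar_width R k <= x])).
  apply: closed_bigI => i _; apply: preimage_closed; last exact: closed_ge.
  by move=> v _; exact: matrix_normedtype.coord_continuous.
by apply/seteqP; split=> v vP; [move=> i _|move=> i]; exact: vP.
Qed.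

Lemma core_ocell : core `<=` ocell.
Proof.
move=> _ [v [sv vw] <-]; exists (mkpt v) => //; apply/int_mkpt => // i.
exact: lt_le_trans (collar_width_gt0 R k) (vw i).
Qed.

Lemma radial1_core v : std_simplex R k v ->
  ~ (forall i, collar_width R k <= v ord0 i) -> simplex_boundary (radial 1 v).
Proof.
move=> sv nw; have [i vi] : exists i, v ord0 i < collar_width R k.
  apply: contrapT => nv; apply: nw => i; rewrite leNgt; apply/negP => vi.
  by apply: nv; exists i.
exact: radial1_collar vi.
Qed.

Lemma extend_radial1_core y : Y y -> ~ core y -> B' (extend_radial 1 y).
Proof.
move=> /Y_hat[By _|[v sv ->] ncore]; first by rewrite extend_radial_B'.
rewrite extend_radial_hat ?ler01 ?lexx//; apply: boundary_B'.
by apply: radial1_core => // vw; apply: ncore; exists v.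
Qed.

(** Over the image of the cell the homotopy is a quotient of [radial_homotopy] along a map from a
    compact set; on [B'] it is constant. The two closed pieces are pasted. *)
Lemma extend_radial_homotopy : homotopy_on Y extend_radial.
Proof.
have I01 : compact (`[0, 1] : set R) by exact: segment_compact.
have hatc : {within `[0, 1] `*` (char_bary @` std_simplex R k),
    continuous (fun p : R * T => extend_radial p.1 p.2)}.
  have -> : `[0, 1] `*` (char_bary @` std_simplex R k) =
      (fun p : R * V => (p.1, char_bary p.2)) @` (`[0, 1] `*` std_simplex R k).
    apply/seteqP; split=> [[t y] [/= t01 [v sv <-]]|_ [[t v] [/= t01 sv] <-]].
      by exists (t, v).
    by split=> //=; exists v.
  have qc : {within `[0, 1] `*` std_simplex R k,
      continuous (fun p : R * V => (p.1, char_bary p.2))}.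
    have hatc : {within `[0, 1] `*` std_simplex R k, continuous (char_bary \o snd : R * V -> T)}.
      apply: within_continuous_comp hat_continuous; last by move=> [t v] [].
      by apply: continuous_subspaceT => p; exact: cvg_snd.
    apply/subspace_continuousP => p Sp.
    apply: (@cvg_pair _ _ _ _ (nbhs _) (nbhs _)).
      by apply: cvg_within_filter; exact: cvg_fst.
    by move/subspace_continuousP : hatc; exact.
  apply: within_continuous_quotient => //.
  - apply: prod_hausdorff; [exact: Rhausdorff|exact: metric_hausdorff].
  - by apply: compact_setX => //; exact: std_simplex_rV_compact.
  - have rc : {within `[0, 1] `*` std_simplex R k,
        continuous (char_bary \o (fun p : R * V => radial p.1 p.2))}.
      apply: within_continuous_comp hat_continuous; first exact: radial_homotopy.
      by move=> [t v] [/= t01 sv]; apply: radial_std.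
    apply: subspace_eq_continuous rc => -[t v]; rewrite inE => -[/= t01 sv].
    by rewrite /from_subspace /= extend_radial_hat.
have sub : (`[0, 1]%classic : set R) `*` Y `<=`
    (`[0, 1] `*` (char_bary @` std_simplex R k)) `|` (`[0, 1] `*` B').
  move=> [t y] [/= t01 /Y_hat[By|[v sv ->]]]; [by right|left].
  by split=> //; exists v.
apply: (continuous_subspaceW sub); apply: withinU_continuous => //.
- apply: closed_rectangle; first exact: interval_closed.
  by have := hat_closed closedT; rewrite setIT.
- by apply: closed_rectangle => //; exact: interval_closed.
- have sc : {within `[0, 1] `*` B', continuous (snd : R * T -> T)}.
    by apply: continuous_subspaceT => p; exact: cvg_snd.
  apply: subspace_eq_continuous sc => -[t y]; rewrite inE => -[/= t01 By].
  by rewrite /from_subspace /= extend_radial_B'.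
Qed.
End CellCollar.

Lemma subm_small_chain (R : realType) (A : zmodType) (T : metricType R) n
    (c : simplex T n -> A) (Q : set T -> Prop) : finc c ->
  (forall U U' : set T, U `<=` U' -> Q U' -> Q U) ->
  (forall s (p : std_simplex R n), c s != 0 -> exists2 U, nbhs p U & Q (s @` U)) ->
  exists m0, forall m, (m0 <= m)%N -> forall s, c s != 0 ->
    allc (fun t : simplex T n => Q (range t)) (subm m s).
Proof.
move=> fc QS QU; have [r ur rP] := finite_uniq_seq fc.
have Qr s : s \in r -> exists m0, forall m, (m0 <= m)%N ->
    allc (fun t : simplex T n => Q (range t)) (subm m s).
  by move=> /rP cs; apply: subm_small => // p; exact: QU.
have [m0 m0P] : exists m0, forall m s, s \in r -> (m0 <= m)%N ->
    allc (fun t : simplex T n => Q (range t)) (subm m s).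
  elim: r Qr {ur rP} => [|s r IHr] Qr; first by exists 0%N.
  have [|m1 m1P] := IHr; first by move=> t tr; apply: Qr; rewrite inE tr orbT.
  have [m2 m2P] := Qr s (mem_head _ _); exists (maxn m1 m2) => m t.
  rewrite inE geq_max => /orP[/eqP -> /andP[_]|tr /andP[+ _]]; first exact: m2P.
  exact: m1P.
by exists m0 => m mm0 s cs; apply: m0P => //; exact/rP.
Qed.

Lemma homotopy_at (R : realType) (T : metricType R) (Y : set T) h t :
  homotopy_on Y h -> 0 <= t <= 1 -> {within Y, continuous (h t)}.
Proof.
move=> hc t01; rewrite (_ : h t = (fun p => h p.1 p.2) \o (fun y => (t, y)))//.
apply: within_continuous_comp hc.
  apply: continuous_subspaceT => y; apply: (@cvg_pair _ _ _ _ (nbhs _) (nbhs _)) => //.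
  exact: cvg_cst.
by move=> y Yy; split=> //=; rewrite in_itv.
Qed.

Section StandardCell.
Variables (R : realType) (k : nat).
Local Notation V := 'rV[R]_k.+1.

Definition std_cell : simplex V k := mkcts (@set_val_continuous R k).

Lemma std_cell_range : range std_cell `<=` std_simplex R k.
Proof. by move=> _ [p _ <-]; exact: set_valP. Qed.

Lemma simplex_boundary_sub : @simplex_boundary R k `<=` std_simplex R k.
Proof. by move=> v []. Qed.

Definition in_core (v : V) := forall i, collar_width R k <= v ord0 i.
End StandardCell.
Arguments std_cell : clear implicits.

Lemma std_cell_face (R : realType) k (i : 'I_k.+2) :
  range (face i (std_cell R k.+1)) `<=` @simplex_boundary R k.+1.
Proof.
move=> _ [p _ <-]; rewrite [face i _ p]/(face_row i (set_val p)); split.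
  by apply: face_row_std; exact: set_valP.
by exists i; rewrite mxE unlift_none.
Qed.

Lemma bd_in_std_cell (R : realType) (A : zmodType) k (a : A) :
  bd_in (@simplex_boundary R k) (single (std_cell R k) a).
Proof.
case: k => //= k; rewrite bdry_fin; last exact: finc_single.
apply: act_cin => s /single_neq0 ->; apply: allc_sum => i; apply: allcMz.
by apply: allc_delta; exact: std_cell_face.
Qed.

Lemma bd_in_subm (R : realType) (A : zmodType) (T : metricType R) (B : set T) m n
    (z : simplex T n -> A) : finc z -> bd_in B z -> bd_in B (act (@subm _ _ m n) z).
Proof. by case: n z => //= n z fz Bz; rewrite bdry_subm//; exact: cin_subm. Qed.

(** The operator [psi] gives the bounding chain, and its value on the boundary of [z] stays in [B]
    because [h] preserves [B]. *)
Lemma relbound_subdivide (R : realType) (A : zmodType) (T : metricType R) (Y B : set T)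
    h m n (z : simplex T n -> A) : B `<=` Y -> finc z -> cin Y z -> bd_in B z ->
  homotopy_on Y h -> (forall x, Y x -> h 0 x = x) ->
  (forall t x, 0 <= t <= 1 -> Y x -> Y (h t x)) ->
  (forall t x, 0 <= t <= 1 -> B x -> B (h t x)) ->
  relbound Y B (z - gpush (h 1) (act (@subm _ _ m.+1 n) z)).
Proof.
move=> BY fz Yz Bz hc h0 hY hB.
have fpsi : finc (act (@psi _ _ h m n) z) by exact: act_fin.
have Ypsi : cin Y (act (@psi _ _ h m n) z) by exact: (cin_psi hc Yz Yz).
have := relbound_bdry B fpsi Ypsi.
case: n z fz Yz Bz {fpsi Ypsi} => [|n] z fz Yz Bz.
  by rewrite (bdry_psi0 m fz Yz hc h0).
rewrite (bdry_psi m fz Yz hc h0) => rel.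
rewrite -[_ - _](subrK (act (@psi _ _ h m n) (bdry z))).
apply: relboundD => //; apply: relbound_in; first by apply: act_fin; exact: finc_bdry.
exact: (cin_psi hc (cin_sub BY Bz) Bz).
Qed.

Section Excision.
Variables (R : realType) (A : zmodType) (T : metricType R) (k : nat) (phi : simplex T k).
Variables (Y B' : set T).
Local Notation V := 'rV[R]_k.+1.
Local Notation int := (@std_interior R k).
Local Notation Delta := (std_simplex R k).
Local Notation bDelta := (@simplex_boundary R k).

Hypothesis phi_cell : cell_in phi Y B'.
Local Notation B := (Y `&` B').
Local Notation ocell := (ocell phi).
Local Notation core := (core phi).
Local Notation hat := (char_bary phi).
Local Notation coord := (coord phi).
Local Notation ext := (extend_radial phi).

Lemma BY : B `<=` Y. Proof. by move=> y []. Qed.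

Let one01 : 0 <= (1 : R) <= 1. Proof. by rewrite ler01 lexx. Qed.

Let ext_hom := extend_radial_homotopy phi_cell.
Let ext0 := extend_radial0 phi_cell.
Let ext1c := homotopy_at ext_hom one01.
Let hatc := @hat_continuous _ _ _ phi.
Let coordc := coord_continuous phi_cell.
Let rad1c := homotopy_at (@radial_homotopy R k) one01.

Lemma ext_B t y : 0 <= t <= 1 -> B y -> B (ext t y).
Proof. by move=> t01 [Yy By]; rewrite (extend_radial_B' phi_cell). Qed.

Lemma ext1_core y : Y y -> ~ core y -> B (ext 1 y).
Proof.
move=> Yy nK; split; first exact: (extend_radial_Y phi_cell).
exact: (extend_radial1_core phi_cell).
Qed.

Lemma hat_Y v : Delta v -> Y (hat v).
Proof. by move=> sv; apply: (cell_in_range phi_cell); eexists. Qed.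

Lemma hat_B v : bDelta v -> B (hat v).
Proof. by move=> bv; split; [case: bv => /hat_Y|exact: (boundary_B' phi_cell)]. Qed.

Definition inner n (t : simplex T n) := range t `<=` ocell.

(** The open cell and the complement of the core are open in [Y] and cover it. Simplices in the
    former can be read in coordinates; those in the latter are pushed into [B'] by [ext 1]. *)
Definition small (U : set T) := U `<=` ocell \/ forall y, U y -> ~ core y.

Lemma chain_small n (z : simplex T n -> A) : finc z -> cin Y z ->
  exists m0, forall m, (m0 <= m)%N ->
    forall t, act (@subm _ _ m n) z t != 0 -> small (range t).
Proof.
move=> fz Yz; have [| |m0 m0P] := @subm_small_chain _ _ _ _ z small fz.
- by move=> U U' UU' [U'o|U'K]; [left=> y /UU'/U'o|right=> y /UU'/U'K].
- move=> s p zs; have [op|np] := pselect (ocell (s p)).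
    exists (s @^-1` (~` B')).
      apply: open_nbhs_nbhs; split; last exact: (ocell_notB' phi_cell).
      apply: open_comp; first by move=> q _; exact: cts_fun.
      by apply: closed_openC; exact: cell_in_closed phi_cell.
    left=> _ [q nB <-]; have Yq : Y (s q) by apply: (Yz _ zs); exists q.
    by have [/nB|] := cell_in_cover phi_cell Yq.
  exists (s @^-1` (~` core)).
    apply: open_nbhs_nbhs; split.
      apply: open_comp; first by move=> q _; exact: cts_fun.
      by apply: closed_openC; exact: core_closed phi.
    by move=> /(core_ocell)/np.
  by right=> _ [q nK <-].
by exists m0 => m mm0 t /act_neq0[s zs]; exact: m0P.
Qed.

(** The simplices inside the open cell are read in coordinates. Cutting off the others creates new
    faces, but these avoid the core, and [radial 1] moves them into the boundary of the standard
    simplex. *)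
Let cell_lift n (x : simplex T n -> A) :=
  gpush (@radial R k 1) (gpush coord (restr (@inner _) x)).

Section Lift.
Variables (n : nat) (x : simplex T n -> A).
Hypotheses (fx : finc x) (Yx : cin Y x).
Hypothesis sx : forall t, x t != 0 -> small (range t).
Let xe := restr (@inner n) x.
Let xB := restr (fun t => ~ inner t) x.

Let xe_o : cin ocell xe.
Proof. by move=> t nz; have [] := restr_neq0 nz. Qed.
Let fxe : finc xe. Proof. exact: finc_restr. Qed.
Let fxB : finc xB. Proof. exact: finc_restr. Qed.

Lemma outer_core t y : xB t != 0 -> range t y -> ~ core y.
Proof. by move=> nz; have [no /sx[/no//|nK]] := restr_neq0 nz; exact: nK. Qed.

Let coord_cin : cin Delta (gpush coord xe).
Proof. by apply: cin_gpush coordc _ => // s y _ _; exact: coord_std. Qed.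

Lemma finc_lift : finc (cell_lift x).
Proof. by do 2 apply: finc_gpush. Qed.

Lemma cin_lift : cin Delta (cell_lift x).
Proof.
by apply: (cin_gpush coord_cin rad1c) => s v nz sv; apply: radial_std => //; exact: coord_cin sv.
Qed.

Lemma hat_lift : relbound Y B (gpush (ext 1) x - gpush hat (cell_lift x)).
Proof.
have -> : gpush hat (cell_lift x) = gpush (ext 1) xe.
  rewrite /cell_lift (gpush_comp _ _ coord_cin rad1c); last exact: finc_gpush.
  rewrite (gpush_comp _ fxe xe_o coordc); apply: gpush_eq => s y /xe_o so sy.
  have oy := so _ sy; rewrite /= -(extend_radial_hat phi_cell one01 (coord_std _ _)).
  by rewrite (hat_coord phi_cell).
rewrite [x in gpush _ x](restr_split (@inner n)).
rewrite gpushD// addrC addKr; apply: relbound_in; first exact: finc_gpush.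
have YxB : cin Y xB by exact: cin_restr.
apply: (cin_gpush YxB ext1c) => s y nz sy; apply: ext1_core; first exact: YxB sy.
exact: outer_core sy.
Qed.
End Lift.

(** On a simplex inside the open cell the boundary of [x] vanishes, so there the boundary of the
    inner part is minus that of the remaining simplices, which avoid the core. *)
Lemma bdry_inner_core n (x : simplex T n.+1 -> A) t y : finc x -> 
  (forall t, x t != 0 -> small (range t)) -> cin B (bdry x) ->
  bdry (restr (@inner n.+1) x) t != 0 ->
  range t y -> ~ core y.
Proof.
move=> fx sx Bx; set xe := restr _ x; set xB := restr (fun t => ~ inner t) x.
have fxe : finc xe by exact: finc_restr.
have fxB : finc xB by exact: finc_restr.
move=> nz ty; have to : range t `<=` ocell.
  by apply: (cin_bdry fxe _ nz) => s nzs; have [] := restr_neq0 nzs.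
have : bdry x t = bdry xe t + bdry xB t.
  by rewrite [x](restr_split (@inner _)) bdryD.
have -> : bdry x t = 0.
  apply/eqP/negPn/negP => /Bx tB; have [z tz] := simplex_range_neq0 t.
  by have [_] := tB _ tz; apply: (ocell_notB' phi_cell); exact: to.
move=> /esym/eqP; rewrite addr_eq0 => /eqP e; move: nz; rewrite e oppr_eq0.
rewrite bdry_fin// => /act_neq0[s ns /bd_range st].
by apply: (outer_core sx ns); exact: st.
Qed.

Lemma bd_in_lift n (x : simplex T n -> A) : finc x -> cin Y x ->
  (forall t, x t != 0 -> small (range t)) -> bd_in B x ->
  bd_in bDelta (cell_lift x).
Proof.
case: n x => //= n x fx Yx sx Bx; set xe := restr (@inner n.+1) x.
have fxe : finc xe by exact: finc_restr.
have xe_o : cin ocell xe by move=> t nz; have [] := restr_neq0 nz.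
have cc : cin Delta (gpush coord xe).
  by apply: (cin_gpush xe_o coordc) => s y _ _; exact: coord_std.
rewrite /cell_lift (bdry_gpush _ cc rad1c); last exact: finc_gpush.
rewrite (bdry_gpush fxe xe_o coordc).
have bo : cin ocell (bdry xe) by exact: cin_bdry.
have bc : cin Delta (gpush coord (bdry xe)).
  by apply: (cin_gpush bo coordc) => s y _ _; exact: coord_std.
apply: (cin_gpush bc rad1c) => _ v /gpush_neq0[t nt ->].
rewrite (smap_range coordc); last exact: bo.
move=> [y ty <-]; apply: (radial1_core (coord_std _ _)) => // yw.
have oy : ocell y by apply: bo ty.
apply: (bdry_inner_core fx sx Bx nt ty).
by exists (coord y); [split=> //; exact: coord_std|exact: (hat_coord phi_cell)].
Qed.

Lemma excision_lift n (z : simplex T n -> A) : finc z -> cin Y z -> bd_in B z ->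
  exists w, [/\ finc w, cin Delta w, bd_in bDelta w & relbound Y B (z - gpush hat w)].
Proof.
move=> fz Yz Bz; have [m mP] := chain_small fz Yz.
pose x := act (@subm _ _ m.+1 n) z.
have fx : finc x by exact: act_fin.
have Yx : cin Y x by exact: cin_subm.
have sx : forall t, x t != 0 -> small (range t) by exact: mP.
exists (cell_lift x); split; [exact: finc_lift|exact: cin_lift| |].
  exact/bd_in_lift/bd_in_subm.
rewrite -[z in z - _](subrK (gpush (ext 1) x)) -addrA.
apply: relboundD; last exact: hat_lift.
exact: (relbound_subdivide m BY fz Yz Bz ext_hom ext0 (extend_radial_Y phi_cell) ext_B).
Qed.

Lemma hat_std_cell : smap hat (std_cell R k) = phi.
Proof.
rewrite -[RHS]mks_eta; congr mks; apply/funext => p.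
by rewrite /char_bary /= set_valK.
Qed.

Lemma core_hat v : Delta v -> core (hat v) -> in_core v.
Proof.
move=> sv [u [su uw] uv]; have oh : ocell (hat v).
  by apply: core_ocell; exists u.
have iv := ocell_hat phi_cell sv oh.
have iu : int (mkpt u) by apply: (ocell_hat phi_cell su); rewrite uv.
rewrite -(coord_hat phi_cell iv sv) -uv (coord_hat phi_cell iu su).
exact: uw.
Qed.

Definition std_small (U : set V) :=
  U `<=` [set v | forall i, 0 < v ord0 i] \/ forall v, U v -> ~ in_core v.

Lemma std_chain_small n (z : simplex V n -> A) : finc z ->
  exists m0, forall m, (m0 <= m)%N ->
    forall t, act (@subm _ _ m n) z t != 0 -> std_small (range t).
Proof.
move=> fz; have [| |m0 m0P] := @subm_small_chain _ _ _ _ z std_small fz.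
- by move=> U U' UU' [U'o|U'K]; [left=> y /UU'/U'o|right=> y /UU'/U'K].
- have opn i (U : set R) s : open U ->
      open ((fun p : std_simplex R n => (s : simplex V n) p ord0 i) @^-1` U).
    move=> oU; apply: (@open_comp _ _ (fun p : std_simplex R n => s p ord0 i)) => // q _.
    apply: (@cvg_comp _ _ _ s (fun v : V => v ord0 i) (nbhs q) (nbhs (s q)) (nbhs _)).
      exact: cts_fun.
    exact: matrix_normedtype.coord_continuous.
  move=> s p zs; have [pos|npos] := pselect (forall i, 0 < s p ord0 i).
    exists [set q | forall i, 0 < s q ord0 i]; last by move=> /=; left=> _ [q qP <-].
    have : \forall q \near p, forall i, 0 < s q ord0 i.
      apply: (@filter_forall _ _ (fun i q => 0 < s q ord0 i) (nbhs p)) => i.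
      by apply: open_nbhs_nbhs; split; [exact/(opn i [set x | 0 < x])/open_gt|exact: pos].
    by [].
  have [i ip] : exists i, ~ (0 < s p ord0 i) by apply/existsNP.
  exists ((fun p : std_simplex R n => s p ord0 i) @^-1` [set x | x < collar_width R k]).
    apply: open_nbhs_nbhs; split; first exact/(opn i [set x | x < collar_width R k])/open_lt.
    by apply: le_lt_trans (collar_width_gt0 R k); rewrite leNgt; exact/negP.
  by right=> _ [q qP <-] /(_ i); rewrite leNgt qP.
by exists m0 => m mm0 t /act_neq0[s zs]; exact: m0P.
Qed.

(** A relation in [Y] is carried back to the standard simplex: after subdivision the chain and its
    bounding chain are restricted to the open cell, read in coordinates and pushed outwards. What is
    cut off ends in the boundary. *)
Lemma excision_free (a : A) : relbound Y B (single phi a) ->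
  relbound Delta bDelta (single (std_cell R k) a).
Proof.
move=> [b [l [fb Yb fl Bl e]]].
have [m0 m0P] := chain_small fb Yb.
have fi : finc (single (std_cell R k) a) by exact: finc_single.
have ci : cin Delta (single (std_cell R k) a).
  by apply: cin_single; exact: std_cell_range.
have [m1 m1P] := std_chain_small fi.
pose m := maxn m0 m1; pose S n := act (A := A) (@subm R T m.+1 n).
pose U := act (@subm R _ m.+1 k) (single (std_cell R k) a).
have fU : finc U by exact: act_fin.
have cU : cin Delta U by exact: cin_subm.
have sU t : U t != 0 -> std_small (range t).
  by apply: m1P; rewrite leqW// leq_maxr.
have fb' : finc (S _ b) by exact: act_fin.
have sb t : S _ b t != 0 -> small (range t).
  by apply: m0P; rewrite leqW// leq_maxl.
have Bl' : cin B (S _ l) by exact: cin_subm.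
have hatU : gpush hat U = bdry (S _ b) + S _ l.
  rewrite /S bdry_subm// -actD; [|apply: admissible_fin..] => //; last exact: finc_bdry.
  by rewrite -e -[in RHS]hat_std_cell -gpush_single (act_subm_gpush _ fi ci hatc).
pose be := restr (@inner _) (S _ b); pose bB := restr (fun t => ~ inner t) (S _ b).
pose pos (t : simplex V k) := range t `<=` [set v | forall i, 0 < v ord0 i].
pose Ui := restr pos U; pose Uo := restr (fun t => ~ pos t) U.
have fbe : finc be by exact: finc_restr.
have fbB : finc bB by exact: finc_restr.
have fUi : finc Ui by exact: finc_restr.
have fUo : finc Uo by exact: finc_restr.
have cUi : cin Delta Ui by exact: cin_restr.
have cUo : cin Delta Uo by exact: cin_restr.
have be_o : cin ocell be by move=> t nz; have [] := restr_neq0 nz.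
have hUi_o : cin ocell (gpush hat Ui).
  apply: (cin_gpush cUi hatc) => s v nz sv; have sD := cUi _ nz _ sv.
  have [ps _] := restr_neq0 nz; exists (mkpt v) => //.
  by apply/int_mkpt => // i; exact: ps.
(* On simplices inside the open cell the subdivision of [l] vanishes, so there [q] is the image of
   [Uo] minus the boundary of [bB], and both avoid the core. *)
pose q := bdry be - gpush hat Ui.
have fq : finc q by apply: fincB; [exact: finc_bdry|exact: finc_gpush].
have q_o : cin ocell q by apply: cinB => //; exact: cin_bdry.
have Uo_core t v : Uo t != 0 -> range t v -> ~ in_core v.
  by move=> nz; have [np /sU[/np//|nc]] := restr_neq0 nz; exact: nc.
have q_core t y : q t != 0 -> range t y -> ~ core y.
  move=> nz ty.
  have : bdry be t + bdry bB t + S _ l t = gpush hat Ui t + gpush hat Uo t.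
    have /(congr1 (@^~ t)) := hatU.
    rewrite [in gpush hat U](restr_split pos U) gpushD//.
    rewrite [in bdry (S _ b)](restr_split (@inner _) (S _ b)) bdryD// => <-.
  have -> : S _ l t = 0.
    apply/eqP/negPn/negP => /Bl' tB.
    by have [_] := tB _ ty; apply: (ocell_notB' phi_cell); exact: q_o ty.
  rewrite addr0 => e'.
  have {}e' : q t = gpush hat Uo t - bdry bB t.
    rewrite /q -[(_ - _) t]/(bdry be t - gpush hat Ui t).
    by apply/eqP; rewrite subr_eq addrAC [_ + gpush _ _ _]addrC -e' addrK.
  have [h0|hn] := eqVneq (gpush hat Uo t) 0.
    move: nz; rewrite e' h0 sub0r oppr_eq0 bdry_fin// => /act_neq0[s ns /bd_range st].
    apply: (@outer_core _ _ sb s) => //; exact: st.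
  have [u nu tu] := gpush_neq0 hn; move: ty; rewrite tu (smap_range hatc); last exact: cUo.
  move=> [v uv <-] cv; apply: (Uo_core u v) => //; apply: core_hat => //.
  exact: cUo uv.
pose bt := gpush coord be.
have fbt : finc bt by exact: finc_gpush.
have cbt : cin Delta bt.
  by apply: (cin_gpush be_o coordc) => s y _ _; exact: coord_std.
pose y := bdry bt - Ui.
have yE : y = gpush coord q.
  rewrite /q gpushB//; [|exact: finc_bdry|exact: finc_gpush].
  rewrite -(bdry_gpush fbe be_o coordc); congr (_ - _).
  rewrite (gpush_comp _ fUi cUi hatc) gpush_id// => s v nz sv /=.
  have [ps _] := restr_neq0 nz; have sD := cUi _ nz _ sv.
  by rewrite (coord_hat phi_cell)//; apply/int_mkpt => // i; exact: ps.
have fy : finc y by rewrite yE; exact: finc_gpush.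
have y_core u : y u != 0 -> forall v, range u v -> Delta v /\ ~ in_core v.
  rewrite yE => /gpush_neq0[t nt ->] v.
  rewrite (smap_range coordc); last exact: q_o.
  move=> [x tx <-]; split; first exact: coord_std.
  move=> cx; apply: (q_core t x) => //; have ox : ocell x by exact: q_o tx.
  by exists (coord x); [split=> //; exact: coord_std|exact: (hat_coord phi_cell)].
have cy : cin Delta y by move=> u /y_core uP v /uP[].
have Ui_E : Ui = bdry bt - y by rewrite /y opprB addrC subrK.
have rel : relbound Delta bDelta (gpush (@radial R k 1) U).
  rewrite [U](restr_split pos) gpushD//; apply: relboundD; last first.
    apply: relbound_in; first exact: finc_gpush.
    apply: (cin_gpush cUo rad1c) => s v ns sv; apply: radial1_core; first exact: cUo sv.
    exact: Uo_core sv.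
  rewrite -/Ui Ui_E gpushB//; last exact: finc_bdry.
  apply: relboundB.
    rewrite -(bdry_gpush fbt cbt rad1c); apply: relbound_bdry; first exact: finc_gpush.
    by apply: (cin_gpush cbt rad1c) => s v ns sv; apply: radial_std => //; exact: cbt sv.
  apply: relbound_in; first exact: finc_gpush.
  apply: (cin_gpush cy rad1c) => s v ns sv; have [sD nc] := y_core _ ns _ sv.
  exact: radial1_core.
have rad0 v : Delta v -> radial 0 v = v by move=> _; exact: radial0.
rewrite -[single _ _](subrK (gpush (@radial R k 1) U)); apply: relboundD => //.
apply: relbound_subdivide => //; first exact: simplex_boundary_sub.
- exact: bd_in_std_cell.
- exact: radial_homotopy.
- by move=> t v; exact: radial_std.
- by move=> t v t01 bv; rewrite radial_boundary.
Qed.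
End Excision.

Lemma excision (R : realType) (A : zmodType) (T : metricType R) k (phi : simplex T k)
    (Y B' : set T) : cell_in phi Y B' ->
  cell_homology A (std_simplex R k) (@simplex_boundary R k) (std_cell R k) ->
  cell_homology A Y (Y `&` B') phi.
Proof.
move=> phi_cell [van gen free].
have push n (w : simplex _ n -> A) : relbound (std_simplex R k) (@simplex_boundary R k) w ->
    relbound Y (Y `&` B') (gpush (char_bary phi) w).
  apply: relbound_gpush; [exact: simplex_boundary_sub|exact: hat_continuous| |].
    exact: (hat_Y phi_cell).
  exact: (hat_B phi_cell).
split.
- move=> n z fz Yz Bz nk; have [w [fw cw bw zw]] := excision_lift phi_cell fz Yz Bz.
  by rewrite -[z](subrK (gpush (char_bary phi) w)); apply/relboundD/push => //; exact: van.
- move=> z fz Yz Bz; have [w [fw cw bw zw]] := excision_lift phi_cell fz Yz Bz.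
  have [a /push] := gen w fw cw bw.
  rewrite gpushB ?gpush_single//; last exact: finc_single.
  rewrite hat_std_cell => wa; exists a.
  rewrite -[z in z - _](subrK (gpush (char_bary phi) w)) -addrA.
  exact: relboundD.
- by move=> a /(excision_free phi_cell)/free.
Qed.

(** * Homology of the standard simplex modulo its boundary *)

Section Contraction.
Variables (R : realType) (A : zmodType) (T : metricType R).
Implicit Types (Y : set T).

Definition const_simplex n (v : T) : simplex T n := mks (fun=> v).

Lemma const_simplexE n v p : const_simplex n v p = v.
Proof. by rewrite mksE// => q; exact: cst_continuous. Qed.

Lemma const_face n v (i : 'I_n.+2) : face i (const_simplex n.+1 v) = const_simplex n v.
Proof. by apply/continuousEP => p; rewrite /= !const_simplexE. Qed.

Lemma sum_signs m : \sum_(i < m) (-1) ^+ i = (odd m)%:R :> int.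
Proof.
elim: m => [|m IHm]; first by rewrite big_ord0.
by rewrite big_ord_recr IHm /= -signr_odd; case: (odd m).
Qed.

Lemma bd_const n v : bd (const_simplex n.+1 v) =
  if odd n then fdelta (const_simplex n v) else 0.
Proof.
rewrite /bd; under eq_bigr do rewrite const_face.
rewrite -mulrz_sumr sum_signs /= negbK.
by case: (odd n); rewrite ?mulr0z ?mulr1z.
Qed.

Lemma bdry_single n (s : simplex T n.+1) (a : A) :
  bdry (single s a) = \sum_(i < n.+2) single (face i s) (a *~ (-1) ^+ i).
Proof.
rewrite bdry_fin; last exact: finc_single.
rewrite act_single; apply/funext => t; rewrite /bd coef_sum mulrz_sumr.
transitivity (\sum_(i < n.+2) single (face i s) (a *~ (-1) ^+ i) t); last first.
  by rewrite fct_sumE.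
apply: eq_bigr => i _; rewrite coefMz fdeltaE /single.
by case: eqP => _; rewrite ?mul0rz ?mulr0z// mulrzz mul1r.
Qed.

Lemma single0 (K : eqType) (k : K) : single k (0 : A) = 0.
Proof. by apply/funext => l; rewrite /single; case: ifP. Qed.

Lemma bd_in_bdry Y n (c : simplex T n.+1 -> A) : finc c -> bd_in Y (bdry c).
Proof. by case: n c => //= n c fc; rewrite bdry_bdry//; exact: cin0. Qed.

Lemma cin_sum Y n I (r : seq I) (P : pred I) (F : I -> simplex T n -> A) :
  (forall i, P i -> cin Y (F i)) -> cin Y (\sum_(i <- r | P i) F i).
Proof.
move=> YF; elim/big_rec: _ => [|i x Pi Yx]; first exact: cin0.
by apply: cinD => //; exact: YF.
Qed.

Definition eps (c : simplex T 0 -> A) : A := act (fun=> fdelta tt) c tt.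

Lemma eps_single s a : eps (single s a) = a.
Proof. by rewrite /eps act_single fdeltaE. Qed.

Lemma epsD c e : finc c -> finc e -> eps (c + e) = eps c + eps e.
Proof. by move=> fc fe; rewrite /eps actD//; exact: admissible_fin. Qed.

Lemma eps_bdry (c : simplex T 1 -> A) : finc c -> eps (bdry c) = 0.
Proof.
move=> fc; rewrite /eps bdry_fin// act_comp_fin//.
apply: fsbig1 => s _; rewrite (_ : linext _ _ = 0) ?coef0 ?mulr0z//.
rewrite /bd linext_bigZ big_ord_recl big_ord1 !linext_delta.
by rewrite expr0 expr1 mulr1z mulrNz mulr1z subrr.
Qed.

Section Contract.
Variables (Y : set T) (v0 : T) (g : R -> T -> T).
Hypotheses (Yv0 : Y v0) (gc : homotopy_on Y g) (g0 : forall x, Y x -> g 0 x = x)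
  (g1 : forall x, Y x -> g 1 x = v0)
  (gY : forall t x, 0 <= t <= 1 -> Y x -> Y (g t x)).

Lemma contract_end n (z : simplex T n -> A) : finc z -> cin Y z ->
  exists a, gpush (g 1) (act (@subm _ _ 1 n) z) = single (const_simplex n v0) a.
Proof.
move=> fz Yz; set x := gpush _ _; exists (x (const_simplex n v0)).
apply/funext => t; rewrite /single; case: eqP => [->//|nt].
apply/eqP/negPn/negP => /gpush_neq0[s ns ts]; apply: nt; rewrite ts.
congr mks; apply/funext => p /=; apply: g1.
by apply: (cin_subm Yz ns); exists p.
Qed.

Lemma contract_subdivide n (z : simplex T n -> A) : finc z -> cin Y z ->
  match n return (simplex T n -> A) -> Prop with
  | 0 => fun=> True | m.+1 => fun z => bdry z = 0 end z ->
  exists b, [/\ finc b, cin Y b & z - gpush (g 1) (act (@subm _ _ 1 n) z) = bdry b].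
Proof.
move=> fz Yz bz; exists (act (@psi _ _ g 0 n) z); split; first exact: act_fin.
  exact: (cin_psi gc Yz Yz).
case: n z fz Yz bz => [|n] z fz Yz bz; first by rewrite (bdry_psi0 0 fz Yz gc g0).
by rewrite (bdry_psi 0 fz Yz gc g0) bz act0 subr0.
Qed.

(** The contraction reduces the cycle to a multiple of a constant simplex. According to parity, that
    simplex either bounds the next constant simplex or has a nonzero boundary, and then the multiple
    is zero. *)
Lemma contract n (z : simplex T n.+1 -> A) : finc z -> cin Y z -> bdry z = 0 ->
  exists b, [/\ finc b, cin Y b & z = bdry b].
Proof.
move=> fz Yz bz; have [b [fb Yb]] := contract_subdivide fz Yz bz.
have [a ea] := contract_end fz Yz.
have kY m : range (const_simplex m v0) `<=` Y by move=> _ [p _ <-]; rewrite const_simplexE.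
have bx : bdry (single (const_simplex n.+1 v0) a) = 0.
  rewrite -ea (bdry_gpush _ (cin_subm Yz) (homotopy_at gc _)) ?lexx ?ler01//.
    by rewrite bdry_subm// bz act0; apply: act0.
  exact: act_fin.
rewrite ea => /eqP; rewrite subr_eq => /eqP ->.
have [odn|evn] := boolP (odd n).
  suff -> : single (const_simplex n.+1 v0) a = 0 by exists b; rewrite addr0.
  have := congr1 (@^~ (const_simplex n v0)) bx.
  rewrite bdry_fin ?act_single ?bd_const ?odn; last exact: finc_single.
  rewrite fdeltaE eqxx mulr1z => ->.
  by rewrite single0.
exists (b + single (const_simplex n.+2 v0) a); split.
- by apply: fincD => //; exact: finc_single.
- by apply: cinD => //; exact: cin_single.
rewrite bdryD//; last exact: finc_single.
congr (_ + _); rewrite [RHS]bdry_fin; last exact: finc_single.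
rewrite act_single bd_const /= evn; apply/funext => t.
by rewrite fdeltaE /single; case: eqP; rewrite ?mulr1z ?mulr0z.
Qed.

Lemma contract0 (z : simplex T 0 -> A) : finc z -> cin Y z ->
  exists a b, [/\ finc b, cin Y b & z = single (const_simplex 0 v0) a + bdry b].
Proof.
move=> fz Yz; have [b [fb Yb]] := contract_subdivide fz Yz I.
have [a ->] := contract_end fz Yz => /eqP.
by rewrite subr_eq addrC => /eqP zE; exists a, b.
Qed.
End Contract.
End Contraction.

Section StarContraction.
Variables (R : realType) (k : nat).
Local Notation V := 'rV[R]_k.+1.

Definition vertex0 : V := delta_mx ord0 ord0.
Definition star (t : R) (v : V) : V := (1 - t) *: v + t *: vertex0.

Lemma star_homotopy Y : homotopy_on Y star.
Proof.
apply: continuous_subspaceT => p; apply: cvgD; apply: cvgZ.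
- by apply: cvgB; [exact: cvg_cst|exact: cvg_fst].
- exact: cvg_snd.
- exact: cvg_fst.
- exact: cvg_cst.
Qed.

Lemma star0 v : star 0 v = v.
Proof. by rewrite /star subr0 scale1r scale0r addr0. Qed.

Lemma star1 v : star 1 v = vertex0.
Proof. by rewrite /star subrr scale0r scale1r add0r. Qed.

Lemma vertex0_std : std_simplex R k vertex0.
Proof.
split=> [i|]; first by rewrite mxE ler0n.
rewrite (bigD1 ord0)//= mxE !eqxx big1 ?addr0// => i /negPf i0.
by rewrite mxE i0 andbF.
Qed.

Lemma starE t v i : star t v ord0 i = (1 - t) * v ord0 i + t * vertex0 ord0 i.
Proof. by rewrite mxE [X in X + _]mxE [X in _ + X]mxE. Qed.

Lemma star_std t v : 0 <= t <= 1 -> std_simplex R k v -> std_simplex R k (star t v).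
Proof.
move=> /andP[t0 t1] [v0 v1]; have [e0 e1] := vertex0_std; split=> [i|].
  by rewrite starE addr_ge0// mulr_ge0// subr_ge0.
under eq_bigr do rewrite starE.
by rewrite big_split /= -!mulr_sumr v1 e1 !mulr1 subrK.
Qed.

Lemma star_face t (v : V) (i : 'I_k.+1) : i != ord0 -> v ord0 i = 0 -> star t v ord0 i = 0.
Proof. by move=> /negPf i0 vi; rewrite starE vi mxE i0 andbF !mulr0 addr0. Qed.
End StarContraction.

Section StandardHomology.
Variables (R : realType) (A : zmodType).

Lemma std_homology0 :
  cell_homology A (std_simplex R 0) (@simplex_boundary R 0) (std_cell R 0).
Proof.
have pt v : std_simplex R 0 v -> v = vertex0 R 0.
  move=> [_]; rewrite big_ord1 => v0; apply/rowP => i.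
  by rewrite (ord1 i) v0 mxE !eqxx.
have nobd v : ~ @simplex_boundary R 0 v.
  by move=> [/pt -> [i]]; rewrite (ord1 i) mxE !eqxx => /eqP; rewrite oner_eq0.
have cell_const : std_cell R 0 = const_simplex 0 (vertex0 R 0).
  by apply/continuousEP => p; rewrite const_simplexE; apply: pt; exact: set_valP.
have Yv0 := @vertex0_std R 0.
have gc := @star_homotopy R 0 (std_simplex R 0).
have g0 v : std_simplex R 0 v -> star 0 v = v by rewrite star0.
have g1 v : std_simplex R 0 v -> star 1 v = vertex0 R 0 by rewrite star1.
split.
- case=> // n z fz Yz Bz _; have bz : bdry z = 0.
    apply/funext => s; apply/eqP/negPn/negP => /Bz sB.
    by have [v sv] := simplex_range_neq0 s; exact: nobd (sB _ sv).
  have [b [fb Yb ->]] := contract Yv0 gc g0 g1 (@star_std R 0) fz Yz bz.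
  exact: relbound_bdry.
- move=> z fz Yz _; have [a [b [fb Yb ->]]] := contract0 gc g0 g1 (@star_std R 0) fz Yz.
  by exists a; rewrite cell_const addrC addKr; exact: relbound_bdry.
- move=> a [b [l [fb Yb fl Bl]]] e; have l0 : l = 0.
    apply/funext => s; apply/eqP/negPn/negP => /Bl sB.
    by have [v sv] := simplex_range_neq0 s; exact: nobd (sB _ sv).
  by rewrite -(eps_single (std_cell R 0) a) e l0 addr0 eps_bdry.
Qed.

Section Step.
Variable k : nat.
Local Notation V := 'rV[R]_k.+2.
Local Notation Delta := (std_simplex R k.+1).
Local Notation bDelta := (@simplex_boundary R k.+1).
Local Notation phi := (face ord0 (std_cell R k.+1)).
Local Notation iota := (std_cell R k.+1).

(** Together with the simplex condition, these are the faces that contain [vertex0]: their union is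
    star-shaped about it and misses only the interior of the face opposite to it. *)
Definition horn : set V := [set v | exists j : 'I_k.+1, v ord0 (lift ord0 j) = 0].
Local Notation Horn := (bDelta `&` horn).

Lemma horn_closed : closed horn.
Proof.
have -> : horn = \bigcup_(j in [set: 'I_k.+1])
    ((fun v : V => v ord0 (lift ord0 j)) @^-1` [set 0]).
  by apply/seteqP; split=> v [j]; [exists j|exists j].
apply: closed_bigcup; first exact: finite_finset.
move=> j _; apply: preimage_closed; last exact: closed_eq.
by move=> v _; exact: matrix_normedtype.coord_continuous.
Qed.

Lemma face0_lift (p : std_simplex R k) j : phi p ord0 (lift ord0 j) = set_val p ord0 j.
Proof. by rewrite [phi p]/(face_row ord0 (set_val p)) mxE liftK. Qed.

Lemma face0_0 (p : std_simplex R k) : phi p ord0 ord0 = 0.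
Proof. by rewrite [phi p]/(face_row ord0 (set_val p)) mxE unlift_none. Qed.

Lemma horn_cell : cell_in phi bDelta horn.
Proof.
split.
- move=> p q _ _ pq; apply: pt_inj; apply/rowP => j.
  by rewrite -!face0_lift pq.
- exact: std_cell_face.
- exact: horn_closed.
- move=> _ [p np <-]; have [j pj] : exists j, ~ (0 < set_val p ord0 j) by apply/existsNP.
  exists j; rewrite face0_lift; apply/eqP; rewrite eq_le leNgt; apply/andP; split.
    exact/negP.
  by have [p0 _] := set_valP p; exact: p0.
- by move=> p ip [j]; rewrite face0_lift => pj; have := ip j; rewrite pj ltxx.
- move=> v [sv [i vi]]; have [hv|nh] := pselect (horn v); [by left|right].
  have vpos j : 0 < v ord0 (lift ord0 j).
    rewrite lt_neqAle; have [-> _] := sv; rewrite andbT; apply/eqP => vj.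
    by apply: nh; exists j.
  have i0 : i = ord0.
    by case: (unliftP ord0 i) vi => [j ->|//] vj; have := vpos j; rewrite vj ltxx.
  pose u : 'rV[R]_k.+1 := \row_j v ord0 (lift ord0 j).
  have su : std_simplex R k u.
    have [v0 v1] := sv; split=> [j|]; first by rewrite mxE.
    rewrite -[RHS]v1 [RHS]big_ord_recl (_ : v ord0 ord0 = 0) ?add0r; last by rewrite -vi i0.
    by apply: eq_bigr => j _; rewrite mxE.
  exists (mkpt u); first by move=> j; rewrite mkptE// mxE.
  apply/rowP => l; case: (unliftP ord0 l) => [j ->|->].
    by rewrite face0_lift mkptE// mxE.
  by rewrite face0_0 -vi i0.
Qed.

Lemma horn_vertex0 : Horn (vertex0 R k.+1).
Proof.
have z : vertex0 R k.+1 ord0 (lift ord0 ord0) = 0 by rewrite mxE.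
by split; [split; [exact: vertex0_std|exists (lift ord0 ord0)]|exists ord0].
Qed.

Lemma star_horn t v : 0 <= t <= 1 -> Horn v -> Horn (star t v).
Proof.
move=> t01 [[sv _] [j vj]].
have sj : star t v ord0 (lift ord0 j) = 0 by apply: star_face.
by split; [split; [exact: star_std|exists (lift ord0 j)]|exists j].
Qed.

Hypothesis IH : cell_homology A (std_simplex R k) (@simplex_boundary R k) (std_cell R k).
Let E := excision horn_cell IH.

(** The connecting map into the homology of the boundary modulo the horn is injective: [l] bounds
    because the horn contracts to [vertex0], and then [w] minus a chain of the boundary is a cycle
    of the contractible simplex. *)
Lemma relbound_of_bdry m (w : simplex V m.+1 -> A) : finc w -> cin Delta w ->
  relbound bDelta Horn (bdry w) -> relbound Delta bDelta w.
Proof.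
move=> fw Dw [b [l [fb Yb fl Hl e]]].
have [b' [fb' Yb' lE]] : exists b', [/\ finc b', cin bDelta b' & l = bdry b'].
  have g0 v : Horn v -> star 0 v = v by rewrite star0.
  have g1 v : Horn v -> star 1 v = vertex0 R k.+1 by rewrite star1.
  have gc := @star_homotopy R k.+1 Horn.
  have HB : Horn `<=` bDelta by move=> v [].
  case: m w b l fw Dw fb Yb fl Hl e => [|m] w b l fw Dw fb Yb fl Hl e.
    have [a [b' [fb' Hb' lE]]] := contract0 gc g0 g1 star_horn fl Hl.
    exists b'; split=> //; first exact: cin_sub Hb'.
    (* In degree 0, [l] is a difference of two boundaries, so its augmentation, which is [a], is
       zero. *)
    suff a0 : a = 0.
      by rewrite lE a0 single0 add0r.
    have := eps_bdry fw; rewrite e epsD//; last exact: finc_bdry.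
    rewrite eps_bdry// add0r lE epsD; [|exact: finc_single|exact: finc_bdry].
    by rewrite eps_single eps_bdry// addr0.
  have bl : bdry l = 0.
    have := bdry_bdry fw; rewrite e bdryD//; last exact: finc_bdry.
    by rewrite bdry_bdry// add0r.
  have [b' [fb' Hb' ->]] := contract horn_vertex0 gc g0 g1 star_horn fl Hl bl.
  by exists b'; split=> //; exact: cin_sub Hb'.
have fc : finc (b + b') by exact: fincD.
have Yc : cin bDelta (b + b') by exact: cinD.
have fz : finc (w - (b + b')) by exact: fincB.
have Dz : cin Delta (w - (b + b')).
  by apply: cinB => //; apply: cin_sub Yc; exact: simplex_boundary_sub.
have bz : bdry (w - (b + b')) = 0 by rewrite bdryB// bdryD// e lE subrr.
have g0 v : Delta v -> star 0 v = v by rewrite star0.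
have g1 v : Delta v -> star 1 v = vertex0 R k.+1 by rewrite star1.
have [c [fc' Dc wE]] := contract (@vertex0_std R k.+1) (@star_homotopy R k.+1 Delta)
  g0 g1 (@star_std R k.+1) fz Dz bz.
by exists c, (b + b'); split=> //; rewrite -wE subrK.
Qed.

Lemma bdry_iota_horn (a : A) : relbound bDelta Horn (bdry (single iota a) - single phi a).
Proof.
rewrite bdry_single big_ord_recl expr0 mulr1z addrC addKr.
have fin : finc (\sum_(i < k.+1) single (face (lift ord0 i) iota) (a *~ (-1) ^+ lift ord0 i)).
  elim/big_rec: _ => [|i x _ fx]; first exact: finc0.
  by apply: fincD => //; exact: finc_single.
apply: relbound_in => //; apply: cin_sum => i _; apply: cin_single => _ [p _ <-].
split; first by apply: std_cell_face; exists p.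
by exists i; rewrite [face _ _ p]/(face_row (lift ord0 i) (set_val p)) mxE unlift_none.
Qed.

(** The connecting map lowers the degree by one, takes [iota] to its face [phi], and lands by
    [excision] in the homology of the simplex of one dimension less. Degree 0 is apart: there every
    chain is homologous to a multiple of [vertex0], which lies in the boundary. *)
Lemma std_homology_step : cell_homology A Delta bDelta iota.
Proof.
have fi a : finc (single iota (a : A)) by exact: finc_single.
have ci (a : A) : cin Delta (single iota a) by apply: cin_single; exact: std_cell_range.
split.
- case=> [|n] z fz Dz Bz nk.
    have g0 v : Delta v -> star 0 v = v by rewrite star0.
    have g1 v : Delta v -> star 1 v = vertex0 R k.+1 by rewrite star1.
    have [a [b [fb Yb ->]]] := contract0 (@star_homotopy R k.+1 Delta) g0 g1
      (@star_std R k.+1) fz Dz.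
    apply: relboundD; last exact: relbound_bdry.
    apply: relbound_in; first exact: finc_single.
    by apply: cin_single => _ [p _ <-]; rewrite const_simplexE; case: horn_vertex0.
  apply: relbound_of_bdry => //; apply: (cellh_vanish E) => //.
  + exact: finc_bdry.
  + exact: bd_in_bdry.
  + by move=> nk'; apply: nk; rewrite nk'.
- move=> z fz Dz Bz; have [|a aP] := cellh_gen E (finc_bdry fz) Bz.
    exact: bd_in_bdry.
  exists a; apply: relbound_of_bdry; [exact: fincB|exact: cinB|].
  rewrite bdryB// -[bdry z](subrK (single phi a)) -addrA.
  rewrite -[single phi a - _]opprB.
  apply: relboundD => //; apply: relboundN; exact: bdry_iota_horn.
- move=> a [b [l [fb Yb fl Bl e]]]; apply: (cellh_free E).
  have bl : bdry (single iota a) = bdry l.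
    by rewrite e bdryD ?bdry_bdry ?add0r//; exact: finc_bdry.
  rewrite -[single phi a](subrK (bdry (single iota a))) {2}bl.
  apply: relboundD; last exact: relbound_bdry.
  rewrite -opprB; apply: relboundN; exact: bdry_iota_horn.
Qed.
End Step.

Lemma std_homology k :
  cell_homology A (std_simplex R k) (@simplex_boundary R k) (std_cell R k).
Proof. by elim: k => [|k IHk]; [exact: std_homology0|exact: std_homology_step]. Qed.
End StandardHomology.

(** * Cells and morphisms *)

Section CellGeometry.
Variables (R : realType) (X : metricType R) (C : cellular_pattern X).
Local Notation cells := {k & cell C k}.
Local Notation closed_cell := (@closed_cell R X C _).
Local Notation open_cell := (@open_cell R X C _).
Local Notation frontier := (@cell_frontier R X C _).

Definition tclosed (c : cells) : set X := closed_cell (tagged c).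

Lemma closed_cell_split k (c : cell C k) : closed_cell c = open_cell c `|` frontier c.
Proof.
apply/seteqP; split=> [_ [p _ <-]|x [[p ip <-]|[p ip <-]]]; [|by exists p..].
by have [ip|np] := pselect (std_interior p); [left; exists p|right; exists p].
Qed.

Lemma open_cell_sub k (c : cell C k) : open_cell c `<=` closed_cell c.
Proof. by rewrite closed_cell_split => x; left. Qed.

Lemma frontier_sub k (c : cell C k) : frontier c `<=` closed_cell c.
Proof. by rewrite closed_cell_split => x; right. Qed.

(* The union of the cells of dimension less than k, that is the (k-1)-skeleton. *)
Definition Sk k : set X := [set x | exists j (c : cell C j), (j < k)%N /\ closed_cell c x].

Lemma SkP k x : Sk k x <-> exists j (c : cell C j), (j < k)%N /\ open_cell c x.
Proof.
split=> [[j [c [jk]]]|[j [c [jk cx]]]]; last first.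
  by exists j, c; split=> //; exact: open_cell_sub.
rewrite closed_cell_split => -[cx|/cw_frontier[i [d [ij dx]]]]; first by exists j, c.
by exists i, d; split=> //; exact: ltn_trans jk.
Qed.

Lemma open_cell_eq k l (c : cell C k) (d : cell C l) x : open_cell c x ->
  open_cell d x -> existT (cell C) k c = existT (cell C) l d.
Proof. exact: cw_disjoint. Qed.

Lemma open_cell_inj k (c d : cell C k) x : open_cell c x -> open_cell d x -> c = d.
Proof.
move=> cx dx; have /eqP := open_cell_eq cx dx.
by rewrite -tag_eqE /tag_eq eqxx /= tagged_asE => /eqP.
Qed.

Lemma Sk_open_cell k l (c : cell C l) x : (k <= l)%N -> open_cell c x -> ~ Sk k x.
Proof.
move=> kl cx /SkP[j [d [jk dx]]]; have /(congr1 tag) /= jl := open_cell_eq dx cx.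
by move: jk; rewrite jl ltnNge kl.
Qed.

Lemma frontier_Sk k (c : cell C k) : frontier c `<=` Sk k.
Proof. by move=> x /cw_frontier[j [d [jk dx]]]; apply/SkP; exists j, d. Qed.

Lemma closed_cell_Sk k (c : cell C k) : closed_cell c `&` Sk k = frontier c.
Proof.
apply/seteqP; split=> [x [cx sx]|x fx]; last first.
  by split; [exact: frontier_sub fx|exact: frontier_Sk fx].
by move: cx; rewrite closed_cell_split => -[/(Sk_open_cell (leqnn k))|].
Qed.

Lemma closed_cell_SkS k j (c : cell C j) : (j <= k)%N -> closed_cell c `<=` Sk k.+1.
Proof. by move=> jk x cx; exists j, c. Qed.

Lemma Sk_le k k' : (k <= k')%N -> Sk k `<=` Sk k'.
Proof. by move=> kk' x [j [c [jk cx]]]; exists j, c; split=> //; exact: leq_trans kk'. Qed.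

Lemma SkSP k x : Sk k.+1 x -> Sk k x \/ exists c : cell C k, open_cell c x.
Proof.
move=> /SkP[j [c [jk cx]]]; move: jk; rewrite ltnS leq_eqVlt => /orP[/eqP jk|jk].
  by subst j; right; exists c.
by left; apply/SkP; exists j, c.
Qed.

Lemma closed_cell_disjoint k j (c : cell C j) (d : cell C k) x : (j <= k)%N ->
  closed_cell c x -> open_cell d x -> existT (cell C) j c = existT (cell C) k d.
Proof.
move=> jk; rewrite closed_cell_split => -[cx|/cw_frontier[i [e [ij ex]]]] dx.
  exact: open_cell_eq cx dx.
have /(congr1 tag) /= ik := open_cell_eq ex dx.
by move: ij; rewrite ik ltnNge jk.
Qed.

Lemma closed_cell_disjointk k (c d : cell C k) x : closed_cell c x -> open_cell d x -> c = d.
Proof.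
move=> cx dx; have /eqP := closed_cell_disjoint (leqnn k) cx dx.
by rewrite -tag_eqE /tag_eq eqxx /= tagged_asE => /eqP.
Qed.

Lemma closed_cell_compact k (c : cell C k) : compact (closed_cell c).
Proof. exact: simplex_compact. Qed.

Lemma closed_cell_closed k (c : cell C k) : closed (closed_cell c).
Proof. by apply: compact_closed; [exact: metric_hausdorff|exact: closed_cell_compact]. Qed.

Lemma std_interior_open k : open (@std_interior R k).
Proof.
rewrite openE => p ip; rewrite /interior.
have : \forall q \near p, forall i : 'I_k.+1, 0 < (set_val q : 'rV[R]_k.+1) ord0 i.
  apply: (@filter_forall _ _ (fun i q => 0 < (set_val q : 'rV[R]_k.+1) ord0 i) (nbhs p)) => i.
  have : (fun q : std_simplex R k => (set_val q : 'rV[R]_k.+1) ord0 i) @ p -->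
      (set_val p : 'rV[R]_k.+1) ord0 i.
    apply: (@cvg_comp _ _ _ (set_val : std_simplex R k -> 'rV[R]_k.+1)
      (fun v : 'rV[R]_k.+1 => v ord0 i) (nbhs p) (nbhs (set_val p)) (nbhs _)).
      exact: set_val_continuous.
    exact: matrix_normedtype.coord_continuous.
  move=> cvp; apply: (cvp [set x | 0 < x]); apply: open_nbhs_nbhs; split; last exact: ip.
  exact: open_gt.
by [].
Qed.

Lemma frontier_closed k (c : cell C k) : closed (frontier c).
Proof.
apply: compact_closed; first exact: metric_hausdorff.
apply: continuous_compact; first by apply: continuous_subspaceT; exact: cts_fun.
apply: (@subclosed_compact _ _ setT) => //; last exact: std_simplex_compact.
by apply: open_closedC; exact: std_interior_open.
Qed.

Lemma locally_finite_closed (W : cells -> set X) : (forall c, closed (W c)) ->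
  (forall c, W c `<=` tclosed c) -> closed [set x | exists c, W c x].
Proof.
move=> Wc Wsub x clx; have [U Ux Ufin] := cp_locally_finite C x.
have [r ur rP] := finite_uniq_seq Ufin.
have cr : closed (\big[setU/set0]_(c <- r) W c) by apply: closed_bigsetU => c _; exact: Wc.
apply: contrapT => nx.
have nxr : ~ (\big[setU/set0]_(c <- r) W c) x.
  by rewrite -bigcup_seq => -[c _ Wx]; apply: nx; exists c.
have Nx : nbhs x (U `&` ~` \big[setU/set0]_(c <- r) W c).
  by apply: filterI => //; apply: open_nbhs_nbhs; split=> //; exact: closed_openC.
have [y [[c cy] [Uy nr]]] := clx _ Nx.
apply: nr; rewrite -bigcup_seq; exists c => //=.
by apply/rP; exists y; split=> //; exact: Wsub.
Qed.

Lemma compact_finite_cells (K : set X) : compact K ->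
  finite_set [set c : cells | tclosed c `&` K !=set0].
Proof.
(* The filter generated by the supersets of finite sets of cells: the near-covering property then
   gives a single finite set that contains all cells meeting [K]. *)
move=> cK; pose F : set_system (set cells) :=
  [set Q | exists2 S, finite_set S & forall S', S `<=` S' -> Q S'].
have FF : Filter F.
  split; first by exists set0.
    move=> Q Q' [S fS SQ] [S' fS' SQ']; exists (S `|` S').
      by rewrite finite_setU.
    by move=> S''; rewrite subUset => -[SS SS']; split; [exact: SQ|exact: SQ'].
  by move=> Q Q' QQ' [S fS SQ]; exists S => // S' /SQ /QQ'.
have /compact_near_coveringP/(_ _ F (fun S y => forall c : cells, tclosed c y -> S c) FF) := cK.
case=> [x _|S fS /(_ S (@subset_refl _ _)) KS].
  have [U Ux Ufin] := cp_locally_finite C x.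
  exists (U, [set S | [set c : cells | tclosed c `&` U !=set0] `<=` S]).
    by split=> //=; eexists; first exact: Ufin.
  by move=> [y S] /= [Uy US] c cy; apply: US; exists y.
by apply: sub_finite_set fS => c /= [y [cy Ky]]; exact: (KS y).
Qed.

Lemma cell_union_closed (Q : cells -> Prop) : closed [set x | exists2 c, Q c & tclosed c x].
Proof.
rewrite (_ : [set x | _] = [set x | exists c, (if `[< Q c >] then tclosed c else set0) x]).
  apply: locally_finite_closed => c; case: asboolP => _ //; last exact: closed0.
  exact: closed_cell_closed.
apply/seteqP; split=> x [c]; first by move=> Qc cx; exists c; rewrite asboolT.
by case: asboolP => // Qc cx; exists c.
Qed.

Lemma closed_cell_in k (c : cell C k) : cell_in (cmap c) (closed_cell c) (frontier c).
Proof.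
split=> //.
- exact: cw_inj.
- exact: frontier_closed.
- by move=> p ip /frontier_Sk; apply: Sk_open_cell (leqnn k) _; exists p.
- by move=> x; rewrite closed_cell_split => -[]; [right|left].
Qed.

(** Closed by local finiteness. Within [Sk k.+1] this is the complement of the open cell [d], so the
    pair that defines incidence numbers has the form required by [excision]. *)
Definition other_cells k (d : cell C k) : set X :=
  [set x | exists2 c : cells, (tag c <= k)%N /\ c <> Tagged (cell C) d & tclosed c x].

Lemma skeleton_cell_in k (d : cell C k) : cell_in (cmap d) (Sk k.+1) (other_cells d).
Proof.
split.
- exact: cw_inj.
- exact: closed_cell_SkS.
- exact: cell_union_closed.
- move=> x /cw_frontier[j [e [jk ex]]]; exists (Tagged (cell C) e) => /=.
    split; first exact: ltnW.
    by move=> /(congr1 tag)/= jk'; move: jk; rewrite jk' ltnn.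
  exact: open_cell_sub.
- move=> p ip [[j e] [/= jk ne] ex]; apply: ne.
  by apply: closed_cell_disjoint ex _ => //; exists p.
- move=> x [j [e [jk ex]]]; have [ed|ned] := pselect (Tagged (cell C) e = Tagged (cell C) d).
    have jk' := congr1 tag ed; rewrite /= in jk'; subst j.
    have ed' : e = d by move/eqP : ed; rewrite -tag_eqE /tag_eq eqxx /= tagged_asE => /eqP.
    subst e; move: ex; rewrite closed_cell_split => -[|/cw_frontier[j [e [jk' ex]]]]; [by right|left].
    exists (Tagged (cell C) e); last exact: open_cell_sub.
    by split=> /=; [exact: ltnW|move=> /(congr1 tag)/= e'; move: jk'; rewrite e' ltnn].
  by left; exists (Tagged (cell C) e).
Qed.

Lemma other_cellsE k (d : cell C k) : Sk k.+1 `&` other_cells d = Sk k.+1 `\` open_cell d.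
Proof.
have [_ _ _ _ oc cov] := skeleton_cell_in d.
apply/seteqP; split=> x [sx]; first by move=> ox; split=> // -[p ip px]; apply: (oc p) => //; rewrite px.
by move=> nx; split=> //; have [|/nx] := cov x sx.
Qed.

Lemma Sk_all : exists N, Sk N = setT.
Proof.
have [N NP] := cp_dim C; exists N.+1; apply/seteqP; split=> // x _.
have [k [c cx]] := cw_cover C x; exists k, c; split; last exact: open_cell_sub.
by rewrite ltnS leqNgt; apply/negP => /NP/(_ c).
Qed.

Lemma closed_cell_homology (A : zmodType) k (c : cell C k) :
  cell_homology A (closed_cell c) (frontier c) (cmap c).
Proof.
have := excision (closed_cell_in c) (@std_homology R A k).
by rewrite setIidr//; exact: frontier_sub.
Qed.

Lemma skeleton_homology (A : zmodType) k (c : cell C k) :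
  cell_homology A (Sk k.+1) (Sk k.+1 `\` open_cell c) (cmap c).
Proof.
have := excision (skeleton_cell_in c) (@std_homology R A k).
by rewrite other_cellsE.
Qed.
End CellGeometry.

Section PartialIsometryMaps.
Variables (R : realType) (X : metricType R).
Implicit Types (f : partial_map X).

Definition fn f (x : X) : X := xget x [set y | f (x, y)].

Lemma fnP f x : pdom f x -> f (x, fn f x).
Proof. by move=> [y fxy]; rewrite /fn; case: xgetP => [_ -> //|/(_ y)]. Qed.

Lemma fn_eq f x y : isometric f -> f (x, y) -> fn f x = y.
Proof.
move=> fi fxy; apply: (isometric_fun fi _ fxy).
by apply: fnP; exists y.
Qed.

Lemma fn_continuous f : isometric f -> {within pdom f, continuous (fn f)}.
Proof.
move=> fi; apply/subspace_continuousP => x dx A /nbhs_ballP[e /= e0 eA].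
apply/nbhs_ballP; exists e => // y xy dy; apply: eA.
by move: xy; rewrite !ballEmdist /= (fi _ _ _ _ (fnP dx) (fnP dy)).
Qed.

Lemma carriesP f n (s t : simplex X n) : isometric f ->
  carries f s t <-> range s `<=` pdom f /\ t = smap (fn f) s.
Proof.
move=> fi; split=> [st|[sd ->] p].
  have sd : range s `<=` pdom f by move=> _ [p _ <-]; exists (t p).
  split=> //; apply/continuousEP => p; rewrite (smapE _ (fn_continuous fi) sd).
  by rewrite (fn_eq fi (st p)).
by rewrite (smapE _ (fn_continuous fi) sd); apply: fnP; apply: sd; exists p.
Qed.

Lemma pdom_inv f : pdom (Defs.pinv f) = prange f. Proof. by []. Qed.
Lemma isometric_inv f : isometric f -> isometric (Defs.pinv f).
Proof. by move=> fi x y x' y' /= xy xy'; rewrite (fi _ _ _ _ xy xy'). Qed.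

Lemma fn_inv f x : isometric f -> pdom f x -> fn (Defs.pinv f) (fn f x) = x.
Proof. by move=> fi dx; apply: fn_eq; [exact: isometric_inv|exact: fnP]. Qed.

Lemma fn_range f x : pdom f x -> prange f (fn f x).
Proof. by move=> dx; exists x; exact: fnP. Qed.

Lemma smap_fn_inv f n (s : simplex X n) : isometric f -> range s `<=` pdom f ->
  smap (fn (Defs.pinv f)) (smap (fn f) s) = s.
Proof.
move=> fi sd; rewrite (smap_comp _ (fn_continuous fi) sd); apply: smap_id => x sx /=.
by rewrite fn_inv//; exact: sd.
Qed.

Lemma push_single (A : zmodType) f n (s : simplex X n) (a : A) : isometric f ->
  range s `<=` pdom f -> push f (single s a) = single (smap (fn f) s) a.
Proof.
move=> fi sd; apply/funext => t; rewrite /push fsum_set (@fsum1 _ _ _ s); last first.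
  by move=> u /negPf us; rewrite /single us if_same.
rewrite /single eqxx; case: asboolP => /= [/(carriesP _ _ fi)[_ ->]|nc].
  by rewrite eqxx.
by case: eqP => // ts; case: nc; apply/(carriesP _ _ fi).
Qed.
End PartialIsometryMaps.

Section CoefficientChange.
Variables (R : realType) (T : metricType R) (A A' : zmodType) (g : {additive A -> A'}).

Lemma bdry_morph n (b : simplex T n.+1 -> A) : finc b -> bdry (g \o b) = g \o bdry b.
Proof.
move=> fb; rewrite !bdry_fin//; first by rewrite act_morph//; exact: admissible_fin.
by apply: sub_finite_set fb => s; rewrite /fsupp /=; apply: contra_neq => ->; rewrite raddf0.
Qed.

Lemma finc_morph (K : choiceType) (b : K -> A) : finc b -> finc (g \o b).
Proof. by apply: sub_finite_set => s; rewrite /fsupp /=; apply: contra_neq => ->; rewrite raddf0. Qed.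

Lemma cin_morph Y n (b : simplex T n -> A) : cin Y b -> cin Y (g \o b).
Proof. by move=> Yb s gs; apply: Yb; apply: contra_neq gs => /= ->; exact: raddf0. Qed.

Lemma relbound_morph Y B n (z : simplex T n -> A) : relbound Y B z -> relbound Y B (g \o z).
Proof.
move=> [b [l [fb Yb fl Bl ->]]]; exists (g \o b), (g \o l).
split; [exact: finc_morph|exact: cin_morph|exact: finc_morph|exact: cin_morph|].
by rewrite bdry_morph//; apply/funext => s /=; rewrite raddfD.
Qed.

Lemma single_morph (K : eqType) (k : K) a : g \o single k a = single k (g a).
Proof. by apply/funext => s /=; rewrite /single; case: eqP => // _; exact: raddf0. Qed.
End CoefficientChange.

Lemma bd_in_gpush (R : realType) (A : zmodType) (T T' : metricType R) (g : T -> T')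
    (Y B : set T) (B' : set T') n (z : simplex T n -> A) :
  B `<=` Y -> {within Y, continuous g} -> finc z -> cin Y z ->
  (forall x, B x -> B' (g x)) -> bd_in B z -> bd_in B' (gpush g z).
Proof.
move=> BY gc; case: n z => // n z fz Yz gB Bz /=.
rewrite (bdry_gpush fz Yz gc); apply: (@cin_gpush _ _ _ _ B) => //.
  exact: continuous_subspaceW gc.
by move=> s x zs sx; apply: gB; exact: Bz zs _ sx.
Qed.

Lemma singleB (A : zmodType) (K : eqType) (k : K) (a b : A) : single k (a - b) = single k a - single k b.
Proof. by apply/funext => s; rewrite /single !fctE; case: eqP => // _; rewrite subr0. Qed.

Lemma singleD (A : zmodType) (K : eqType) (k : K) (a b : A) : single k (a + b) = single k a + single k b.
Proof. by apply/funext => s; rewrite /single !fctE; case: eqP => // _; rewrite addr0. Qed.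

Lemma cellh_uniq (R : realType) (A : zmodType) (T : metricType R) (Y B : set T) k
    (phi : simplex T k) (z : simplex T k -> A) a b : cell_homology A Y B phi ->
  relbound Y B (z - single phi a) -> relbound Y B (z - single phi b) -> a = b.
Proof.
move=> H za zb; apply/eqP; rewrite -subr_eq0; apply/eqP; apply: (cellh_free H).
rewrite singleB.
have -> : single phi a - single phi b = (z - single phi b) - (z - single phi a).
  by rewrite opprB [RHS]addrC addrA subrK.
exact: relboundB.
Qed.

Section Incidence.
Variables (R : realType) (X : metricType R) (C : cellular_pattern X).
Local Notation closed_cell := (@closed_cell R X C _).
Local Notation open_cell := (@open_cell R X C _).
Local Notation frontier := (@cell_frontier R X C _).
Local Notation Sk := (Sk C).

Section Morphisms.
Variables (r : R) (r0 : 0 < r) (k : nat) (c d : cell C k) (f : partial_map X).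
Hypothesis fm : cp_mor r c d f.

Lemma mor_isometric : isometric f.
Proof. by case: (cp_isometry r0 fm). Qed.
Lemma mor_dom : pdom f = closed_cell c.
Proof. by case: (cp_isometry r0 fm). Qed.
Lemma mor_range : prange f = closed_cell d.
Proof. by case: (cp_isometry r0 fm). Qed.

Lemma mor_Sk x y j : f (x, y) -> Sk j x -> Sk j y.
Proof.
case: j => [|j]; first by move=> _ [? [? []]].
by case: (cp_isometry r0 fm) => _ _ _; apply.
Qed.

Lemma mor_fn x : closed_cell c x -> f (x, fn f x).
Proof. by rewrite -mor_dom; exact: fnP. Qed.

Lemma mor_fn_range x : closed_cell c x -> closed_cell d (fn f x).
Proof. by rewrite -mor_dom -mor_range; exact: fn_range. Qed.

Lemma mor_continuous : {within closed_cell c, continuous (fn f)}.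
Proof. by rewrite -mor_dom; apply: fn_continuous; exact: mor_isometric. Qed.

Lemma mor_dom_sub x y : f (x, y) -> closed_cell c x.
Proof. by rewrite -mor_dom => fxy; exists y. Qed.
Lemma mor_range_sub x y : f (x, y) -> closed_cell d y.
Proof. by rewrite -mor_range => fxy; exists x. Qed.
End Morphisms.

Lemma mor_SkE r (r0 : 0 < r) k (c d : cell C k) f x y j : cp_mor r c d f -> f (x, y) ->
  Sk j x <-> Sk j y.
Proof.
move=> fm fxy; split; first exact: (mor_Sk r0 fm fxy).
by apply: (mor_Sk r0 (cp_inv r0 fm)).
Qed.

Lemma mor_frontier r (r0 : 0 < r) k (c d : cell C k) f x y : cp_mor r c d f -> f (x, y) ->
  frontier c x <-> frontier d y.
Proof.
move=> fm fxy; rewrite -!closed_cell_Sk; split=> -[_ sx]; split.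
- exact: (mor_range_sub r0 fm fxy).
- exact: (mor_Sk r0 fm fxy sx).
- exact: (mor_dom_sub r0 fm fxy).
- by apply: (mor_Sk r0 (cp_inv r0 fm) _ sx).
Qed.

Lemma open_cellE k (c : cell C k) x : open_cell c x <-> closed_cell c x /\ ~ frontier c x.
Proof.
split=> [cx|[]]; last by rewrite closed_cell_split => -[].
split; first exact: open_cell_sub.
by move=> /frontier_Sk; exact: Sk_open_cell cx.
Qed.

Lemma mor_open r (r0 : 0 < r) k (c d : cell C k) f x y : cp_mor r c d f -> f (x, y) ->
  open_cell c x <-> open_cell d y.
Proof.
move=> fm fxy; rewrite !open_cellE (mor_frontier r0 fm fxy).
split=> -[cx nx]; split=> //; first exact: (mor_range_sub r0 fm fxy).
exact: (mor_dom_sub r0 fm fxy).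
Qed.

Lemma bd_in_cell (A : zmodType) k (c : cell C k) (a : A) : bd_in (frontier c) (single (cmap c) a).
Proof.
case: k c => // k c /=; rewrite bdry_single; apply: cin_sum => i _; apply: cin_single.
move=> _ [p _ <-]; exists (face_fun i p) => //= /(_ i).
by rewrite mxE unlift_none ltxx.
Qed.

(** An integer satisfying the relation over the integers exists because the characteristic map of
    [d] generates, so the selected degree satisfies it. The map sending m to [a *~ m] then carries
    the relation to [A]. *)
Lemma relbound_degree (A : zmodType) r (r0 : 0 < r) k (c d : cell C k) f (a : A) :
  cp_mor r c d f -> relbound (closed_cell d) (frontier d)
   (gpush (fn f) (single (cmap c) a) - single (cmap d) (a *~ cell_degree f c d)).
Proof.
move=> fm; have fi := mor_isometric r0 fm.
have fcc := mor_continuous r0 fm.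
have cc : cin (closed_cell c) (single (cmap c) (1 : int)) by apply: cin_single.
have Hd := @closed_cell_homology R X C int k d.
have [m mP] : exists m, relbound (closed_cell d) (frontier d)
    (gpush (fn f) (single (cmap c) (1 : int)) - single (cmap d) m).
  apply: (cellh_gen Hd).
  - by apply: finc_gpush; exact: finc_single.
  - apply: (cin_gpush cc fcc) => s x /single_neq0 -> sx.
    exact: (mor_fn_range r0 fm).
  - apply: (bd_in_gpush (@frontier_sub _ _ _ _ c) fcc _ cc _ (bd_in_cell _ _)).
      exact: finc_single.
    move=> x fx; apply/(mor_frontier r0 fm (mor_fn r0 fm (frontier_sub fx))).
    exact: fx.
have hom m' : relbound (closed_cell d) (frontier d)
    (gpush (fn f) (single (cmap c) (1 : int)) - single (cmap d) m') <->
  homologous (closed_cell d) (frontier d) (push f (unit_chain (cmap c) 1))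
     (unit_chain (cmap d) m').
  rewrite gpush_single -push_single//; last by rewrite (mor_dom r0 fm).
  split=> -[b [l [fb cb fl cl e]]]; exists b, l; split=> //.
    by rewrite -addrA -e addrC subrK.
  have {}e : push f (single (cmap c) 1) = single (cmap d) m' + bdry b + l := e.
    by rewrite e [LHS]addrC !addrA addNr add0r.
have : homologous (closed_cell d) (frontier d) (push f (unit_chain (cmap c) 1))
     (unit_chain (cmap d) (cell_degree f c d)).
  by rewrite /cell_degree; case: xgetP => [_ -> //|/(_ m)]; case; apply/hom.
move=> /hom /(relbound_morph ( *~%R a)).
rewrite !gpush_single => E.
suff <- : *~%R a \o (single (smap (fn f) (cmap c)) 1 - single (cmap d) (cell_degree f c d))
  = single (smap (fn f) (cmap c)) a - single (cmap d) (a *~ cell_degree f c d) by [].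
have -> : single (smap (fn f) (cmap c)) a = *~%R a \o single (smap (fn f) (cmap c)) 1.
  by rewrite single_morph /= mulr1z.
rewrite -(single_morph ( *~%R a)).
by apply/funext => s; rewrite /= !fctE /= mulrzBr.
Qed.

(** As for the degree: the relation holds for integers by generation and is carried to [A] by a
    change of coefficients. The sets [skeleton C k] and [Sk k.+1] agree by conversion. *)
Lemma relbound_incidence (A : zmodType) k (c : cell C k.+1) (d : cell C k) (a : A) :
  relbound (Sk k.+1) (Sk k.+1 `\` open_cell d)
    (bdry (single (cmap c) a) - single (cmap d) (a *~ incidence c d)).
Proof.
have Hd := @skeleton_homology R X C int k d.
have fS : frontier c `<=` Sk k.+1 by exact: frontier_Sk.
have [m mP] : exists m, relbound (Sk k.+1) (Sk k.+1 `\` open_cell d)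
    (bdry (single (cmap c) (1 : int)) - single (cmap d) m).
  apply: (cellh_gen Hd).
  - by apply: finc_bdry; exact: finc_single.
  - by apply: (cin_sub fS); exact: (bd_in_cell c (1 : int)).
  - case: k c d Hd fS => // k c d _ _ /=; rewrite bdry_bdry; first exact: cin0.
    exact: finc_single.
have hom m' : relbound (Sk k.+1) (Sk k.+1 `\` open_cell d)
    (bdry (single (cmap c) (1 : int)) - single (cmap d) m') <->
  homologous (skeleton C k) (skeleton C k `\` open_cell d) (bdry (unit_chain (cmap c) 1))
     (unit_chain (cmap d) m').
  split=> -[b [l [fb cb fl cl e]]]; exists b, l; split=> //.
    by rewrite -addrA -e addrC subrK.
  have {}e : bdry (single (cmap c) 1) = single (cmap d) m' + bdry b + l := e.
    by rewrite e [LHS]addrC !addrA addNr add0r.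
have : homologous (skeleton C k) (skeleton C k `\` open_cell d) (bdry (unit_chain (cmap c) 1))
     (unit_chain (cmap d) (incidence c d)).
  by rewrite /incidence; case: xgetP => [_ -> //|/(_ m)]; case; apply/hom.
move=> /hom /(relbound_morph ( *~%R a)) E.
have -> : single (cmap c) a = *~%R a \o single (cmap c) 1.
  by rewrite single_morph /= mulr1z.
rewrite bdry_morph; last exact: finc_single.
rewrite -(single_morph ( *~%R a)).
suff -> : ( *~%R a \o bdry (single (cmap c) 1)) - ( *~%R a \o single (cmap d) (incidence c d))
  = *~%R a \o (bdry (single (cmap c) 1) - single (cmap d) (incidence c d)) by [].
by apply/funext => s; rewrite /= !fctE /= mulrzBr.
Qed.
End Incidence.

(** * Tame deformations *)

Section DistanceToCompact.
Variables (R : realType) (T : metricType R).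

Lemma lipschitz1_continuous (g : T -> R) : (forall x y, g x <= g y + mdist x y) -> continuous g.
Proof.
move=> gl x; apply/cvgrPdist_lt => e e0; apply/nbhs_ballP; exists e => // y.
rewrite /= ballEmdist /= => xy; apply: le_lt_trans xy; rewrite ler_norml.
have := gl x y; have := gl y x; rewrite [mdist y x]metric_sym => h1 h2.
by apply/andP; split; [rewrite lerBrDl lerBlDr|rewrite lerBlDl].
Qed.

Lemma mdist_continuous (x : T) : continuous (mdist x).
Proof.
apply: lipschitz1_continuous => y z; rewrite [mdist y z]metric_sym.
exact: metric_triangle.
Qed.

Definition dist_to (F : set T) (x : T) : R := inf [set mdist x y | y in F].

Variable F : set T.
Hypotheses (Fc : compact F) (F0 : F !=set0).

Lemma dist_to_attained x : exists2 y, F y &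
  dist_to F x = mdist x y /\ forall w, F w -> dist_to F x <= mdist x w.
Proof.
have [|y yF yP] := compact_EVT_min F0 Fc (f := mdist x).
  by apply: continuous_subspaceT => z; exact: mdist_continuous.
have {}yF : F y by rewrite inE in yF.
have lbF : lbound [set mdist x y | y in F] (mdist x y).
  by move=> _ [w Fw <-]; apply: yP; rewrite inE.
have dE : dist_to F x = mdist x y.
  apply/eqP; rewrite eq_le; apply/andP; split.
    by apply: ge_inf; [exists (mdist x y)|exists y].
  by apply: lb_le_inf => //; exists (mdist x y), y.
by exists y => //; split=> // w Fw; rewrite dE; apply: yP; rewrite inE.
Qed.

Lemma dist_to_ge0 x : 0 <= dist_to F x.
Proof. by have [y Fy [-> _]] := dist_to_attained x; exact: mdist_ge0. Qed.

Lemma dist_to_le x y : F y -> dist_to F x <= mdist x y.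
Proof. by have [z Fz [_]] := dist_to_attained x; exact. Qed.

Lemma dist_to_continuous : continuous (dist_to F).
Proof.
apply: lipschitz1_continuous => x y; have [w Fw [-> _]] := dist_to_attained y.
apply: le_trans (dist_to_le x Fw) _; rewrite addrC; exact: metric_triangle.
Qed.

Lemma dist_to0 x : F x -> dist_to F x = 0.
Proof.
move=> Fx; apply/eqP; rewrite eq_le dist_to_ge0 andbT -(mdistxx x).
exact: dist_to_le.
Qed.

Lemma dist_to_eq0 x : dist_to F x = 0 -> F x.
Proof.
by have [y Fy [-> _]] := dist_to_attained x => /mdist_positivity ->.
Qed.
End DistanceToCompact.

Section Cutoff.
Variables (R : realType) (e : R).
Hypothesis e0 : 0 < e.

(** Equal to 1 up to [e] and to 0 from [2 * e] on. Applied to the distance to the frontier, it slows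
    down a deformation in a way that the isometries of the cell respect. *)
Definition cutoff (d : R) : R := Num.min 1 (Num.max 0 (2 - d / e)).

Lemma cutoff01 d : 0 <= cutoff d <= 1.
Proof. by rewrite /cutoff le_min ler01 le_max lexx ge_min lexx. Qed.

Lemma cutoff1 d : d <= e -> cutoff d = 1.
Proof.
move=> de; have : 1 <= 2 - d / e.
  by rewrite lerBrDl -lerBrDr (_ : 2 - 1 = 1)// ?ler_pdivrMr ?mul1r// -[2]/(1 + 1) addrK.
by move=> h; rewrite /cutoff max_r ?min_l// (le_trans ler01).
Qed.

Lemma cutoff0 d : 2 * e <= d -> cutoff d = 0.
Proof.
by move=> de; rewrite /cutoff max_l ?min_r// subr_le0 ler_pdivlMr.
Qed.

Lemma cutoff_continuous : continuous cutoff.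
Proof.
rewrite (_ : cutoff = cst 1 \min (cst 0 \max (fun d => 2 - d / e))) => [d|]; last exact/funext.
apply: continuous_min; first exact: cst_continuous.
apply: continuous_max; first exact: cst_continuous.
apply: continuousB; first exact: cst_continuous.
by apply: continuousM => //; exact: cst_continuous.
Qed.
End Cutoff.

Section TameDeformation.
Variables (R : realType) (X : metricType R) (C : cellular_pattern X).
Local Notation closed_cell := (@closed_cell R X C _).
Local Notation open_cell := (@open_cell R X C _).
Local Notation frontier := (@cell_frontier R X C _).

(** The whole closed cell is deformed, and [K] is a compact core outside which the deformation ends
    in the frontier. [S] is a set of symmetries that commute with it and preserve the core. *)
Record cell_deformation k (c : cell C k) (S : set (partial_map X)) (h : R -> X -> X)
    (K : set X) := CellDeformation {
  cdef_continuous : homotopy_on (closed_cell c) h ;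
  cdef_compact : compact K ;
  cdef_open : K `<=` open_cell c ;
  cdef_stable : forall t x, 0 <= t <= 1 -> closed_cell c x -> closed_cell c (h t x) ;
  cdef_start : forall x, closed_cell c x -> h 0 x = x ;
  cdef_frontier : forall t x, 0 <= t <= 1 -> frontier c x -> h t x = x ;
  cdef_end : forall x, closed_cell c x -> ~ K x -> frontier c (h 1 x) ;
  cdef_map : forall f t x y, S f -> 0 <= t <= 1 -> f (x, y) -> f (h t x, h t y) ;
  cdef_core : forall f x y, S f -> f (x, y) -> K x -> K y }.

Lemma frontier_compact k (c : cell C k) : compact (frontier c).
Proof.
apply: (subclosed_compact _ (@closed_cell_compact _ _ _ _ c)); last exact: frontier_sub.
exact: frontier_closed.
Qed.

Lemma frontier_neq0 k (c : cell C k.+1) : frontier c !=set0.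
Proof.
have [p _] := simplex_range_neq0 (face ord0 (cmap c)).
exists (cmap c (face_fun ord0 (center R k))); exists (face_fun ord0 (center R k)) => //=.
by move=> /(_ ord0); rewrite mxE unlift_none ltxx.
Qed.

Lemma dist_to_mor r (r0 : 0 < r) k (c d : cell C k.+1) f x y : cp_mor r c d f -> f (x, y) ->
  dist_to (frontier c) x = dist_to (frontier d) y.
Proof.
move=> fm fxy; suff le (c' d' : cell C k.+1) f' x' y' : cp_mor r c' d' f' -> f' (x', y') ->
    dist_to (frontier d') y' <= dist_to (frontier c') x'.
  apply/eqP; rewrite eq_le (le _ _ _ _ _ fm fxy) andbT.
  by apply: (le _ _ _ _ _ (cp_inv r0 fm)).
move=> {fxy}fm {}fxy; have [w cw [-> _]] := dist_to_attained
  (@frontier_compact _ c') (@frontier_neq0 _ c') x'.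
have fw := mor_fn r0 fm (frontier_sub cw).
rewrite (mor_isometric r0 fm fxy fw); apply: dist_to_le.
- exact: frontier_compact.
- exact: frontier_neq0.
- by apply/(mor_frontier r0 fm fw).
Qed.

(** Tameness moves only a collar [U]. Its time is multiplied by a cutoff of the distance to the
    frontier, so that the motion stops within [U] and extends by the identity; symmetries of the
    cell preserve that distance. A 0-cell has no frontier: it stays at rest and is its own core. *)
Lemma tame_deformation r (r0 : 0 < r) k (c : cell C k) :
  exists h K, cell_deformation c (cp_mor r c c) h K.
Proof.
case: k c => [|k] c.
  have f0 : frontier c = set0.
    by apply/seteqP; split=> // x /frontier_Sk [j [? []]].
  exists (@still R X), (closed_cell c); split=> //.
  - apply: continuous_subspaceW (@still_homotopy R X).
    by move=> p [].
  - exact: closed_cell_compact.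
  - by move=> x; rewrite closed_cell_split f0 setU0.
  - by move=> f x y fm /(mor_range_sub r0 fm).
have cF := @frontier_compact k.+1 c; have nF := @frontier_neq0 k c.
have [U [F [cU Uc [W [oW FW WU]] Fc [FU Ffr F0 F1 Feq]]]] := cp_tame r0 c (ltn0Sn k).
pose dl := dist_to (frontier c).
have dlc : continuous dl by exact: dist_to_continuous.
have [e e0 eW] : exists2 e, 0 < e & forall x, closed_cell c x -> dl x <= 2 * e -> U x.
  pose Q := closed_cell c `\` W.
  have cQ : compact Q.
    apply: (subclosed_compact _ (@closed_cell_compact _ _ _ _ c)) => [|x []//].
    by rewrite /Q setDE; apply: closedI; [exact: closed_cell_closed|exact: open_closedC].
  have [Q0|Q0] := pselect (Q !=set0); last first.
    exists 1 => // x cx _; apply: WU; split=> //; apply: contrapT => nW.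
    by apply: Q0; exists x.
  have [|y + yP] := compact_EVT_min Q0 cQ (f := dl).
    by apply: continuous_subspaceT => z; exact: dlc.
  rewrite inE => -[cy nWy].
  have dy : 0 < dl y.
    rewrite lt_neqAle dist_to_ge0// andbT; apply/eqP => /esym/(dist_to_eq0 cF nF) /FW.
    exact: nWy.
  (* A quarter of the least distance to the frontier outside [W]: points at distance at most [2 * e]
     are then in [W], hence in [U]. *)
  exists (dl y / 4) => [|x cx]; first by rewrite divr_gt0.
  move=> dx; apply: WU; split=> //; apply: contrapT => nW.
  have : dl y <= dl x by apply: yP; rewrite inE; split.
  move=> /le_trans/(_ dx); apply/negP; rewrite -ltNge mulrA mulrAC.
  by rewrite gtr_pMl// ltr_pdivrMr// mul1r ltr_nat.
pose h t x := if `[< U x >] then F (t * cutoff e (dl x)) x else x.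
have cut01 t x : 0 <= t <= 1 -> 0 <= t * cutoff e (dl x) <= 1.
  move=> /andP[t0 t1]; have /andP[l0 l1] := cutoff01 e (dl x).
  by rewrite mulr_ge0//= mulr_ile1.
have FrU x : frontier c x -> U x.
  by move=> fx; apply: WU; split; [exact: FW|exact: frontier_sub].
have h_far t x : closed_cell c x -> 2 * e <= dl x -> h t x = x.
  by move=> cx dx; rewrite /h cutoff0// mulr0; case: asboolP => // /F0.
exists h, (closed_cell c `&` [set x | e <= dl x]); split.
- have sub : (`[0, 1]%classic : set R) `*` closed_cell c `<=`
      (`[0, 1] `*` (closed_cell c `&` [set x | dl x <= 2 * e])) `|`
      (`[0, 1] `*` (closed_cell c `&` [set x | 2 * e <= dl x])).
    move=> [t x] [/= t01 cx]; have [dx|/ltW dx] := leP (dl x) (2 * e); [left|right];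
    by split.
  have clc : closed (closed_cell c) by exact: closed_cell_closed.
  apply: (continuous_subspaceW sub); apply: withinU_continuous.
  - apply: closed_rectangle; first exact: interval_closed.
    apply: closedI => //; apply: (@preimage_closed _ _ dl [set x | x <= 2 * e]).
      by move=> x _; exact: dlc.
    exact: closed_le.
  - apply: closed_rectangle; first exact: interval_closed.
    apply: closedI => //; apply: (@preimage_closed _ _ dl [set x | 2 * e <= x]).
      by move=> x _; exact: dlc.
    exact: closed_ge.
  - pose q (p : R * X) := (p.1 * cutoff e (dl p.2), p.2).
    have qc : continuous q.
      move=> p; apply: (@cvg_pair _ _ _ _ (nbhs _) (nbhs _)); last exact: cvg_snd.
      apply: (@continuousM _ _ fst (fun p : R * X => cutoff e (dl p.2))).
        exact: cvg_fst.
      apply: (@continuous_comp _ _ _ snd (cutoff e \o dl)); first exact: cvg_snd.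
      by apply: continuous_comp; [exact: dlc|exact: cutoff_continuous].
    have fqc : {within `[0, 1] `*` (closed_cell c `&` [set x | dl x <= 2 * e]),
        continuous ((fun p : R * X => F p.1 p.2) \o q)}.
      apply: within_continuous_comp Fc; first exact: continuous_subspaceT.
      move=> [t x] [/= t01 [cx dx]]; split=> /=; last exact: eW.
      by move: t01; rewrite !in_itv /=; exact: cut01.
    apply: subspace_eq_continuous fqc => -[t x]; rewrite inE => -[/= t01 [cx dx]].
    by rewrite /from_subspace /= /h asboolT//; exact: eW.
  - have sc : {within `[0, 1] `*` (closed_cell c `&` [set x | 2 * e <= dl x]),
        continuous (snd : R * X -> X)}.
      by apply: continuous_subspaceT => p; exact: cvg_snd.
    apply: subspace_eq_continuous sc => -[t x]; rewrite inE => -[/= t01 [cx dx]].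
    by rewrite /from_subspace /= h_far.
- apply: (subclosed_compact _ (@closed_cell_compact _ _ _ _ c)) => [|x []//].
  apply: closedI; first exact: closed_cell_closed.
  apply: (@preimage_closed _ _ dl [set x | e <= x]); last exact: closed_ge.
  by move=> x _; exact: dlc.
- move=> x [cx dx]; apply/open_cellE; split=> // fx.
  by move: dx; rewrite /= /dl dist_to0// leNgt e0.
- move=> t x t01 cx; rewrite /h; case: asboolP => // Ux; apply: Uc.
  by apply: FU => //; exact: cut01.
- by move=> x cx; rewrite /h mul0r; case: asboolP => // /F0.
- by move=> t x t01 fx; rewrite /h asboolT; [apply: Ffr => //; exact: cut01|exact: FrU].
- move=> x cx nK; have dx : dl x <= e.
    by rewrite leNgt; apply/negP => /ltW dx; apply: nK.
  have Ux : U x by apply: eW => //; rewrite (le_trans dx)// mulr_natl mulr2n lerDl ltW.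
  by rewrite /h asboolT// cutoff1// mulr1; exact: F1.
- move=> f t x y fm t01 fxy; have dxy : dl x = dl y by exact: dist_to_mor fm fxy.
  rewrite /h; case: asboolP => Ux.
    have [Uy fF] := Feq f _ _ _ fm (cut01 t x t01) fxy Ux.
    by rewrite asboolT// -dxy.
  (* Membership of [y] in [U] passes back to [x] by the tameness clause for the inverse morphism, at
     time 0. *)
  rewrite asboolF// => Uy; apply: Ux.
  by have [] := Feq _ 0 _ _ (cp_inv r0 fm) _ fxy Uy; rewrite ?lexx ?ler01.
- move=> f x y fm fxy [cx dx]; split; first exact: (mor_range_sub r0 fm fxy).
  by rewrite /= -(_ : dl x = dl y)//; exact: dist_to_mor fm fxy.
Qed.

(* A deformation is chosen for one representative of each class of isometric cells and carried
   to the others by morphisms; tameness makes the result independent of the morphisms. *)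
Lemma equivariant_deformation r (r0 : 0 < r) k :
  exists (h : cell C k -> R -> X -> X) (K : cell C k -> set X),
    (forall c, cell_deformation c set0 (h c) (K c)) /\
    forall c d f t x y, cp_mor r c d f -> f (x, y) -> 0 <= t <= 1 ->
      f (h c t x, h d t y) /\ (K c x <-> K d y).
Proof.
pose rep (c : cell C k) : cell C k := xget c [set d | exists f, cp_mor r d c f].
have repP c : exists f, cp_mor r (rep c) c f.
  by rewrite /rep; case: xgetP => [d _ //|/(_ c)]; case; eexists; exact: cp_id.
have rep_eq c d f : cp_mor r c d f -> rep c = rep d.
  move=> fm; rewrite /rep (_ : [set _ | _] = [set e | exists f, cp_mor r e d f]).
    (* The two sets of candidates are equal but the defaults [c] and [d] differ, so it must be seen
       that the common set is nonempty. *)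
    rewrite /xget; case: pselect => // -[]; exists c; apply/asboolP.
    by exists f.
  apply/seteqP; split=> [e [g gm]|e [g gm]]; eexists; first exact: cp_comp gm fm.
  by apply: cp_comp gm (cp_inv r0 fm).
have [g gP] := choice repP.
have [h0 h0P] := choice (fun c => @tame_deformation r r0 k c).
have [K0 hK] := choice h0P.
pose h c t y := fn (g c) (h0 (rep c) t (fn (Defs.pinv (g c)) y)).
pose K c := fn (g c) @` K0 (rep c).
have fng c x y : g c (x, y) -> fn (g c) x = y.
  by apply: fn_eq; exact: mor_isometric (gP c).
have fnv c x y : g c (x, y) -> fn (Defs.pinv (g c)) y = x.
  by move=> gxy; apply: fn_eq => //; apply: isometric_inv; exact: mor_isometric (gP c).
have preim c y : closed_cell c y -> exists2 x, closed_cell (rep c) x & g c (x, y).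
  rewrite -(mor_range r0 (gP c)) => -[x gxy]; exists x => //.
  exact: (mor_dom_sub r0 (gP c) gxy).
have hE c t x y : g c (x, y) -> 0 <= t <= 1 -> g c (h0 (rep c) t x, h c t y).
  move=> gxy t01; rewrite /h (fnv _ _ _ gxy); apply: (mor_fn r0 (gP c)).
  apply: (cdef_stable (hK (rep c))) => //; exact: (mor_dom_sub r0 (gP c) gxy).
have KE c x y : g c (x, y) -> K c y <-> K0 (rep c) x.
  move=> gxy; split=> [[x' Kx' e]|Kx]; last by exists x => //; exact: fng.
  suff -> : x = x' by [].
  apply: (isometric_inj (mor_isometric r0 (gP c)) gxy); rewrite -e.
  by apply: (mor_fn r0 (gP c)); apply: open_cell_sub; exact: (cdef_open (hK (rep c))).
have t0 : 0 <= (0 : R) <= 1 by rewrite lexx ler01.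
have t1 : 0 <= (1 : R) <= 1 by rewrite lexx ler01.
exists h, K; split=> [c|c d f t x y fm fxy t01].
  split=> //.
  - have c1 : {within `[0, 1] `*` closed_cell c,
        continuous (fun p : R * X => (p.1, fn (Defs.pinv (g c)) p.2))}.
      have ic : {within closed_cell c, continuous (fn (Defs.pinv (g c)))}.
        by have := mor_continuous r0 (cp_inv r0 (gP c)).
      have ic2 : {within `[0, 1] `*` closed_cell c,
          continuous (fn (Defs.pinv (g c)) \o snd : R * X -> X)}.
        apply: within_continuous_comp ic; last by move=> [t v] [].
        by apply: continuous_subspaceT => p; exact: cvg_snd.
      apply/subspace_continuousP => p Sp.
      apply: (@cvg_pair _ _ _ _ (nbhs _) (nbhs _)).
        by apply: cvg_within_filter; exact: cvg_fst.
      by move/subspace_continuousP : ic2; exact.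
    have c2 : {within `[0, 1] `*` closed_cell c,
        continuous ((fun p : R * X => h0 (rep c) p.1 p.2) \o
          (fun p : R * X => (p.1, fn (Defs.pinv (g c)) p.2)))}.
      apply: within_continuous_comp (cdef_continuous (hK (rep c))); first exact: c1.
      move=> [t y] [/= t01 /preim[x cx gxy]]; split=> //=.
      by rewrite (fnv _ _ _ gxy).
    apply: (within_continuous_comp c2) (mor_continuous r0 (gP c)).
    move=> [t y] [/= t01 /preim[x cx gxy]]; rewrite (fnv _ _ _ gxy).
    by apply: (cdef_stable (hK (rep c))).
  - apply: continuous_compact; last exact: (cdef_compact (hK (rep c))).
    apply: continuous_subspaceW (mor_continuous r0 (gP c)).
    by move=> x /(cdef_open (hK (rep c))); exact: open_cell_sub.
  - move=> _ [x /(cdef_open (hK (rep c))) ox <-].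
    apply/(mor_open r0 (gP c)); last exact: ox.
    by apply: (mor_fn r0 (gP c)); exact: open_cell_sub.
  - by move=> t y t01 /preim[x cx /hE/(_ t01)]; exact: (mor_range_sub r0 (gP c)).
  - move=> y /preim[x cx gxy]; have := hE _ _ _ _ gxy t0.
    rewrite (cdef_start (hK (rep c)))// => gh.
    exact: (isometric_fun (mor_isometric r0 (gP c)) gh gxy).
  - move=> t y t01 fy; have [x cx gxy] := preim _ _ (frontier_sub fy).
    have := hE _ _ _ _ gxy t01; rewrite (cdef_frontier (hK (rep c)))//.
      by move=> gh; exact: (isometric_fun (mor_isometric r0 (gP c)) gh gxy).
    exact/(mor_frontier r0 (gP c) gxy).
  - move=> y /preim[x cx gxy] nK; have gh := hE _ _ _ _ gxy t1.
    apply/(mor_frontier r0 (gP c) gh); apply: (cdef_end (hK (rep c))) => // Kx.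
    by apply: nK; apply/(KE _ _ _ gxy).
have [x' cx' gx] := preim _ _ (mor_dom_sub r0 fm fxy).
have [y' cy' gy] := preim _ _ (mor_range_sub r0 fm fxy).
have re := rep_eq _ _ _ fm.
have gdm : cp_mor r (rep c) d (g d) by rewrite re.
(* Carried back to the representative, [f] becomes one of its symmetries, with which the chosen
   deformation commutes. *)
have em : cp_mor r (rep c) (rep c) (Defs.pcomp (Defs.pinv (g d)) (Defs.pcomp f (g c))).
  by apply: cp_comp (cp_inv r0 gdm) => //; apply: cp_comp fm => //; exact: gP.
have exy : Defs.pcomp (Defs.pinv (g d)) (Defs.pcomp f (g c)) (x', y').
  by exists y; split=> //; exists x.
have hx := hE _ _ _ _ gx t01; have hy := hE _ _ _ _ gy t01.
have [z [[z' [/= gz fz]] /= gz']] := cdef_map (hK (rep c)) em t01 exy.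
split.
  rewrite (isometric_fun (mor_isometric r0 (gP c)) hx gz).
  by rewrite -re in hy; rewrite (isometric_fun (mor_isometric r0 (gP d)) hy gz').
rewrite (KE _ _ _ gx) (KE _ _ _ gy) -re; split=> [|Ky].
  exact: (cdef_core (hK (rep c)) em exy).
by apply: (cdef_core (hK (rep c)) (cp_inv r0 em) exy).
Qed.
End TameDeformation.

(** * Settling chains in cells *)

Lemma coef_linext (K K' : choiceType) (F : K -> fch K') x t :
  coef (linext F x) t = linext (fun k => coef (F k) t) x.
Proof. exact: (linext_morph (@coef_at K' t)). Qed.

Section SettlingOperator.
Variables (R : realType) (T : metricType R) (H : R -> T -> T) (small : set T -> Prop).

Definition good_level n (x : fch (simplex T n)) m :=
  allc (fun t : simplex T n => small (range t)) (linext (@subm R T m.+1 n) x).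
(** The value depends on [x] only through the set of its good levels. Isometric chains have the same
    good levels and therefore receive the same level. *)
Definition level n (x : fch (simplex T n)) : nat := xget 0%N [set m | good_level x m].
Definition settle n (x : fch (simplex T n)) : fch (simplex T n.+1) :=
  linext (@psi R T H (level x) n) x.

(* On the faces of s the operator is already defined; [tail s] is the
   correction of s that they impose, and s is settled together with it. *)
Fixpoint sop n : simplex T n -> fch (simplex T n.+1) :=
  match n return simplex T n -> fch (simplex T n.+1) with
  | 0 => fun s => settle (fdelta s)
  | m.+1 => fun s => settle (fdelta s - linext (@sop m) (bd s))
  end.

Definition sop_bd n : simplex T n -> fch (simplex T n) :=
  match n return simplex T n -> fch (simplex T n) with
  | 0 => fun=> 0
  | m.+1 => fun s => linext (@sop m) (bd s)
  end.

Definition tail n (s : simplex T n) : fch (simplex T n) := fdelta s - sop_bd s.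
(** The identity minus both composites of [sop] with the boundary, hence a chain map homotopic to
    the identity. *)
Definition rho n (s : simplex T n) : fch (simplex T n) := tail s - lbdry (sop s).

Lemma sopE n (s : simplex T n) : sop s = settle (tail s).
Proof. by case: n s => // s; rewrite /tail /= subr0. Qed.

(** Since the boundary squares to zero, the boundary of a corrected simplex is made of faces that
    have already been settled; this is the purpose of the correction. *)
Lemma linext_rho_bd n (s : simplex T n.+1) : lbdry (tail s) = linext (@rho n) (bd s).
Proof.
rewrite /tail /rho !linextfB raddfB /= lbdry_delta linext_id.
have -> : linext (@sop_bd n) (bd s) = 0.
  case: n s => [|n] s; first exact: linext0.
  by rewrite /= -linext_linext -/(lbdry (bd s)) lbdry_bd raddf0.
by rewrite subr0 /lbdry !linext_linext.
Qed.

Variable Y : set T.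
Hypotheses (H_cont : homotopy_on Y H) (H_start : forall x, Y x -> H 0 x = x).
Definition stable (Z : set T) := forall t x, 0 <= t <= 1 -> Z x -> Z (H t x).

Lemma settle_range Z n (x : fch (simplex T n)) : stable Z -> allc (inside Y (n:=n)) x ->
  allc (inside Z (n:=n)) x -> allc (inside Z (n:=n.+1)) (settle x).
Proof.
move=> HZ xY xZ; apply: (@allc_linext _ _ (fun k => coef x k != 0)) => // t xt.
apply: (@psi_range _ _ Y H (level x) _ t Z H_cont (xY _ xt) (xZ _ xt)) => u v u01 tv.
by apply: HZ => //; exact: xZ xt _ tv.
Qed.

Lemma allc_bd Z n (s : simplex T n.+1) : range s `<=` Z -> allc (inside Z (n:=n)) (bd s).
Proof. by move=> sZ; apply: allc_sub (@bd_range _ _ _ s) => t ts; exact: subset_trans sZ. Qed.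

Hypothesis Y_stable : stable Y.

Lemma sop_range Z n (s : simplex T n) : stable Z -> range s `<=` Y ->
  range s `<=` Z -> allc (inside Z (n:=n.+1)) (sop s).
Proof.
elim: n s Z => [|n IHn] s Z HZ sY sZ.
  rewrite sopE /tail /= subr0.
  by apply: settle_range => //; apply: allc_delta.
rewrite sopE; have tl W : stable W -> range s `<=` W -> allc (inside W (n:=n.+1)) (tail s).
  move=> HW sW; apply: allcB; first exact: allc_delta.
  apply: allc_linext (@bd_range _ _ _ s) _ => t ts.
  by apply: IHn => //; apply: subset_trans ts _.
by apply: settle_range; [|exact: tl..].
Qed.

Lemma sop_bd_range Z n (s : simplex T n) : stable Z -> range s `<=` Y ->
  range s `<=` Z -> allc (inside Z (n:=n)) (sop_bd s).
Proof.
case: n s => [|n] s HZ sY sZ; first exact: allc0.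
apply: allc_linext (@bd_range _ _ _ s) _ => t ts.
by apply: sop_range => //; apply: subset_trans ts _.
Qed.

Lemma tail_range Z n (s : simplex T n) : stable Z -> range s `<=` Y ->
  range s `<=` Z -> allc (inside Z (n:=n)) (tail s).
Proof.
move=> HZ sY sZ; apply: allcB; first exact: allc_delta.
exact: sop_bd_range.
Qed.

Lemma rho_range Z n (s : simplex T n) : stable Z -> range s `<=` Y ->
  range s `<=` Z -> allc (inside Z (n:=n)) (rho s).
Proof.
move=> HZ sY sZ; apply: allcB; first exact: tail_range.
apply: allc_linext (sop_range HZ sY sZ) _ => t tZ.
exact: allc_bd.
Qed.

Variable settled : set T -> Prop.
Hypotheses
  (small_sub : forall U V : set T, U `<=` V -> small V -> small U)
  (settled_sub : forall U V : set T, U `<=` V -> settled V -> settled U)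
  (small_near : forall n (s : simplex T n) (p : std_simplex R n), range s `<=` Y ->
     exists2 U, nbhs p U & small (s @` U))
  (small_settled : forall U, U `<=` Y -> small U -> settled (H 1 @` U))
  (settled_stable : forall U, U `<=` Y -> settled U ->
     exists Z, [/\ settled Z, U `<=` Z & stable Z]).

Lemma level_good n (x : fch (simplex T n)) : allc (inside Y (n:=n)) x ->
  good_level x (level x).
Proof.
move=> xY; have [m mP] : exists m, good_level x m.
  have [m0 m0P] := @subm_small_chain R int T n (coef x) small (coef_finite x) small_sub
    (fun s p xs => @small_near n s p (xY _ xs)).
  by exists m0; apply: (@allc_linext _ _ (fun k => coef x k != 0)) => // t; exact: m0P.
by rewrite /level; case: xgetP => [_ -> //|/(_ m)].
Qed.

Lemma lbdry_settle n (x : fch (simplex T n.+1)) : allc (inside Y (n:=n.+1)) x ->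
  lbdry (settle x) = x - lsmap (H 1) (linext (@subm R T (level x).+1 n.+1) x)
    - linext (@psi R T H (level x) n) (lbdry x).
Proof.
move=> xY; rewrite /settle /lbdry linext_linext.
rewrite (linext_eq (g := fun s => fdelta s - lsmap (H 1) (subm (level x).+1 s) -
    linext (@psi R T H (level x) n) (bd s))); last first.
  by move=> s xs; apply: psi_bdry H_cont (xY _ xs) H_start.
by rewrite !linextfB linext_id /lsmap /fmap !linext_linext.
Qed.

Lemma lbdry_settle0 (x : fch (simplex T 0)) : allc (inside Y (n:=0)) x ->
  lbdry (settle x) = x - lsmap (H 1) (linext (@subm R T (level x).+1 0) x).
Proof.
move=> xY; rewrite /settle /lbdry linext_linext.
rewrite (linext_eq (g := fun s => fdelta s - lsmap (H 1) (subm (level x).+1 s))); last first.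
  by move=> s xs; apply: psi_bdry0 H_cont (xY _ xs) H_start.
by rewrite linextfB linext_id /lsmap /fmap !linext_linext.
Qed.

(** Settling [tail s] leaves two terms: its fine subdivision moved by [H 1], settled because it was
    small, and [psi] of its boundary. That boundary is [rho] of the faces, settled by induction, and
    [psi] keeps it in a stable settled set. *)
Lemma rho_settled n (s : simplex T n) : range s `<=` Y ->
  allc (fun t : simplex T n => settled (range t)) (rho s).
Proof.
have H1c : {within Y, continuous (H 1)} by apply: homotopy_at => //; rewrite ler01 lexx.
have first m (x : fch (simplex T m)) : allc (inside Y (n:=m)) x ->
    allc (fun t : simplex T m => settled (range t))
      (lsmap (H 1) (linext (@subm R T (level x).+1 m) x)).
  move=> xY; have xsY : allc (inside Y (n:=m)) (linext (@subm R T (level x).+1 m) x).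
    apply: allc_linext xY _ => u uY; apply: allc_sub (@subm_range _ _ _ _ u) => t tu.
    exact: subset_trans uY.
  apply: (@allc_linext _ _ (fun t => inside Y t /\ small (range t))).
    by move=> t xt; split; [exact: xsY|exact: level_good xt].
  move=> t [tY tsm]; apply: allc_delta; rewrite (smap_range H1c tY).
  exact: small_settled.
elim: n s => [|n IHn] s sY; have tY := tail_range Y_stable sY sY.
  rewrite /rho sopE lbdry_settle0// opprB addrC subrK; exact: first.
have subBB (M : zmodType) (a b c : M) : a - (a - b - c) = b + c.
  by rewrite -addrA -opprD opprB addrC subrK.
rewrite /rho sopE lbdry_settle// linext_rho_bd subBB.
apply: allcD; first exact: first.
apply: (@allc_linext _ _ (fun t : simplex T n => settled (range t) /\ range t `<=` Y)).
  apply: allc_linext (@bd_range _ _ _ s) _ => u us.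
  have uY : range u `<=` Y by apply: subset_trans us _.
  by move=> t ut; split; [exact: IHn ut|exact: (rho_range Y_stable uY uY ut)].
move=> t [st tY']; have [Z [sZ tZ HZ]] := settled_stable tY' st.
have := psi_range (m := level (tail s)) H_cont tY' tZ (fun u x u01 tx => HZ u x u01 (tZ x tx)).
by apply: allc_sub => v vZ; exact: settled_sub sZ.
Qed.
End SettlingOperator.

Section SettlingNaturality.
Variables (R : realType) (T : metricType R) (H : R -> T -> T) (small : set T -> Prop).
Variables (Y : set T) (g : T -> T).
Hypotheses (H_cont : homotopy_on Y H)
  (Y_stable : stable H Y)
  (g_cont : {within Y, continuous g})
  (g_inj : forall x y, Y x -> Y y -> g x = g y -> x = y)
  (g_H : forall t x, 0 <= t <= 1 -> Y x -> g (H t x) = H t (g x))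
  (g_small : forall U, U `<=` Y -> small U <-> small (g @` U)).

Lemma hsimp_smap h n m (s : simplex T n) (w : 'M[R]_(m.+1, n.+1 + 1)) : homotopy_on Y h ->
  (forall t x, 0 <= t <= 1 -> Y x -> g (h t x) = h t (g x)) ->
  prism_points w -> range s `<=` Y -> hsimp h (smap g s) w = smap g (hsimp h s w).
Proof.
move=> hc gh wP sY; rewrite /smap /hsimp; congr mks; apply/funext => p /=.
rewrite [in RHS]mksE; last exact: hsimp_continuous hc sY wP.
rewrite -/(smap g s) (smapE _ g_cont sY) gh//; last by apply: sY; eexists.
by have [] := prism_point_mul (set_valP p) wP.
Qed.

Lemma Theta_smap h n (s : simplex T n) : homotopy_on Y h ->
  (forall t x, 0 <= t <= 1 -> Y x -> g (h t x) = h t (g x)) ->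
  range s `<=` Y -> Theta h (smap g s) = lsmap g (Theta h s).
Proof.
move=> hc gh sY; rewrite /Theta /lsmap /fmap linext_linext; apply: linext_eq => w wP.
by rewrite linext_delta (hsimp_smap hc gh)//; exact: prism_support wP.
Qed.

Lemma linext_smap n m (D : forall s : simplex T n, fch (simplex T m)) (x : fch (simplex T n)) :
  (forall s : simplex T n, range s `<=` Y -> D (smap g s) = lsmap g (D s)) ->
  allc (inside Y (n:=n)) x -> linext D (lsmap g x) = lsmap g (linext D x).
Proof.
move=> Dg xY; rewrite /lsmap /fmap !linext_linext; apply: linext_eq => s xs.
by rewrite linext_delta Dg//; exact: xY.
Qed.

Lemma psi_smap m n (s : simplex T n) : range s `<=` Y ->
  psi H m (smap g s) = lsmap g (psi H m s).
Proof.
move=> sY; have subY j : allc (inside Y (n:=n)) (subm j s).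
  by apply: allc_sub (@subm_range _ _ _ _ s) => t ts; exact: subset_trans sY.
rewrite /psi raddfD raddf_sum /=; congr (_ + _).
  apply: eq_bigr => j _; rewrite (subm_smap _ g_cont sY); apply: linext_smap => // u uY.
  by apply: (@Theta_smap (@still R T)) => //; apply: continuous_subspaceW (@still_homotopy R T) => -[? ?] [].
by rewrite (subm_smap _ g_cont sY); apply: linext_smap => // u uY; exact: Theta_smap.
Qed.

Lemma smap_inj n (s t : simplex T n) : range s `<=` Y -> range t `<=` Y ->
  smap g s = smap g t -> s = t.
Proof.
move=> sY tY st; apply/continuousEP => p; apply: g_inj; [by apply: sY; exists p|by apply: tY; exists p|].
by rewrite -(smapE p g_cont sY) st (smapE p g_cont tY).
Qed.

Lemma coef_lsmap n (x : fch (simplex T n)) (s : simplex T n) : allc (inside Y (n:=n)) x -> range s `<=` Y ->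
  coef (lsmap g x) (smap g s) = coef x s.
Proof.
move=> xY sY; rewrite /lsmap /fmap.
rewrite coef_linext -[in RHS](linext_id x) coef_linext; apply: linext_eq => u xu.
rewrite !fdeltaE; congr (nat_of_bool _)%:R; apply/eqP/eqP => [|->//].
by move/esym => e; apply/esym; apply: smap_inj e => //; exact: xY.
Qed.

Lemma allc_lsmap n (x : fch (simplex T n)) (Q : simplex T n -> Prop) :
  allc (inside Y (n:=n)) x -> allc Q (lsmap g x) <-> allc (fun s => Q (smap g s)) x.
Proof.
move=> xY; split=> Qx; first by move=> s xs; apply: Qx; rewrite coef_lsmap//; exact: xY.
by apply: allc_linext Qx _ => s Qs; exact: allc_delta.
Qed.

(** [g] is injective on [Y] and respects smallness in both directions, so a chain and its image have
    the same good levels. This makes the whole inductive construction natural. *)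
Lemma level_smap n (x : fch (simplex T n)) : allc (inside Y (n:=n)) x ->
  level small (lsmap g x) = level small x.
Proof.
move=> xY; rewrite /level; congr xget; apply/seteqP.
have sY m : allc (inside Y (n:=n)) (linext (@subm R T m.+1 n) x).
  apply: allc_linext xY _ => u uY; apply: allc_sub (@subm_range _ _ _ _ u) => t tu.
  exact: subset_trans uY.
have E m : good_level small (lsmap g x) m <-> good_level small x m.
  rewrite /good_level linext_smap//; last by move=> s sY'; exact: subm_smap g_cont sY'.
  rewrite (allc_lsmap _ (sY m)); split=> h s xs; have := h s xs; rewrite (smap_range g_cont (sY m s xs));
  by move/(g_small (sY m s xs)).
by split=> m /=; rewrite E.
Qed.

Lemma settle_smap n (x : fch (simplex T n)) : allc (inside Y (n:=n)) x ->
  settle H small (lsmap g x) = lsmap g (settle H small x).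
Proof.
move=> xY; rewrite /settle level_smap//; apply: linext_smap => // s sY.
exact: psi_smap.
Qed.

Lemma bd_smap n (s : simplex T n.+1) : range s `<=` Y -> bd (smap g s) = lsmap g (bd s).
Proof.
move=> sY; rewrite /bd raddf_sum; apply: eq_bigr => i _.
by rewrite raddfMz /= lsmap_delta (smap_face i g_cont sY).
Qed.

Lemma sop_smap n (s : simplex T n) : range s `<=` Y ->
  sop H small (smap g s) = lsmap g (sop H small s).
Proof.
elim: n s => [|n IHn] s sY.
  by rewrite /= -lsmap_delta settle_smap//; exact: allc_delta.
have tY := tail_range H_cont Y_stable Y_stable sY sY.
rewrite !sopE -settle_smap//; congr settle.
rewrite /tail raddfB /= lsmap_delta (bd_smap sY); congr (_ - _).
by apply: linext_smap => //; exact: allc_bd.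
Qed.
End SettlingNaturality.

(** * The deformation of a skeleton and its naturality *)

Section GlobalDeformation.
Variables (R : realType) (X : metricType R) (C : cellular_pattern X) (k : nat).
Variables (h : cell C k -> R -> X -> X) (K : cell C k -> set X).
Local Notation closed_cell := (@closed_cell R X C _).
Local Notation open_cell := (@open_cell R X C _).
Local Notation Sk := (Sk C).
Local Notation cells := {j & cell C j}.
Hypothesis hK : forall c, cell_deformation c set0 (h c) (K c).

(** Points outside the open k-cells stay fixed, in agreement with the cell deformations on the
    frontiers. The map is only used on [Sk k.+1]. *)
Definition glob (t : R) (x : X) : X :=
  if pselect (exists c : cell C k, open_cell c x) is left e then h (sval (cid e)) t x else x.

Lemma glob_open c t x : open_cell c x -> glob t x = h c t x.
Proof.
move=> cx; rewrite /glob; case: pselect => [e|[]]; last by exists c.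
by rewrite (open_cell_inj (svalP (cid e)) cx).
Qed.

Lemma glob_Sk t x : Sk k x -> glob t x = x.
Proof.
move=> sx; rewrite /glob; case: pselect => // e; case: (Sk_open_cell (leqnn k) (svalP (cid e))).
by [].
Qed.

Lemma glob_closed c t x : 0 <= t <= 1 -> closed_cell c x -> glob t x = h c t x.
Proof.
move=> t01; rewrite closed_cell_split => -[|fx]; first exact: glob_open.
by rewrite glob_Sk ?(cdef_frontier (hK c))//; exact: frontier_Sk fx.
Qed.

Lemma glob0 x : glob 0 x = x.
Proof.
rewrite /glob; case: pselect => // e; apply: (cdef_start (hK _)).
by apply: open_cell_sub; case: cid.
Qed.

Definition kcore : set X := [set x | exists c, K c x].

Lemma kcore_closed : closed kcore.
Proof.
pose W (d : cells) := [set x | exists2 c, d = Tagged (cell C) c & K c x].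
rewrite (_ : kcore = [set x | exists d, W d x]); last first.
  apply/seteqP; split=> [x [c Kx]|x [_ [c _ Kx]]]; last by exists c.
  by exists (Tagged (cell C) c), c.
apply: locally_finite_closed => [d|d x [c -> /(cdef_open (hK c))]]; last exact: open_cell_sub.
have [[c ->]|nd] := pselect (exists c : cell C k, d = Tagged (cell C) c).
  rewrite (_ : W _ = K c).
    apply: compact_closed; first exact: metric_hausdorff.
    exact: (cdef_compact (hK c)).
  apply/seteqP; split=> [x [c' /eqP]|x Kx]; last by exists c.
  by rewrite -tag_eqE /tag_eq eqxx /= tagged_asE => /eqP ->.
rewrite (_ : W _ = set0); first exact: closed0.
by apply/seteqP; split=> // x [c dc _]; apply: nd; exists c.
Qed.

(** A simplex with image [S] is settled within this set: it is stable under [glob], and it is a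
    finite union of closed cells when [S] is compact. *)
Definition cstar (S : set X) : set X :=
  [set x | exists2 c : cells, (tag c <= k)%N /\ tclosed c `&` S !=set0 & tclosed c x].

Lemma cstar_Sk S : cstar S `<=` Sk k.+1.
Proof. by move=> x [[j c] /= [jk _] cx]; exists j, c. Qed.

Lemma cstar_sub S : S `<=` Sk k.+1 -> S `<=` cstar S.
Proof.
move=> SS x Sx; have [j [c [jk cx]]] := SS _ Sx.
by exists (Tagged (cell C) c) => //; split=> //; exists x.
Qed.

Local Notation stable := (stable glob).

Lemma Sk_stable : stable (Sk k).
Proof. by move=> t x _ sx; rewrite glob_Sk. Qed.

Lemma closed_cell_stable (c : cell C k) : stable (closed_cell c).
Proof. by move=> t x t01 cx; rewrite (glob_closed t01 cx); exact: (cdef_stable (hK c)). Qed.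

Lemma lower_cell_stable j (c : cell C j) : (j <= k)%N -> stable (closed_cell c).
Proof.
rewrite leq_eqVlt => /orP[/eqP jk|jk]; first by subst j; exact: closed_cell_stable.
by move=> t x t01 cx; rewrite glob_Sk//; exists j, c.
Qed.

Lemma cstar_stable S : stable (cstar S).
Proof.
move=> t x t01 [[j c] /= [jk cS] cx]; exists (existT _ j c) => //.
exact: lower_cell_stable.
Qed.

Lemma lower_cell_homotopy j (c : cell C j) : (j <= k)%N -> homotopy_on (closed_cell c) glob.
Proof.
rewrite leq_eqVlt => /orP[/eqP jk|jk].
  subst j; apply: subspace_eq_continuous (cdef_continuous (hK c)) => -[t x].
  rewrite inE => -[/= t01 cx]; rewrite /from_subspace /= (glob_closed _ cx)//.
have sc : {within `[0, 1] `*` closed_cell c, continuous (snd : R * X -> X)}.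
  by apply: continuous_subspaceT => p; exact: cvg_snd.
apply: subspace_eq_continuous sc => -[t x]; rewrite inE => -[/= t01 cx].
by rewrite /from_subspace /= glob_Sk//; exists j, c.
Qed.

(** Compactness leaves finitely many closed cells, on which the continuous pieces of [glob] are
    pasted one after the other. *)
Lemma cstar_homotopy S : compact S -> homotopy_on (cstar S) glob.
Proof.
move=> cS; have [r _ rP] := finite_uniq_seq (compact_finite_cells C cS).
pose W (l : seq cells) : set X := [set x | exists2 c, (tag c <= k)%N /\ c \in l & tclosed c x].
have Wh l : closed (W l) /\ homotopy_on (W l) glob.
  elim: l => [|c l [cl IHl]].
    rewrite (_ : W [::] = set0); last by apply/seteqP; split=> // x [c []].
    split; first exact: closed0.
    have := @still_homotopy R X; rewrite /homotopy_on => _.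
    rewrite (_ : _ `*` set0 = set0); last by apply/seteqP; split=> // -[t x] [].
    by apply/subspace_continuousP.
  have [ck|nck] := boolP (tag c <= k)%N; last first.
    suff -> : W (c :: l) = W l by [].
    apply/seteqP; split=> [x [d [dk]]|x [d [dk dl] dx]]; last first.
      by exists d => //; rewrite inE dl orbT.
    rewrite inE => /orP[/eqP dc|dl] dx; last by exists d.
    by move: nck; rewrite -dc dk.
  have -> : W (c :: l) = tclosed c `|` W l.
    apply/seteqP; split=> [x [d [dk]]|x [cx|[d [dk dl] dx]]].
    - by rewrite inE => /orP[/eqP ->|dl] dx; [left|right; exists d].
    - by exists c => //; rewrite mem_head.
    - by exists d => //; rewrite inE dl orbT.
  split; first by apply: closedU => //; exact: closed_cell_closed.
  rewrite /homotopy_on (_ : _ `*` (_ `|` _) =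
      ((`[0, 1]%classic : set R) `*` tclosed c) `|` (`[0, 1] `*` W l)); last first.
    by apply/seteqP; split=> [[t x] [/= t01 [cx|lx]]|[t x] [[/= t01 cx]|[/= t01 lx]]];
      [left|right|split=> //; left|split=> //; right].
  apply: withinU_continuous => //.
  - by apply: closed_rectangle; [exact: interval_closed|exact: closed_cell_closed].
  - by apply: closed_rectangle => //; exact: interval_closed.
  - by case: c ck => j c /= jk; exact: lower_cell_homotopy.
apply: continuous_subspaceW (Wh r).2 => -[t x] [/= t01 [c [ck cS'] cx]].
by split=> //; exists c => //; split=> //; apply/rP.
Qed.

(** The open k-cells and the complement of [kcore] cover [Sk k.+1] by relatively open sets. The
    former are deformed within their closures; the latter ends in [Sk k] at time 1. *)
Definition csmall (U : set X) :=
  (exists c : cell C k, U `<=` open_cell c) \/ forall x, U x -> ~ kcore x.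
Definition csettled (U : set X) := U `<=` Sk k \/ exists c : cell C k, U `<=` closed_cell c.

Lemma csmall_sub (U V : set X) : U `<=` V -> csmall V -> csmall U.
Proof.
move=> UV [[c Vc]|nV]; [left; exists c; exact: subset_trans Vc|right => x /UV; exact: nV].
Qed.

Lemma csettled_sub (U V : set X) : U `<=` V -> csettled V -> csettled U.
Proof.
move=> UV [Vs|[c Vc]]; [left|right; exists c]; exact: subset_trans UV _.
Qed.

Lemma csmall_near n (s : simplex X n) (p : std_simplex R n) : range s `<=` Sk k.+1 ->
  exists2 U, nbhs p U & csmall (s @` U).
Proof.
move=> sS; have sc : continuous s by exact: cts_fun.
have near (W : set X) : closed W -> ~ W (s p) -> nbhs p (s @^-1` ~` W).
  move=> cW nW; apply: sc; apply: open_nbhs_nbhs; split=> //.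
  exact: closed_openC.
have [|sp|[c cp]] := @SkSP _ _ C k (s p); first by apply: sS; exists p.
  exists (s @^-1` ~` kcore); last by right => _ [q nq <-].
  apply: near; first exact: kcore_closed.
  by move=> [c /(cdef_open (hK c)) /(Sk_open_cell (leqnn k))]; apply.
have [_ _ ocl _ oint ocov] := skeleton_cell_in c.
exists (s @^-1` ~` other_cells c).
  by apply: near => //; move: cp => [q iq <-]; exact: oint.
left; exists c => _ [q nq <-]; have [|/nq//|//] := ocov (s q).
by apply: sS; exists q.
Qed.

Lemma csmall_settled U : U `<=` Sk k.+1 -> csmall U -> csettled (glob 1 @` U).
Proof.
have t1 : 0 <= (1 : R) <= 1 by rewrite lexx ler01.
move=> US [[c Uc]|nU].
  right; exists c => _ [x Ux <-]; apply: closed_cell_stable => //.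
  by apply: open_cell_sub; exact: Uc.
left => _ [x Ux <-]; have [sx|[c cx]] := SkSP (US _ Ux); first by rewrite glob_Sk.
rewrite (glob_open _ cx); apply: (@frontier_Sk _ _ _ _ c); apply: (cdef_end (hK c)).
  exact: open_cell_sub.
by move=> Kx; apply: (nU x Ux); exists c.
Qed.

Lemma csettled_stable U : csettled U -> exists Z, [/\ csettled Z, U `<=` Z & stable Z].
Proof.
move=> [Us|[c Uc]]; first by exists (Sk k); split=> //; [left|exact: Sk_stable].
by exists (closed_cell c); split=> //; [right; exists c|exact: closed_cell_stable].
Qed.

Section Naturality.
Variables (r : R) (r0 : 0 < r).
Hypothesis h_mor : forall (c d : cell C k) f t x y, cp_mor r c d f -> f (x, y) -> 0 <= t <= 1 ->
  f (h c t x, h d t y) /\ (K c x <-> K d y).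
Variables (F : partial_map X) (Y : set X).

(** What naturality asks of an isometry [F] of the pattern: on the cells around [Y] it is a morphism
    of the cellular pattern. *)
Definition cellwise (F : partial_map X) (Y : set X) := forall x j (c : cell C j), Y x ->
  closed_cell c x -> exists d, cp_mor r c d (prestrict F (closed_cell c)).

Hypotheses (F_iso : isometric F) (F_Y : cellwise F Y) (Y_Sk : Y `<=` Sk k.+1).

Lemma cellwise_fn j (c d : cell C j) x : cp_mor r c d (prestrict F (closed_cell c)) ->
  closed_cell c x -> F (x, fn F x).
Proof.
move=> fm cx; have [_ fd _ _] := cp_isometry r0 fm.
have : pdom (prestrict F (closed_cell c)) x by rewrite fd.
by move=> [y [Fxy _]]; apply: fnP; exists y.
Qed.

Lemma cellwise_dom : Y `<=` pdom F.
Proof.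
move=> x Yx; have [j [c [_ cx]]] := Y_Sk Yx; have [d fm] := F_Y Yx cx.
by exists (fn F x); exact: cellwise_fn fm cx.
Qed.

Lemma cellwise_Sk j x : Y x -> Sk j x <-> Sk j (fn F x).
Proof.
move=> Yx; have [i [c [_ cx]]] := Y_Sk Yx; have [d fm] := F_Y Yx cx.
have fxy : prestrict F (closed_cell c) (x, fn F x) by split=> //; exact: cellwise_fn fm cx.
exact: (@mor_SkE _ _ _ r r0 _ c d _ _ _ j fm fxy).
Qed.

Lemma cellwise_cell x : Y x -> Sk k x \/ exists (c d : cell C k) f,
  [/\ open_cell c x, open_cell d (fn F x), cp_mor r c d f & f = prestrict F (closed_cell c)].
Proof.
move=> Yx; have [sx|[c cx]] := SkSP (Y_Sk Yx); [by left|right].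
have [d fm] := F_Y Yx (open_cell_sub cx).
exists c, d, (prestrict F (closed_cell c)); split=> //.
apply/(mor_open r0 fm); last exact: cx.
by split; [exact: cellwise_fn fm (open_cell_sub cx)|exact: open_cell_sub].
Qed.

Lemma cellwise_glob t x : 0 <= t <= 1 -> Y x -> fn F (glob t x) = glob t (fn F x).
Proof.
move=> t01 Yx; have [sx|[c [d [f [cx dx fm fE]]]]] := cellwise_cell Yx.
  by rewrite !glob_Sk//; exact/(cellwise_Sk k Yx).
rewrite (glob_open _ cx) (glob_open _ dx); apply: fn_eq => //.
have fxy : f (x, fn F x).
  by rewrite fE; split; [apply: (@cellwise_fn _ c d); rewrite -?fE//; exact: open_cell_sub|exact: open_cell_sub].
by have [+ _] := h_mor fm fxy t01; rewrite fE => -[].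
Qed.

Lemma cellwise_kcore x : Y x -> kcore x <-> kcore (fn F x).
Proof.
move=> Yx; have [sx|[c [d [f [cx dx fm fE]]]]] := cellwise_cell Yx.
  split=> -[c /(cdef_open (hK c))/(Sk_open_cell (leqnn k)) nS]; first by case: nS.
  by case: nS; apply/(cellwise_Sk k Yx).
have fxy : f (x, fn F x).
  by rewrite fE; split; [apply: (@cellwise_fn _ c d); rewrite -?fE//; exact: open_cell_sub|exact: open_cell_sub].
have [_ KE] := @h_mor _ _ _ 0 _ _ fm fxy (@andb_true_intro _ _ (conj (lexx 0) ler01)).
split=> -[c' Kc'].
  by exists d; apply/KE; rewrite (open_cell_inj cx (cdef_open (hK c') Kc')).
by exists c; apply/KE; rewrite (open_cell_inj dx (cdef_open (hK c') Kc')).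
Qed.

Lemma cellwise_small U : U `<=` Y -> csmall U <-> csmall (fn F @` U).
Proof.
move=> UY; split=> [[[c Uc]|nU]|[[d Ud]|nU]].
- have [[x Ux]|U0] := pselect (U !=set0); last first.
    by right => y [z Uz _]; case: U0; exists z.
  left; have [d fm] := F_Y (UY _ Ux) (open_cell_sub (Uc _ Ux)).
  exists d => _ [y /Uc cy <-]; apply/(mor_open r0 fm); last exact: cy.
  by split; [exact: cellwise_fn fm (open_cell_sub cy)|exact: open_cell_sub].
- by right => _ [x Ux <-] /(cellwise_kcore (UY _ Ux)); exact: nU.
(* Each point of [U] lies in some open k-cell. It is the same cell for all points, because the
   morphism on one of these cells is onto [d] and [F] is injective. *)
- have pre x : U x -> exists (c : cell C k) f, [/\ open_cell c x, cp_mor r c d f & f = prestrict F (closed_cell c)].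
    move=> Ux; have dx : open_cell d (fn F x) by apply: Ud; exists x.
    have [sx|[c [d' [f [cx dx' fm fE]]]]] := cellwise_cell (UY _ Ux).
      by case: (Sk_open_cell (leqnn k) dx); apply/(cellwise_Sk k (UY _ Ux)).
    by exists c, f; rewrite (open_cell_inj dx dx').
  have [[x Ux]|U0] := pselect (U !=set0); last first.
    by right => z Uz; case: U0; exists z.
  have [c [f [cx fm fE]]] := pre _ Ux.
  left; exists c => y Uy; have [c' [f' [cy fm' fE']]] := pre _ Uy.
  have : closed_cell d (fn F y) by apply: open_cell_sub; apply: Ud; exists y.
  rewrite -(mor_range r0 fm) fE => -[z [/= Fz cz]].
  have Fy : F (y, fn F y).
    by apply: (@cellwise_fn _ c' d); rewrite -?fE'//; exact: open_cell_sub.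
  have zy := isometric_inj F_iso Fz Fy.
  by move: cz; rewrite zy => cy'; rewrite (closed_cell_disjointk cy' cy).
- by right => x Ux /(cellwise_kcore (UY _ Ux)); apply: nU; exists x.
Qed.
End Naturality.
End GlobalDeformation.

(* [D] is a homotopy from the identity to [rho], which takes chains in the k-skeleton to chains
   of simplices each of which lies in a closed k-cell or in the (k-1)-skeleton. *)
Record settling (R : realType) (X : metricType R) (C : cellular_pattern X) (r : R) k
    (D : forall n, simplex X n -> fch (simplex X n.+1))
    (rho : forall n, simplex X n -> fch (simplex X n)) := Settling {
  settling_rho0 : forall s : simplex X 0, rho 0%N s = fdelta s - lbdry (D 0%N s) ;
  settling_rhoS : forall n (s : simplex X n.+1),
    rho n.+1 s = fdelta s - linext (D n) (bd s) - lbdry (D n.+1 s) ;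
  settling_star : forall n (s : simplex X n), range s `<=` Sk C k.+1 ->
    allc (inside (cstar C k (range s)) (n:=n.+1)) (D n s) ;
  settling_Sk : forall n (s : simplex X n), range s `<=` Sk C k ->
    allc (inside (Sk C k) (n:=n.+1)) (D n s) ;
  settling_settled : forall n (s : simplex X n), range s `<=` Sk C k.+1 ->
    allc (fun t : simplex X n => csettled C k (range t)) (rho n s) ;
  settling_map : forall n (s : simplex X n) F, range s `<=` Sk C k.+1 -> isometric F ->
    cellwise C r F (cstar C k (range s)) -> D n (smap (fn F) s) = lsmap (fn F) (D n s) }.

Lemma settling_exists (R : realType) (X : metricType R) (C : cellular_pattern X) (r : R) k :
  0 < r -> exists D rho, settling C r k D rho.
Proof.
move=> r0; have [h [K [hK h_mor]]] := @equivariant_deformation R X C r r0 k.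
exists (fun n => @sop R X (glob h) (csmall K) n), (fun n => @rho R X (glob h) (csmall K) n).
have st n (s : simplex X n) : range s `<=` Sk C k.+1 -> range s `<=` cstar C k (range s).
  exact: cstar_sub.
have hm n (s : simplex X n) : homotopy_on (cstar C k (range s)) (glob h).
  by apply: cstar_homotopy => //; exact: simplex_compact.
have stb n (s : simplex X n) := @cstar_stable _ _ _ _ _ _ hK (range s).
split.
- by move=> s; rewrite /rho /tail /= subr0.
- by [].
- by move=> n s sS; apply: (sop_range (hm n s)) => //; exact: st.
- move=> n s sS; have sS' : range s `<=` Sk C k.+1 by apply: subset_trans sS _; exact: Sk_le.
  apply: (sop_range (hm n s)) => //; [exact: Sk_stable|exact: st].
- move=> n s sS; apply: (rho_settled (hm n s)); last exact: st.
  + by move=> x _; exact: glob0.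
  + exact: stb.
  + exact: csmall_sub.
  + exact: csettled_sub.
  + by move=> m t p tY; apply: csmall_near => //; apply: subset_trans tY (@cstar_Sk _ _ _ _ _).
  + by move=> U UY; apply: csmall_settled => //; apply: subset_trans UY (@cstar_Sk _ _ _ _ _).
  + by move=> U _; exact: csettled_stable.
- move=> n s F sS Fi FY; have dom := cellwise_dom r0 FY (@cstar_Sk _ _ _ _ _).
  apply: (sop_smap (hm n s) (stb n s)); last exact: st.
  + by apply: continuous_subspaceW dom _; exact: fn_continuous.
  + move=> x y Yx Yy e; have Fx := fnP (dom _ Yx); have Fy := fnP (dom _ Yy).
    by rewrite -e in Fy; exact: isometric_inj Fx Fy.
  + by move=> t x; exact: (cellwise_glob r0 h_mor Fi FY (@cstar_Sk _ _ _ _ _)).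
  + by move=> U; exact: (cellwise_small hK r0 h_mor Fi FY (@cstar_Sk _ _ _ _ _)).
Qed.

(** * Locally finite and equivariant chains *)

Section LocallyFiniteChains.
Variables (R : realType) (X : metricType R) (C : cellular_pattern X).
Local Notation cells := {j & cell C j}.

Definition gstar (S : set X) : set X :=
  [set x | exists2 c : cells, tclosed c `&` S !=set0 & tclosed c x].

Lemma gstar_sub S : S `<=` gstar S.
Proof.
move=> x Sx; have [k [c cx]] := cw_cover C x; have cx' := open_cell_sub cx.
by exists (existT _ k c) => //; exists x.
Qed.

Lemma cstar_gstar k S : cstar C k S `<=` gstar S.
Proof. by move=> x [c [_ cS] cx]; exists c. Qed.

Lemma gstar_compact S : compact S -> compact (gstar S).
Proof.
move=> cS; have [r _ rP] := finite_uniq_seq (compact_finite_cells C cS).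
rewrite (_ : gstar S = \big[setU/set0]_(c <- r) tclosed c).
  by apply: bigsetU_compact => c _; exact: closed_cell_compact.
rewrite -bigcup_seq; apply/seteqP; split=> x [c cS' cx]; exists c => //.
  exact/rP.
exact/rP.
Qed.

(** Lying in cells that meet a set is symmetric in the two sets: a simplex near [S] reaches [K] only
    if [S] meets the star of [K]. Through this, local finiteness passes from a chain to its
    image. *)
Lemma gstar_meet (S T K : set X) : T `<=` gstar S -> T `&` K !=set0 -> S `&` gstar K !=set0.
Proof.
move=> TS [x [/TS[c [y [cy Sy]] cx] Kx]]; exists y; split=> //.
by exists c => //; exists x.
Qed.

Variable A : zmodType.

Definition local_on n m (D : simplex X n -> fch (simplex X m)) (c : simplex X n -> A) :=
  forall s, c s != 0 -> allc (inside (gstar (range s)) (n:=m)) (D s).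

Lemma lf_admissible n m (D : simplex X n -> fch (simplex X m)) (c : simplex X n -> A) :
  locally_finite c -> local_on D c -> admissible D c.
Proof.
move=> fc Dc t; apply: sub_finite_set (fc _ (gstar_compact (@simplex_compact _ _ _ t))).
move=> s [/= cs st]; split=> //; apply: (gstar_meet (Dc _ cs _ st)).
by rewrite setIid; exact: simplex_range_neq0.
Qed.

Lemma lf_act n m (D : simplex X n -> fch (simplex X m)) (c : simplex X n -> A) :
  locally_finite c -> local_on D c -> locally_finite (act D c).
Proof.
move=> fc Dc K cK; apply: (@sub_finite_set _ _ (\bigcup_(s in [set s | c s != 0 /\
    range s `&` gstar K !=set0]) [set t | coef (D s) t != 0])).
  move=> t [/= /act_neq0[s cs st] tK]; exists s => //; split=> //.
  exact: gstar_meet (Dc _ cs _ st) tK.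
apply: bigcup_finite => [|s _]; last exact: coef_finite.
by apply: fc; exact: gstar_compact.
Qed.

(** Whatever the intermediate simplex, a simplex that contributes at [u] meets the star of the star
    of the image of [u], which is compact. *)
Lemma lf_act_comp n m l (D : simplex X n -> fch (simplex X m))
    (E : simplex X m -> fch (simplex X l)) (c : simplex X n -> A) :
  locally_finite c -> local_on D c ->
  (forall s t, c s != 0 -> coef (D s) t != 0 -> allc (inside (gstar (range t)) (n:=l)) (E t)) ->
  act E (act D c) = act (fun s => linext E (D s)) c.
Proof.
move=> fc Dc Ec; apply: act_comp; last exact: lf_admissible.
move=> u; have cu := gstar_compact (gstar_compact (@simplex_compact _ _ _ u)).
apply: sub_finite_set (fc _ cu) => s [/= cs [t st tu]]; split=> //.
apply: (gstar_meet (Dc _ cs _ st)); apply: (gstar_meet (Ec _ _ cs st _ tu)).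
by rewrite setIid; exact: simplex_range_neq0.
Qed.

Lemma local_bd n (c : simplex X n.+1 -> A) : local_on (@bd _ _ n) c.
Proof.
by move=> s _; apply: allc_sub (@bd_range _ _ _ s) => t ts; exact: subset_trans ts (@gstar_sub _).
Qed.

Lemma bdry_lf n (c : simplex X n.+1 -> A) : locally_finite c -> bdry c = act (@bd _ _ n) c.
Proof.
move=> fc; apply: bdry_act => t.
apply: sub_finite_set (fc _ (@simplex_compact _ _ _ t)) => s [/= cs [i st]]; split=> //.
have [x tx] := simplex_range_neq0 t; exists x; split=> //.
by move: tx; rewrite -st; exact: face_range.
Qed.

Lemma lf_bdry n (c : simplex X n.+1 -> A) : locally_finite c -> locally_finite (bdry c).
Proof. by move=> fc; rewrite bdry_lf//; apply: lf_act => //; exact: local_bd. Qed.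

Lemma lfD n (c e : simplex X n -> A) : locally_finite c -> locally_finite e ->
  locally_finite (c + e).
Proof.
move=> fc fe K cK; apply: (@sub_finite_set _ _ ([set s | c s != 0 /\ range s `&` K !=set0] `|`
   [set s | e s != 0 /\ range s `&` K !=set0])).
  move=> s [/= nz sK]; have [cs|cs] := eqVneq (c s) 0; last by left.
  by right; split=> //; move: nz; rewrite [X in X != 0](_ : _ = c s + e s)// cs add0r.
by rewrite finite_setU; split; [exact: fc|exact: fe].
Qed.

Lemma lfN n (c : simplex X n -> A) : locally_finite c -> locally_finite (- c).
Proof.
move=> fc K cK; apply: sub_finite_set (fc K cK) => s [/= nz sK]; split=> //.
by move: nz; rewrite [X in X != 0](_ : _ = - c s)// oppr_eq0.
Qed.

Lemma lfB n (c e : simplex X n -> A) : locally_finite c -> locally_finite e ->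
  locally_finite (c - e).
Proof. by move=> fc fe; apply: lfD => //; exact: lfN. Qed.

Lemma lf_finc n (c : simplex X n -> A) : finc c -> locally_finite c.
Proof. by move=> fc K _; apply: sub_finite_set fc => s []. Qed.

Lemma bdry_lfD n (c e : simplex X n.+1 -> A) : locally_finite c -> locally_finite e ->
  bdry (c + e) = bdry c + bdry e.
Proof.
move=> fc fe; rewrite !bdry_lf//; last exact: lfD.
by apply: actD; apply: lf_admissible => //; exact: local_bd.
Qed.

Lemma bdry_lfN n (c : simplex X n.+1 -> A) : locally_finite c -> bdry (- c) = - bdry c.
Proof.
move=> fc; rewrite !bdry_lf//; last exact: lfN.
by apply: actN; apply: lf_admissible => //; exact: local_bd.
Qed.

Lemma bdry_lfB n (c e : simplex X n.+1 -> A) : locally_finite c -> locally_finite e ->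
  bdry (c - e) = bdry c - bdry e.
Proof. by move=> fc fe; rewrite bdry_lfD ?bdry_lfN//; exact: lfN. Qed.

Lemma bdry_bdry_lf n (c : simplex X n.+2 -> A) : locally_finite c -> bdry (bdry c) = 0.
Proof.
move=> fc; rewrite [bdry c]bdry_lf// bdry_lf; last by apply: lf_act => //; exact: local_bd.
rewrite lf_act_comp//; first 1 last.
- exact: local_bd.
- by move=> s t _ _; apply: allc_sub (@bd_range _ _ _ t) => u ut; exact: subset_trans ut (@gstar_sub _).
apply/funext => t; rewrite /act fsbig1// => s _.
by rewrite -/(lbdry (bd s)) lbdry_bd coef0 mulr0z.
Qed.

Lemma cin_bdry_lf Y n (c : simplex X n.+1 -> A) : locally_finite c -> cin Y c -> cin Y (bdry c).
Proof.
move=> fc Yc; rewrite bdry_lf//; apply: act_cin => s cs.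
by apply: allc_bd; exact: Yc.
Qed.
End LocallyFiniteChains.

(** * Equivariance simplex by simplex, and operators that preserve it *)

Section Equivariance.
Variables (R : realType) (X : metricType R) (P : pattern X).

(** Equivariance is tested at the points of the simplices, so an isometry given around [x] has to be
    used around another point [x'], the radius being reduced by their distance. *)
Lemma pattern_ball_recenter (r r' : R) x y x' f : 0 < r -> mdist x x' + r <= r' ->
  pattern_ball P r' x y f ->
  pattern_ball P r x' (fn f x') (prestrict f (ball x' r)).
Proof.
move=> r0 xr [Pf fxy fdom fran]; have fi := pattern_isometric Pf.
have sub : ball x' r `<=` ball x r'.
  move=> z; rewrite !ballEmdist /= => xz.
  by apply: le_lt_trans (metric_triangle x x' z) (lt_le_trans _ xr); rewrite ltrD2l.
have fx' : f (x', fn f x') by apply: fnP; rewrite fdom; apply: sub; exact: ballxx.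
have sub' : ball (fn f x') r `<=` ball y r'.
  move=> z; rewrite !ballEmdist /= => xz.
  apply: le_lt_trans (metric_triangle y (fn f x') z) (lt_le_trans _ xr).
  by rewrite -(fi _ _ _ _ fxy fx') ltrD2l.
split.
- have -> : prestrict f (ball x' r) = Defs.pcomp f (pid (ball x' r)).
    apply/seteqP; split=> [[u v] [/= fuv xu]|[u v] [w /= [[xu uw] fuv]]].
      by exists u.
    by move: xu fuv => /= xu fuv; split => //=; move: uw => /= ->.
  by apply: pattern_comp => //; apply: pattern_id; exact: metric_ball_open.
- by split => //=; exact: ballxx.
- apply/seteqP; split=> [u [v [_]]//|u xu].
  have : pdom f u by rewrite fdom; exact: sub.
  by move=> [v fuv]; exists v.
- apply/seteqP; split=> [v [u [fuv]]|v yv] /=.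
    by rewrite !ballEmdist/= (fi _ _ _ _ fx' fuv).
  have : prange f v by rewrite fran; exact: sub'.
  move=> [u fuv]; exists u; split => //=; move: yv.
  by rewrite !ballEmdist/= (fi _ _ _ _ fx' fuv).
Qed.

Lemma pattern_ball_inv (r : R) x y f : pattern_ball P r x y f -> pattern_ball P r y x (Defs.pinv f).
Proof. by move=> [Pf fxy fd fr]; split=> //; exact: pattern_inv. Qed.

Lemma fn_restrict f (B : set X) x : isometric f -> pdom f x -> B x -> fn (prestrict f B) x = fn f x.
Proof.
move=> fi fx Bx; apply: fn_eq; first by move=> ? ? ? ? [+ _] [+ _]; exact: fi.
by split=> //; exact: fnP.
Qed.

Lemma smap_restrict f (B : set X) n (s : simplex X n) : isometric f -> range s `<=` pdom f ->
  range s `<=` B -> smap (fn (prestrict f B)) s = smap (fn f) s.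
Proof. by move=> fi sd sB; apply: smap_eq => x sx; apply: fn_restrict; [|exact: sd|exact: sB]. Qed.

Variables (G : pzRingType) (V : lmodType G).

Definition bounded_by (r : R) n (c : simplex X n -> V) :=
  forall s, c s != 0 -> exists z, range s `<=` ball z (r / 2).

Definition peq (r : R) n (c : simplex X n -> V) := forall x y f (s : simplex X n),
  pattern_ball P r x y f -> range s x -> range s `<=` ball x r -> c (smap (fn f) s) = c s.

Lemma bounded_ball r n (c : simplex X n -> V) (s : simplex X n) x : bounded_by r c -> c s != 0 -> range s x ->
  range s `<=` ball x r.
Proof.
move=> bc /bc[z sz] sx y sy; rewrite [r]splitr; apply: (@ball_triangle _ _ z).
  by apply: ball_sym; exact: sz.
exact: sz.
Qed.

Lemma push_smap r x y f n (c : simplex X n -> V) (s : simplex X n) : pattern_ball P r x y f ->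
  range s `<=` ball x r -> push f c (smap (fn f) s) = c s.
Proof.
move=> [Pf fxy fd fr] sr; have fi := pattern_isometric Pf.
have fs : carries f s (smap (fn f) s) by apply/(carriesP _ _ fi); split; rewrite ?fd.
rewrite /push fsum_set (@fsum1 _ _ _ s) ?asboolT// => s' s's.
case: asboolP => // fs'; case/eqP: s's; exact: carries_inj fs' fs.
Qed.

(** An isometry is injective, so its push forward has at most one term at each simplex and
    equivariance can be stated one simplex at a time. By [bounded_by], a simplex of the support
    through [y] lies in the range of [f] and thus has a preimage. *)
Lemma equivariant_toP r n (c : simplex X n -> V) :
  equivariant_to P r c <-> bounded_by r c /\ peq r c.
Proof.
split=> [[bc ec]|[bc ec]]; split=> //.
  move=> x y f s fP sx sr; have [Pf fxy fd fr] := fP.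
  have fi := pattern_isometric Pf.
  have sd : range s `<=` pdom f by rewrite fd.
  have := congr1 (@^~ (smap (fn f) s)) (ec _ _ _ fP); rewrite (push_smap _ fP)//.
  rewrite /chain_at !asboolT//; last first.
    by rewrite (smap_range (fn_continuous fi) sd); exists x => //; exact: fn_eq.
move=> x y f fP; have [Pf fxy fd fr] := fP.
have fi := pattern_isometric Pf; apply/funext => t.
have [[s st]|ns] := pselect (exists s, carries f s t).
  have [sd tE] := (carriesP _ _ fi).1 st; rewrite fd in sd.
  rewrite tE (push_smap _ fP)// -tE /chain_at.
  have xy : range s x <-> range t y.
    rewrite tE (smap_range (fn_continuous fi)) ?fd//; split=> [sx|[x' sx' e]].
      by exists x => //; exact: fn_eq.
    have fx' : f (x', fn f x') by apply: fnP; rewrite fd; exact: sd.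
    by rewrite -(isometric_inj fi _ fxy (x := x'))// -e.
  case: asboolP => sx; case: asboolP => ty //; last 2 first.
  - by case: ty; apply/xy.
  - by case: sx; apply/xy.
  by rewrite tE -(ec _ _ _ _ fP sx sd).
rewrite /push fsbig1; last by move=> s fs; case: ns; exists s.
rewrite /chain_at; case: asboolP => // ty; apply/esym/eqP/negPn/negP => ct.
have tr : range t `<=` prange f by rewrite fr; exact: bounded_ball bc ct ty.
apply: ns; exists (smap (fn (Defs.pinv f)) t) => p.
have fii := isometric_inv fi.
rewrite (smapE _ (fn_continuous fii) tr).
by apply: (@fnP _ _ (Defs.pinv f)); apply: tr; exists p.
Qed.

Definition eqv n (c : simplex X n -> V) :=
  locally_finite c /\ exists2 r, 0 < r & equivariant_to P r c.

Lemma eqv_chain n (c : simplex X n -> V) : eqv c ->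
  exists2 b : bm_chain X V n, equivariant P b & subm_val b = c.
Proof.
move=> [fc [r r0 cr]].
by exists (@SubmType G _ (bm_submodule X V n) c (asboolT fc)) => //; exists r.
Qed.

Lemma chain_eqv n (b : bm_chain X V n) : equivariant P b -> eqv (subm_val b).
Proof. by move=> [r r0 br]; split; [exact: bm_chain_finite|exists r]. Qed.

Lemma eqv_lin n a (c e : simplex X n -> V) : eqv c -> eqv e -> eqv (a *: c + e).
Proof.
move=> /eqv_chain[b bE <-] /eqv_chain[b' bE' <-].
exact: (chain_eqv (equivariantP a bE bE')).
Qed.

Lemma eqvD n (c e : simplex X n -> V) : eqv c -> eqv e -> eqv (c + e).
Proof. by move=> ec ee; have := eqv_lin 1 ec ee; rewrite scale1r. Qed.

Lemma eqvB n (c e : simplex X n -> V) : eqv c -> eqv e -> eqv (c - e).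
Proof. by move=> ec ee; have := eqv_lin (-1) ee ec; rewrite scaleN1r addrC. Qed.

Lemma eqv0 n : eqv (0 : simplex X n -> V).
Proof. exact: (chain_eqv (equivariant0 P V n)). Qed.

Section LocalOperators.
Variables (C : cellular_pattern X) (rad : R).
Hypothesis cell_rad : cw_radii_lt C rad.

Lemma gstar_near S x : gstar C S x -> exists2 y, S y & mdist x y < rad + rad.
Proof.
move=> [c [y [cy Sy]] cx]; exists y => //; have [z cz] := cell_rad (tagged c).
have := cz _ cx; have := cz _ cy; rewrite !ballEmdist /= => zy zx.
by apply: le_lt_trans (metric_triangle x z y) _; apply: ltrD => //; rewrite metric_sym.
Qed.

Lemma rad_ge0 : (exists x : X, True) -> 0 <= rad.
Proof.
move=> [x _]; have [k [c /open_cell_sub cx]] := cw_cover C x; have [z /(_ _ cx)] := cell_rad c.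
by rewrite ballEmdist /= => /ltW; apply: le_trans; exact: mdist_ge0.
Qed.

(** An operator whose values stay in the cells around a simplex, and which commutes with pattern
    isometries defined deep enough around it, preserves equivariance, at a larger radius. *)
Lemma act_eqv n m (D : simplex X n -> fch (simplex X m)) (c : simplex X n -> V) r1 : 0 < r1 ->
  eqv c -> local_on C D c ->
  (forall (s : simplex X n) x y r' f x', c s != 0 -> pattern_ball P r' x y f ->
    range s `<=` ball x r' -> range s x' -> mdist x x' + r1 <= r' ->
    D (smap (fn f) s) = lsmap (fn f) (D s)) -> eqv (act D c).
Proof.
move=> r10 [fc [r r0 /equivariant_toP[bc ec]]] Dc Dnat; split; first exact: lf_act fc Dc.
have [[x0 _]|nX] := pselect (exists x : X, True); last first.
  exists 1 => //; apply/equivariant_toP; split=> s; last by move=> y; case: nX; exists s.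
  by have [x] := simplex_range_neq0 s; case: nX; exists x.
have rad0 : 0 <= rad by apply: rad_ge0; exists x0.
have [d dE] : exists d, d = rad + rad by exists (rad + rad).
have d0 : 0 <= d by lra.
(* Half of [r'] exceeds [d + d + r], a bound for the distances between points of a simplex of [D s].
   The existential form keeps the name opaque for [lra]. *)
have [r' r'E] : exists r', r' = (d + d + r + r1) * 2 by exists ((d + d + r + r1) * 2).
have r'0 : 0 < r' by lra.
have far s t x y : c s != 0 -> coef (D s) t != 0 -> range t x -> range s y ->
    mdist x y < d + r.
  move=> cs st tx sy; have [x' sx' xx'] := gstar_near (Dc _ cs _ st _ tx).
  have := bounded_ball bc cs sx' sy; rewrite ballEmdist /= => x'y.
  by have := metric_triangle x x' y; lra.
have step x y f (s : simplex X n) (t : simplex X m) : pattern_ball P r' x y f -> range t x -> range t `<=` ball x r' ->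
    c s != 0 -> coef (D s) t != 0 ->
    [/\ range s `<=` ball x r', c (smap (fn f) s) = c s &
        coef (D (smap (fn f) s)) (smap (fn f) t) = coef (D s) t].
  move=> fP tx tr cs st; have [Pf fxy fd fr] := fP; have fi := pattern_isometric Pf.
  have [x' sx' xx'] := gstar_near (Dc _ cs _ st _ tx).
  have sr : range s `<=` ball x r'.
    move=> z sz; rewrite ballEmdist /=; apply: lt_le_trans (far _ _ _ _ cs st tx sz) _.
    by lra.
  have sd : range s `<=` pdom f by rewrite fd.
  have g1 : pattern_ball P r x' (fn f x') (prestrict f (ball x' r)).
    by apply: pattern_ball_recenter fP => //; lra.
  have Df : D (smap (fn f) s) = lsmap (fn f) (D s).
    by apply: Dnat fP sr sx' _ => //; lra.
  have sx'r : range s `<=` ball x' r by exact: bounded_ball bc cs sx'.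
  split=> //; first by rewrite -(ec _ _ _ _ g1 sx' sx'r) (smap_restrict fi sd sx'r).
  rewrite Df (@coef_lsmap _ _ (pdom f)) ?fd//; first by rewrite -fd; exact: fn_continuous.
    move=> u v xu xv e; have fu : f (u, fn f u) by apply: fnP; rewrite fd.
    have fv : f (v, fn f v) by apply: fnP; rewrite fd.
    by rewrite -e in fv; exact: isometric_inj fu fv.
  move=> u /(Dc _ cs) us z /us /gstar_near[y' sy' zy']; rewrite ballEmdist /=.
  by have := metric_triangle x y' z; have := far _ _ _ _ cs st tx sy'; rewrite [mdist y' z]metric_sym; lra.
have pinvK f : Defs.pinv (Defs.pinv f) = f by apply/seteqP; split=> -[].
exists r' => //; apply/equivariant_toP; split=> [t /act_neq0[s cs st]|x y f t fP tx tr].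
  have [z tz] := simplex_range_neq0 t; exists z => u tu; rewrite ballEmdist /=.
  have [x' sx' xx'] := gstar_near (Dc _ cs _ st _ tu).
  have := far _ _ _ _ cs st tz sx'; have := metric_triangle z x' u; rewrite [mdist x' u]metric_sym.
  by rewrite r'E mulfK// => h1 h2; lra.
have [Pf fxy fd fr] := fP; have fi := pattern_isometric Pf; have fii := isometric_inv fi.
(* The simplices that contribute at the image of [t] are the images of those that contribute at [t];
   the converse inclusion is [step] for the inverse isometry. *)
have [l ul lP] := finite_uniq_seq (lf_admissible fc Dc t).
have lr s : s \in l -> range s `<=` pdom f.
  by move=> /lP[cs st]; rewrite fd; have [] := step _ _ _ _ _ fP tx tr cs st.
have td : range t `<=` pdom f by rewrite fd.
rewrite [RHS](@actE _ _ _ D c t l ul (fun s cs st => (lP s).1 (conj cs st))).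
rewrite (@actE _ _ _ D c (smap (fn f) t) (map (@smap _ _ _ (fn f) n) l)) => [||s' cs' st'].
- rewrite big_map; apply: eq_big_seq => s /lP[cs st].
  by have [_ -> ->] := step _ _ _ _ _ fP tx tr cs st.
- rewrite map_inj_in_uniq// => s s' sl s'l e.
  by rewrite -(smap_fn_inv fi (lr _ sl)) e smap_fn_inv//; exact: lr.
have ty : range (smap (fn f) t) y.
  by rewrite (smap_range (fn_continuous fi) td); exists x => //; exact: fn_eq.
have try : range (smap (fn f) t) `<=` ball y r'.
  by rewrite (smap_range (fn_continuous fi) td) -fr => _ [z tz <-]; apply: fn_range; exact: td.
have [s'r cs ] := step _ _ _ _ _ (pattern_ball_inv fP) ty try cs' st'.
rewrite smap_fn_inv// => ds.
have s'd : range s' `<=` pdom (Defs.pinv f) by rewrite pdom_inv fr.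
rewrite -[s'](smap_fn_inv fii s'd) pinvK; apply: map_f; apply/lP.
by rewrite -cs in cs'; rewrite -ds in st'.
Qed.

Lemma eqv_bdry n (c : simplex X n.+1 -> V) : eqv c -> eqv (bdry c).
Proof.
move=> ec; rewrite bdry_lf; last by case: ec.
apply: (@act_eqv _ _ _ _ 1) => //; first exact: local_bd.
move=> s x y r' f x' cs [Pf fxy fd fr] sr _ _; have fi := pattern_isometric Pf.
by apply: (@bd_smap _ _ (pdom f)); [exact: fn_continuous|rewrite fd].
Qed.
End LocalOperators.
End Equivariance.

Lemma admissible_opB (K K' : choiceType) (A : zmodType) (D D' : K -> fch K') (c : K -> A) :
  admissible D c -> admissible D' c -> admissible (fun s => D s - D' s) c.
Proof.
move=> hD hD' t; apply: (@sub_finite_set _ _ ([set s | c s != 0 /\ coef (D s) t != 0] `|`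
    [set s | c s != 0 /\ coef (D' s) t != 0])); last by rewrite finite_setU; split; [exact: hD|exact: hD'].
move=> s [cs]; rewrite coefB => st.
have [e|] := eqVneq (coef (D s) t) 0; last by left.
by right; split=> //; apply: contra_neq st => e'; rewrite e e' subr0.
Qed.

Lemma bdry_local (R : realType) (X : metricType R) (A : zmodType) n (c e : simplex X n.+1 -> A) (u : simplex X n) :
  (forall s : simplex X n.+1, range u `<=` range s -> c s = e s) -> bdry c u = bdry e u.
Proof.
move=> ce; rewrite /bdry; apply: eq_bigr => i _; apply: mulrz_congr; apply: eq_fsbigr => s.
by rewrite inE /= => su; apply: ce; rewrite -su; exact: face_range.
Qed.

Section PushBijection.
Variables (R : realType) (T T' : metricType R) (A : zmodType) (g : T -> T') (Y : set T).
Hypotheses (gc : {within Y, continuous g}) (g_inj : forall x y, Y x -> Y y -> g x = g y -> x = y).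

Lemma gpush_at n (c : simplex T n -> A) (s : simplex T n) : finc c -> cin Y c -> range s `<=` Y ->
  gpush g c (smap g s) = c s.
Proof.
move=> fc Yc sY; rewrite /gpush /act (@fsum1 _ _ _ s) => [|t ts].
  by rewrite fdeltaE eqxx mulr1z.
have [->|ct] := eqVneq (c t) 0; first by rewrite mul0rz.
rewrite fdeltaE; case: eqP => [e|]; last by rewrite mulr0z.
case/eqP: ts; apply/continuousEP => p; apply: g_inj.
- by apply: (Yc _ ct); exists p.
- by apply: sY; exists p.
by rewrite -(smapE p gc (Yc _ ct)) -e (smapE p gc sY).
Qed.

Lemma gpush_bij n (c : simplex T n -> A) (e : simplex T' n -> A) : finc c -> cin Y c ->
  (forall s : simplex T n, range s `<=` Y -> e (smap g s) = c s) ->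
  (forall t, e t != 0 -> exists2 s : simplex T n, range s `<=` Y & t = smap g s) -> gpush g c = e.
Proof.
move=> fc Yc ec et; apply/funext => t.
have [[s [sY ->]]|ns] := pselect (exists s : simplex T n, range s `<=` Y /\ t = smap g s).
  by rewrite gpush_at// ec.
transitivity (0 : A); last first.
  by apply/esym/eqP/negPn/negP => /et[s sY ts]; apply: ns; exists s.
apply/eqP/negPn/negP => /gpush_neq0[s /Yc sY ts]; apply: ns; by exists s.
Qed.
End PushBijection.

(** * Settling equivariant chains of a represented pattern *)

Section Representation.
Variables (R : realType) (X : metricType R) (P : pattern X) (C : cellular_pattern X).
Variables (G : comPzRingType) (V : lmodType G).
Hypothesis hCP : represents C P.
Local Notation closed_cell := (@closed_cell R X C _).
Local Notation Sk := (Sk C).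
Local Notation eqv := (@eqv R X P G V _).

Lemma mdist_cell rad : cw_radii_lt C rad -> forall k (c : cell C k) x y, closed_cell c x ->
  closed_cell c y -> mdist x y < rad + rad.
Proof.
move=> cr k c x y cx cy; have [z cz] := cr k c.
have := cz _ cx; have := cz _ cy; rewrite !ballEmdist /= => zy zx.
by have := metric_triangle x z y; rewrite [mdist x z]metric_sym; lra.
Qed.

(** The first half of [represents], applied at every point of [Y] at once: around each of them the
    isometry is still defined to depth [r2]. *)
Lemma pattern_cellwise r : 0 < r -> exists2 r2, 0 < r2 & forall r' x y f Y,
  pattern_ball P r' x y f -> (forall x', Y x' -> mdist x x' + r2 <= r') -> cellwise C r f Y.
Proof.
move=> r0; have [r2 r20 r2P] := hCP.1 _ r0; exists r2 => // r' x y f Y fP Yr x' j c Yx' cx'.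
have fi : isometric f by case: fP => Pf _ _ _; exact: pattern_isometric Pf.
have gP := pattern_ball_recenter r20 (Yr _ Yx') fP.
have [d fm] := r2P _ _ _ gP _ c cx'; exists d; move: (fm).
(* The ball does not cut the cell, because the domain of a morphism is the whole closed cell. *)
suff -> : prestrict (prestrict f (ball x' r2)) (closed_cell c) = prestrict f (closed_cell c) by [].
apply/seteqP; split=> -[u v] [/= fuv cu]; split=> //; first by case: fuv.
have : pdom (prestrict (prestrict f (ball x' r2)) (closed_cell c)) u.
  by rewrite (mor_dom r0 fm).
by move=> [v' [[fuv' bu] _]]; split.
Qed.

Section Decomposition.
Variable k : nat.

Lemma act_settling_eqv D rho n (c : simplex X n -> V) : settling C 1 k D rho ->
  eqv c -> cin (Sk k.+1) c -> eqv (act (D n) c).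
Proof.
move=> st ec cS; have [rad cr] := cp_bounded C.
have [r2 r20 cw] := pattern_cellwise ltr01.
have [fc [r r0 /equivariant_toP[bc pc]]] := ec.
have loc : local_on C (D n) c.
  by move=> s cs; apply: allc_sub (settling_star st (cS _ cs)) => t ts; exact: subset_trans ts (@cstar_gstar _ _ _ _ _).
have [[x0 _]|nX] := pselect (exists x : X, True); last first.
  split; first exact: lf_act fc loc.
  exists 1 => //; apply/equivariant_toP; split=> s; last by move=> y; case: nX; exists s.
  by have [x] := simplex_range_neq0 s; case: nX; exists x.
have rad0 := rad_ge0 cr (ex_intro _ x0 I).
(* Points in the star of [s] are within [r + (rad + rad)] of any point of [s], and depth [r2] must
   be left there. *)
apply: (act_eqv cr (r1 := r + (rad + rad) + r2)) => //; first by lra.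
move=> s x y r' f x' cs fP sr sx' xr.
have fi : isometric f by case: fP => Pf _ _ _; exact: pattern_isometric Pf.
apply: (settling_map st (cS _ cs) fi); apply: (cw _ _ _ _ _ fP) => z.
move=> /cstar_gstar/(gstar_near cr)[z' sz' zz'].
have := bounded_ball bc cs sx' sz'; rewrite ballEmdist /= => x'z'.
have := metric_triangle x x' z; have := metric_triangle x' z' z; rewrite [mdist z' z]metric_sym; lra.
Qed.

(** Here [e] is the homotopy operator applied to [z], and [l] the same operator applied to the
    boundary of [z], or 0 in degree 0; what is left of [z] is its image under [rho]. *)
Lemma settle_chain n (z : simplex X n -> V) : eqv z -> cin (Sk k.+1) z -> bd_in (Sk k) z ->
  exists (e : simplex X n.+1 -> V) (l : simplex X n -> V), [/\ eqv e, cin (Sk k.+1) e, eqv l, cin (Sk k) l &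
    forall s, (z - bdry e - l) s != 0 -> csettled C k (range s)].
Proof.
move=> ez zS bz; have [D [rho st]] := @settling_exists R X C 1 k ltr01.
have [fz _] := ez.
have locD m (c : simplex X m -> V) : cin (Sk k.+1) c -> local_on C (D m) c.
  move=> cS s cs; apply: allc_sub (settling_star st (cS _ cs)) => t ts.
  exact: subset_trans ts (@cstar_gstar _ _ _ _ _).
have loc := locD _ _ zS.
have SkS : Sk k `<=` Sk k.+1 by exact: Sk_le.
have cstarS (S : set X) : cstar C k S `<=` Sk k.+1 by exact: cstar_Sk.
have admD : admissible (fun s => lbdry (D n s)) z.
  apply: (@lf_admissible _ _ C) => // s zs; apply: allc_linext (loc s zs) _ => t ts.
  exact: allc_bd.
have bE : bdry (act (D n) z) = act (fun s => lbdry (D n s)) z.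
  rewrite bdry_lf; last exact: lf_act fz loc.
  apply: (@lf_act_comp _ _ C) => // s t zs st'.
  by apply: allc_bd; exact: gstar_sub.
have admd : admissible (@fdelta _) z.
  apply: (@lf_admissible _ _ C) => // s zs.
  by apply: allc_delta; exact: gstar_sub.
have eqvD' : eqv (act (D n) z) by exact: act_settling_eqv st ez zS.
have cinD : cin (Sk k.+1) (act (D n) z).
  by apply: act_cin => s /zS sS; apply: allc_sub (settling_star st sS) => t ts; exact: subset_trans ts (cstarS _).
exists (act (D n) z); case: n z ez zS bz fz loc admD bE admd eqvD' cinD => [|n] z ez zS bz fz loc admD bE admd eqvD' cinD.
  exists 0; split=> //; [exact: eqv0|exact: cin0|] => t.
  rewrite subr0 bE -{1}[z]act_delta -act_opB// => /act_neq0[s zs].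
  by rewrite -(settling_rho0 st); exact: (settling_settled st (zS _ zs)).
have bzS : cin (Sk k.+1) (bdry z) by exact: cin_sub bz.
exists (act (D n) (bdry z)); split=> //.
- by have [rad cr] := cp_bounded C; apply: (act_settling_eqv st _ bzS); exact: (eqv_bdry cr ez).
- by apply: act_cin => s bs; apply: (settling_Sk st); exact: bz.
- have lE : act (D n) (bdry z) = act (fun s => linext (D n) (bd s)) z.
    rewrite bdry_lf//; apply: (@lf_act_comp _ _ C) => //; first exact: local_bd.
    move=> s t zs ts; apply: allc_sub (settling_star st _) => [u ut|].
      exact: subset_trans ut (@cstar_gstar _ _ _ _ _).
    by apply: subset_trans (zS _ zs); exact: bd_range ts.
  have admB : admissible (fun s => linext (D n) (bd s)) z.
    apply: (@lf_admissible _ _ C) => // s zs; apply: allc_linext (@bd_range _ _ _ s) _ => t ts.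
    apply: allc_sub (settling_star st (subset_trans ts (zS _ zs))) => u ut x /ut.
    move=> [c [_ [y [cy ty]]] cx]; exists c => //; exists y; split=> //; exact: ts.
  move=> t; rewrite lE bE -{1}[z]act_delta addrAC -act_opB// -act_opB//; last first.
    exact: admissible_opB.
  move=> /act_neq0[s zs]; rewrite -(settling_rhoS st).
  exact: (settling_settled st (zS _ zs)).
Qed.
End Decomposition.
End Representation.

(** * Families of chains in cells *)

Section CellFamilies.
Variables (R : realType) (X : metricType R) (P : pattern X) (C : cellular_pattern X).
Variables (G : comPzRingType) (V : lmodType G).
Hypothesis hCP : represents C P.
Local Notation closed_cell := (@closed_cell R X C _).
Local Notation open_cell := (@open_cell R X C _).
Local Notation frontier := (@cell_frontier R X C _).
Local Notation Sk := (Sk C).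
Local Notation eqv := (@eqv R X P G V _).
Variable k : nat.
Implicit Types (c d : cell C k).

(** A simplex not contained in [Sk k] lies in at most one closed k-cell, so proper chains of
    distinct cells have disjoint supports. *)
Definition proper c n (b : simplex X n -> V) := forall s, b s != 0 ->
  range s `<=` closed_cell c /\ ~ range s `<=` Sk k.

(** Equality of chains is required, not of homology classes: this is what makes the assembled chain
    equivariant. *)
Definition invariant (r : R) n (b : cell C k -> simplex X n -> V) := forall c d f,
  cp_mor r c d f -> gpush (fn f) (b c) = b d.

Lemma proper_cin c n (b : simplex X n -> V) : proper c b -> cin (closed_cell c) b.
Proof. by move=> bp s /bp[]. Qed.

Lemma Sk_cell_open c x : closed_cell c x -> ~ Sk k x -> open_cell c x.
Proof. by rewrite closed_cell_split => -[//|/frontier_Sk]. Qed.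

Lemma cell_uniq c d (S : set X) : S `<=` closed_cell c -> S `<=` closed_cell d ->
  ~ S `<=` Sk k -> c = d.
Proof.
move=> Sc Sd nS; have [x Sx nx] : exists2 x, S x & ~ Sk k x.
  apply: contrapT => nx; apply: nS => x Sx; apply: contrapT => nk; by apply: nx; exists x.
exact: closed_cell_disjointk (Sc _ Sx) (Sk_cell_open (Sd _ Sx) nx).
Qed.

Lemma cell_inj r c d f : 0 < r -> cp_mor r c d f ->
  forall x y, closed_cell c x -> closed_cell c y -> fn f x = fn f y -> x = y.
Proof.
move=> r0 fm x y cx cy e; have fx := mor_fn r0 fm cx; have fy := mor_fn r0 fm cy.
by rewrite -e in fy; exact: isometric_inj (mor_isometric r0 fm) fx fy.
Qed.

Lemma mor_smap_range r c d f n (s : simplex X n) : 0 < r -> cp_mor r c d f ->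
  range s `<=` closed_cell c -> range (smap (fn f) s) `<=` closed_cell d.
Proof.
move=> r0 fm sc; rewrite (smap_range (mor_continuous r0 fm) sc) => _ [x sx <-].
by apply: (mor_fn_range r0 fm); exact: sc.
Qed.

Lemma mor_smap_Sk r c d f n (s : simplex X n) j : 0 < r -> cp_mor r c d f ->
  range s `<=` closed_cell c -> range (smap (fn f) s) `<=` Sk j <-> range s `<=` Sk j.
Proof.
move=> r0 fm sc; rewrite (smap_range (mor_continuous r0 fm) sc); split=> sS.
  move=> x sx; apply/(mor_SkE r0 j fm (mor_fn r0 fm (sc _ sx))).
  by apply: sS; exists x.
by move=> _ [x sx <-]; apply/(mor_SkE r0 j fm (mor_fn r0 fm (sc _ sx))); exact: sS.
Qed.

Lemma mor_smap_onto r c d f n (t : simplex X n) : 0 < r -> cp_mor r c d f ->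
  range t `<=` closed_cell d -> exists2 s : simplex X n, range s `<=` closed_cell c & t = smap (fn f) s.
Proof.
move=> r0 fm td; have fi := mor_isometric r0 fm; have gm := cp_inv r0 fm.
exists (smap (fn (Defs.pinv f)) t); first exact: mor_smap_range r0 gm td.
have tdd : range t `<=` pdom (Defs.pinv f) by rewrite (mor_dom r0 gm).
have := smap_fn_inv (isometric_inv fi) tdd.
by rewrite (_ : Defs.pinv (Defs.pinv f) = f)//; apply/seteqP; split=> -[].
Qed.

Definition cell_part c n (w : simplex X n -> V) : simplex X n -> V :=
  restr (fun s : simplex X n => range s `<=` closed_cell c /\ ~ range s `<=` Sk k) w.

Lemma cell_part_proper c n (w : simplex X n -> V) : proper c (cell_part c w).
Proof. by move=> s sw; have [] := restr_neq0 sw. Qed.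

Lemma finc_proper c n (w b : simplex X n -> V) : locally_finite w -> proper c b ->
  (forall s, b s != 0 -> w s != 0) -> finc b.
Proof.
move=> fw bp bw; apply: sub_finite_set (fw _ (@closed_cell_compact _ _ _ _ c)) => s bs.
split; first exact: bw.
have [x sx] := simplex_range_neq0 s; exists x; split=> //; exact: (bp _ bs).1.
Qed.

Lemma cell_part_finc c n (w : simplex X n -> V) : locally_finite w -> finc (cell_part c w).
Proof.
move=> fw; apply: (finc_proper fw (@cell_part_proper c n w)) => s sw.
by have [] := restr_neq0 sw.
Qed.

Lemma cell_part_bd c n (w : simplex X n -> V) : locally_finite w ->
  (forall s, w s != 0 -> csettled C k (range s)) -> bd_in (Sk k) w ->
  bd_in (frontier c) (cell_part c w).
Proof.
case: n w => // n w fw ws bw u /= nz.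
have fy := cell_part_finc c fw.
have uc : range u `<=` closed_cell c.
  by apply: (cin_bdry fy _ nz); apply: proper_cin; exact: cell_part_proper.
suff uS : range u `<=` Sk k by move=> x ux; rewrite -closed_cell_Sk; split; [exact: uc|exact: uS].
apply: contrapT => nu; have : bdry w u != 0.
  rewrite (bdry_local (e := cell_part c w))// => s us.
  rewrite /cell_part /restr; case: asboolP => // ns.
  apply/eqP/negPn/negP => /ws[sS|[d sd]]; first by apply: nu; exact: subset_trans sS.
  apply: ns; split; last by move=> sS; apply: nu; exact: subset_trans sS.
  by rewrite (cell_uniq uc (subset_trans us sd) nu).
by move=> /bw.
Qed.

(** The second half of [represents]: a morphism is the restriction of an isometry of the pattern,
    and the latter preserves the coefficients of [w]. *)
Lemma cell_part_invariant n (w : simplex X n -> V) : eqv w ->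
  exists2 r, 0 < r & invariant r (fun c => cell_part c w).
Proof.
move=> [fw [r r0 /equivariant_toP[bw pw]]]; have [rad cr] := cp_bounded C.
have [[x0 _]|nX] := pselect (exists x : X, True); last first.
  exists 1 => // c d f _; apply/funext => s; case: nX.
  by have [x] := simplex_range_neq0 s; exists x.
have rad0 := rad_ge0 cr (ex_intro _ x0 I).
(* Every point of the cell is at distance less than [rad + rad] from the point at which the isometry
   is centred, so radius [r] is left after recentring. *)
have r'0 : 0 < r + (rad + rad) by lra.
have cr' : cw_radii_lt C ((r + (rad + rad)) / 2).
  move=> j c; have [z cz] := cr j c; exists z; apply: subset_trans cz _; apply: le_ball.
  by rewrite ler_pdivlMr//; lra.
have [r'' r''0 r''P] := hCP.2 _ r'0 cr'; exists r'' => // c d f fm.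
have [x [y [f' [cx fP fE]]]] := r''P _ _ _ _ fm.
have [Pf' fxy fd fr] := fP; have f'i := pattern_isometric Pf'.
have csub : closed_cell c `<=` pdom f'.
  by rewrite -(mor_dom r''0 fm) -fE => z [z' [fz _]]; exists z'.
have fs (s : simplex X n) : range s `<=` closed_cell c -> smap (fn f) s = smap (fn f') s.
  move=> sc; rewrite -fE; apply: smap_restrict => //; exact: subset_trans csub.
have ws (s : simplex X n) : range s `<=` closed_cell c -> w s != 0 -> w (smap (fn f') s) = w s.
  move=> sc ws; have [x' sx'] := simplex_range_neq0 s.
  have gP := pattern_ball_recenter r0 _ fP (x' := x').
  have {}gP : pattern_ball P r x' (fn f' x') (prestrict f' (ball x' r)).
    by apply: gP; have := mdist_cell cr cx (sc _ sx'); lra.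
  have sb : range s `<=` ball x' r by exact: bounded_ball bw ws sx'.
  rewrite -(pw _ _ _ _ gP sx' sb) smap_restrict//; exact: subset_trans csub.
have ws' (s : simplex X n) : range s `<=` closed_cell c -> w (smap (fn f') s) != 0 ->
    w s = w (smap (fn f') s).
  move=> sc; have scd : range s `<=` pdom f' by exact: subset_trans csub.
  set t := smap (fn f') s => wt; have [y' ty'] := simplex_range_neq0 t.
  have td : range t `<=` closed_cell d by rewrite /t -fs//; exact: mor_smap_range r''0 fm sc.
  have gP := pattern_ball_recenter r0 _ (pattern_ball_inv fP) (x' := y').
  have yd : closed_cell d y.
    rewrite -(mor_range r''0 fm) -fE; exists x; split=> //.
  have {}gP : pattern_ball P r y' (fn (Defs.pinv f') y') (prestrict (Defs.pinv f') (ball y' r)).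
    by apply: gP; have := mdist_cell cr yd (td _ ty'); lra.
  have tb : range t `<=` ball y' r by exact: bounded_ball bw wt ty'.
  rewrite -(pw _ _ _ _ gP ty' tb) smap_restrict//.
  - by rewrite /t smap_fn_inv.
  - exact: isometric_inv.
  - rewrite pdom_inv /t (smap_range (fn_continuous f'i) scd) => _ [z sz <-].
    by apply: fn_range; exact: scd.
apply: (gpush_bij (mor_continuous r''0 fm) (cell_inj r''0 fm)).
- exact: cell_part_finc.
- by apply: proper_cin; exact: cell_part_proper.
- move=> s sc; rewrite /cell_part /restr.
  have -> : `[< range s `<=` closed_cell c /\ ~ range s `<=` Sk k >] = `[< ~ range s `<=` Sk k >].
    by apply/asboolP/asboolP => [[]|].
  have sk := mor_smap_Sk k r''0 fm sc.
  have -> : `[< range (smap (fn f) s) `<=` closed_cell d /\ ~ range (smap (fn f) s) `<=` Sk k >]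
      = `[< ~ range s `<=` Sk k >].
    apply/asboolP/asboolP => [[_ nS] /sk//|nS]; split=> [|/sk//].
    exact: mor_smap_range r''0 fm sc.
  case: asboolP => // _; rewrite fs//.
  have [e|nz] := eqVneq (w (smap (fn f') s)) 0; last by rewrite (ws' _ sc nz).
  by have [->//|nz] := eqVneq (w s) 0; rewrite ws.
- by move=> t wt; have [[td _] _] := restr_neq0 wt; exact: mor_smap_onto r''0 fm td.
Qed.

(** The sum of the family, written without a summation since at most one cell contributes to each
    simplex; simplices inside [Sk k] are dropped. *)
Definition asm n (b : cell C k -> simplex X n -> V) : simplex X n -> V := fun s =>
  if pselect (exists c : cell C k, range s `<=` closed_cell c) is left e then
    (if `[< range s `<=` Sk k >] then 0 else b (sval (cid e)) s)
  else 0.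

Lemma asm_in n (b : cell C k -> simplex X n -> V) c (s : simplex X n) : range s `<=` closed_cell c ->
  ~ range s `<=` Sk k -> asm b s = b c s.
Proof.
move=> sc nS; rewrite /asm; case: pselect => [e|[]]; last by exists c.
by rewrite asboolF// (cell_uniq (svalP (cid e)) sc nS).
Qed.

Lemma asm_neq0 n (b : cell C k -> simplex X n -> V) (s : simplex X n) : asm b s != 0 ->
  exists c, [/\ range s `<=` closed_cell c, ~ range s `<=` Sk k & asm b s = b c s].
Proof.
rewrite /asm; case: pselect => [e|]; last by rewrite eqxx.
case: asboolP => [_|nS _]; first by rewrite eqxx.
by exists (sval (cid e)); split=> //; exact: (svalP (cid e)).
Qed.

Lemma asm_cin n (b : cell C k -> simplex X n -> V) : cin (Sk k.+1) (asm b).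
Proof. by move=> s /asm_neq0[c [sc _ _]]; apply: subset_trans sc _; exact: closed_cell_SkS. Qed.

Lemma asm_bdry n (b : cell C k -> simplex X n.+1 -> V) c (u : simplex X n) : cin (closed_cell c) (b c) ->
  range u `<=` closed_cell c -> ~ range u `<=` Sk k -> bdry (asm b) u = bdry (b c) u.
Proof.
move=> bc uc nu; apply: bdry_local => s us.
have nS : ~ range s `<=` Sk k by move=> sS; apply: nu; exact: subset_trans sS.
have [sc|nsc] := pselect (range s `<=` closed_cell c); first by rewrite (asm_in b sc nS).
have -> : b c s = 0 by apply/eqP/negPn/negP => /bc.
apply/eqP/negPn/negP => /asm_neq0[d [sd _ _]]; apply: nsc.
by rewrite (cell_uniq uc (subset_trans us sd) nu).
Qed.

Lemma asm_bdry0 n (b : cell C k -> simplex X n.+1 -> V) (u : simplex X n) : ~ range u `<=` Sk k ->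
  (forall c, ~ range u `<=` closed_cell c) -> bdry (asm b) u = 0.
Proof.
move=> nu nc; rewrite (bdry_local (e := 0)); first by rewrite bdry0.
move=> s us; apply/eqP/negPn/negP => /asm_neq0[c [sc _ _]].
by apply: (nc c); exact: subset_trans sc.
Qed.

Lemma asm_lf n (b : cell C k -> simplex X n -> V) : (forall c, finc (b c)) -> locally_finite (asm b).
Proof.
move=> fb K cK; pose cells := {j & cell C j}.
have inj : {in Tagged (cell C) @^-1` [set c : cells | tclosed c `&` K !=set0] &,
    injective (fun c : cell C k => Tagged (cell C) c)}.
  by move=> c c' _ _ /eqP; rewrite -tag_eqE /tag_eq eqxx /= tagged_asE => /eqP.
have fin := finite_preimage inj (compact_finite_cells C cK).
apply: (@sub_finite_set _ _ (\bigcup_(c in [set c : cell C k | tclosed (Tagged (cell C) c) `&` K !=set0])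
   [set s | b c s != 0])).
  move=> s [/= nz [x [sx Kx]]]; have [c [sc nS e]] := asm_neq0 nz.
  exists c; last by rewrite /= -e.
  by exists x; split=> //; exact: sc.
by apply: bigcup_finite => // c _; exact: fb.
Qed.

Lemma asm_eqv n (b : cell C k -> simplex X n -> V) r : 0 < r -> (forall c, finc (b c)) ->
  (forall c, cin (closed_cell c) (b c)) -> invariant r b -> eqv (asm b).
Proof.
move=> r0 fb cb bi; split; first exact: asm_lf.
have [rad cr] := cp_bounded C.
have [r' r'0 r'P] := hCP.1 _ r0.
have [[x0 _]|nX] := pselect (exists x : X, True); last first.
  exists 1 => //; apply/equivariant_toP; split=> s; last by move=> y; case: nX; exists s.
  by have [x] := simplex_range_neq0 s; case: nX; exists x.
have rad0 := rad_ge0 cr (ex_intro _ x0 I).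
have step r1 x y f (s : simplex X n) : r' <= r1 -> pattern_ball P r1 x y f -> range s x ->
    range s `<=` ball x r1 -> asm b s != 0 -> asm b (smap (fn f) s) = asm b s.
  move=> rr fP sx sb /asm_neq0[c [sc nS ->]].
  have [Pf fxy fd fr] := fP; have fi := pattern_isometric Pf.
  have gP := pattern_ball_le r'0 rr fP.
  have [d fm] := r'P _ _ _ gP _ c (sc _ sx).
  have cd : closed_cell c `<=` pdom (prestrict f (ball x r')).
    by move=> z; rewrite -(mor_dom r0 fm) => -[v [fv _]]; exists v.
  have E : smap (fn (prestrict (prestrict f (ball x r')) (closed_cell c))) s = smap (fn f) s.
    apply: smap_eq => z sz; have [v [fv bv]] := cd _ (sc _ sz).
    apply: fn_eq; first exact: (mor_isometric r0 fm).
    split; last exact: sc.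
    by split=> //; apply: fnP; exists v.
  rewrite -E; have sd := mor_smap_range r0 fm sc.
  have nS' : ~ range (smap (fn (prestrict (prestrict f (ball x r')) (closed_cell c))) s) `<=` Sk k.
    by move/(mor_smap_Sk k r0 fm sc).
  rewrite (asm_in b sd nS') -(bi _ _ _ fm).
  by rewrite (gpush_at (mor_continuous r0 fm) (cell_inj r0 fm) (fb c) (cb c) sc).
(* The term [rad * 2] provides balls of half the radius that contain the cells, hence the
   simplices. *)
exists (Num.max r' (rad * 2)) => [|]; first by rewrite lt_max r'0.
apply/equivariant_toP; split=> [s /asm_neq0[c [sc _ _]]|x y f s fP sx sb].
  have [z cz] := cr k c; exists z; apply: subset_trans sc _; apply: subset_trans cz _.
  by apply: le_ball; rewrite ler_pdivlMr// le_max lexx orbT.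
have [Pf fxy fd fr] := fP; have fi := pattern_isometric Pf.
have sd : range s `<=` pdom f by rewrite fd.
have rr : r' <= Num.max r' (rad * 2) by rewrite le_max lexx.
have [e|nz] := eqVneq (asm b (smap (fn f) s)) 0; last first.
  rewrite -(step _ _ _ _ _ rr (pattern_ball_inv fP) _ _ nz) ?smap_fn_inv//.
    by rewrite (smap_range (fn_continuous fi) sd); exists x => //; exact: fn_eq.
  by rewrite (smap_range (fn_continuous fi) sd) -fr => _ [z sz <-]; apply: fn_range; exact: sd.
have [->//|nz] := eqVneq (asm b s) 0.
exact: step fP sx sb nz.
Qed.

(** The form in which every relative cycle of a skeleton is used from here on: an invariant family
    of relative cycles of the cells, up to a boundary and a chain of the lower skeleton. *)
Lemma cell_reduction n (z : simplex X n -> V) : eqv z -> cin (Sk k.+1) z -> bd_in (Sk k) z ->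
  exists (y : cell C k -> simplex X n -> V) (e : simplex X n.+1 -> V) (l : simplex X n -> V),
  [/\ eqv e /\ cin (Sk k.+1) e, eqv l /\ cin (Sk k) l, z = asm y + bdry e + l,
      forall c, [/\ finc (y c), proper c (y c) & bd_in (frontier c) (y c)] &
      exists2 r, 0 < r & invariant r y].
Proof.
move=> ez zS bz; have [e [l [ee eS el lS sw]]] := settle_chain hCP ez zS bz.
have [rad cr] := cp_bounded C.
set w := z - bdry e - l; have ew : eqv w.
  by apply: eqvB => //; apply: eqvB => //; exact: (eqv_bdry cr ee).
have bw : bd_in (Sk k) w.
  case: n z e l ez zS bz ee eS el lS sw @w ew => // n z e l ez zS bz ee eS el lS sw w ew /=.
  have [[fz _] [fe _] [fl _]] := And3 ez ee el.
  rewrite /w bdry_lfB//; last by apply: lfB => //; exact: (lf_bdry C).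
  rewrite bdry_lfB//; last exact: (lf_bdry C).
  rewrite (bdry_bdry_lf C fe) subr0; apply: cinB => //.
  exact: (cin_bdry_lf fl lS).
have [fw _] := ew.
have ea : eqv (asm (fun c => cell_part c w)).
  have [r r0 ri] := cell_part_invariant ew; apply: (asm_eqv r0) => // c.
    exact: cell_part_finc.
  by apply: proper_cin; exact: cell_part_proper.
(* The settled simplices of [w] that lie in [Sk k] belong to no cell part and go into the last
   term. *)
exists (fun c => cell_part c w), e, (l + (w - asm (fun c => cell_part c w))); split=> //.
- split; first by apply: eqvD => //; exact: eqvB.
  apply: cinD => // s nz; apply: contrapT => nS; case/eqP: nz.
  apply/eqP; rewrite [X in X == 0](_ : _ = w s - asm (fun c => cell_part c w) s)// subr_eq0.
  have [e0|ws] := eqVneq (w s) 0.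
    rewrite e0 eq_sym; apply/negPn/negP => nz; have [c [_ _ a]] := asm_neq0 nz.
    by move: nz; rewrite a /cell_part /restr; case: asboolP => _; rewrite ?e0 eqxx.
  have [//|[c sc]] := sw _ ws.
  by rewrite (asm_in _ sc nS) /cell_part /restr asboolT.
- have E (M : zmodType) (a b d x : M) : x = a + b + (d + (x - b - d - a)).
    by rewrite (addrC d) (addrAC (x - b - d)) subrK [RHS]addrC addrA !subrK.
  exact: E.
- move=> c; split; [exact: cell_part_finc|exact: cell_part_proper|exact: cell_part_bd].
- exact: cell_part_invariant.
Qed.
End CellFamilies.

Lemma card_uniq_seq (T : choiceType) (A : set T) (l : seq T) : uniq l ->
  (forall x, A x <-> x \in l) -> (A #= `I_(size l))%card.
Proof.
move=> ul lP; apply/card_set_bijP; exists (fun x => index x l); split.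
- by move=> x /lP xl; rewrite /= index_mem.
- move=> x y; rewrite !inE => /lP xl /lP yl e.
  by rewrite -(nth_index x xl) e nth_index.
- move=> i /= il; case: l ul lP il => // x0 l ul lP il.
  exists (nth x0 (x0 :: l) i); first by apply/lP; exact: mem_nth.
  exact: index_uniq.
Qed.

Section PushLinear.
Variables (R : realType) (T T' : metricType R) (G : pzRingType) (V : lmodType G) (g : T -> T').

Lemma gpushZ n (a : G) (c : simplex T n -> V) : finc c -> gpush g (a *: c) = a *: gpush g c.
Proof.
move=> fc; rewrite /gpush [a *: c](_ : _ = ( *:%R a) \o c)//.
by rewrite act_morph//; exact: admissible_fin.
Qed.

Lemma fincZ (K : choiceType) a (c : K -> V) : finc c -> finc (a *: c).
Proof.
apply: sub_finite_set => s; rewrite /fsupp /=; apply: contra_neq => e.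
by rewrite [LHS](_ : _ = a *: c s)// e scaler0.
Qed.

Lemma finc_sum (A : zmodType) (K : choiceType) I (r : seq I) (F : I -> K -> A) :
  (forall i, finc (F i)) -> finc (\sum_(i <- r) F i).
Proof.
by move=> fF; elim: r => [|i r IHr]; rewrite ?big_nil ?big_cons; [exact: finc0|exact: fincD].
Qed.

Lemma gpush_sum (A : zmodType) I n (r : seq I) (F : I -> simplex T n -> A) : (forall i, finc (F i)) ->
  gpush g (\sum_(i <- r) F i) = \sum_(i <- r) gpush g (F i).
Proof.
move=> fF; elim: r => [|i r IHr]; first by rewrite !big_nil /gpush act0.
by rewrite !big_cons gpushD// ?IHr//; exact: finc_sum.
Qed.

Lemma cinZ Y n a (c : simplex T n -> V) : cin Y c -> cin Y (a *: c).
Proof.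
move=> Yc s; rewrite [X in X != 0](_ : _ = a *: c s)// => nz; apply: Yc.
by apply: contra_neq nz => ->; rewrite scaler0.
Qed.

Lemma bdryZ n a (c : simplex T n.+1 -> V) : finc c -> bdry (a *: c) = a *: bdry c.
Proof. by move=> fc; rewrite [a *: c](_ : _ = ( *:%R a) \o c)// bdry_morph. Qed.
End PushLinear.

(** * Averaging over the morphisms between two cells *)

Section Averaging.
Variables (R : realType) (X : metricType R) (C : cellular_pattern X).
Variables (G : comPzRingType) (V : lmodType G) (k : nat) (r : R).
Hypothesis r0 : 0 < r.
Hypothesis hdiv : forall (c d : cell C k) m,
  (cp_mor r c d #= `I_m)%card -> m <> 0%N -> has_division G m.
Local Notation closed_cell := (@closed_cell R X C _).

Lemma pcomp_mor_inv (e c d : cell C k) f g : cp_mor r e c g -> cp_mor r c d f ->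
  Defs.pcomp (Defs.pinv f) (Defs.pcomp f g) = g.
Proof.
move=> gm fm; apply/seteqP; split=> -[x y] /=.
  move=> [z [[w [/= gw fw]] /= fy]].
  have fyz : f (y, z) by exact: fy.
  by rewrite (isometric_inj (mor_isometric r0 fm) fyz fw).
move=> gxy; have cy := mor_range_sub r0 gm gxy; have fy := mor_fn r0 fm cy.
by exists (fn f y); split=> //; exists y.
Qed.

(* The witness at c is the average over C^r(c0, c) of the push forwards of a chain at a
   representative c0 of the class of c; this is where division by |C^r(c0, c)| is used. *)
Lemma average n (Q : cell C k -> (simplex X n -> V) -> Prop) :
  (forall c b, Q c b -> finc b) -> (forall c b, Q c b -> cin (closed_cell c) b) ->
  (forall c, exists b, Q c b) ->
  (forall c d f b, cp_mor r c d f -> Q c b -> Q d (gpush (fn f) b)) ->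
  (forall c a b b1 b2, Q c b -> Q c b1 -> Q c b2 -> Q c (b + a *: (b1 - b2))) ->
  exists b, (forall c, Q c (b c)) /\ invariant r b.
Proof.
move=> Qf Qc Qe Qp Qa.
pose rep (c : cell C k) : cell C k := xget c [set d | exists f, cp_mor r d c f].
have repP c : exists f, cp_mor r (rep c) c f.
  by rewrite /rep; case: xgetP => [d _ //|/(_ c)]; case; eexists; exact: cp_id.
have rep_eq c d f : cp_mor r c d f -> rep c = rep d.
  move=> fm; rewrite /rep (_ : [set _ | _] = [set e | exists f, cp_mor r e d f]).
    rewrite /xget; case: pselect => // -[]; exists c; apply/asboolP.
    by exists f.
  apply/seteqP; split=> [e [g gm]|e [g gm]]; eexists; first exact: cp_comp gm fm.
  by apply: cp_comp gm (cp_inv r0 fm).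
have Lx c : exists l : seq (partial_map X), uniq l /\ forall f, cp_mor r (rep c) c f <-> f \in l.
  by have [l ul lP] := finite_uniq_seq (cp_finite r0 (rep c) c); exists l.
have [L LP] := choice Lx.
pose u m : G := xget 0 [set u | m%:R * u = 1].
have uP c : (size (L c))%:R * u (size (L c)) = 1.
  have [ul lP] := LP c; have [f /lP fl] := repP c.
  have [|v vP] := hdiv (card_uniq_seq ul lP); first by move=> /size0nil l0; rewrite l0 in fl.
  by rewrite /u; case: xgetP => [w -> //|/(_ v)].
have [b0 b0P] := choice Qe.
pose b c : simplex X n -> V := u (size (L c)) *: \sum_(g <- L c) gpush (fn g) (b0 (rep c)).
exists b; split=> [c|c d f fm].
  have [ul lP] := LP c; have [f /lP fl] := repP c.
  pose e g := gpush (fn g) (b0 (rep c)).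
  have Qg g : g \in L c -> Q c (e g) by move=> /lP gm; exact: Qp gm (b0P _).
  (* The number of morphisms times [u] is 1, so the mean is an affine combination. It is written as
     one term plus multiples of differences, to which the closure property [Qa] applies one at a
     time. *)
  have -> : b c = e f + \sum_(g <- L c) u (size (L c)) *: (e g - e f).
    rewrite -scaler_sumr sumrB scalerBr big_const_seq count_predT iter_addr_0.
    by rewrite -scaler_nat scalerA mulrC uP scale1r addrC subrK.
  have Qs l x : {subset l <= L c} -> Q c x ->
      Q c (x + \sum_(g <- l) u (size (L c)) *: (e g - e f)).
    elim: l x => [|g l IHl] x lL Qx; first by rewrite big_nil addr0.
    rewrite big_cons addrA; apply: IHl; first by move=> h hl; apply: lL; rewrite inE hl orbT.
    by apply: Qa => //; apply: Qg => //; apply: lL; rewrite mem_head.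
  by apply: Qs => //; exact: Qg.
have [uc cP] := LP c; have [ud dP] := LP d; have re := rep_eq _ _ _ fm.
have fb g x : cp_mor r x c g -> finc (gpush (fn g) (b0 x)).
  by move=> gm; apply: finc_gpush; exact: Qf (b0P _).
(* Composition with [f] is a bijection between the morphisms from the representative to [c] and
   those to [d], so the mean at [c] is pushed to the mean at [d]. *)
have pL : perm_eq (map (Defs.pcomp f) (L c)) (L d).
  have pinvK (h : partial_map X) : Defs.pinv (Defs.pinv h) = h by apply/seteqP; split=> -[].
  apply: uniq_perm => //.
    rewrite map_inj_in_uniq// => g g' /cP gm /cP gm' e.
    by rewrite -(pcomp_mor_inv gm fm) e (pcomp_mor_inv gm' fm).
  move=> h; apply/mapP/idP => [[g /cP gm ->]|/dP hm].
    by apply/dP; rewrite -re; exact: cp_comp gm fm.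
  exists (Defs.pcomp (Defs.pinv f) h).
    by apply/cP; rewrite re; exact: cp_comp hm (cp_inv r0 fm).
  by have := pcomp_mor_inv hm (cp_inv r0 fm); rewrite pinvK.
rewrite /b; have -> : size (L c) = size (L d) by rewrite -(perm_size pL) size_map.
have fbb g : finc (gpush (fn g) (b0 (rep c))) by apply: finc_gpush; exact: Qf (b0P _).
rewrite gpushZ; last exact: finc_sum.
rewrite gpush_sum//; congr (_ *: _).
rewrite -(perm_big _ pL) /= big_map; apply: eq_big_seq => g /cP gm.
rewrite (gpush_comp _ (Qf _ _ (b0P _)) (Qc _ _ (b0P _)) (mor_continuous r0 gm)) -re.
apply: gpush_eq => s x /(Qc _ _ (b0P _)) sc /sc cx /=; apply/esym/fn_eq.
  exact: (mor_isometric r0 (cp_comp r0 gm fm)).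
exists (fn g x); split=> /=; first exact: (mor_fn r0 gm).
by apply: (mor_fn r0 fm); exact: (mor_fn_range r0 gm).
Qed.
End Averaging.

Section Vanishing.
Variables (R : realType) (X : metricType R) (P : pattern X) (C : cellular_pattern X).
Variables (G : comPzRingType) (V : lmodType G).
Hypothesis hCP : represents C P.
Hypothesis hG : exists2 r0 : R, 0 < r0 & forall r : R, r0 <= r ->
  forall (k : nat) (c d : cell C k) (m : nat),
    (cp_mor r c d #= `I_m)%card -> m <> 0%N -> has_division G m.
Local Notation closed_cell := (@closed_cell R X C _).
Local Notation frontier := (@cell_frontier R X C _).
Local Notation Sk := (Sk C).
Local Notation eqv := (@eqv R X P G V _).
Variable k : nat.

Lemma invariant_le (r r' : R) n (b : cell C k -> simplex X n -> V) : 0 < r -> r <= r' ->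
  invariant r b -> invariant r' b.
Proof. by move=> r0 rr bi c d f fm; apply: bi; exact: cp_le fm. Qed.

Lemma gpush_frontier r (c d : cell C k) f n (b : simplex X n -> V) : 0 < r -> cp_mor r c d f ->
  cin (frontier c) b -> cin (frontier d) (gpush (fn f) b).
Proof.
move=> r0 fm bc; have bc' : cin (closed_cell c) b by apply: cin_sub bc; exact: frontier_sub.
apply: (cin_gpush bc' (mor_continuous r0 fm)) => s x bs sx.
by apply/(mor_frontier r0 fm (mor_fn r0 fm (bc' _ bs _ sx))); exact: bc bs _ sx.
Qed.

Lemma gpush_closed r (c d : cell C k) f n (b : simplex X n -> V) : 0 < r -> cp_mor r c d f ->
  cin (closed_cell c) b -> cin (closed_cell d) (gpush (fn f) b).
Proof.
move=> r0 fm bc; apply: (cin_gpush bc (mor_continuous r0 fm)) => s x bs sx.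
by apply: (mor_fn_range r0 fm); exact: bc bs _ sx.
Qed.

(** The fillings of [y c] modulo the frontier form an affine space, and morphisms preserve these
    spaces because [y] is invariant. Averaging turns arbitrary fillings into an invariant family;
    the radius is large enough both for that invariance and for division. *)
Lemma family_bounding n (y : cell C k -> simplex X n -> V) r1 : 0 < r1 -> invariant r1 y ->
  (forall c, finc (y c) /\ proper c (y c)) ->
  (forall c, relbound (closed_cell c) (frontier c) (y c)) ->
  exists (e : simplex X n.+1 -> V) l, [/\ eqv e, cin (Sk k.+1) e, eqv l, cin (Sk k) l &
    asm y = bdry e + l].
Proof.
move=> r10 yi yP yb; have [r2 r20 r2P] := hG; set r := Num.max r1 r2.
have r0 : 0 < r by rewrite lt_max r10.
have {}yi : invariant r y by apply: invariant_le yi => //; rewrite le_max lexx.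
pose Q (c : cell C k) (b : simplex X n.+1 -> V) :=
  [/\ finc b, cin (closed_cell c) b & cin (frontier c) (y c - bdry b)].
have [||||||b [bQ bi]] := @average R X C G V k r r0 _ n.+1 Q.
- by move=> c d m; apply: r2P; rewrite le_max lexx orbT.
- by move=> c b [].
- by move=> c b [].
- move=> c; have [b [l [fb cb fl cl e]]] := yb c; exists b; split=> //.
  by rewrite e addrC addKr.
- move=> c d f b fm [fb cb fy]; split; [exact: finc_gpush|exact: gpush_closed fm cb|].
  rewrite -(yi _ _ _ fm) (bdry_gpush fb cb (mor_continuous r0 fm)) -gpushB//; last exact: finc_bdry.
    exact: gpush_frontier fm fy.
  by case: (yP c).
- move=> c a b b1 b2 [fb cb fy] [fb1 cb1 fy1] [fb2 cb2 fy2]; split.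
  + by apply: fincD => //; apply: fincZ; exact: fincB.
  + by apply: cinD => //; apply: cinZ; exact: cinB.
  + rewrite bdryD ?bdryZ ?bdryB//; [|exact: fincB|by apply: fincZ; exact: fincB].
    have -> : y c - (bdry b + a *: (bdry b1 - bdry b2)) =
        (y c - bdry b) + a *: ((y c - bdry b1) - (y c - bdry b2)).
      rewrite opprD addrA -scalerN opprB; congr (_ + _ *: _).
      by rewrite opprB [RHS]addrC addrA subrK.
    by apply: cinD => //; apply: cinZ; exact: cinB.
have fb c : finc (b c) by case: (bQ c).
have cb c : cin (closed_cell c) (b c) by case: (bQ c).
have eb : eqv (asm b) by exact: asm_eqv r0 fb cb bi.
have ey : eqv (asm y).
  apply: (asm_eqv hCP r0) => // c; first by case: (yP c).
  by apply: proper_cin; case: (yP c).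
have [rad cr] := cp_bounded C.
exists (asm b), (asm y - bdry (asm b)); split=> //.
- exact: asm_cin.
- by apply: eqvB => //; exact: (eqv_bdry cr eb).
- move=> u; rewrite [X in X != 0](_ : _ = asm y u - bdry (asm b) u)// => nz.
  apply: contrapT => nu; have [[c uc]|nc] := pselect (exists c : cell C k, range u `<=` closed_cell c).
    move: nz; rewrite (asm_in _ uc nu) (asm_bdry (cb c) uc nu) => nz.
    case: (bQ c) => _ _ /(_ u nz) uf; apply: nu; apply: subset_trans uf _; exact: frontier_Sk.
  move/eqP: nz; apply; rewrite asm_bdry0//; last by move=> c uc; apply: nc; exists c.
  rewrite subr0; apply/eqP/negPn/negP => /asm_neq0[c [uc _ _]]; apply: nc; by exists c.
- by rewrite addrC subrK.
Qed.
End Vanishing.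

(** * The coefficient of a relative cycle at a cell *)

Section Theta.
Variables (R : realType) (X : metricType R) (C : cellular_pattern X).
Variables (G : comPzRingType) (V : lmodType G).
Local Notation closed_cell := (@closed_cell R X C _).
Local Notation open_cell := (@open_cell R X C _).
Local Notation frontier := (@cell_frontier R X C _).
Local Notation Sk := (Sk C).

Lemma relbound_sub (A : zmodType) (Y B Y' B' : set X) n (z : simplex X n -> A) : Y `<=` Y' -> B `<=` B' ->
  relbound Y B z -> relbound Y' B' z.
Proof.
move=> YY BB [b [l [fb cb fl cl e]]]; by exists b, l; split=> //; [exact: cin_sub YY cb|exact: cin_sub BB cl].
Qed.

Lemma relboundZ (Y B : set X) n a (z : simplex X n -> V) : relbound Y B z -> relbound Y B (a *: z).
Proof. by move=> /(relbound_morph ( *:%R a)). Qed.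

Lemma relbound0 (A : zmodType) (Y B : set X) n : relbound Y B (0 : simplex X n -> A).
Proof. by apply: relbound_in; [exact: finc0|exact: cin0]. Qed.

Lemma relbound_sum (A : zmodType) (Y B : set X) n I (r : seq I) (F : I -> simplex X n -> A) :
  (forall i, relbound Y B (F i)) -> relbound Y B (\sum_(i <- r) F i).
Proof.
move=> rF; elim: r => [|i r IHr]; first by rewrite big_nil; exact: relbound0.
by rewrite big_cons; exact: relboundD.
Qed.

Section Truncation.
Variables (k : nat) (d : cell C k).

(* Discards the simplices away from d, which leaves finitely many. *)
Definition trunc n (z : simplex X n -> V) : simplex X n -> V :=
  restr (fun s : simplex X n => range s `&` closed_cell d !=set0) z.

Local Notation Y := (Sk k.+1).
Local Notation B := (Sk k.+1 `\` open_cell d).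

Lemma trunc_finc n (z : simplex X n -> V) : locally_finite z -> finc (trunc z).
Proof.
move=> fz; apply: sub_finite_set (fz _ (@closed_cell_compact _ _ _ _ d)) => s sz.
by have [? ?] := restr_neq0 sz.
Qed.

Lemma trunc_cin n (z : simplex X n -> V) Z : cin Z z -> cin Z (trunc z).
Proof. exact: cin_restr. Qed.

Lemma trunc_meet n (z : simplex X n -> V) (s : simplex X n) : range s `&` open_cell d !=set0 ->
  trunc z s = z s.
Proof.
move=> [x [sx dx]]; rewrite /trunc /restr asboolT//; exists x; split=> //.
exact: open_cell_sub.
Qed.

Lemma trunc_lin n a (z w : simplex X n -> V) : trunc (a *: z + w) = a *: trunc z + trunc w.
Proof.
apply/funext => s; rewrite !fct_lin /trunc /restr; case: ifP => // _.
by rewrite scaler0 addr0.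
Qed.

Lemma truncD n (z w : simplex X n -> V) : trunc (z + w) = trunc z + trunc w.
Proof. by have := trunc_lin 1 z w; rewrite !scale1r. Qed.

Lemma bdry_meet n (z w : simplex X n.+1 -> V) (u : simplex X n) : range u `&` open_cell d !=set0 ->
  (forall s : simplex X n.+1, range s `&` open_cell d !=set0 -> z s = w s) -> bdry z u = bdry w u.
Proof.
move=> [x [ux dx]] zw; apply: bdry_local => s us; apply: zw.
by exists x; split=> //; exact: us.
Qed.

Lemma relbound_meet n (z w : simplex X n -> V) : finc z -> finc w -> cin Y z -> cin Y w ->
  (forall s : simplex X n, range s `&` open_cell d !=set0 -> z s = w s) -> relbound Y B (z - w).
Proof.
move=> fz fw cz cw zw; apply: relbound_in; first exact: fincB.
move=> s nz x sx; split; first exact: cinB nz _ sx.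
move=> dx; move/eqP: nz; apply; rewrite [LHS](_ : _ = z s - w s)// zw ?subrr//.
by exists x.
Qed.

(** Truncation does not commute with the boundary, but the two orders agree on simplices that meet
    the open cell [d], and the other simplices lie in the subspace. *)
Lemma trunc_bdry n (b : simplex X n.+1 -> V) : locally_finite b -> cin Y b ->
  relbound Y B (trunc (bdry b)).
Proof.
move=> fb cb; rewrite -[trunc _](subrK (bdry (trunc b))).
have ft := trunc_finc fb; apply: relboundD; last first.
  by apply: relbound_bdry => //; exact: trunc_cin.
apply: relbound_meet.
- by apply: trunc_finc; exact: (lf_bdry C).
- exact: finc_bdry.
- by apply: trunc_cin; exact: cin_bdry_lf.
- by apply: cin_bdry => //; exact: trunc_cin.
- move=> u ud; rewrite trunc_meet//; apply: bdry_meet => // s sd.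
  by rewrite trunc_meet.
Qed.

Lemma trunc_low n (l : simplex X n -> V) : locally_finite l -> cin (Sk k) l ->
  relbound Y B (trunc l).
Proof.
move=> fl cl; apply: relbound_in; first exact: trunc_finc.
move=> s sl x sx; have kx := trunc_cin cl sl sx; split; first exact: Sk_le kx.
by move=> /(Sk_open_cell (leqnn k)).
Qed.

(* By excision a cycle of the k-skeleton modulo the (k-1)-skeleton is, away from the other cells,
   homologous to a unique multiple of the characteristic map of d. *)
Definition theta (z : simplex X k -> V) : V :=
  xget 0 [set m | relbound Y B (trunc z - single (cmap d) m)].

Lemma theta_eq z a : relbound Y B (trunc z - single (cmap d) a) -> theta z = a.
Proof.
move=> za; rewrite /theta; case: xgetP => [m _ zm|/(_ a)//].
exact: cellh_uniq (@skeleton_homology R X C V k d) zm za.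
Qed.

Lemma trunc_bd_in n (z : simplex X n -> V) : locally_finite z -> cin Y z -> bd_in (Sk k) z ->
  bd_in B (trunc z).
Proof.
case: n z => // n z fz cz bz u /= uz x ux; have ft := trunc_finc fz.
split; first exact: (cin_bdry ft (trunc_cin cz) uz).
move=> dx; have : bdry z u != 0.
  rewrite -(bdry_meet (z := trunc z)) //; first by exists x.
  by move=> s sd; rewrite trunc_meet.
by move=> /bz/(_ _ ux); exact: Sk_open_cell dx.
Qed.

Lemma thetaP z : locally_finite z -> cin Y z -> bd_in (Sk k) z ->
  relbound Y B (trunc z - single (cmap d) (theta z)).
Proof.
move=> fz cz bz.
have [|||m mP] := cellh_gen (@skeleton_homology R X C V k d) (z := trunc z).
- exact: trunc_finc.
- exact: trunc_cin.
- exact: trunc_bd_in.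
by rewrite (theta_eq mP).
Qed.

Lemma theta_lin a z w : locally_finite z -> cin Y z -> bd_in (Sk k) z ->
  locally_finite w -> cin Y w -> bd_in (Sk k) w -> theta (a *: z + w) = a *: theta z + theta w.
Proof.
move=> fz cz bz fw cw bw; apply: theta_eq; rewrite trunc_lin.
have -> : single (cmap d) (a *: theta z + theta w) =
    a *: single (cmap d) (theta z) + single (cmap d) (theta w) :> (simplex X k -> V).
  by apply/funext => s; rewrite fct_lin /single; case: eqP => // _; rewrite scaler0 addr0.
have -> (x y x' y' : simplex X k -> V) : a *: x + y - (a *: x' + y') = a *: (x - x') + (y - y').
  by rewrite opprD addrACA scalerBr.
by apply: relboundD; [apply: relboundZ|]; exact: thetaP.
Qed.

(** Boundaries from the skeleton and chains of the lower skeleton are invisible to [theta], so the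
    coefficient can be computed on the first summand, for which an assembled family will be
    taken. *)
Lemma theta_split (y : simplex X k -> V) (e : simplex X k.+1 -> V) (l : simplex X k -> V) a :
  relbound Y B (trunc y - single (cmap d) a) -> locally_finite e -> cin Y e ->
  locally_finite l -> cin (Sk k) l -> theta (y + bdry e + l) = a.
Proof.
move=> ya fe ce fl cl; apply: theta_eq; rewrite !truncD addrAC [_ + trunc (bdry e) - _]addrAC.
by apply: relboundD; [apply: relboundD => //; exact: trunc_bdry|exact: trunc_low].
Qed.

(** Simplices of the family that meet the open cell [d] all come from [y d], so the coefficient at
    [d] is the class of [y d] in the closed cell. *)
Lemma trunc_asm (y : cell C k -> simplex X k -> V) a : (forall c, finc (y c)) ->
  cin (closed_cell d) (y d) ->
  relbound (closed_cell d) (frontier d) (y d - single (cmap d) a) ->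
  relbound Y B (trunc (asm y) - single (cmap d) a).
Proof.
move=> fy cd ya; rewrite -[trunc _](subrK (y d)) -addrA.
have dY : closed_cell d `<=` Y by exact: closed_cell_SkS.
apply: relboundD; last first.
  apply: relbound_sub ya => // x fx; split; first by apply: dY; exact: frontier_sub.
  by move=> /(Sk_open_cell (leqnn k)); apply; exact: frontier_Sk fx.
apply: relbound_meet => //.
- by apply: trunc_finc; exact: asm_lf.
- by apply: trunc_cin; exact: asm_cin.
- exact: cin_sub dY cd.
move=> s sd; rewrite trunc_meet//; have [x [sx dx]] := sd.
have nS : ~ range s `<=` Sk k by move=> /(_ _ sx); exact: Sk_open_cell dx.
have [sc|nsc] := pselect (range s `<=` closed_cell d); first exact: asm_in.
have -> : y d s = 0 by apply/eqP/negPn/negP => /cd.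
apply/eqP/negPn/negP => /asm_neq0[c [sc _ _]]; apply: nsc.
by rewrite -(closed_cell_disjointk (sc _ sx) dx).
Qed.
End Truncation.

Section Pattern.
Variable P : pattern X.
Hypothesis hCP : represents C P.
Hypothesis hG : exists2 r0 : R, 0 < r0 & forall r : R, r0 <= r ->
  forall (k : nat) (c d : cell C k) (m : nat),
    (cp_mor r c d #= `I_m)%card -> m <> 0%N -> has_division G m.
Local Notation eqv := (@eqv R X P G V _).

Lemma relbound_cell k (c : cell C k) (y : simplex X k -> V) : finc y -> cin (closed_cell c) y ->
  bd_in (frontier c) y -> exists a, relbound (closed_cell c) (frontier c) (y - single (cmap c) a).
Proof. by move=> fy cy by'; exact: (cellh_gen (@closed_cell_homology R X C V k c)). Qed.

(** Outside degree k each member of the family bounds in its cell modulo the frontier, and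
    [family_bounding] makes the fillings equivariant. *)
Lemma vanish n k (z : simplex X n -> V) : n <> k -> eqv z -> cin (Sk k.+1) z -> bd_in (Sk k) z ->
  exists (e : simplex X n.+1 -> V) l, [/\ eqv e, cin (Sk k.+1) e, eqv l, cin (Sk k) l &
    z = bdry e + l].
Proof.
move=> nk ez cz bz; have [y [e [l [[ee ce] [el cl] -> yP [r r0 yi]]]]] := cell_reduction hCP ez cz bz.
have [rad cr] := cp_bounded C.
have [||e' [l' [ee' ce' el' cl' ->]]] := family_bounding hCP hG r0 yi.
- by move=> c; case: (yP c).
- move=> c; have [fy py by'] := yP c.
  by apply: (cellh_vanish (@closed_cell_homology R X C V k c)) => //; exact: proper_cin.
exists (e' + e), (l' + l); split; [exact: eqvD|exact: cinD|exact: eqvD|exact: cinD|].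
have [[fe' _] [fe _]] := conj ee' ee.
by rewrite (bdry_lfD C)// -!addrA; congr (_ + _); rewrite addrCA.
Qed.

(** The coefficient at [c] is the class of [y c] in its cell; if all coefficients are zero, every
    member of the family bounds. *)
Lemma theta_kernel k (z : simplex X k -> V) : eqv z -> cin (Sk k.+1) z -> bd_in (Sk k) z ->
  (forall d, theta d z = 0) ->
  exists (e : simplex X k.+1 -> V) l, [/\ eqv e, cin (Sk k.+1) e, eqv l, cin (Sk k) l &
    z = bdry e + l].
Proof.
move=> ez cz bz tz.
have [y [e [l [[ee ce] [el cl] zE yP [r r0 yi]]]]] := cell_reduction hCP ez cz bz.
have [[fe _] [fl _]] := conj ee el.
have fy c : finc (y c) by case: (yP c).
have [||e' [l' [ee' ce' el' cl' yE]]] := family_bounding hCP hG r0 yi.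
- by move=> c; case: (yP c).
- move=> c; have [_ py by'] := yP c; have cy := proper_cin py.
  have [a ya] := relbound_cell (fy c) cy by'.
  have : theta c z = a by rewrite zE; apply: theta_split => //; exact: trunc_asm.
  by rewrite tz => a0; move: ya; rewrite -a0 single0 subr0.
have [fe' _] := ee'.
exists (e' + e), (l' + l); split; [exact: eqvD|exact: cinD|exact: eqvD|exact: cinD|].
by rewrite zE yE (bdry_lfD C)// -!addrA; congr (_ + _); rewrite addrCA.
Qed.

(** By invariance the class of [y d] is the push forward of that of [y c], and push forward
    multiplies the generator by the degree. *)
Lemma theta_equivariant k (z : simplex X k -> V) : eqv z -> cin (Sk k.+1) z -> bd_in (Sk k) z ->
  exists2 r, 0 < r & forall (c d : cell C k) f, cp_mor r c d f ->
    theta d z = theta c z *~ cell_degree f c d.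
Proof.
move=> ez cz bz.
have [y [e [l [[ee ce] [el cl] zE yP [r r0 yi]]]]] := cell_reduction hCP ez cz bz.
have [[fe _] [fl _]] := conj ee el.
have fy c : finc (y c) by case: (yP c).
have cy c : cin (closed_cell c) (y c) by apply: proper_cin; case: (yP c).
have tE c a : relbound (closed_cell c) (frontier c) (y c - single (cmap c) a) -> theta c z = a.
  by move=> ya; rewrite zE; apply: theta_split => //; exact: trunc_asm.
exists r => // c d f fm; have [_ _ by'] := yP c.
have [a ya] := relbound_cell (fy c) (cy c) by'.
rewrite (tE _ _ ya); apply: tE; rewrite -(yi _ _ _ fm).
have := relbound_degree r0 a fm => D.
have := relbound_gpush (@frontier_sub R X C k c) (mor_continuous r0 fm)
  (fun x => mor_fn_range r0 fm (x := x)) _ ya => /(_ (frontier d)) E.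
rewrite -[gpush _ _](subrK (gpush (fn f) (single (cmap c) a))) -addrA; apply: relboundD => //.
rewrite -gpushB//; last exact: finc_single.
apply: E => x fx; apply/(mor_frontier r0 fm (mor_fn r0 fm (frontier_sub fx))); exact: fx.
Qed.

Lemma bd_in_affine (B : set X) n a (b b1 b2 : simplex X n -> V) : finc b -> finc b1 -> finc b2 ->
  bd_in B b -> bd_in B b1 -> bd_in B b2 -> bd_in B (b + a *: (b1 - b2)).
Proof.
case: n b b1 b2 => // n b b1 b2 fb fb1 fb2 /= bb bb1 bb2.
rewrite bdryD ?bdryZ ?bdryB//; [|exact: fincB|by apply: fincZ; exact: fincB].
by apply: cinD => //; apply: cinZ; exact: cinB.
Qed.

Lemma asm_bd_in k n (b : cell C k -> simplex X n -> V) : (forall c, cin (closed_cell c) (b c)) ->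
  (forall c, bd_in (frontier c) (b c)) -> bd_in (Sk k) (asm b).
Proof.
case: n b => // n b cb bb u /= nz; apply: contrapT => nu.
have [[c uc]|nc] := pselect (exists c : cell C k, range u `<=` closed_cell c).
  move: nz; rewrite (asm_bdry (cb c) uc nu) => nz.
  by apply: nu; apply: subset_trans (bb c u nz) _; exact: frontier_Sk.
by move/eqP: nz; apply; apply: asm_bdry0 => // c uc; apply: nc; exists c.
Qed.

(** The relative cycles of [c] in the class [s c] form an affine space, and the equivariance of [s]
    means that morphisms preserve these spaces; averaging selects an invariant family. *)
Lemma theta_surjective k (s : cell C k -> V) r1 : 0 < r1 ->
  (forall (c d : cell C k) f, cp_mor r1 c d f -> s d = s c *~ cell_degree f c d) ->
  exists z, [/\ eqv z, cin (Sk k.+1) z, bd_in (Sk k) z & forall d, theta d z = s d].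
Proof.
move=> r10 si; have [r2 r20 r2P] := hG; set r := Num.max r1 r2.
have r0 : 0 < r by rewrite lt_max r10.
have r1r : r1 <= r by rewrite le_max lexx.
pose Q (c : cell C k) (b : simplex X k -> V) := [/\ finc b, cin (closed_cell c) b,
  bd_in (frontier c) b & relbound (closed_cell c) (frontier c) (b - single (cmap c) (s c))].
have [||||||b [bQ bi]] := @average R X C G V k r r0 _ k Q.
- by move=> c d m; apply: r2P; rewrite le_max lexx orbT.
- by move=> c b [].
- by move=> c b [].
- move=> c; exists (single (cmap c) (s c)); split.
  + exact: finc_single.
  + exact: cin_single.
  + exact: bd_in_cell.
  + by rewrite subrr; exact: relbound0.
- move=> c d f b fm [fb cb bb rb].
  have ff x : frontier c x -> frontier d (fn f x).
    by move=> fx; apply/(mor_frontier r0 fm (mor_fn r0 fm (frontier_sub fx))).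
  split; [exact: finc_gpush|exact: gpush_closed fm cb| |].
    exact: (bd_in_gpush (@frontier_sub R X C k c) (mor_continuous r0 fm)).
  have := relbound_gpush (@frontier_sub R X C k c) (mor_continuous r0 fm)
    (fun x => mor_fn_range r0 fm (x := x)) ff rb.
  rewrite gpushB//; last exact: finc_single.
  move=> E; rewrite (si _ _ _ (cp_le r10 r1r fm)).
  rewrite -[gpush _ _](subrK (gpush (fn f) (single (cmap c) (s c)))) -addrA.
  by apply: relboundD => //; exact: (relbound_degree r0 _ fm).
- move=> c a b b1 b2 [fb cb bb rb] [fb1 cb1 bb1 rb1] [fb2 cb2 bb2 rb2]; split.
  + by apply: fincD => //; apply: fincZ; exact: fincB.
  + by apply: cinD => //; apply: cinZ; exact: cinB.
  + exact: bd_in_affine.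
  + rewrite addrAC; apply: relboundD => //; apply: relboundZ.
    rewrite -[b1](subrK (single (cmap c) (s c))) -addrA.
    by apply: relboundD => //; rewrite -opprB; exact: relboundN.
have fb c : finc (b c) by case: (bQ c).
have cb c : cin (closed_cell c) (b c) by case: (bQ c).
exists (asm b); split.
- exact: asm_eqv r0 fb cb bi.
- exact: asm_cin.
- by apply: asm_bd_in => // c; case: (bQ c).
- by move=> d; apply: theta_eq; apply: trunc_asm => //; case: (bQ d).
Qed.

(** The connecting map is the cellular boundary: at [d] only the cells whose closure meets the open
    cell count, and each member of the family may be replaced by a multiple of the characteristic
    map, for which the incidence numbers are defined. *)
Lemma theta_bdry k (z : simplex X k.+1 -> V) (d : cell C k) : eqv z -> cin (Sk k.+2) z ->
  bd_in (Sk k.+1) z ->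
  theta d (bdry z) = \sum_(c \in [set c | closed_cell c `&` open_cell d !=set0])
    theta c z *~ incidence c d.
Proof.
move=> ez cz bz.
have [y [e [l [[ee ce] [el cl] zE yP _]]]] := cell_reduction hCP ez cz bz.
have [[fe _] [fl _]] := conj ee el.
have fy c : finc (y c) by case: (yP c).
have py c : proper c (y c) by case: (yP c).
have cy c : cin (closed_cell c) (y c) by exact: proper_cin.
have tE c a : relbound (closed_cell c) (frontier c) (y c - single (cmap c) a) -> theta c z = a.
  by move=> ya; rewrite zE; apply: theta_split => //; exact: trunc_asm.
have fa : locally_finite (asm y) by exact: asm_lf.
have bE : bdry z = bdry (asm y) + bdry l + 0.
  rewrite addr0 zE (bdry_lfD C)//; last by apply: (lfD) => //; exact: (lf_bdry C).
  by rewrite (bdry_lfD C)//; [rewrite (bdry_bdry_lf C)// addr0|exact: (lf_bdry C)].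
have [S uS SP] := finite_uniq_seq (cofaces_finite d).
rewrite bE; apply: theta_split => //; last 2 first.
- exact: (lf_finc (finc0 _ _)).
- exact: cin0.
(* A finite part of the family, which agrees with the assembled chain on all simplices that meet the
   open cell [d]. *)
pose w := \sum_(c <- S) y c.
have fw : finc w by exact: finc_sum.
have cw : cin (Sk k.+2) w.
  by apply: cin_sum => c _; apply: cin_sub (cy c); exact: closed_cell_SkS.
have byc c : cin (Sk k.+1) (bdry (y c)).
  by case: (yP c) => _ _ b; apply: cin_sub b; exact: frontier_Sk.
have bw : bdry w = \sum_(c <- S) bdry (y c).
  rewrite /w; elim: (S) => [|c S' IHS]; first by rewrite !big_nil bdry0.
  by rewrite !big_cons bdryD ?IHS//; exact: finc_sum.
have cbw : cin (Sk k.+1) (bdry w) by rewrite bw; apply: cin_sum.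
rewrite -[trunc _ _](subrK (bdry w)) -addrA; apply: relboundD.
  apply: relbound_meet => //.
  - by apply: trunc_finc; exact: (lf_bdry C).
  - exact: finc_bdry.
  - apply: trunc_cin => u nz; have [s us as0] : exists2 s : simplex X k.+1, range u `<=` range s & asm y s != 0.
      apply: contrapT => ns; move/eqP: nz; apply; rewrite (bdry_local (e := 0)) ?bdry0// => s us.
      by apply/eqP/negPn/negP => nz; apply: ns; exists s.
    apply: contrapT => nu; have [c [sc _ _]] := asm_neq0 as0.
    have uc := subset_trans us sc.
    by move: nz; rewrite (asm_bdry (cy c) uc nu) => /byc.
  - move=> u ud; rewrite trunc_meet//; apply: bdry_meet ud _ => s [x [sx dx]].
    have inS c : range s `<=` closed_cell c -> c \in S.
      by move=> sc; apply/SP; exists x; split=> //; exact: sc.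
    have wE c : c \in S -> (forall c', y c' s != 0 -> c' = c) -> w s = y c s.
      move=> cS uniqc; rewrite /w fct_sumE (bigD1_seq c)//= big1_seq ?addr0// => c' /andP[c'c _].
      by apply/eqP/negPn/negP => /uniqc e'; rewrite e' eqxx in c'c.
    have [e0|nz] := eqVneq (asm y s) 0; last first.
      have [c [sc nS ->]] := asm_neq0 nz; rewrite (wE c)//; first exact: inS.
      by move=> c' /py[sc' _]; exact: cell_uniq sc' sc nS.
    rewrite e0 /w fct_sumE big1_seq// => c _; apply/eqP/negPn/negP => nz.
    have [sc nS] := py _ _ nz; move: nz; rewrite -(asm_in y sc nS) e0 eqxx.
    by [].
have [a aP] := choice (fun c => relbound_cell (fy c) (cy c) (match yP c with And3 _ _ b => b end)).
rewrite (_ : \sum_(c \in _) _ = \sum_(c <- S) a c *~ incidence c d); last first.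
  rewrite fsum_set (@fsumE _ _ S)// => [|c].
    by apply: eq_big_seq => c /SP cd; rewrite asboolT// (tE _ _ (aP c)).
  by case: asboolP => [/SP//|_]; rewrite eqxx.
have -> : single (cmap d) (\sum_(c <- S) a c *~ incidence c d) =
    \sum_(c <- S) single (cmap d) (a c *~ incidence c d) :> (simplex X k -> V).
  by elim: (S) => [|c S' IHS]; rewrite ?big_nil ?single0// !big_cons singleD IHS.
(* [y c] and the multiple of the characteristic map differ by a boundary and a chain of the
   frontier. Taking boundaries leaves that of the latter, which bounds in [Sk k.+1]. *)
rewrite bw -sumrB; apply: relbound_sum => c.
rewrite -[bdry (y c)](subrK (bdry (single (cmap c) (a c)))) -addrA; apply: relboundD; last first.
  exact: relbound_incidence.
rewrite -bdryB//; last exact: finc_single.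
have [b [l' [fb cb fl' cl' ->]]] := aP c.
rewrite bdryD ?bdry_bdry//; last exact: finc_bdry.
rewrite add0r; apply: relbound_bdry => //; apply: cin_sub cl'; exact: frontier_Sk.
Qed.
End Pattern.
End Theta.

(** * The skeletal filtration *)

Section QuotientEquality.
Variables (G : pzRingType) (A : lmodType G) (S : submodule A).

Lemma quotm_pi_eq (x y : A) : quotm_pi S x = quotm_pi S y <-> subm_set S (x - y).
Proof.
have E := Quotient.idealrBE (subm_pred S) x y.
split=> [xy|Sxy]; last by apply/eqP; rewrite -E; apply/asboolP.
by apply/asboolP; rewrite -[`[< _ >]]/(x - y \in subm_pred S) E; apply/eqP.
Qed.

Lemma quotm_pi_lin a (x y : A) : a *: quotm_pi S x + quotm_pi S y = quotm_pi S (a *: x + y).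
Proof. by rewrite -quotm_piD -quotm_scaleE. Qed.

End QuotientEquality.

Section QuotientRelation.
Variables (G : pzRingType) (A B : lmodType G) (S : submodule A) (T : submodule B).
Variable E : A -> B -> Prop.
Hypotheses (E_lin : forall a x y x' y', E x y -> E x' y' -> E (a *: x + x') (a *: y + y'))
  (E_total : forall x, exists y, E x y) (E_onto : forall y, exists x, E x y)
  (E_sub : forall x y, E x y -> subm_set S x <-> subm_set T y).

(** The map is chosen pointwise among classes of related elements; since the relation matches [S]
    with [T] and is linear, the choice does not matter, and the map is linear and injective.
    [E_onto] gives surjectivity. *)
Lemma quotm_iso : exists f : {linear quotm S -> quotm T}, bijective f.
Proof.
have ex (x : quotm S) : exists y, exists x' y', [/\ x = quotm_pi S x', E x' y' & y = quotm_pi T y'].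
  by have [x' ->] := quotm_piP x; have [y' xy] := E_total x'; exists (quotm_pi T y'), x', y'.
have [f fP] := choice ex.
have EB x y x' y' : E x y -> E x' y' -> E (x - x') (y - y').
  by move=> xy xy'; have := E_lin (-1) xy' xy; rewrite !scaleN1r ![- _ + _]addrC.
have eqE x y x' y' : E x y -> E x' y' ->
    quotm_pi S x = quotm_pi S x' <-> quotm_pi T y = quotm_pi T y'.
  by move=> xy xy'; rewrite !quotm_pi_eq; exact: E_sub (EB _ _ _ _ xy xy').
have fE x y : E x y -> f (quotm_pi S x) = quotm_pi T y.
  move=> xy; have [x' [y' [e x'y' ->]]] := fP (quotm_pi S x).
  exact/esym/(eqE _ _ _ _ xy x'y').1.
have flin : linear f.
  move=> a x y; have [x' ->] := quotm_piP x; have [y' ->] := quotm_piP y.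
  have [u xu] := E_total x'; have [v yv] := E_total y'.
  by rewrite quotm_pi_lin (fE _ _ xu) (fE _ _ yv) (fE _ _ (E_lin a xu yv)) -quotm_pi_lin.
pose g : {linear quotm S -> quotm T} := HB.pack f (GRing.isLinear.Build G (quotm S) (quotm T) *:%R f flin).
exists g; rewrite -setTT_bijective; split=> //.
  move=> x y _ _; have [x' ->] := quotm_piP x; have [y' ->] := quotm_piP y.
  have [u xu] := E_total x'; have [v yv] := E_total y'.
  by rewrite /= (fE _ _ xu) (fE _ _ yv) => /(eqE _ _ _ _ xu yv).
move=> y _; have [y' ->] := quotm_piP y; have [x xy] := E_onto y'.
by exists (quotm_pi S x) => //=; exact: fE.
Qed.
End QuotientRelation.

Section SkeletalFiltration.
Variables (R : realType) (X : metricType R) (P : pattern X) (C : cellular_pattern X).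
Variables (G : comPzRingType) (V : lmodType G).
Hypothesis hCP : represents C P.
Hypothesis hG : exists2 r0 : R, 0 < r0 & forall r : R, r0 <= r ->
  forall (k : nat) (c d : cell C k) (m : nat),
    (cp_mor r c d #= `I_m)%card -> m <> 0%N -> has_division G m.
Local Notation closed_cell := (@closed_cell R X C _).
Local Notation open_cell := (@open_cell R X C _).
Local Notation Sk := (Sk C).
Local Notation eqv := (@eqv R X P G V _).

Definition cyc n : (simplex X n -> V) -> Prop :=
  match n return (simplex X n -> V) -> Prop with
  | 0 => fun=> True
  | m.+1 => fun z => bdry z = 0
  end.

Lemma cyc_bd_in n (z : simplex X n -> V) B : cyc z -> bd_in B z.
Proof. by case: n z => // n z /= ->; exact: cin0. Qed.

Lemma cyc_shift n (w : simplex X n -> V) e : locally_finite w -> locally_finite e ->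
  cyc w <-> cyc (w + bdry e).
Proof.
case: n w e => // n w e fw fe /=; rewrite (bdry_lfD C)//; last exact: (lf_bdry C).
by rewrite (bdry_bdry_lf C)// addr0.
Qed.

Lemma bd_in_sub (B B' : set X) n (z : simplex X n -> V) : B `<=` B' -> bd_in B z -> bd_in B' z.
Proof. by case: n z => // n z BB; exact: cin_sub. Qed.

Lemma bd_in_shift n (w : simplex X n -> V) e B : locally_finite w -> locally_finite e ->
  bd_in B (w + bdry e) -> bd_in B w.
Proof.
case: n w e => // n w e fw fe /=; rewrite (bdry_lfD C)//; last exact: (lf_bdry C).
by rewrite (bdry_bdry_lf C)// addr0.
Qed.

Lemma eqv_boundary n (e : simplex X n.+1 -> V) : eqv e -> eqv (bdry e).
Proof. by move=> ee; have [rad cr] := cp_bounded C; exact: (eqv_bdry cr ee). Qed.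

(** Finite dimension puts the chain in some [Sk N]. The layers of cells of dimension greater than n
    have no relative homology in degree n, and [vanish] removes them one by one from the top. *)
Lemma push_down n (z : simplex X n -> V) : eqv z -> bd_in (Sk n) z ->
  exists w e, [/\ eqv w, cin (Sk n.+1) w, eqv e & z = w + bdry e].
Proof.
have [N NS] := Sk_all C.
have step j : forall z : simplex X n -> V, eqv z -> cin (Sk (n.+1 + j)) z -> bd_in (Sk n) z ->
    exists w e, [/\ eqv w, cin (Sk n.+1) w, eqv e & z = w + bdry e].
  elim: j => [|j IHj] {}z ez cz bz.
    exists z, 0; split=> //; [by rewrite addn0 in cz|exact: eqv0|by rewrite bdry0 addr0].
  have [|||e [l [ee ce el cl zE]]] := vanish hCP hG (k := (n.+1 + j)%N) _ ez.
  - by apply/eqP; rewrite -[X in X == _]addn0 addSn -addnS eqn_add2l.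
  - by rewrite -addnS.
  - by apply: bd_in_sub bz; apply: Sk_le; rewrite addSn ltnW// ltnS leq_addr.
  have [[fe _] [fl _]] := conj ee el.
  have bl : bd_in (Sk n) l by apply: (bd_in_shift fl fe); rewrite addrC -zE.
  have [w [e' [ew cw ee' lE]]] := IHj l el cl bl.
  exists w, (e' + e); split=> //; first exact: eqvD.
  by rewrite (bdry_lfD C) ?addrA -?lE 1?addrC//; case: ee'.
move=> ez bz; apply: (step N) => //.
by apply: (cin_sub (@Sk_le _ _ C N _ _)); [exact: leq_addl|rewrite NS => s].
Qed.

(** All cells of [Sk j] have dimension less than n, so each layer has no relative homology in degree
    n; the descent ends at [Sk 0], which is empty. *)
Lemma low_cycle n j (w : simplex X n -> V) : (j <= n)%N -> eqv w -> cyc w -> cin (Sk j) w ->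
  exists2 e, eqv e /\ cin (Sk j) e & w = bdry e.
Proof.
elim: j w => [|j IHj] w jn ew zw cw.
  exists 0; first by split; [exact: eqv0|exact: cin0].
  rewrite bdry0; apply/funext => s; apply/eqP/negPn/negP => /cw ws.
  by have [x /ws[i [c []]]] := simplex_range_neq0 s.
have [|e [l [ee ce el cl wE]]] := vanish hCP hG (k := j) _ ew cw (cyc_bd_in _ zw).
  by apply/eqP; rewrite neq_ltn jn orbT.
have [[fe _] [fl _]] := conj ee el.
have zl : cyc l by rewrite (cyc_shift fl fe) addrC -wE.
have [e' [ee' ce'] lE] := IHj l (ltnW jn) el zl cl.
exists (e + e'); last by rewrite (bdry_lfD C) -?lE//; case: ee'.
by split; [exact: eqvD|apply: cinD => //; apply: cin_sub ce'; exact: Sk_le].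
Qed.

Lemma bdry_bd_in B n (z : simplex X n.+1 -> V) : locally_finite z -> bd_in B (bdry z).
Proof. by case: n z => // n z fz; rewrite /= (bdry_bdry_lf C)//; exact: cin0. Qed.

Lemma cyc_bdry n (z : simplex X n.+1 -> V) : locally_finite z -> cyc (bdry z).
Proof. by case: n z => // n z fz; rewrite /= (bdry_bdry_lf C). Qed.

(** Subtracting the boundary of a chain with coefficients [t] cancels all the coefficients of [w],
    by [theta_bdry]. By [theta_kernel] the rest is a boundary plus a cycle of the lower skeleton,
    and that cycle bounds by [low_cycle]. *)
Lemma cell_bounding n (w : simplex X n -> V) (t : cell C n.+1 -> V) r : 0 < r ->
  (forall (c d : cell C n.+1) f, cp_mor r c d f -> t d = t c *~ cell_degree f c d) ->
  eqv w -> cyc w -> cin (Sk n.+1) w ->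
  (forall d, theta d w = \sum_(c \in [set c | closed_cell c `&` open_cell d !=set0])
     t c *~ incidence c d) ->
  exists2 e, eqv e & w = bdry e.
Proof.
move=> r0 ti ew zw cw tw; have [u [eu cu bu tu]] := theta_surjective hCP hG r0 ti.
have [[fw _] [fu _]] := conj ew eu.
have ebu := eqv_boundary eu.
have w'E : w - bdry u = (-1) *: bdry u + w by rewrite scaleN1r addrC.
have [||||e [l [ee ce el cl E]]] := theta_kernel hCP hG (z := w - bdry u).
- exact: eqvB.
- by apply: cinB.
- apply: cyc_bd_in; have := cyc_shift (e := - u) fw (lfN fu).
  by rewrite (bdry_lfN C)// => <-.
- move=> d; rewrite w'E theta_lin//; first 1 last.
  + by case: ebu.
  + exact: bdry_bd_in.
  + exact: cyc_bd_in.
  rewrite (theta_bdry hCP)// tw scaleN1r addrC; apply/eqP; rewrite subr_eq0.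
  by apply/eqP/eq_fsbigr => c _; rewrite tu.
have [[fe _] [fl _]] := conj ee el.
have zl : cyc l.
  rewrite (cyc_shift fl fe) addrC -E; have := cyc_shift (e := - u) fw (lfN fu).
  by rewrite (bdry_lfN C)// => <-.
have [e' [ee' _] lE] := low_cycle (leqnn n) el zl cl.
exists (e + e' + u); first by apply: eqvD => //; exact: eqvD.
rewrite (bdry_lfD C)//; last by apply: lfD => //; case: ee'.
by rewrite (bdry_lfD C) -?lE -?E ?subrK//; case: ee'.
Qed.

(** [push_down] replaces [e] by a chain of the (n+1)-skeleton with the same boundary; its
    coefficients are the required [t]. *)
Lemma theta_bounding n (e : simplex X n.+1 -> V) : eqv e -> cin (Sk n.+1) (bdry e) ->
  exists2 t : cell C n.+1 -> V,
   exists2 r, 0 < r & forall (c d : cell C n.+1) f, cp_mor r c d f -> t d = t c *~ cell_degree f c d &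
  forall d, theta d (bdry e) = \sum_(c \in [set c | closed_cell c `&` open_cell d !=set0])
     t c *~ incidence c d.
Proof.
move=> ee ce; have [w [a [ew cw ea eE]]] := push_down ee ce.
have [[fw _] [fa _]] := conj ew ea.
have bE : bdry e = bdry w.
  by rewrite eE (bdry_lfD C) ?(bdry_bdry_lf C) ?addr0//; exact: (lf_bdry C).
have bw : bd_in (Sk n.+1) w by rewrite /= -bE.
exists (fun c => theta c w); first exact: (theta_equivariant hCP ew cw bw).
by move=> d; rewrite bE (theta_bdry hCP).
Qed.

Lemma theta0 k (d : cell C k) : theta d (0 : simplex X k -> V) = 0.
Proof.
apply: theta_eq; rewrite single0 subr0 [trunc _ _](_ : _ = 0); first exact: relbound0.
by apply/funext => s; rewrite /trunc /restr; case: ifP.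
Qed.

Definition cell_cyc n : (cell C n -> V) -> Prop :=
  match n return (cell C n -> V) -> Prop with
  | 0 => fun=> True
  | m.+1 => fun t => forall d : cell C m,
      \sum_(c \in [set c | closed_cell c `&` open_cell d !=set0]) t c *~ incidence c d = 0
  end.

(** A chain with coefficients [t] is a cycle only modulo the lower skeleton. As [t] is a cellular
    cycle, the boundary of that chain also bounds within the lower skeleton, and subtracting the
    bounding chain does not change [theta]. *)
Lemma theta_cycle n (t : cell C n -> V) r : 0 < r ->
  (forall (c d : cell C n) f, cp_mor r c d f -> t d = t c *~ cell_degree f c d) ->
  cell_cyc t ->
  exists z, [/\ eqv z, cin (Sk n.+1) z, cyc z & forall d, theta d z = t d].
Proof.
move=> r0 ti tz; have [z [ez cz bz tE]] := theta_surjective hCP hG r0 ti.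
case: n t ti tz z ez cz bz tE => [|n] t ti tz z ez cz bz tE; first by exists z.
have [fz _] := ez.
have [||||e [l [ee ce el cl E]]] := theta_kernel hCP hG (z := bdry z).
- exact: eqv_boundary.
- exact: bz.
- exact: bdry_bd_in.
- move=> d; rewrite (theta_bdry hCP)// -[RHS](tz d).
  by apply: eq_fsbigr => c _; rewrite tE.
have [[fe _] [fl _]] := conj ee el.
have zl : cyc l by rewrite (cyc_shift fl fe) addrC -E; exact: cyc_bdry.
have [e' [ee' ce'] lE] := low_cycle (leqnn n) el zl cl.
have [fe' _] := ee'.
have ca : cin (Sk n.+1) (- (e + e')).
  by apply: cinN; apply: cinD => //; apply: cin_sub ce'; exact: Sk_le.
exists (z - (e + e')); split.
- by apply: eqvB => //; exact: eqvD.
- by apply: cinD => //; apply: cin_sub ca; exact: Sk_le.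
- rewrite /= (bdry_lfB C)//; last exact: lfD.
  by rewrite (bdry_lfD C)// E lE subrr.
- move=> d; rewrite -tE -[z in LHS](addr0 z) -(bdry0 _ _ n.+1).
  apply: theta_split => //; [exact: thetaP|exact: (lf_finc (finc0 _ _))|exact: cin0|].
  by apply: lfN; exact: lfD.
Qed.

Definition cell_eqv k (t : cell C k -> V) := exists2 r, 0 < r &
  forall (c d : cell C k) f, cp_mor r c d f -> t d = t c *~ cell_degree f c d.

(* z is homologous to a cycle w of the n-skeleton, and t collects the coefficients of w. *)
Definition corresponding n (z : simplex X n -> V) (t : cell C n -> V) := exists w e,
  [/\ eqv w, cin (Sk n.+1) w, cyc w, eqv e & z = w + bdry e /\ forall d, theta d w = t d].

Lemma corresponding_lin n a (z z' : simplex X n -> V) t t' : corresponding z t ->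
  corresponding z' t' -> corresponding (a *: z + z') (a *: t + t').
Proof.
move=> [w [e [ew cw zw ee [zE tE]]]] [w' [e' [ew' cw' zw' ee' [zE' tE']]]].
exists (a *: w + w'), (a *: e + e').
have [[[fw _] [fw' _]] [[fe _] [fe' _]]] := conj (conj ew ew') (conj ee ee').
split; [exact: eqv_lin|by apply: cinD => //; exact: cinZ| |exact: eqv_lin|].
  case: n w w' fw fw' zw zw' {z z' t t' e e' ew cw zE tE ew' cw' zE' tE' ee ee' fe fe'} => // m w w' fw fw' /= zw zw'.
  by rewrite (bdry_linear a fw fw') zw zw' scaler0 addr0.
split=> [|d].
  rewrite zE zE' (bdry_linear a fe fe') scalerDr -!addrA; congr (_ + _).
  by rewrite addrCA.
rewrite fct_lin -tE -tE'; apply: theta_lin => //; exact: cyc_bd_in.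
Qed.

Lemma corresponding_total n (z : simplex X n -> V) : eqv z -> cyc z ->
  exists t, [/\ cell_eqv t, cell_cyc t & corresponding z t].
Proof.
move=> ez zc; have [w [e [ew cw ee zE]]] := push_down ez (cyc_bd_in _ zc).
have [[fw _] [fe _]] := conj ew ee.
have zw : cyc w by rewrite (cyc_shift fw fe) -zE.
exists (fun d => theta d w); split; last by exists w, e.
  exact: (theta_equivariant hCP ew cw (cyc_bd_in _ zw)).
case: n w ew cw zw {z ez zc e ee zE fw fe} => // m w ew cw zw d.
rewrite -(theta_bdry hCP d ew cw (cyc_bd_in _ zw)) [bdry w]zw; exact: theta0.
Qed.

Lemma corresponding_onto n (t : cell C n -> V) : cell_eqv t -> cell_cyc t ->
  exists z, [/\ eqv z, cyc z & corresponding z t].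
Proof.
move=> [r r0 ti] tc; have [w [ew cw zw tE]] := theta_cycle r0 ti tc.
exists w; split=> //; exists w, 0; split=> //; first exact: eqv0.
by rewrite bdry0 addr0.
Qed.

(** [theta_bounding] gives one direction and [cell_bounding] the other. Together they make the
    induced map both well defined and injective. *)
Lemma corresponding_boundary n (z : simplex X n -> V) t : corresponding z t ->
  (exists2 e, eqv e & z = bdry e) <->
  exists2 t' : cell C n.+1 -> V, cell_eqv t' & forall d, t d =
    \sum_(c \in [set c | closed_cell c `&` open_cell d !=set0]) t' c *~ incidence c d.
Proof.
move=> [w [e [ew cw zw ee [zE tE]]]]; have [[fw _] [fe _]] := conj ew ee.
split=> [[b eb zb]|[t' [r r0 ti] st]].
  have [fb _] := eb; have wE : w = bdry (b - e) by rewrite (bdry_lfB C)// -zb zE addrK.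
  have [|t' tr tb] := theta_bounding (eqvB eb ee); first by rewrite -wE.
  by exists t' => // d; rewrite -tE wE tb.
have [|b eb wb] := cell_bounding r0 ti ew zw cw; first by move=> d; rewrite tE st.
have [fb _] := eb; exists (b + e); first exact: eqvD.
by rewrite (bdry_lfD C)// zE wb.
Qed.
End SkeletalFiltration.

(** * Elements of the homology modules as classes of cycles *)

Lemma subm_valP (G : pzRingType) (V : lmodType G) (S : submodule V) (x : subm_type S) :
  subm_set S (subm_val x).
Proof. by case: x => x xS; exact/asboolP. Qed.

Lemma subm_val_lin (G : pzRingType) (V : lmodType G) (S : submodule V) a (x y : subm_type S) :
  subm_val (a *: x + y) = a *: subm_val x + subm_val y.
Proof. exact: (linearP (val : subm_type S -> V)). Qed.

Lemma subm_type_onto (G : pzRingType) (V : lmodType G) (S : submodule V) (x : V) :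
  subm_set S x -> exists y : subm_type S, subm_val y = x.
Proof. by move=> Sx; exists (SubmType (asboolT Sx)). Qed.

Lemma subm_val_inj (G : pzRingType) (V : lmodType G) (S : submodule V) : injective (@subm_val G V S).
Proof. exact: val_inj. Qed.

Section CycleClasses.
Variables (R : realType) (X : metricType R) (P : pattern X) (C : cellular_pattern X).
Variables (G : comPzRingType) (n : nat).
Local Notation Z := (subm_type (cycles (@bm_bdry R X G G^o) (pattern_chains P G^o) n)).
Local Notation S := (subm_type (@cycles G (fun k => (cell C k -> G^o : lmodType G))
  (fun k => @cell_bdry R X C G k) (cell_chains C G) n)).

Definition chain_of (z : Z) : simplex X n -> G^o := subm_val (subm_val z).
Definition cochain_of (s : S) : cell C n -> G^o := subm_val s.

Lemma chain_of_eqv z : eqv P (chain_of z).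
Proof. have [zS _] := subm_valP z; exact: chain_eqv. Qed.

Lemma is_cycle_cyc (b : bm_chain X G^o n) : is_cycle (@bm_bdry R X G G^o) b <-> cyc (subm_val b).
Proof.
case: n b => // m b; split=> [e|e]; first exact: (congr1 (@subm_val _ _ _) e).
exact: subm_val_inj.
Qed.

Lemma chain_of_cyc z : cyc (chain_of z).
Proof. by have [_ zc] := subm_valP z; apply/is_cycle_cyc. Qed.

Lemma chain_of_onto (c : simplex X n -> G^o) : eqv P c -> cyc c -> exists z, chain_of z = c.
Proof.
move=> /eqv_chain[b bE <-] /is_cycle_cyc bc.
have [z zE] := subm_type_onto (S := cycles (@bm_bdry R X G G^o) (pattern_chains P G^o) n) (conj bE bc).
by exists z; rewrite /chain_of zE.
Qed.

Lemma chain_of_lin a z z' : chain_of (a *: z + z') = a *: chain_of z + chain_of z'.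
Proof. by rewrite /chain_of !subm_val_lin. Qed.

Lemma chain_of_boundary z : is_boundary z <-> exists2 e, eqv P e & chain_of z = bdry e.
Proof.
split=> [[y yS zy]|[e /eqv_chain[b bE <-] zb]].
  by exists (subm_val y); [exact: chain_eqv|rewrite /chain_of zy].
by exists b => //; exact: subm_val_inj.
Qed.

Lemma cochain_of_eqv s : cell_equivariant (cochain_of s).
Proof. by have [] := subm_valP s. Qed.
Lemma cochain_of_cyc s : cell_cyc (cochain_of s).
Proof.
have [_] := subm_valP s; rewrite /cochain_of; move: (subm_val s).
case: n => // m t e d; exact: (congr1 (@^~ d) e).
Qed.

Lemma cochain_of_onto (t : cell C n -> G^o) : cell_equivariant t -> cell_cyc t ->
  exists s, cochain_of s = t.
Proof.
move=> tE tc.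
have [|s sE] := subm_type_onto (S := @cycles G (fun k => (cell C k -> G^o : lmodType G))
  (fun k => @cell_bdry R X C G k) (cell_chains C G) n) (x := t); last by exists s.
by split=> //; case: n t tE tc => // m t tE tc /=; apply/funext.
Qed.

Lemma cochain_of_lin a s s' : cochain_of (a *: s + s') = a *: cochain_of s + cochain_of s'.
Proof. exact: subm_val_lin. Qed.

Lemma cochain_of_boundary s : is_boundary s <->
  exists2 t, @cell_equivariant R X C G n.+1 t & cochain_of s = cell_bdry t.
Proof. by split=> -[t tE st]; exists t. Qed.

End CycleClasses.

Theorem theorem3p2p7 (R : realType) (X : metricType R) (P : pattern X)
    (C : cellular_pattern X) (G : comPzRingType)
    (hCP : represents C P)
    (hG : exists2 r0 : R, 0 < r0 & forall r : R, r0 <= r ->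
      forall (k : nat) (c d : cell C k) (m : nat),
        (cp_mor r c d #= `I_m)%card -> m <> 0%N -> has_division G m)
    (n : nat) :
  exists f : {linear pattern_homology P G n -> cellular_homology C G n},
    bijective f.
Proof.
pose S := boundaries (@bm_bdry R X G G^o) (pattern_chains P G^o) n.
pose T := @boundaries G (fun k => (cell C k -> G^o : lmodType G))
  (fun k => @cell_bdry R X C G k) (cell_chains C G) n.
(* Both homology modules are quotients of subtypes of cycles, so the relation is taken between the
   underlying chains, and its four properties remain to be transported. *)
apply: (@quotm_iso G _ _ S T
  (fun z s => corresponding P (@chain_of R X P G n z) (@cochain_of R X C G n s))).
- move=> a z s z' s' zs zs'; rewrite chain_of_lin cochain_of_lin.
  exact: corresponding_lin.
- move=> z; have [t [te tc zt]] := corresponding_total hCP hG (chain_of_eqv z) (chain_of_cyc z).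
  by have [s sE] := cochain_of_onto te tc; exists s; rewrite sE.
- move=> s; have [z [ez cz zs]] := corresponding_onto hCP hG (cochain_of_eqv s) (cochain_of_cyc s).
  by have [z' zE] := chain_of_onto ez cz; exists z'; rewrite zE.
- move=> z s /(corresponding_boundary hCP hG) zs.
  split=> [/chain_of_boundary/zs[t te st]|/cochain_of_boundary[t te st]].
    by apply/cochain_of_boundary; exists t => //; exact/funext.
  by apply/chain_of_boundary/zs; exists t => // d; rewrite st.
Qed.
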